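(* Let $n\ge5$ be odd, let $\Gamma\le\Gamma(X_n)$ be a congruence group, let $b$ be a minimal congruence level of $\Gamma$ and let $a=\mathrm{level}(\Gamma)$ be its generalised Wohlfahrt level. Then $a\mid b$, and every prime number $p$ dividing $b$ also divides $a$. However, $b$ does not have to divide $a$: there exist an odd $n\ge5$ and a congruence group $\Gamma\le\Gamma(X_n)$ with a minimal congruence level $b$ such that $b\nmid\mathrm{level}(\Gamma)$.
   Context: For odd $n\ge5$, $\bar X_n$ is the translation surface obtained from two regular $n$-gons, glued along one pair of parallel sides to form a $2(n-1)$-gon whose sides are then identified with their unique parallel partner by translations; it is placed so that each $n$-gon has a horizontal side. It has exactly one singular point (the image of the vertices), and $X_n$ denotes $\bar X_n$ without it. An affine map of $\bar X_n$ is an orientation preserving homeomorphism fixing the singular point that on $X_n$ is in translation charts of the form $z\mapsto Az+v$, $A\in\mathrm{SL}_2(\mathbb R)$; $A$ is its derivative. The Veech group $\Gamma(X_n)\le\mathrm{SL}_2(\mathbb R)$ is the group of derivatives of affine maps. By Veech, $\Gamma(X_n)=\langle R,T\rangle$ with $R=\begin{pmatrix}\cos\frac{\pi}{n}&-\sin\frac{\pi}{n}\\ \sin\frac{\pi}{n}&\cos\frac{\pi}{n}\end{pmatrix}$, $T=\begin{pmatrix}1&2\cot\frac{\pi}{n}\\0&1\end{pmatrix}$. Each element of $\Gamma(X_n)$ is the derivative of a unique affine map (the surface is primitive), so $\Gamma(X_n)$ acts on $H_1(\bar X_n,\mathbb Z/a\mathbb Z)$ for every $a\ge1$. The principal congruence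 group $\Gamma(a)\le\Gamma(X_n)$ of level $a\geq 1$ is the group of elements acting trivially on $H_1(\bar X_n,\mathbb Z/a\mathbb Z)$. A subgroup of $\Gamma(X_n)$ is a congruence group of level $a$ if it contains $\Gamma(a)$, and a congruence group if it is one of some level $a\ge1$. A level $a$ of a congruence group $\Gamma$ is a minimal congruence level if $\Gamma$ is not a congruence group of level $b$ for any proper divisor $b$ of $a$. Every parabolic element of $\Gamma(X_n)$ with positive trace has the form $A=S^{-1}T^mS$ with $m\in\mathbb Z\setminus\{0\}$, $S\in\Gamma(X_n)$; its width is $\mathrm{width}(A)=|m|$. For a finite index subgroup $\Gamma\le\Gamma(X_n)$, such an $A\in\Gamma$ is maximal parabolic in $\Gamma$ if $S^{-1}T^kS\notin\Gamma$ for all proper divisors $k$ of $m$ ($0<k<|m|$). The (generalised) Wohlfahrt level is $$\mathrm{level}(\Gamma)=\mathrm{lcm}\{\mathrm{width}(A)\mid A\in\Gamma \text{ parabolic with positive trace and maximal parabolic in }\Gamma\}.$$ *)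

(* Defs.v *)
From HB Require Import structures.
From Stdlib Require Import Relations.
From mathcomp Require Import all_boot all_order all_algebra.
From mathcomp Require Import finmap monalg.
From mathcomp Require Import all_classical all_reals all_analysis.

Set Implicit Arguments.
Unset Strict Implicit.
Unset Printing Implicit Defensive.

Import Order.TTheory GRing.Theory Num.Theory.
Import numFieldNormedType.Exports.

Local Open Scope classical_set_scope.
Local Open Scope ring_scope.
Local Open Scope quotient_scope.

Section SingularHomology.
Variable R : realType.

(* The points of [R^m] with nonnegative coordinates of sum 1; the standard
   [k]-simplex is [stdsimplex k.+1]. *)
Definition stdsimplex (m : nat) : set 'rV[R]_m :=
  [set t | (forall i, 0 <= t 0 i) /\ \sum_i t 0 i = 1].
Arguments stdsimplex : clear implicits.

Definition insert0 (m : nat) (i : 'I_m.+1) (t : 'rV[R]_m) : 'rV[R]_m.+1 :=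
  \row_j oapp (t 0) 0 (unlift i j).

Lemma insert0_stdsimplex m (i : 'I_m.+1) (t : stdsimplex m) :
  insert0 i (val t) \in stdsimplex m.+1.
Proof.
case: t => t /= /set_mem [t_ge0 t_sum]; apply/mem_set; split=> [j|].
  by rewrite mxE; case: unliftP => [k|] _ /=.
rewrite (bigD1_ord i) //= mxE unlift_none /= add0r -t_sum.
by apply: eq_bigr => k _; rewrite mxE liftK.
Qed.

Definition face_inclusion m (i : 'I_m.+1) (t : stdsimplex m) :
  stdsimplex m.+1 := exist _ (insert0 i (val t)) (insert0_stdsimplex i t).

Lemma face_inclusion_continuous m (i : 'I_m.+1) :
  continuous (@face_inclusion m i).
Proof.
apply: continuous_comp_initial => t U /= [P nP sPU].
have vc : {for t, continuous (val : stdsimplex m -> 'rV[R]_m)}.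
  exact: initial_continuous.
have nQ : nbhs (val t : 'rV[R]_m) [set u | forall j, P 0 j (insert0 i u 0 j)].
  apply: (@filter_forall _ _ _ _ (nbhs_filter (val t : 'rV[R]_m))) => j.
  have := nP 0 j; rewrite /= mxE.
  case: (unliftP i j) => [k|] -> /= nPj.
  - have := @coord_continuous _ _ _ 0 k (val t) _ nPj.
    apply: (@filterS _ _ (nbhs_filter (val t : 'rV[R]_m))) => u /= Pu.
    by rewrite mxE liftK.
  - apply: (@nearW _ _ _ (nbhs_filter (val t : 'rV[R]_m))) => u.
    by rewrite mxE unlift_none /=; exact: nbhs_singleton nPj.
have := vc _ nQ; apply: (@filterS _ _ (nbhs_filter t)) => u /= Qu.
apply: sPU => a j.
by rewrite (ord1 a); exact: Qu.
Qed.

HB.instance Definition _ m (i : 'I_m.+1) :=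
  isContinuous.Build _ _ _ (@face_inclusion_continuous m i).

Definition singular_simplex (k : nat) (X : topologicalType) :=
  continuousType (stdsimplex k.+1) X.

Definition chain (G : zmodType) (k : nat) (X : topologicalType) :=
  {malg G[singular_simplex k X]}.

Definition face k (X : topologicalType) (i : 'I_k.+2)
    (s : singular_simplex k.+1 X) : singular_simplex k X :=
  s \o @face_inclusion k.+1 i.

Definition boundary (G : zmodType) k (X : topologicalType)
    (c : chain G k.+1 X) : chain G k X :=
  \sum_(s <- msupp c) \sum_(i < k.+2) << c@_s *~ (-1) ^+ i *g face i s >>.

Definition chain_map (G : zmodType) k (X Y : topologicalType)
    (f : continuousType X Y) (c : chain G k X) : chain G k Y :=
  \sum_(s <- msupp c) << c@_s *g (f \o s : singular_simplex k Y) >>.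

(* [f_* = id] on [H_1(X, G)]: [f_# z - z] bounds for every 1-cycle [z]. *)
Definition trivial_on_H1 (G : zmodType) (X : topologicalType)
    (f : continuousType X X) : Prop :=
  forall z : chain G 1 X, boundary z = 0 ->
    exists d : chain G 2 X, chain_map f z - z = boundary d.

End SingularHomology.

Arguments stdsimplex : clear implicits.

Section DoubleNGon.
Variables (R : realType) (n : nat).

(* The vertices of a regular [n]-gon inscribed in the unit circle, numbered
   counterclockwise with period [n]; the side from [vertex n.-1] to [vertex 0]
   is horizontal. *)
Definition vertex (k : nat) : 'cV[R]_2 :=
  let theta := (2 * k + 1)%:R * pi / n%:R in
  \col_(i < 2) if i == 0 then sin theta else - cos theta.

(* [polygon false] is the convex hull of the vertices and [polygon true] is its
   image under [-1]: for odd [n], the [n]-gon adjacent to it along a side. *)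
Definition polygon (b : bool) : set 'cV[R]_2 :=
  [set \sum_(k < n) t 0 k *: ((-1) ^+ b *: vertex k) | t in stdsimplex R n].

Definition side_point (b : bool) (k : nat) (s : R) : 'cV[R]_2 :=
  (-1) ^+ b *: ((1 - s) *: vertex k + s *: vertex k.+1).

Definition side (b : bool) (k : nat) : set 'cV[R]_2 :=
  [set side_point b k s | s in `[0, 1]].

Definition open_side (b : bool) (k : nat) : set 'cV[R]_2 :=
  [set side_point b k s | s in `]0, 1[].

(* The translation by [side_shift k] carries the [k]-th side of [polygon true]
   to the parallel side, the [k]-th one, of [polygon false]. *)
Definition side_shift (k : nat) : 'cV[R]_2 := vertex k + vertex k.+1.

Definition two_polygons : set (bool * 'cV[R]_2) :=
  [set p | polygon p.1 p.2].

Definition glued (p q : two_polygons) : Prop :=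
  exists k : 'I_n, [/\ (val p).1 = false, (val q).1 = true,
    side false k (val p).2 & (val p).2 = (val q).2 + side_shift k].

Definition gluing (p q : two_polygons) : bool :=
  `[< clos_refl_sym_trans _ glued p q >].

Lemma gluing_refl : reflexive gluing.
Proof. by move=> p; apply/asboolP; exact: rst_refl. Qed.

Lemma gluing_sym : symmetric gluing.
Proof. by move=> p q; apply/asboolP/asboolP; exact: rst_sym. Qed.

Lemma gluing_trans : transitive gluing.
Proof.
by move=> q p r /asboolP pq /asboolP qr; apply/asboolP; exact: rst_trans pq qr.
Qed.

Definition gluing_equiv := EquivRel gluing gluing_refl gluing_sym gluing_trans.

Definition surface := {eq_quot gluing_equiv}.

HB.instance Definition _ := Topological.copy surface (quotient_topology surface).
HB.instance Definition _ := Quotient.on surface.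

Definition singular_point : set surface :=
  [set x | exists2 p : two_polygons, \pi_surface p = x &
     exists k, (val p).2 = (-1) ^+ (val p).1 *: vertex k].

(* The [k]-th translation chart develops the two polygons side by side along
   their [k]-th sides. The domains of the [n] charts are open and cover the
   complement of the singular point; neither [chart_domain] nor, on that
   domain, [chart] depends on the choice of the representative [repr x]. *)
Definition chart_domain (k : nat) : set surface :=
  [set x | let p := val (repr x) in
     (polygon p.1)° p.2 \/ open_side p.1 k p.2].

Definition chart (k : nat) (x : surface) : 'cV[R]_2 :=
  let p := val (repr x) in if p.1 then p.2 + side_shift k else p.2.

(* Such maps preserve the orientation because [\det A = 1]. *)
Definition affine_map (A : 'M[R]_2) (f : continuousType surface surface) :
    Prop :=
  [/\ \det A = 1,
      exists2 g : continuousType surface surface, cancel f g & cancel g f,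
      forall x, singular_point x -> f x = x &
      forall (i j : 'I_n) (x : surface),
        chart_domain i x -> chart_domain j (f x) ->
        exists v : 'cV[R]_2,
          \forall y \near x, chart j (f y) = A *m chart i y + v].

Definition veech_group : set 'M[R]_2 :=
  [set A | exists f, affine_map A f].

Definition subgroup (Gamma : set 'M[R]_2) : Prop :=
  [/\ Gamma `<=` veech_group, Gamma 1,
      forall A B, Gamma A -> Gamma B -> Gamma (A * B) &
      forall A, Gamma A -> Gamma A^-1].

(* For [0 < a], the type ['I_a.-1.+1] carries the additive group [Z/aZ]
   (['Z_a] is wrong for [a = 1]). *)
Definition principal_congruence (a : nat) : set 'M[R]_2 :=
  [set A | exists2 f, affine_map A f & trivial_on_H1 R 'I_a.-1.+1 f].

Definition congruence_level (Gamma : set 'M[R]_2) (a : nat) : Prop :=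
  (0 < a)%N /\ principal_congruence a `<=` Gamma.

Definition congruence_group (Gamma : set 'M[R]_2) : Prop :=
  subgroup Gamma /\ exists a, congruence_level Gamma a.

Definition minimal_congruence_level (Gamma : set 'M[R]_2) (a : nat) : Prop :=
  congruence_level Gamma a /\
  forall b, (b %| a)%N -> b != a -> ~ congruence_level Gamma b.

Definition T_mx : 'M[R]_2 :=
  1 + (2 * (cos (pi / n%:R) / sin (pi / n%:R))) *: delta_mx 0 1.

Definition parabolic (A : 'M[R]_2) : Prop :=
  [/\ A != 1, A != -1 & `|\tr A| = 2].

(* The width [`|m|] does not depend on the way of writing [A] as
   [S^-1 * T_mx ^ m * S]. *)
Definition maximal_widths (Gamma : set 'M[R]_2) : set nat :=
  [set w | exists A, [/\ Gamma A, parabolic A, 0 < \tr A &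
     exists S (m : int),
       [/\ veech_group S, m != 0, A = S^-1 * T_mx ^ m * S, w = `|m|%N &
           forall k : nat, (k %| `|m|)%N -> (0 < k < `|m|)%N ->
             ~ Gamma (S^-1 * T_mx ^+ k * S)]]].

(* [maximal_widths Gamma] is finite if [Gamma] has finite index; on an infinite
   set the iterated operator would be 1. *)
Definition wohlfahrt_level (Gamma : set 'M[R]_2) : nat :=
  \big[lcmn/1%N]_(w \in maximal_widths Gamma) w.

End DoubleNGon.

(* Main.v *)
(* Straight segments from the singular point show that an affine map is
   determined by its derivative, and by descent on the lengths of vectors that the
   Veech group is generated by the rotation [R] and the twist [T]. The homology of
   the surface is spanned by the sides of one polygon, and [T] adds to a side plus
   or minus the core curve of a horizontal cylinder, which [T] fixes. Hence [T^b]
   has level [b], and all widths of a congruence group of level [b] divide [b].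

   As [(T^-1 R)^2 = -1 = R^n] with [n] odd, the conjugates of [T] generate the
   Veech group. If [b = b' q] with [q] a power of a prime that does not divide the
   Wohlfahrt level of [Gamma], every conjugate of [T] is, by the Chinese remainder
   theorem, the product of an element of [Gamma] of level [b'] and one of level
   [q]. Hence so is every element of level [b'], and then its second factor has
   level [b' q = b] and is in [Gamma]. Thus [Gamma] has level [b'].

   For [n = 5], let [Gamma] be the group of the elements acting on the homology
   modulo 8 as [1 + 4 X], where a certain linear form vanishes on [X] modulo 2. As
   modulo 2 the Veech group acts through the dihedral group of order 10, the form
   vanishes on the conjugates of [T^4], so the Wohlfahrt level divides 4. It does
   not vanish on the commutator of [T^2] and [R T^2 R^-1], which has level 4, so 8
   is a minimal congruence level. The form is well defined because winding numbers
   show that the sides satisfy no relation modulo 8 other than that their sum is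
   zero. *)

Require Import Defs.
From HB Require Import structures.
From Stdlib Require Import Relations.
From mathcomp Require Import all_boot all_order all_algebra.
From mathcomp Require Import finmap monalg ring lra zify.
From mathcomp Require Import all_classical all_reals all_analysis.

Set Implicit Arguments.
Unset Strict Implicit.
Unset Printing Implicit Defensive.

Import Order.TTheory GRing.Theory Num.Theory.
Import numFieldNormedType.Exports.

Local Open Scope classical_set_scope.
Local Open Scope ring_scope.
Local Open Scope quotient_scope.

(** * Plane geometry of the regular polygon *)

(** The homology group itself is never computed. Trivial action is obtained from a criterion: a
    singular simplex is, up to a boundary, an integral combination of sides plus a difference of
    chosen paths to its two ends, and on a cycle these paths cancel. So a map acts trivially modulo
    [a] as soon as it moves each side by [a] times a chain plus a boundary. Nontrivial action, in
    the example, is detected by integer valued cocycles.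

    The numbers of the example come from [4 * 4 = 0] modulo 8: matrices [1 + 4 X] multiply by adding
    the [X]. Likewise the commutator of [1 + 2 N] and [1 + 2 N'] is [1 + 4 (N N' - N' N)] modulo 8,
    whence the squares of two conjugate twists. A conjugate of [1 + 4 N] modulo 8 depends on the
    conjugating matrix modulo 2 only, so finitely many matrices decide which linear forms vanish on
    all conjugates of [T^4].

    The singular point has no chart. Statements about points and their neighbours rest on finiteness
    instead: the representatives of a point differ by finitely many translations, and a continuous
    map with values in a finite set is locally constant. *)

Section Nbhs.
Variables (T : topologicalType) (x : T).

Lemma nbhsS (P Q : set T) : (forall y, P y -> Q y) -> nbhs x P -> nbhs x Q.
Proof. by move=> h; apply: (@filterS _ _ (nbhs_filter x)). Qed.
Lemma nbhsA (P Q : set T) :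
  nbhs x P -> nbhs x Q -> nbhs x [set y | P y /\ Q y].
Proof. by move=> h1 h2; apply: filterI. Qed.
Lemma nbhs_forall (I : finType) (P : I -> set T) :
  (forall i, nbhs x (P i)) -> nbhs x [set y | forall i, P i y].
Proof. exact: (@filter_forall _ _ _ _ (nbhs_filter x)). Qed.
Lemma nbhs_all (P : set T) : (forall y, P y) -> nbhs x P.
Proof. exact: (@nearW _ _ _ (nbhs_filter x)). Qed.

End Nbhs.

Section Plane.
Variable R : realType.
Implicit Types x y : 'cV[R]_2.

Definition px x : R := x 0 0.
Definition py x : R := x 1 0.
Definition mkv (a b : R) : 'cV[R]_2 := \col_(i < 2) if i == 0 then a else b.

Lemma px_mkv a b : px (mkv a b) = a. Proof. by rewrite /px mxE. Qed.
Lemma py_mkv a b : py (mkv a b) = b. Proof. by rewrite /py mxE. Qed.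
Lemma pxD x y : px (x + y) = px x + px y. Proof. by rewrite /px mxE. Qed.
Lemma pyD x y : py (x + y) = py x + py y. Proof. by rewrite /py mxE. Qed.
Lemma pxN x : px (- x) = - px x. Proof. by rewrite /px mxE. Qed.
Lemma pyN x : py (- x) = - py x. Proof. by rewrite /py mxE. Qed.
Lemma pxZ a x : px (a *: x) = a * px x. Proof. by rewrite /px mxE. Qed.
Lemma pyZ a x : py (a *: x) = a * py x. Proof. by rewrite /py mxE. Qed.
Lemma px0 : px 0 = 0. Proof. by rewrite /px mxE. Qed.
Lemma py0 : py 0 = 0. Proof. by rewrite /py mxE. Qed.
Lemma px_sum I r (P : pred I) (F : I -> 'cV[R]_2) :
  px (\sum_(i <- r | P i) F i) = \sum_(i <- r | P i) px (F i).
Proof. by rewrite /px summxE. Qed.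
Lemma py_sum I r (P : pred I) (F : I -> 'cV[R]_2) :
  py (\sum_(i <- r | P i) F i) = \sum_(i <- r | P i) py (F i).
Proof. by rewrite /py summxE. Qed.

Definition pE := (px_mkv, py_mkv, pxD, pyD, pxN, pyN, pxZ, pyZ, px0, py0).

Lemma vecP x y : px x = px y -> py x = py y -> x = y.
Proof.
move=> ex ey; apply/matrixP => i j; rewrite (ord1 j).
by case: i => -[|[|//]] i; [move: ex|move: ey]; rewrite /px /py;
  congr (x _ _ = y _ _); apply: val_inj.
Qed.

Lemma px_mulmx (A : 'M[R]_2) x : px (A *m x) = A 0 0 * px x + A 0 1 * py x.
Proof.
rewrite /px /py mxE big_ord_recl big_ord_recl big_ord0 addr0.
by congr (A _ _ * x _ _ + A _ _ * x _ _); apply: val_inj.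
Qed.
Lemma py_mulmx (A : 'M[R]_2) x : py (A *m x) = A 1 0 * px x + A 1 1 * py x.
Proof.
rewrite /px /py mxE big_ord_recl big_ord_recl big_ord0 addr0.
by congr (A _ _ * x _ _ + A _ _ * x _ _); apply: val_inj.
Qed.

Lemma px_continuous : continuous px.
Proof. by move=> x; apply: coord_continuous. Qed.
Lemma py_continuous : continuous py.
Proof. by move=> x; apply: coord_continuous. Qed.

Lemma mkv_continuous (T : topologicalType) (f g : T -> R) :
  continuous f -> continuous g -> continuous (fun t => mkv (f t) (g t)).
Proof.
move=> cf cg t.
have -> : (fun t => mkv (f t) (g t)) = (fun t => f t *: mkv 1 0 + g t *: mkv 0 1).
  by apply/funext => u; apply: vecP; rewrite !pE; ring.
by apply: (@continuousD _ _ _ (fun t => f t *: mkv 1 0) (fun t => g t *: mkv 0 1));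
  apply: continuousZl; [exact: cf|exact: cg].
Qed.

End Plane.

(** A class, so that the standing hypotheses on [n] are found by instance resolution. *)
Class odd_ge5 (n : nat) : Prop :=
  OddGe5 { n_is_odd : odd n; n_is_ge5 : (5 <= n)%N }.

Section Geometry.
Variables (R : realType) (n : nat).
Context {n_ok : odd_ge5 n}.
Let n_odd : odd n := n_is_odd.
Let n_ge5 : (5 <= n)%N := n_is_ge5.
Implicit Types (x y : 'cV[R]_2) (b : bool) (j k l : nat).

Local Notation vertex := (vertex R n).

Lemma n_gt0 : (0 < n)%N. Proof. exact: leq_trans n_ge5. Qed.
Let nR_gt0 : 0 < n%:R :> R. Proof. by rewrite ltr0n n_gt0. Qed.
Let nR_neq0 : n%:R != 0 :> R. Proof. exact: lt0r_neq0. Qed.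

(** All angles that occur are multiples of [pi / n]. As [cs] and [sn] take the multiple as argument,
    trigonometry becomes arithmetic of indices modulo [2 * n]. *)
Definition ang l : R := l%:R * pi / n%:R.

Lemma angD l m : ang (l + m) = ang l + ang m.
Proof. by rewrite /ang natrD; field. Qed.
Lemma ang_n : ang n = pi.
Proof. by rewrite /ang; field. Qed.
Lemma ang0 : ang 0 = 0. Proof. by rewrite /ang !mul0r. Qed.
Lemma ang_ge0 l : 0 <= ang l.
Proof. by rewrite /ang !mulr_ge0 ?invr_ge0 // ?ler0n // pi_ge0. Qed.
Lemma ang_lt l m : (ang l < ang m) = (l < m)%N.
Proof. by rewrite /ang ltr_pM2r ?invr_gt0 // ltr_pM2r ?pi_gt0 // ltr_nat. Qed.
Lemma ang_le l m : (ang l <= ang m) = (l <= m)%N.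
Proof. by rewrite /ang ler_pM2r ?invr_gt0 // ler_pM2r ?pi_gt0 // ler_nat. Qed.

Definition cs l : R := cos (ang l).
Definition sn l : R := sin (ang l).

Lemma cs0 : cs 0 = 1. Proof. by rewrite /cs ang0 cos0. Qed.
Lemma sn0 : sn 0 = 0. Proof. by rewrite /sn ang0 sin0. Qed.
Lemma cs_n : cs n = -1. Proof. by rewrite /cs ang_n cospi. Qed.
Lemma sn_n : sn n = 0. Proof. by rewrite /sn ang_n sinpi. Qed.
Lemma csD l m : cs (l + m) = cs l * cs m - sn l * sn m.
Proof. by rewrite /cs angD cosD. Qed.
Lemma snD l m : sn (l + m) = sn l * cs m + cs l * sn m.
Proof. by rewrite /sn angD sinD. Qed.
Lemma cs2sn2 l : cs l ^+ 2 + sn l ^+ 2 = 1.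
Proof. exact: cos2Dsin2. Qed.
Lemma cs_addn l : cs (l + n) = - cs l.
Proof. by rewrite csD cs_n sn_n; ring. Qed.
Lemma sn_addn l : sn (l + n) = - sn l.
Proof. by rewrite snD cs_n sn_n; ring. Qed.
Lemma rot_inv (a b c s : R) : a ^+ 2 + b ^+ 2 = 1 -> b * c + a * s = 0 ->
  a * c - b * s = 1 -> c = a /\ s = - b.
Proof.
move=> h h1 h2; split.
  have -> : c = c * (a ^+ 2 + b ^+ 2) by rewrite h mulr1.
  have -> : c * (a ^+ 2 + b ^+ 2) = b * (b * c + a * s) + a * (a * c - b * s).
    by ring.
  by rewrite h1 h2; ring.
have -> : s = s * (a ^+ 2 + b ^+ 2) by rewrite h mulr1.
have -> : s * (a ^+ 2 + b ^+ 2) = a * (b * c + a * s) - b * (a * c - b * s).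
  by ring.
by rewrite h1 h2; ring.
Qed.
Lemma cs_sn_sub2n l : (l <= 2 * n)%N ->
  cs (2 * n - l) = cs l /\ sn (2 * n - l) = - sn l.
Proof.
move=> le; apply: rot_inv (cs2sn2 l) _ _.
  by rewrite -snD subnKC // mul2n -addnn sn_addn sn_n oppr0.
by rewrite -csD subnKC // mul2n -addnn cs_addn cs_n opprK.
Qed.
Lemma cs_sub2n l : (l <= 2 * n)%N -> cs (2 * n - l) = cs l.
Proof. by case/cs_sn_sub2n. Qed.
Lemma sn_sub2n l : (l <= 2 * n)%N -> sn (2 * n - l) = - sn l.
Proof. by case/cs_sn_sub2n. Qed.

Lemma cs_lt l m : (l < m <= n)%N -> cs m < cs l.
Proof.
move=> /andP[lm mn]; rewrite /cs ltr_cos ?ang_lt // in_itv /= ang_ge0 -ang_n.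
  by rewrite ang_le; lia.
by rewrite ang_le.
Qed.
Lemma sn_gt0 l : (0 < l < n)%N -> 0 < sn l.
Proof.
by move=> /andP[l0 ln]; apply: sin_gt0_pi; rewrite -ang_n -{1}ang0 !ang_lt l0.
Qed.
Definition c1 := cs 1.
Definition c3 := cs 3.
Definition s1 := sn 1.

Lemma c3_lt_c1 : c3 < c1. Proof. by apply: cs_lt; lia. Qed.
Lemma s1_gt0 : 0 < s1. Proof. by apply: sn_gt0; lia. Qed.

(** The chain is [- c1 = cs (n - 1) < cs 2 <= c1]. *)
Lemma c1_gt0 : 0 < c1.
Proof.
have h : cs (n + 1) < cs (n + n.-2).
  rewrite (_ : n + n.-2 = 2 * n - 2)%N; last by lia.
  rewrite (_ : n + 1 = 2 * n - n.-1)%N; last by lia.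
  by rewrite !cs_sub2n ?cs_lt //; lia.
have h' : cs (n + 1) = - c1 by rewrite addnC cs_addn.
have h2 : cs 2 <= c1 by apply/ltW/cs_lt; lia.
move: h; rewrite h' (_ : n + n.-2 = 2 * n - 2)%N; last by lia.
by rewrite cs_sub2n; [lra|lia].
Qed.

Lemma cs_far l : (3 <= l <= 2 * n - 3)%N -> cs l <= c3.
Proof.
move=> h; wlog ln : l h / (l <= n)%N => [wl|].
  have [/wl->//|ln] := leqP l n.
  by rewrite -cs_sub2n ?wl //; lia.
have [->//|l3] := eqVneq l 3%N.
by apply/ltW/cs_lt; lia.
Qed.

Lemma cs_dist l m : cs ((l - m) + (m - l)) = cs l * cs m + sn l * sn m.
Proof.
wlog lm : l m / (m <= l)%N => [wl|].
  have [/wl//|/ltnW/wl] := leqP m l; rewrite addnC => ->; ring.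
have [d ->] : exists d, l = (m + d)%N by exists (l - m)%N; lia.
rewrite (_ : m + d - m + (m - (m + d)) = d)%N; last by lia.
rewrite csD snD; have h := cs2sn2 m; rewrite -[LHS]mulr1 -[X in _ * X = _]h; ring.
Qed.

Lemma px_vertex k : px (vertex k) = sn (2 * k + 1).
Proof. by rewrite /px mxE. Qed.
Lemma py_vertex k : py (vertex k) = - cs (2 * k + 1).
Proof. by rewrite /py mxE. Qed.
Lemma vertex_addn k : vertex (k + n) = vertex k.
Proof.
apply: vecP; rewrite ?px_vertex ?py_vertex.
  by rewrite (_ : 2 * (k + n) + 1 = 2 * k + 1 + n + n)%N ?sn_addn ?opprK //; lia.
by rewrite (_ : 2 * (k + n) + 1 = 2 * k + 1 + n + n)%N ?cs_addn ?opprK //; lia.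
Qed.
Lemma vertex_mod k : vertex (k %% n) = vertex k.
Proof.
rewrite {2}(divn_eq k n); elim: (k %/ n)%N => [|m IH]; first by rewrite mul0n.
by rewrite mulSn -addnA addnC vertex_addn.
Qed.

(* [hf k x <= c1] is the half-plane bounded by the line through the [k]-th side
   of [polygon false]. *)
Definition hf k x : R := sn (2 * k + 2) * px x - cs (2 * k + 2) * py x.

Lemma hfD k x y : hf k (x + y) = hf k x + hf k y.
Proof. by rewrite /hf !pE; ring. Qed.
Lemma hfN k x : hf k (- x) = - hf k x.
Proof. by rewrite /hf !pE; ring. Qed.
Lemma hfB k x y : hf k (x - y) = hf k x - hf k y.
Proof. by rewrite hfD hfN. Qed.
Lemma hfZ k a x : hf k (a *: x) = a * hf k x.
Proof. by rewrite /hf !pE; ring. Qed.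
Lemma hf0 k : hf k 0 = 0. Proof. by rewrite /hf !pE; ring. Qed.
Lemma hf_sum k I r (P : pred I) (F : I -> 'cV[R]_2) :
  hf k (\sum_(i <- r | P i) F i) = \sum_(i <- r | P i) hf k (F i).
Proof. by apply: (big_morph (hf k)); [exact: hfD|exact: hf0]. Qed.
Lemma hf_continuous k : continuous (hf k).
Proof.
move=> x; apply: (@continuousB _ _ _ (fun x => sn _ * px x) (fun x => cs _ * py x)).
  by apply: continuousM; [exact: cst_continuous|exact: px_continuous].
by apply: continuousM; [exact: cst_continuous|exact: py_continuous].
Qed.

Lemma hf_vertexE k j : hf k (vertex j) = cs (2 * j + 1 - (2 * k + 2) + (2 * k + 2 - (2 * j + 1))).
Proof. by rewrite /hf px_vertex py_vertex cs_dist; ring. Qed.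
Lemma hf_vertex k : hf k (vertex k) = c1.
Proof. by rewrite hf_vertexE /c1; congr cs; lia. Qed.
Lemma hf_vertexS k : hf k (vertex k.+1) = c1.
Proof. by rewrite hf_vertexE /c1; congr cs; lia. Qed.
Lemma hf_addn k x : hf (k + n) x = hf k x.
Proof.
rewrite /hf (_ : 2 * (k + n) + 2 = 2 * k + 2 + n + n)%N; last by lia.
by rewrite !cs_addn !sn_addn !opprK.
Qed.
Lemma hf_mod k x : hf (k %% n) x = hf k x.
Proof.
rewrite {2}(divn_eq k n); elim: (k %/ n)%N => [|m IH]; first by rewrite mul0n.
by rewrite mulSn -addnA addnC hf_addn.
Qed.
(** In units of [pi / n] the normal of the [k]-th side has angle [2 * k + 2] and [vertex j] has
    angle [2 * j + 1]: the two ends of the side are 1 away from the normal, all other vertices at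
    least 3. *)
Lemma hf_vertex_far k j : (k < n)%N -> (j < n)%N -> j != k -> j != (k.+1 %% n)%N ->
  hf k (vertex j) <= c3.
Proof.
move=> kn jn jk jk'; rewrite hf_vertexE; apply: cs_far.
have [e|e] := eqVneq k.+1 n; first by move: jk'; rewrite e modnn; lia.
by move: jk'; rewrite modn_small; lia.
Qed.
Lemma hf_vertex_le k j : hf k (vertex j) <= c1.
Proof.
rewrite -hf_mod -vertex_mod; set k' := (k %% n)%N; set j' := (j %% n)%N.
have kn : (k' < n)%N by rewrite ltn_pmod ?n_gt0.
have jn : (j' < n)%N by rewrite ltn_pmod ?n_gt0.
have [->|jk] := eqVneq j' k'; first by rewrite hf_vertex.
have [->|jk'] := eqVneq j' (k'.+1 %% n)%N; first by rewrite vertex_mod hf_vertexS.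
by apply: (le_trans (hf_vertex_far kn jn jk jk')); apply/ltW/c3_lt_c1.
Qed.

Lemma cs_sub l m : cs l - cs (l + m + m) = 2 * sn m * sn (l + m).
Proof.
rewrite !csD !snD; have h := cs2sn2 m; rewrite -[X in X - _]mulr1 -[X in _ * X - _]h; ring.
Qed.
Lemma sn_sub l m : sn (l + m + m) - sn l = 2 * sn m * cs (l + m).
Proof.
rewrite !csD !snD !csD; have h := cs2sn2 m; rewrite -[X in _ - X]mulr1 -[X in _ - _ * X]h; ring.
Qed.
Lemma sn_add l m : sn (l + m + m) + sn l = 2 * cs m * sn (l + m).
Proof.
apply/eqP; rewrite -subr_eq0 !snD !csD; apply/eqP.
transitivity (sn l * (1 - (cs m ^+ 2 + sn m ^+ 2))); first by ring.
by rewrite cs2sn2 subrr mulr0.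
Qed.

(** After multiplication by [2 * s1] both coordinates telescope by the product formulas. *)
Lemma sum_vertex : \sum_(k < n) vertex k = 0.
Proof.
have s2 : 2 * s1 != 0 by have := s1_gt0; lra.
have e k : (2 * k.+1 = 2 * k + 1 + 1)%N by lia.
have tele (u : nat -> R) m : \sum_(k < m) (u k - u k.+1) = u 0%N - u m.
  by elim: m => [|m IH]; rewrite ?big_ord0 ?subrr // big_ord_recr /= IH; ring.
have c2n : cs (2 * n) = 1 by rewrite mul2n -addnn cs_addn cs_n opprK.
have s2n : sn (2 * n) = 0 by rewrite mul2n -addnn sn_addn sn_n oppr0.
apply: vecP; rewrite ?px_sum ?py_sum ?pE; apply: (mulfI s2); rewrite mulr0 mulr_sumr.
  transitivity (\sum_(k < n) (cs (2 * k) - cs (2 * k.+1))).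
    by apply: eq_bigr => k _; rewrite px_vertex e cs_sub.
  by rewrite (tele (fun k => cs (2 * k))) muln0 cs0 c2n subrr.
transitivity (\sum_(k < n) (sn (2 * k) - sn (2 * k.+1))).
  by apply: eq_bigr => k _; rewrite py_vertex e mulrN -sn_sub opprB.
by rewrite (tele (fun k => sn (2 * k))) muln0 sn0 s2n subrr.
Qed.

Definition sg b : R := (-1) ^+ b.
Lemma sgE b x : (-1) ^+ b *: x = sg b *: x. Proof. by []. Qed.
Lemma sgsg b : sg b * sg b = 1.
Proof. by case: b; rewrite /sg ?expr1 ?expr0; ring. Qed.
Lemma sgK b x : sg b *: (sg b *: x) = x.
Proof. by rewrite scalerA sgsg scale1r. Qed.
Lemma sg_neg b : sg (~~ b) = - sg b.
Proof. by case: b; rewrite /sg ?expr1 ?expr0 ?opprK. Qed.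
Lemma sg0 : sg false = 1. Proof. by rewrite /sg expr0. Qed.
Lemma sg1 : sg true = -1. Proof. by rewrite /sg expr1. Qed.

End Geometry.

(** * The polygon as an intersection of half-planes *)

Section Polygon.
Variables (R : realType) (n : nat).
Context {n_ok : odd_ge5 n}.
Let n_odd : odd n := n_is_odd.
Let n_ge5 : (5 <= n)%N := n_is_ge5.
Implicit Types (x y : 'cV[R]_2) (b : bool) (j k l : nat).

Local Notation vertex := (vertex R n).
Local Notation polygon := (@polygon R n).
Local Notation hf := (@hf R n).
Local Notation c1 := (c1 R n).
Local Notation sn := (sn R n).
Local Notation sg := (@sg R).

Lemma ltn_modn k : (k %% n < n)%N. Proof. by rewrite ltn_pmod // n_gt0. Qed.

Lemma polygon_sg b x : polygon b x <-> polygon false (sg b *: x).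
Proof.
split=> -[t tP e].
  exists t => //; rewrite -e scaler_sumr; apply: eq_bigr => k _.
  by rewrite expr0 scale1r scalerA mulrC -scalerA sgE sgK.
exists t => //; rewrite -[RHS](sgK b) -e scaler_sumr; apply: eq_bigr => k _.
by rewrite expr0 scale1r scalerA mulrC -scalerA.
Qed.

Definition cross x y : R := px x * py y - py x * px y.

Lemma cross_vertexS k : cross (vertex k) (vertex k.+1) = sn 2.
Proof.
rewrite /cross !px_vertex !py_vertex.
rewrite (_ : 2 * k.+1 + 1 = 2 * k + 1 + 2)%N; last by lia.
move: (2 * k + 1)%N => m; rewrite csD snD.
by rewrite -[RHS]mulr1 -[X in _ = _ * X](cs2sn2 R n m); ring.
Qed.

Lemma cross_decomp x k : x =
  (- cross (vertex k.+1) x / sn 2) *: vertex k + (cross (vertex k) x / sn 2) *: vertex k.+1.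
Proof.
have s2 : sn 2 != 0 by apply/lt0r_neq0/sn_gt0 => //; lia.
rewrite -(cross_vertexS k) in s2 *.
move: (vertex k) (vertex k.+1) s2 => u v; rewrite /cross => s2.
by apply: vecP; rewrite !pE; field.
Qed.

(** The numbers [cross (vertex k) x] are periodic in [k] with sum zero over a period. So they are
    neither all positive nor all negative, and somewhere they pass from nonnegative to
    nonpositive. *)
Lemma exists_cone x : exists k, 0 <= cross (vertex k) x /\ cross (vertex k.+1) x <= 0.
Proof.
apply: contrapT => H.
have H' k : 0 <= cross (vertex k) x -> 0 < cross (vertex k.+1) x.
  by move=> h; rewrite ltNge; apply/negP => h'; apply: H; exists k.
have sum0 : \sum_(k < n) cross (vertex k) x = 0.
  rewrite -[RHS](_ : cross 0 x = 0); last by rewrite /cross !pE; ring.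
  rewrite -sum_vertex /cross px_sum py_sum !mulr_suml -sumrB.
  exact: eq_bigr.
have n0 : (0 < n)%N by exact: n_gt0.
pose o := Ordinal n0.
case: (pselect (exists k, 0 <= cross (vertex k) x)) => [[k hk]|hn].
  have pos m : 0 < cross (vertex (k.+1 + m)) x.
    elim: m => [|m IH]; first by rewrite addn0 H'.
    by rewrite addnS H' // ltW.
  have pos' m : (m < n)%N -> 0 < cross (vertex m) x.
    move=> mn; have := pos (n * k.+1 - k.+1 + m)%N.
    rewrite -vertex_mod (_ : _ + _ = m + k.+1 * n)%N; last by nia.
    by rewrite addnC modnMDl modn_small.
  have e : cross (vertex o) x = 0.
    by apply: (psumr_eq0P _ sum0) => // i _; exact/ltW/pos'.
  by have := pos' 0%N n0; rewrite -[0%N]/(val o) e ltxx.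
have neg m : cross (vertex m) x < 0.
  by rewrite ltNge; apply/negP => h; apply: hn; exists m.
have sum0' : \sum_(k < n) - cross (vertex k) x = 0 by rewrite sumrN sum0 oppr0.
have e : - cross (vertex o) x = 0.
  by apply: (psumr_eq0P _ sum0') => // i _; rewrite oppr_ge0 ltW.
by have := neg 0%N; rewrite -[0%N]/(val o) -oppr_gt0 e ltxx.
Qed.

Lemma hull_halfplane x : polygon false x -> forall k, hf k x <= c1.
Proof.
move=> [t [t0 t1] <-] k; rewrite hf_sum -[leRHS]mul1r -t1 mulr_suml.
by apply: ler_sum => i _; rewrite !hfZ expr0 mul1r ler_wpM2l // hf_vertex_le.
Qed.

Lemma stdsimplexP (t : 'I_n -> R) : (forall i, 0 <= t i) -> \sum_i t i = 1 ->
  stdsimplex R n (\row_i t i).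
Proof.
by move=> t0 t1; split=> [i|]; rewrite ?mxE // -t1; apply: eq_bigr => i _; rewrite mxE.
Qed.

Lemma polygon0_intro (t : 'I_n -> R) : (forall i, 0 <= t i) -> \sum_i t i = 1 ->
  polygon false (\sum_(i < n) t i *: vertex i).
Proof.
move=> t0 t1; exists (\row_i t i); first exact: stdsimplexP.
by apply: eq_bigr => i _; rewrite mxE expr0 scale1r.
Qed.

(** [x] lies in the cone over one side, with coefficients whose sum is at most 1 by the inequality
    for that side. The missing weight is spread evenly over all vertices, whose sum is zero. *)
Lemma halfplane_hull x : (forall k, hf k x <= c1) -> polygon false x.
Proof.
move=> hx; have [k [ck ck']] := exists_cone x.
have s2 : 0 < sn 2 by apply: sn_gt0 => //; lia.
have := cross_decomp x k; set a := _ / sn 2; set b := _ / sn 2 => ex.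
have a0 : 0 <= a by rewrite divr_ge0 ?oppr_ge0 // ltW.
have b0 : 0 <= b by rewrite divr_ge0 // ltW.
have ab1 : a + b <= 1.
  have := hx k; rewrite ex hfD !hfZ hf_vertex // hf_vertexS // -mulrDl.
  by rewrite -{2}[c1]mul1r ler_pM2r // c1_gt0.
have n0 : (0 < n)%N by exact: n_gt0.
have nR : n%:R != 0 :> R by rewrite pnatr_eq0 -lt0n.
pose o i := Ordinal (ltn_modn i).
pose t (i : 'I_n) := (1 - a - b) / n%:R + (a *+ (i == o k) + b *+ (i == o k.+1)).
have -> : x = \sum_(i < n) t i *: vertex i.
  rewrite /t; under eq_bigr do rewrite 2!scalerDl.
  rewrite big_split /= -scaler_sumr sum_vertex // scaler0 add0r big_split /=.
  rewrite (bigD1 (o k)) //= eqxx big1 ?addr0; last first.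
    by move=> i /negbTE ->; rewrite scale0r.
  rewrite (bigD1 (o k.+1)) //= eqxx big1 ?addr0; last first.
    by move=> i /negbTE ->; rewrite scale0r.
  by rewrite !vertex_mod.
apply: polygon0_intro => [i|].
  apply: addr_ge0; first by rewrite divr_ge0 ?ler0n // -addrA -opprD subr_ge0.
  by apply: addr_ge0; apply: mulrn_wge0.
rewrite /t big_split /= sumr_const card_ord -[X in X + _]mulr_natr mulfVK //.
rewrite big_split /= (bigD1 (o k)) //= eqxx big1 ?addr0; last first.
  by move=> i /negbTE ->.
rewrite (bigD1 (o k.+1)) //= eqxx big1 ?addr0; last by move=> i /negbTE ->.
by rewrite /= !mulr1n; ring.
Qed.

Lemma polygonP b x : polygon b x <-> forall k, hf k (sg b *: x) <= c1.
Proof.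
rewrite polygon_sg; split; [exact: hull_halfplane|exact: halfplane_hull].
Qed.

Lemma polygonE b x : polygon b x <-> forall k : 'I_n, hf k (sg b *: x) <= c1.
Proof.
rewrite polygonP; split => [h k|h k]; first exact: h.
by rewrite -hf_mod //; exact: (h (Ordinal (ltn_modn k))).
Qed.

Lemma polygon_vertex b k : polygon b (sg b *: vertex k).
Proof. by apply/polygonP => l; rewrite sgK hf_vertex_le. Qed.

(** Equality on a supporting line forces the weights of the vertices off that line to vanish. *)
Lemma hf_boundary x k : (k < n)%N -> polygon false x -> hf k x = c1 ->
  exists2 s, 0 <= s <= 1 & x = (1 - s) *: vertex k + s *: vertex k.+1.
Proof.
move=> kn [t [t0 t1] ex] hx; pose o := Ordinal kn; pose o' := Ordinal (ltn_modn k.+1).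
have oo' : o != o'.
  apply/eqP => /(congr1 val) /= e; have := kn; rewrite leq_eqVlt => /orP[/eqP e'|kn'].
    by move: e; rewrite e' modnn; lia.
  by move: e; rewrite modn_small //; lia.
have sum0 : \sum_i t 0 i * (c1 - hf k (vertex i)) = 0.
  under eq_bigr do rewrite mulrBr.
  rewrite sumrB -mulr_suml t1 mul1r -hx -ex hf_sum.
  apply/eqP; rewrite subr_eq0; apply/eqP/eq_bigr => i _.
  by rewrite !hfZ expr0 mul1r.
have tz i : i != o -> i != o' -> t 0 i = 0.
  move=> io io'.
  have /eqP : t 0 i * (c1 - hf k (vertex i)) = 0.
    by apply: (psumr_eq0P _ sum0) => // j _; rewrite mulr_ge0 // subr_ge0 hf_vertex_le.
  rewrite mulf_eq0 => /orP[/eqP//|].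
  rewrite subr_eq0 => /eqP e.
  have := @hf_vertex_far R n n_ok _ _ kn (ltn_ord i) io io'; rewrite -e.
  by rewrite leNgt c3_lt_c1.
have e2 : t 0 o + t 0 o' = 1.
  rewrite -t1 (bigD1 o) //= (bigD1 o') /=; last by rewrite eq_sym.
  by rewrite big1 ?addr0 // => i /andP[]; exact: tz.
exists (t 0 o'); first by rewrite t0 -e2 lerDr t0.
rewrite -ex (bigD1 o) //= (bigD1 o') /=; last by rewrite eq_sym.
rewrite big1 ?addr0 => [|i /andP[io io']]; last by rewrite tz // scale0r.
by rewrite expr0 !scale1r vertex_mod // -e2 addrK.
Qed.

Lemma sideP b k x : (k < n)%N ->
  side n b k x <-> polygon b x /\ hf k (sg b *: x) = c1.
Proof.
move=> kn; split=> [[s] /=|[Px hx]].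
  rewrite in_itv /= => /andP[s0 s1'] <-.
  have hh l : hf l ((1 - s) *: vertex k + s *: vertex k.+1) =
     (1 - s) * hf l (vertex k) + s * hf l (vertex k.+1) by rewrite hfD !hfZ.
  rewrite /side_point sgE; split; last first.
    by rewrite sgK hh hf_vertex // hf_vertexS //; ring.
  apply/polygonP => l; rewrite sgK hh.
  have -> : c1 = (1 - s) * c1 + s * c1 by ring.
  by apply: lerD; apply: ler_wpM2l; rewrite ?subr_ge0 // hf_vertex_le.
have /polygon_sg Px' := Px.
have [s s01 e] := hf_boundary kn Px' hx.
by exists s; rewrite /= ?in_itv // /side_point -e sgE sgK.
Qed.

Lemma interior_halfplane b x : (polygon b)° x <-> forall k, hf k (sg b *: x) < c1.
Proof.
split=> [Px k|h].
  rewrite lt_neqAle; have /polygonP/(_ k) -> := interior_subset Px.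
  rewrite andbT; apply/eqP => e.
  (* A point with equality leaves the polygon when it is scaled by [1 + s]. *)
  have cf : (fun s : R => (1 + s) *: x) @ 0 --> x.
    rewrite -[X in _ --> X]scale1r -[X in X *: _]addr0.
    by apply: cvgZr_tmp; apply: cvgD; [exact: cvg_cst|exact: cvg_id].
  have /nbhs_ballP[d /= d0 hd] := cf _ Px.
  have /hd /polygonP/(_ k) : ball (0 : R) d (d / 2).
    by rewrite /ball /= sub0r normrN gtr0_norm; lra.
  rewrite scalerA mulrC -scalerA hfZ e.
  have c0 : 0 < c1 by exact: c1_gt0.
  by rewrite leNgt ltr_pMl // ltrDl divr_gt0.
have : \forall y \near x, forall k : 'I_n, hf k (sg b *: y) < c1.
  apply: (@filter_forall _ _ _ _ (nbhs_filter (x : 'cV[R]_2))) => k.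
  have : {for x, continuous (fun y : 'cV[R]_2 => hf k (sg b *: y))}.
    apply: (@continuous_comp _ _ _ (fun y : 'cV_2 => sg b *: y)); last exact: hf_continuous.
    by apply: continuousZr; exact: cvg_id.
  by move/(_ _ (lt_nbhsl (h k))).
apply: filterS => y hy; apply/polygonE => k; exact/ltW/hy.
Qed.

End Polygon.

(** * Points of the surface *)

Section Surface.
Variables (R : realType) (n : nat).
Context {n_ok : odd_ge5 n}.
Let n_odd : odd n := n_is_odd.
Let n_ge5 : (5 <= n)%N := n_is_ge5.
Implicit Types (x y z : 'cV[R]_2) (b : bool) (j k l : nat).

Local Notation vertex := (vertex R n).
Local Notation polygon := (@polygon R n).
Local Notation hf := (@hf R n).
Local Notation c1 := (c1 R n).
Local Notation sg := (@sg R).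
Local Notation surface := (surface R n).
Local Notation shift := (side_shift R n).

(** The Minkowski functional of the polygon, truncated below at 1, so that division by it retracts
    the plane radially onto the polygon. *)
Definition gauge x : R := \big[Num.max/1]_(k < n) (hf k x / c1).

Lemma gauge_ge1 x : 1 <= gauge x.
Proof. by rewrite /gauge; apply: bigmax_ge_id. Qed.

Lemma hf_gauge (k : 'I_n) x : hf k x <= gauge x * c1.
Proof. by rewrite -ler_pdivrMr ?c1_gt0 // /gauge; apply: le_bigmax. Qed.

Lemma gauge_polygon b x : polygon b x -> gauge (sg b *: x) = 1.
Proof.
move=> /polygonP h; apply/eqP; rewrite eq_le gauge_ge1 andbT.
by apply: bigmax_le => // k _; rewrite ler_pdivrMr ?c1_gt0 // mul1r.
Qed.

Lemma bigmax_continuous (T : topologicalType) (I : Type) (r : seq I) (F : I -> T -> R) :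
  (forall i, continuous (F i)) ->
  continuous (fun t : T => \big[Num.max/1]_(i <- r) F i t).
Proof.
move=> cF; elim: r => [|i r IH] t.
  under eq_fun do rewrite big_nil; exact: cst_continuous.
under eq_fun do rewrite big_cons.
by apply: (@continuous_max _ _ (F i)); [exact: cF|exact: IH].
Qed.

Lemma gauge_continuous : continuous gauge.
Proof.
apply: bigmax_continuous => k x.
by apply: continuousM; [exact: hf_continuous|exact: cst_continuous].
Qed.

Definition retr b x : 'cV[R]_2 := (gauge (sg b *: x))^-1 *: x.

Lemma retr_polygon b x : polygon b (retr b x).
Proof.
apply/polygonE => k; rewrite /retr scalerA mulrC -scalerA hfZ mulrC.
by rewrite ler_pdivrMr ?(lt_le_trans _ (gauge_ge1 _)) // mulrC hf_gauge.
Qed.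

Lemma retr_id b x : polygon b x -> retr b x = x.
Proof. by move=> h; rewrite /retr gauge_polygon // invr1 scale1r. Qed.

Lemma retr_continuous b : continuous (retr b).
Proof.
move=> x; apply: (@continuousZ _ _ _ (fun x => (gauge (sg b *: x))^-1) id).
  apply: continuousV.
    by rewrite lt0r_neq0 // (lt_le_trans _ (gauge_ge1 _)).
  apply: (@continuous_comp _ _ _ (fun y : 'cV_2 => sg b *: y)).
    by apply: continuousZr; exact: cvg_id.
  exact: gauge_continuous.
exact: cvg_id.
Qed.

Definition mkp b x (h : polygon b x) : @two_polygons R n :=
  exist _ (b, x) (mem_set h).

(* [sp b] is a continuous extension to the whole plane of the projection of
   [polygon b] to the surface. *)
Definition sp b x : surface := \pi_(surface) (mkp (retr_polygon b x)).

Lemma mkp_eq b x y (hx : polygon b x) (hy : polygon b y) : x = y -> mkp hx = mkp hy.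
Proof. by move=> e; apply: val_inj; rewrite /= e. Qed.

Lemma sp_pi b x (h : polygon b x) : sp b x = \pi_(surface) (mkp h).
Proof. by congr (\pi _); apply: mkp_eq; rewrite retr_id. Qed.

Lemma two_polygonsP (p : @two_polygons R n) : polygon (val p).1 (val p).2.
Proof. by case: p => p /= /set_mem. Qed.

Lemma piE (p : @two_polygons R n) : \pi_(surface) p = sp (val p).1 (val p).2.
Proof. by rewrite (sp_pi (two_polygonsP p)); congr (\pi _); apply: val_inj => /=; rewrite -surjective_pairing. Qed.

Definition rpb (x : surface) : bool := (val (repr x)).1.
Definition rpv (x : surface) : 'cV[R]_2 := (val (repr x)).2.

Lemma rp_polygon (x : surface) : polygon (rpb x) (rpv x).
Proof. exact: two_polygonsP. Qed.

Lemma rpK (x : surface) : sp (rpb x) (rpv x) = x.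
Proof. by rewrite -piE reprK. Qed.

Definition partner b k x : 'cV[R]_2 := x - sg b *: shift k.

Lemma partnerK b k x : partner (~~ b) k (partner b k x) = x.
Proof. by rewrite /partner sg_neg scaleNr opprK subrK. Qed.

Lemma hf_shift k : hf k (shift k) = 2 * c1.
Proof. by rewrite /side_shift hfD hf_vertex hf_vertexS; ring. Qed.

Lemma side_polygon b k x : side n b k x -> polygon b x.
Proof.
case=> s /=; rewrite in_itv /= => /andP[s0 s1'] <-.
apply/polygonP => l; rewrite /side_point sgE sgK hfD !hfZ.
have -> : c1 = (1 - s) * c1 + s * c1 by ring.
by apply: lerD; apply: ler_wpM2l; rewrite ?subr_ge0 // hf_vertex_le.
Qed.

Lemma side_point_partner b k s :
  partner b k (side_point n b k s) = side_point n (~~ b) k (1 - s).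
Proof.
rewrite /partner /side_point !sgE sg_neg /side_shift.
by apply: vecP; rewrite !(pxD, pyD, pxN, pyN, pxZ, pyZ); ring.
Qed.

Lemma side_partner b k x : side n b k x -> side n (~~ b) k (partner b k x).
Proof.
case=> s /=; rewrite in_itv /= => /andP[s0 s1'] <-; exists (1 - s).
  by rewrite /= in_itv /= subr_ge0 s1' lerBlDr lerDl.
by rewrite side_point_partner.
Qed.

Definition isvtx b x := exists k, x = sg b *: vertex k.

Lemma isvtx_polygon b x : isvtx b x -> polygon b x.
Proof. by case=> k ->; exact: polygon_vertex. Qed.

Lemma isvtx_lt b x : isvtx b x -> exists2 k, (k < n)%N & x = sg b *: vertex k.
Proof.
by case=> k ->; exists (k %% n)%N; [rewrite ltn_pmod ?n_gt0|rewrite vertex_mod].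
Qed.

Lemma vertex_on_side k j : (k < n)%N -> (j < n)%N -> hf k (vertex j) = c1 ->
  j = k \/ j = (k.+1 %% n)%N.
Proof.
move=> kn jn e; have [->|jk] := eqVneq j k; first by left.
have [->|jk'] := eqVneq j (k.+1 %% n)%N; first by right.
have := @hf_vertex_far R n n_ok _ _ kn jn jk jk'; rewrite e leNgt.
by rewrite c3_lt_c1.
Qed.

Lemma modSn k : (k < n)%N -> (k.+1 %% n = if k.+1 == n then 0 else k.+1)%N.
Proof. by move=> kn; case: eqP => [->|e]; rewrite ?modnn // modn_small; lia. Qed.

Lemma isvtx_partner b k x : (k < n)%N -> side n b k x -> isvtx b x ->
  isvtx (~~ b) (partner b k x).
Proof.
move=> kn /(sideP _ _ kn)[_ hx] /isvtx_lt[j jn e].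
rewrite e sgK in hx.
rewrite e; have [->|->] := vertex_on_side kn jn hx; [exists k.+1|exists k];
rewrite /partner ?sg_neg scaleNr -?scalerBr -?scalerN /side_shift ?vertex_mod.
  by apply: vecP; rewrite !(pxD, pyD, pxN, pyN, pxZ, pyZ); ring.
by apply: vecP; rewrite !(pxD, pyD, pxN, pyN, pxZ, pyZ); ring.
Qed.

Lemma side_side b k l x : (k < n)%N -> (l < n)%N -> k != l ->
  side n b k x -> side n b l x -> isvtx b x.
Proof.
move=> kn ln kl [s] /=; rewrite in_itv /= => /andP[s0 s1'] <-.
move=> /(sideP _ _ ln) [_]; rewrite /side_point sgE sgK hfD !hfZ => e.
have [->|s0'] := eqVneq s 0.
  by exists k; rewrite subr0 scale1r scale0r addr0.
have [->|s1''] := eqVneq s 1.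
  by exists k.+1; rewrite subrr scale1r scale0r add0r.
have spos : 0 < s by rewrite lt0r s0' s0.
have spos' : 0 < 1 - s by rewrite subr_gt0 lt_neqAle s1'' s1'.
have h1 := @hf_vertex_le R n n_ok l k; have h2 := @hf_vertex_le R n n_ok l k.+1.
have e1 : hf l (vertex k) = c1.
  apply/eqP; rewrite eq_le h1 leNgt; apply/negP => h1'.
  have : (1 - s) * hf l (vertex k) < (1 - s) * c1 by rewrite ltr_pM2l.
  have : s * hf l (vertex k.+1) <= s * c1 by rewrite ler_pM2l.
  by move: e; lra.
have e2 : hf l (vertex k.+1) = c1.
  apply/eqP; rewrite eq_le h2 leNgt; apply/negP => h1'.
  have : s * hf l (vertex k.+1) < s * c1 by rewrite ltr_pM2l.
  by move: e; rewrite e1; lra.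
rewrite -vertex_mod in e2.
have [kl'|k1] := vertex_on_side ln kn e1; first by rewrite kl' eqxx in kl.
have kS : (k.+1 %% n < n)%N by rewrite ltn_pmod ?n_gt0.
have := vertex_on_side ln kS e2; move: k1 kl.
rewrite (modSn kn) (modSn ln).
move=> k1' kl' h; exfalso; clear -kn ln n_ge5 k1' kl' h.
by move: k1' kl' h; case: eqP; case: eqP => //; case: eqP; lia.
Qed.

(** A closed form of the equivalence relation generated by [glued]. *)
Definition same_point b x b' x' : Prop :=
  [\/ b = b' /\ x = x',
      exists k, [/\ (k < n)%N, b' = ~~ b, side n b k x & x' = partner b k x] |
      isvtx b x /\ isvtx b' x'].

Lemma same_point_sym b x b' x' : same_point b x b' x' -> same_point b' x' b x.
Proof.
case=> [[-> ->]|[k [kn -> sx ->]]|[v v']]; first by apply: Or31.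
  by apply: Or32; exists k; rewrite negbK partnerK; split=> //; exact: side_partner.
by apply: Or33.
Qed.

Lemma same_point_vtx b x b' x' : same_point b x b' x' -> isvtx b x -> isvtx b' x'.
Proof.
case=> [[-> ->]//|[k [kn -> sx ->]]|[v v']//]; exact: isvtx_partner.
Qed.

(** A point that is not a vertex lies on at most one side, so two successive gluings undo each
    other. *)
Lemma same_point_trans b x b' x' b'' x'' :
  same_point b x b' x' -> same_point b' x' b'' x'' -> same_point b x b'' x''.
Proof.
move=> h1 h2.
case: (pselect (isvtx b' x')) => [v|nv].
  apply: Or33; split; first exact: (same_point_vtx (same_point_sym h1)).
  exact: same_point_vtx v.
case: h1 h2 nv => [[<- <-]//|[k [kn -> sx ->]]|[v v']] h2 nv //.
case: h2 => [[<- <-]|[l [ln -> sy ->]]|[v v']] //.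
  by apply: Or32; exists k.
have [<-|kl] := eqVneq k l; first by apply: Or31; rewrite negbK partnerK.
by case: nv; apply: (side_side kn ln kl (side_partner sx)).
Qed.

Lemma sp_glue b k x : (k < n)%N -> side n b k x -> sp b x = sp (~~ b) (partner b k x).
Proof.
move=> kn; wlog -> : b x / b = false => [wl|].
  case: b => sx; last exact: wl.
  by rewrite (wl false (partner true k x)) ?(partnerK true) //; exact: (side_partner sx).
move=> sx; have Px := side_polygon sx; have Py := side_polygon (side_partner sx).
rewrite (sp_pi Px) (sp_pi Py); apply/eqmodP/asboolP; apply: rst_step.
by exists (Ordinal kn); split=> //=; rewrite /partner sg0 scale1r subrK.
Qed.

Lemma side_vertex b k : (k < n)%N -> side n b k (sg b *: vertex k) /\
  side n b k (sg b *: vertex k.+1).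
Proof.
by move=> kn; split; apply/(sideP _ _ kn); rewrite sgK ?hf_vertex ?hf_vertexS;
  split=> //; exact: polygon_vertex.
Qed.

Lemma sp_vertexS b k : sp b (sg b *: vertex k) = sp (~~ b) (sg (~~ b) *: vertex k.+1) /\
  sp b (sg b *: vertex k.+1) = sp (~~ b) (sg (~~ b) *: vertex k).
Proof.
wlog kn : k / (k < n)%N => [wl|].
  have e : vertex k.+1 = vertex (k %% n).+1.
    by rewrite -(vertex_mod R (k %% n).+1) -[(k %% n).+1]addn1 modnDml addn1 vertex_mod.
  by rewrite e -(vertex_mod R k); apply: wl; rewrite ltn_pmod ?n_gt0.
have [s0 s1'] := side_vertex b kn.
rewrite (sp_glue kn s0) (sp_glue kn s1'); split; congr sp;
  rewrite /partner sg_neg /side_shift; apply: vecP;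
  rewrite !(pxD, pyD, pxN, pyN, pxZ, pyZ); ring.
Qed.

Definition sing : surface := sp false (vertex 0).

(** Crossing two sides moves the index of a vertex by two. As [n] is odd and indices have period
    [n], such steps reach all vertices; this is why there is only one singular point. *)
Lemma sp_vertex b k : sp b (sg b *: vertex k) = sing.
Proof.
have even m : sp false (vertex (2 * m)) = sing.
  elim: m => [//|m IH]; rewrite -IH (_ : 2 * m.+1 = (2 * m).+2)%N; last by lia.
  have [_] := sp_vertexS false (2 * m).+1; have [_] := sp_vertexS true (2 * m).
  by rewrite sg0 !scale1r => -> <-.
have hf k' : sp false (vertex k') = sing.
  have [/dvdnP[m ->]|h] := boolP (2 %| k')%N; first by rewrite mulnC even.
  rewrite -(vertex_addn R k').
  have -> : (k' + n = 2 * ((k' + n) %/ 2))%N by move: n_odd h; lia.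
  exact: even.
case: b; last by rewrite sg0 scale1r.
by have [-> _] := sp_vertexS true k; rewrite /= sg0 scale1r.
Qed.

Lemma sp_vtx b x : isvtx b x -> sp b x = sing.
Proof. by case=> k ->; exact: sp_vertex. Qed.

Lemma sp_eq b x b' x' : polygon b x -> polygon b' x' ->
  sp b x = sp b' x' <-> same_point b x b' x'.
Proof.
move=> Px Px'; split=> [|[[-> ->]//|[k [kn -> sx ->]]|[v v']]]; last first.
- by rewrite (sp_vtx v) (sp_vtx v').
- exact: sp_glue.
rewrite (sp_pi Px) (sp_pi Px') => /eqmodP/asboolP.
pose rel (p q : @two_polygons R n) :=
  same_point (val p).1 (val p).2 (val q).1 (val q).2.
move=> h; have : rel (mkp Px) (mkp Px').
  elim: h => [p q [k [p1 q1 sp1 e]]|p|p q _|p q r _ h1 _ h2]; rewrite /rel.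
  - apply: Or32; exists k; rewrite p1 q1 /partner sg0 scale1r e addrK; split=> //.
    by rewrite -e.
  - exact: Or31.
  - exact: same_point_sym.
  - exact: same_point_trans h1 h2.
by [].
Qed.

Lemma singP b x : polygon b x -> sp b x = sing <-> isvtx b x.
Proof.
move=> Px; split=> [|/sp_vtx//].
have v0 : isvtx false (vertex 0) by exists 0%N; rewrite sg0 scale1r.
by move/(sp_eq Px (isvtx_polygon v0))/same_point_sym/same_point_vtx; apply.
Qed.

Lemma singular_pointP (x : surface) : singular_point x <-> x = sing.
Proof.
split=> [[p <- [k e]]|->].
  by rewrite piE e; exact: sp_vertex.
have v0 : polygon false (vertex 0).
  by apply: isvtx_polygon; exists 0%N; rewrite sg0 scale1r.
exists (mkp v0); first by rewrite -sp_pi.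
by exists 0%N; rewrite /= expr0 scale1r.
Qed.

Lemma nbhs_two_polygons (p : @two_polygons R n) (Q : set 'cV[R]_2) :
  nbhs (val p).2 Q ->
  \forall q \near p, (val q).1 = (val p).1 /\ Q (val q).2.
Proof.
move=> nQ.
have vc : {for p, continuous (val : @two_polygons R n -> bool * 'cV[R]_2)}.
  exact: initial_continuous.
have : nbhs (val p) [set u : bool * 'cV[R]_2 | u.1 = (val p).1 /\ Q u.2].
  exists ([set (val p).1], Q) => /=; last by move=> [u1 u2] /= [-> ?].
  by split=> //; exact: discrete_set1.
by move/vc.
Qed.

Lemma two_polygons_continuous (Y : topologicalType) (F : bool -> 'cV[R]_2 -> Y) :
  (forall b, continuous (F b)) ->
  continuous (fun p : @two_polygons R n => F (val p).1 (val p).2).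
Proof.
move=> cF p U /= nU.
have := nbhs_two_polygons (cF (val p).1 (val p).2 _ nU).
by apply: (@filterS _ _ (nbhs_filter p)) => q /= [->].
Qed.

Lemma sp_continuous b : continuous (sp b).
Proof.
have h : continuous (fun x => mkp (retr_polygon b x)).
  apply: continuous_comp_initial => x.
  move=> U [[A B] /= [nA nB] sub]; apply: nbhsS (retr_continuous nB) => y By.
  by apply: sub; split => //=; exact: nbhs_singleton nA.
by move=> y; apply: continuous_comp; [exact: h|exact: pi_continuous].
Qed.

Section Lift.
Variables (Y : topologicalType) (F : bool -> 'cV[R]_2 -> Y).
Hypothesis F_glue : forall (k : nat) x, (k < n)%N -> side n false k x ->
  F false x = F true (x - shift k).
Hypothesis F_vtx : forall b b' k l,
  F b (sg b *: vertex k) = F b' (sg b' *: vertex l).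

(** Evaluation at the chosen representative; [F_glue] and [F_vtx] make it independent of the choice.
    [F] is defined on the whole plane, so that its continuity can be stated without subspaces. *)
Definition slift (x : surface) : Y := F (rpb x) (rpv x).

Lemma slift_sp b x : polygon b x -> slift (sp b x) = F b x.
Proof.
move=> Px; have := rpK (sp b x); have := rp_polygon (sp b x); rewrite /slift.
move: (rpb _) (rpv _) => b' x' Px' /(sp_eq Px' Px).
case=> [[-> ->]//|[k [kn -> sx ->]]|[[i ->] [j ->]]]; last exact: F_vtx.
case: b' sx {Px'} => sx /=; last first.
  by rewrite (F_glue kn sx) /partner sg0 scale1r.
have /= sx' := side_partner sx; rewrite (F_glue kn sx').
by rewrite /partner sg1 scaleN1r opprK addrK.
Qed.

Lemma slift_continuous : (forall b, continuous (F b)) -> continuous slift.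
Proof.
move=> cF; apply/quotient_continuous.
rewrite (_ : _ \o _ = fun p : @two_polygons R n => F (val p).1 (val p).2).
  exact: two_polygons_continuous.
by apply/funext => p; rewrite /= piE slift_sp //; exact: two_polygonsP.
Qed.

End Lift.

(** The tool for neighbourhoods in the quotient: it suffices to look at all representatives of [x].
    The set [U] is open because near a point of a polygon the only relevant sides and vertices are
    those that contain the point, and its partners there represent the same point of the surface. *)
Lemma near_surface (x : surface) (N : bool -> set 'cV[R]_2) :
  (forall b z, polygon b z -> sp b z = x -> nbhs z (N b)) ->
  \forall y \near x, forall b z, polygon b z -> sp b z = y -> N b z.
Proof.
move=> hN.
pose U := [set y : surface | forall b z, polygon b z -> sp b z = y -> nbhs z (N b)].
suff oU : open U.
  have : nbhs x U by apply: open_nbhs_nbhs; split.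
  apply: nbhsS => y Uy b z Pz e; exact: nbhs_singleton (Uy b z Pz e).
rewrite /open /= /quotient_open openE => p /=; rewrite /U /= => Up.
set b := (val p).1; set z := (val p).2.
have Pz : polygon b z := two_polygonsP p.
rewrite piE -/b -/z in Up.
have h1 : \forall z' \near z, nbhs z' (N b).
  by apply: nbhs_interior; apply: Up.
have h2 : \forall z' \near z, forall k : 'I_n, side n b k z' ->
    nbhs (partner b k z') (N (~~ b)).
  apply: nbhs_forall => k; have kn := ltn_ord k.
  case: (pselect (side n b k z)) => [sz|nz].
    have : nbhs (partner b k z) (N (~~ b)).
      by apply: Up; [exact/side_polygon/(side_partner sz)|rewrite -sp_glue].
    move/nbhs_interior.
    have ct : {for z, continuous (partner b k)}.
      by apply: continuousB; [exact: cvg_id|exact: cst_continuous].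
    by move/ct; apply: nbhsS => z' /= h _.
  have lt : hf k (sg b *: z) < c1.
    rewrite lt_neqAle; have /polygonP/(_ k) -> := Pz; rewrite andbT.
    by apply/eqP => e; apply: nz; apply/sideP.
  have ct : {for z, continuous (fun y : 'cV[R]_2 => hf k (sg b *: y))}.
    apply: (@continuous_comp _ _ _ (fun y : 'cV_2 => sg b *: y)); last exact: hf_continuous.
    by apply: continuousZr; exact: cvg_id.
  have := ct _ (lt_nbhsl lt); apply: nbhsS => z' /= h /(sideP _ _ kn)[_ e].
  by rewrite e ltxx in h.
have h3 : \forall z' \near z, forall j : 'I_n, z' = sg b *: vertex j ->
    forall b' i, nbhs (sg b' *: vertex i) (N b').
  apply: nbhs_forall => j.
  have [e|ne] := eqVneq z (sg b *: vertex j).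
    apply: nbhs_all => z' _ b' i; apply: Up; first exact: polygon_vertex.
    by rewrite e !sp_vertex.
  have : nbhs z (~` [set sg b *: vertex j]).
    apply: open_nbhs_nbhs; split; last by apply/eqP.
    by apply: closed_openC; apply: accessible_closed_set1; exact: hausdorff_accessible.
  by apply: nbhsS => z' /= h e; case: h.
have h123 : nbhs z [set z' | [/\ nbhs z' (N b),
   forall k : 'I_n, side n b k z' -> nbhs (partner b k z') (N (~~ b)) &
   forall j : 'I_n, z' = sg b *: vertex j -> forall b' i, nbhs (sg b' *: vertex i) (N b')]].
  by apply: nbhsS (nbhsA h1 (nbhsA h2 h3)) => z' [? []].
have := nbhs_two_polygons h123.
apply: nbhsS => q [q1 [k1 k2 k3]] b' z' Pz' e /=.
rewrite piE in e; have Pq := two_polygonsP q.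
have := e; move/esym/(sp_eq Pq Pz'); rewrite q1 -/b.
case=> [[<- <-]//|[k [kn -> sx ->]]|[v [i ->]]].
  exact: (k2 (Ordinal kn)).
have [j jn ej] := isvtx_lt v.
exact: (k3 (Ordinal jn)).
Qed.

End Surface.

(** * Maps with finitely many values *)

Section General.

Lemma finite_eps (R : realType) (I : finType) (d : I -> R) :
  exists2 e : R, 0 < e & forall i, 0 < d i -> e < d i.
Proof.
exists (\big[Num.min/1]_(i | 0 < d i) d i / 2).
  by apply: divr_gt0 => //; elim/big_ind: _ => // x y x0 y0; rewrite lt_min x0.
move=> i di; apply: (@lt_le_trans _ _ (\big[Num.min/1]_(i | 0 < d i) d i)).
  rewrite ltr_pdivrMr // ltr_pMr; first by rewrite ltr1n.
  by elim/big_ind: _ => // x y x0 y0; rewrite lt_min x0.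
exact: bigmin_le_cond.
Qed.

(** Applied to the difference of two local expressions of a map, this shows that the map is locally
    affine without a distinction of cases on the position of the point. *)
Lemma near_finite_const (R : realType) (T : topologicalType) (I : finType)
    (c : I -> 'cV[R]_2) (phi : T -> 'cV[R]_2) (D : set T) (x : T) :
  (forall y, D y -> exists i, phi y = c i) -> {for x, continuous phi} ->
  nbhs x [set y | D y -> phi y = phi x].
Proof.
move=> hc cphi.
have : nbhs x [set y | forall i, c i = phi x \/ phi y <> c i].
  apply: nbhs_forall => i; have [e|ne] := eqVneq (phi x) (c i).
    by apply: nbhs_all => y; left.
  have h : nbhs (phi x) (~` [set c i]).
    apply: open_nbhs_nbhs; split; last exact/eqP.
    by apply: closed_openC; apply: accessible_closed_set1; exact: hausdorff_accessible.
  by have := cphi _ h; apply: nbhsS => y hy; right.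
apply: nbhsS => y hy Dy; have [i e] := hc y Dy.
by case: (hy i); rewrite /= -e.
Qed.

Lemma linform_continuous (R : realType) (a b : R) :
  continuous (fun x : 'cV[R]_2 => a * px x + b * py x).
Proof.
move=> x; apply: (@continuousD _ _ _ (fun x : 'cV[R]_2 => a * px x) (fun x => b * py x)).
  by apply: continuousM; [exact: cst_continuous|exact: px_continuous].
by apply: continuousM; [exact: cst_continuous|exact: py_continuous].
Qed.

Lemma mulmx_continuous (R : realType) (A : 'M[R]_2) :
  continuous (fun x : 'cV[R]_2 => A *m x).
Proof.
rewrite (_ : (fun x => _) = fun x : 'cV[R]_2 =>
  mkv (A 0 0 * px x + A 0 1 * py x) (A 1 0 * px x + A 1 1 * py x)); last first.
  by apply/funext => x; apply: vecP; rewrite ?px_mulmx ?py_mulmx !(px_mkv, py_mkv).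
by apply: mkv_continuous; exact: linform_continuous.
Qed.

End General.

(** * Charts *)

Section Charts.
Variables (R : realType) (n : nat).
Context {n_ok : odd_ge5 n}.
Let n_odd : odd n := n_is_odd.
Let n_ge5 : (5 <= n)%N := n_is_ge5.
Implicit Types (x y z : 'cV[R]_2) (b : bool) (j k l : nat).

Local Notation vertex := (vertex R n).
Local Notation polygon := (@polygon R n).
Local Notation hf := (@hf R n).
Local Notation c1 := (c1 R n).
Local Notation cs := (cs R n).
Local Notation sg := (@sg R).
Local Notation surface := (surface R n).
Local Notation shift := (side_shift R n).
Local Notation sp := (@sp R n n_ok).
Local Notation sing := (@sing R n n_ok).
Local Notation isvtx := (@isvtx R n).
Local Notation rpb := (@rpb R n).
Local Notation rpv := (@rpv R n).
Implicit Types u v w : surface.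

(* The displacements between two points of [two_polygons] that are glued form a
   finite set. *)
Definition Dvec (t : bool * bool * 'I_n * 'I_n) : 'cV[R]_2 :=
  sg t.1.1.1 *: vertex t.1.2 + sg t.1.1.2 *: vertex t.2.

Lemma DvecP b b' k l : exists t, sg b *: vertex k + sg b' *: vertex l = Dvec t.
Proof.
have kn : (k %% n < n)%N by rewrite ltn_pmod ?n_gt0.
have ln : (l %% n < n)%N by rewrite ltn_pmod ?n_gt0.
by exists (b, b', Ordinal kn, Ordinal ln); rewrite /Dvec /= !vertex_mod.
Qed.

Lemma same_point_Dvec b x b' x' : same_point n b x b' x' -> exists t, x' = x + Dvec t.
Proof.
case=> [[_ ->]|[k [kn _ _ ->]]|[[k ->] [l ->]]].
- have [t e] := DvecP false true 0 0; exists t; rewrite -e sg0 sg1.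
  by rewrite scale1r scaleN1r subrr addr0.
- have [t e] := DvecP (~~ b) (~~ b) k k.+1; exists t; rewrite -e.
  by rewrite -scalerDr sg_neg scaleNr.
have [t e] := DvecP b' (~~ b) l k; exists t; rewrite -e.
by rewrite sg_neg scaleNr addrCA addrN addr0.
Qed.

Lemma sp_Dvec b x b' x' : polygon b x -> polygon b' x' -> sp b x = sp b' x' ->
  exists t, x' = x + Dvec t.
Proof. by move=> Px Px' /(sp_eq Px Px')/same_point_Dvec. Qed.

Lemma near_dist u e : 0 < e ->
  nbhs u [set w | forall b z, polygon b z -> sp b z = w ->
    exists z0, [/\ polygon b z0, sp b z0 = u & `|z - z0| < e]].
Proof.
move=> e0; apply: (near_surface (N := fun b => [set z | exists z0,
  [/\ polygon b z0, sp b z0 = u & `|z - z0| < e]])) => b z Pz ez.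
have : nbhs z (ball z e) by exact: nbhsx_ballx.
apply: nbhsS => z' zz'; exists z; split=> //.
by move: zz'; rewrite -ball_normE /= distrC.
Qed.

(** Representatives of [u] and [v] differ by one of finitely many vectors. If all neighbourhoods
    meet, two representatives in one polygon are closer than every nonzero vector among these, hence
    equal. *)
Lemma surface_hausdorff : hausdorff_space surface.
Proof.
move=> u v cl; apply: contrapT => ne.
have [e e0 he] := finite_eps (fun t => `|(rpv u + Dvec t.1) - (rpv v + Dvec t.2)|).
have e20 : 0 < e / 2 by rewrite divr_gt0.
have [w [/= wu wv]] := cl _ _ (near_dist u e20) (near_dist v e20).
have [z [Pz ez zu]] := wu _ _ (rp_polygon w) (rpK w).
have [z' [Pz' ez' zv]] := wv _ _ (rp_polygon w) (rpK w).
have [t et] := sp_Dvec (rp_polygon u) Pz (etrans (rpK u) (esym ez)).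
have [t' et'] := sp_Dvec (rp_polygon v) Pz' (etrans (rpK v) (esym ez')).
have zz' : 0 < `|z - z'|.
  by rewrite normr_gt0 subr_eq0; apply/eqP => zz; apply: ne; rewrite -ez -ez' zz.
have := he (t, t'); rewrite /= -et -et' => /(_ zz').
have : `|z - z'| <= `|rpv w - z| + `|rpv w - z'|.
  have -> : z - z' = (z - rpv w) + (rpv w - z') by rewrite addrA subrK.
  by rewrite (le_trans (ler_normD _ _)) // distrC.
lra.
Qed.

Definition regular k b z : Prop := (polygon b)° z \/ open_side n b k z.
Definition chv b k z : 'cV[R]_2 := if b then z + shift k else z.

Lemma norm2_vertex k : px (vertex k) ^+ 2 + py (vertex k) ^+ 2 = 1.
Proof. by rewrite px_vertex py_vertex sqrrN addrC cs2sn2. Qed.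

Lemma open_side_side b k z : open_side n b k z -> side n b k z.
Proof.
by case=> s /=; rewrite in_itv /= => /andP[s0 s1'] <-; exists s; rewrite //= in_itv /= !ltW.
Qed.

(** All vertices have norm 1, and a proper convex combination of two different unit vectors is
    shorter. *)
Lemma open_side_nvtx b k z : open_side n b k z -> ~ isvtx b z.
Proof.
case=> s /=; rewrite in_itv /= => /andP[s0 s1'] <- [j].
rewrite /side_point sgE => /(congr1 (fun t => sg b *: t)); rewrite !sgK => e.
have := norm2_vertex j; rewrite -e !(pxD, pyD, pxZ, pyZ).
have h1 := norm2_vertex k; have h2 := norm2_vertex k.+1.
have h3 : px (vertex k) * px (vertex k.+1) + py (vertex k) * py (vertex k.+1) = cs 2.
  rewrite !px_vertex !py_vertex (_ : 2 * k.+1 + 1 = 2 * k + 1 + 2)%N; last by lia.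
  move: (2 * k + 1)%N => m; rewrite csD snD -[RHS]mul1r -(cs2sn2 R n m); ring.
have h4 : cs 2 < 1 by rewrite -[X in _ < X](cs0 R n); apply: cs_lt; lia.
move: (px (vertex k)) (py (vertex k)) (px (vertex k.+1)) (py (vertex k.+1)) h1 h2 h3 => a b' c d h1 h2 h3 h.
have h' : (1 - s) ^+ 2 * (a ^+ 2 + b' ^+ 2) + s ^+ 2 * (c ^+ 2 + d ^+ 2)
  + 2 * s * (1 - s) * (a * c + b' * d) =
  ((1 - s) * a + s * c) ^+ 2 + ((1 - s) * b' + s * d) ^+ 2 by ring.
rewrite h h1 h2 h3 in h'.
have : s * (1 - s) * (1 - cs 2) = 0 by apply: (mulfI (_ : 2 != 0 :> R)) => //; lra.
by apply/eqP; rewrite !mulf_neq0 // ?subr_eq0 ?lt0r_neq0 // 1?eq_sym ?(lt_eqF h4) ?(lt_eqF s1').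
Qed.

Lemma side_open b k z : side n b k z -> ~ isvtx b z -> open_side n b k z.
Proof.
move=> [s] /=; rewrite in_itv /= => /andP[s0 s1'] <- nv.
exists s => //=; rewrite in_itv /= !lt_neqAle s0 s1' !andbT; apply/andP; split.
  apply/eqP => e; apply: nv; exists k; rewrite /side_point -e.
  by rewrite subr0 scale1r scale0r addr0.
apply/eqP => e; apply: nv; exists k.+1; rewrite /side_point e.
by rewrite subrr scale1r scale0r add0r.
Qed.

Lemma interior_nside b k z : (k < n)%N -> (polygon b)° z -> ~ side n b k z.
Proof.
by move=> kn /interior_halfplane/(_ k) h /(sideP _ _ kn)[_ e]; rewrite e ltxx in h.
Qed.

Lemma interior_nvtx b z : (polygon b)° z -> ~ isvtx b z.
Proof.
by move=> /interior_halfplane h [j e]; have := h j; rewrite e sgK hf_vertex ltxx.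
Qed.

Lemma regular_nvtx k b z : regular k b z -> ~ isvtx b z.
Proof. by case=> [/interior_nvtx|/open_side_nvtx]. Qed.

Lemma regular_polygon k b z : regular k b z -> polygon b z.
Proof. by case=> [/interior_subset|/open_side_side/side_polygon]. Qed.

Lemma regular_same k b z b' z' : (k < n)%N -> same_point n b z b' z' ->
  regular k b z -> regular k b' z' /\ chv b k z = chv b' k z'.
Proof.
move=> kn; case=> [[<- <-]//|[l [ln -> sx ->]]|[v _] /regular_nvtx//].
case=> [/interior_nside|oz]; first by move/(_ _ ln).
have lk : l = k.
  apply: contrapT => /eqP lk; apply: (open_side_nvtx oz).
  exact: (side_side ln kn lk sx (open_side_side oz)).
rewrite lk in sx *; split.
  right; apply: side_open; first exact: side_partner.
  by move/(isvtx_partner kn (side_partner sx)); rewrite negbK partnerK; exact: open_side_nvtx oz.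
rewrite /chv /partner; case: (b) => /=; first by rewrite sg1 scaleN1r opprK.
by rewrite sg0 scale1r subrK.
Qed.

Lemma chart_domainE k u : chart_domain k u = regular k (rpb u) (rpv u).
Proof. by []. Qed.

Lemma rp_same b z : polygon b z -> same_point n (rpb (sp b z)) (rpv (sp b z)) b z.
Proof. by move=> Pz; apply/(sp_eq (rp_polygon _) Pz)/rpK. Qed.

Lemma chart_domain_sp (k : 'I_n) b z : polygon b z ->
  chart_domain k (sp b z) <-> regular k b z.
Proof.
move=> Pz; rewrite chart_domainE.
have h := rp_same Pz.
split=> hr; first by have [] := regular_same (ltn_ord k) h hr.
by have [] := regular_same (ltn_ord k) (same_point_sym h) hr.
Qed.

Lemma chart_sp (k : 'I_n) b z : regular k b z -> chart k (sp b z) = chv b k z.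
Proof.
move=> hr; have h := rp_same (regular_polygon hr).
by have [_ ->] := regular_same (ltn_ord k) (same_point_sym h) hr.
Qed.

Lemma chart_sp_dom (k : 'I_n) b z : polygon b z -> chart_domain k (sp b z) ->
  chart k (sp b z) = chv b k z.
Proof. by move=> Pz /(chart_domain_sp _ Pz); exact: chart_sp. Qed.

Lemma chv_continuous b k : continuous (chv b k).
Proof.
case: b => z; last exact: cvg_id.
by apply: (@continuousD _ _ _ id (fun=> shift k)); [exact: cvg_id|exact: cst_continuous].
Qed.

Lemma chart_continuous (k : 'I_n) u : chart_domain k u -> {for u, continuous (chart k)}.
Proof.
move=> du U /= nU.
have : nbhs u [set w | forall b z, polygon b z -> sp b z = w -> U (chv b k z)].
  apply: (near_surface (N := fun b => [set z | U (chv b k z)])) => b z Pz e.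
  apply: (@chv_continuous b k z U).
  by rewrite -e in du nU; rewrite -(chart_sp_dom Pz du).
apply: nbhsS => w hw; exact: (hw _ _ (rp_polygon w) (rpK w)).
Qed.

Lemma chart_domain_open (k : 'I_n) u : chart_domain k u -> nbhs u (chart_domain k).
Proof.
move=> du.
have : nbhs u [set w | forall b z, polygon b z -> sp b z = w -> polygon b z -> regular k b z].
  apply: (near_surface (N := fun b => [set z | polygon b z -> regular k b z])) => b z Pz e.
  rewrite -e in du; case/(chart_domain_sp _ Pz): du => [iz|oz].
    by move: (nbhs_interior iz); apply: nbhsS => z' hz _; left.
  have : nbhs z [set z' | forall l : 'I_n, l != k -> hf l (sg b *: z') < c1].
    apply: nbhs_forall => l; have [->|lk] := eqVneq l k; first exact: nbhs_all.
    have lt : hf l (sg b *: z) < c1.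
      rewrite lt_neqAle; have /polygonP/(_ l) -> := Pz; rewrite andbT.
      apply/eqP => e'; apply: (open_side_nvtx oz).
      apply: (side_side (ltn_ord l) (ltn_ord k) lk); last exact: open_side_side.
      exact/sideP.
    have ct : {for z, continuous (fun y : 'cV[R]_2 => hf l (sg b *: y))}.
      apply: (@continuous_comp _ _ _ (fun y : 'cV_2 => sg b *: y)); last exact: hf_continuous.
      by apply: continuousZr; exact: cvg_id.
    by have := ct _ (lt_nbhsl lt); apply: nbhsS => z' /= h _.
  apply: nbhsS => z' /= hz' Pz'.
  have [e'|ne] := eqVneq (hf k (sg b *: z')) c1.
    right; apply: side_open; first exact/sideP.
    case/isvtx_lt => j jn ej; rewrite ej sgK in hz'.
    have hj l : (l < n)%N -> l != k -> hf l (vertex j) < c1.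
      by move=> ln lk; exact: (hz' (Ordinal ln)).
    have [jk|jk] := eqVneq j k; last first.
      by have := hj _ jn jk; rewrite hf_vertex ltxx.
    (* The other side through [vertex j]; adding [n] makes the predecessor correct for [j = 0]. *)
    pose l := ((j + n).-1 %% n)%N.
    have ln : (l < n)%N by rewrite ltn_pmod ?n_gt0.
    have lk : l != k.
      rewrite -jk /l; have [->|j0] := eqVneq j 0%N.
        by rewrite add0n modn_small; lia.
      by rewrite (_ : (j + n).-1 = j.-1 + n)%N ?modnDr ?modn_small; lia.
    have := hj _ ln lk; rewrite /l hf_mod.
    rewrite -(vertex_addn R j) -{2}(@prednK (j + n)); last by lia.
    by rewrite hf_vertexS ltxx.
  left; apply/interior_halfplane => l.
  rewrite -hf_mod; have ln : (l %% n < n)%N by rewrite ltn_pmod ?n_gt0.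
  have [e'|lk] := eqVneq (Ordinal ln) k; last exact: hz' lk.
  have -> : (l %% n)%N = k by rewrite -e'.
  by rewrite lt_neqAle ne; move/polygonP/(_ k): Pz'.
apply: nbhsS => w hw; rewrite chart_domainE; exact: (hw _ _ (rp_polygon w) (rpK w) (rp_polygon w)).
Qed.

Lemma chart_inj (k : 'I_n) u w : chart_domain k u -> chart_domain k w ->
  chart k u = chart k w -> u = w.
Proof.
move=> du dw; rewrite -(rpK u) -(rpK w) in du dw *.
have Pu := rp_polygon u; have Pw := rp_polygon w.
rewrite (chart_sp_dom Pu du) (chart_sp_dom Pw dw).
move: (rpb u) (rpv u) (rpb w) (rpv w) Pu Pw {du dw} => b z b' z' Pz Pz'.
(* The two developed polygons lie on opposite sides of the line through the [k]-th side and meet in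
   that side only. *)
have key y y' : polygon false y -> polygon true y' -> y = y' + shift k ->
    sp false y = sp true y'.
  move=> Py Py' e.
  have sy : side n false k y.
    apply/(sideP _ _ (ltn_ord k)); split=> //; rewrite sg0 scale1r.
    apply/eqP; rewrite eq_le; apply/andP; split.
      by have /polygonP/(_ k) := Py; rewrite sg0 scale1r.
    have /polygonP/(_ k) := Py'; rewrite sg1 scaleN1r hfN e hfD hf_shift; lra.
  rewrite (sp_glue (ltn_ord k) sy) /partner sg0 scale1r e addrK //.
case: b Pz; case: b' Pz' => Pz' Pz /=.
- by move/addIr ->.
- by move=> /esym/(key _ _ Pz' Pz).
- exact: key.
- by move->.
Qed.

Lemma nonsing_chart u : u <> sing <-> exists k : 'I_n, chart_domain k u.
Proof.
rewrite -(rpK u); have Pu := rp_polygon u.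
rewrite (_ : (_ <> _) = ~ isvtx (rpb u) (rpv u)); last first.
  by apply/propext; split=> h h'; apply: h; apply/(singP Pu).
split=> [nv|[k] /(chart_domain_sp _ Pu)/regular_nvtx//].
case: (pselect (exists k : 'I_n, hf k (sg (rpb u) *: rpv u) = c1)) => [[k e]|ne].
  exists k; apply/(chart_domain_sp _ Pu); right; apply: side_open => //.
  by apply/(sideP _ _ (ltn_ord k)).
have k0 : 'I_n := Ordinal (@n_gt0 n n_ok).
exists k0; apply/(chart_domain_sp _ Pu); left; apply/interior_halfplane => l.
rewrite lt_neqAle; have /polygonP -> := Pu; rewrite andbT.
apply/eqP => e; apply: ne; have ln : (l %% n < n)%N by rewrite ltn_pmod ?n_gt0.
by exists (Ordinal ln); rewrite /= hf_mod.
Qed.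

End Charts.

(** * Affine maps, the rotation *)

Section Affine.
Variables (R : realType) (n : nat).
Context {n_ok : odd_ge5 n}.
Let n_odd : odd n := n_is_odd.
Let n_ge5 : (5 <= n)%N := n_is_ge5.
Implicit Types (x y z : 'cV[R]_2) (b : bool) (j k l : nat).

Local Notation vertex := (vertex R n).
Local Notation polygon := (@polygon R n).
Local Notation hf := (@hf R n).
Local Notation c1 := (c1 R n).
Local Notation cs := (cs R n).
Local Notation sn := (sn R n).
Local Notation sg := (@sg R).
Local Notation surface := (surface R n).
Local Notation shift := (side_shift R n).
Local Notation sp := (@sp R n n_ok).
Local Notation sing := (@sing R n n_ok).
Local Notation rpb := (@rpb R n).
Local Notation rpv := (@rpv R n).
Implicit Types u v w : surface.

Local Notation chv := (@chv R n).
Local Notation Dvec := (@Dvec R n).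
Local Notation smap := (continuousType surface surface).

Lemma surface_ind (P : surface -> Prop) :
  (forall b z, polygon b z -> P (sp b z)) -> forall u, P u.
Proof. by move=> h u; rewrite -(rpK u); apply: h; exact: rp_polygon. Qed.

(** Polygon coordinates replace charts: [f] may be given piecewise, on pieces that need not be open,
    as long as only finitely many translations occur. The difference of the two chart expressions is
    then continuous with finitely many values. *)
Lemma affine_criterion (I : finType) (W : I -> 'cV[R]_2) (A : 'M[R]_2) (f g : smap) :
  \det A = 1 -> cancel f g -> cancel g f -> f sing = sing ->
  (forall b z, polygon b z -> exists i b', polygon b' (A *m z + W i) /\
     f (sp b z) = sp b' (A *m z + W i)) ->
  affine_map A f.
Proof.
move=> dA fg gf fs hf; split=> //; first by exists g.
  by move=> u /singular_pointP ->; rewrite fs.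
move=> i j u du dfu; pose phi w := chart j (f w) - A *m chart i w.
exists (phi u).
suff : nbhs u [set w | True -> phi w = phi u].
  by apply: nbhsS => w /= /(_ Logic.I) e; rewrite addrC -e /phi subrK.
pose c (t : I * (bool * bool * 'I_n * 'I_n) * bool * bool) :=
  W t.1.1.1 + Dvec t.1.1.2 + chv t.1.2 j 0 - A *m chv t.2 i 0.
apply: (near_finite_const (c := c) (D := fun=> True)) => [w _|].
  have [i0 [b' [Pz' e]]] := hf _ _ (rp_polygon w); rewrite rpK in e.
  have [t et] := sp_Dvec Pz' (rp_polygon (f w)) (etrans (esym e) (esym (rpK _))).
  exists (i0, t, rpb (f w), rpb w); rewrite /phi /c /=.
  have chE k v : chart k v = rpv v + chv (rpb v) k 0.
    by rewrite /chart -/(rpb v) -/(rpv v) /chv; case: (rpb v); rewrite ?add0r ?addr0.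
  rewrite !chE et mulmxDr; apply: vecP; rewrite !(pxD, pyD, pxN, pyN); ring.
apply: (@continuousB _ _ _ (fun w => chart j (f w)) (fun w => A *m chart i w)).
  by apply: (@continuous_comp _ _ _ f); [exact: cts_fun|exact: chart_continuous].
apply: (@continuous_comp _ _ _ (chart i) (fun x => A *m x)).
  exact: chart_continuous.
exact: mulmx_continuous.
Qed.

Lemma affine_sing A (f : smap) : affine_map A f -> f sing = sing.
Proof. by case=> _ _ h _; apply: h; apply/singular_pointP. Qed.

Lemma affine_inj A (f : smap) : affine_map A f -> injective f.
Proof. by case=> _ [g fg _] _ _; exact: can_inj fg. Qed.

Lemma affine_nonsing A (f : smap) u : affine_map A f -> u <> sing -> f u <> sing.
Proof.
by move=> hf h e; apply: h; apply: (affine_inj hf); rewrite e (affine_sing hf).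
Qed.

Lemma affine_chart A (f : smap) (i j : 'I_n) u :
  affine_map A f -> chart_domain i u -> chart_domain j (f u) ->
  nbhs u [set w | chart j (f w) = chart j (f u) + A *m (chart i w - chart i u)].
Proof.
move=> [_ _ _ h] du dfu; have [v hv] := h i j u du dfu.
have e0 := nbhs_singleton hv.
by apply: nbhsS hv => w /= ->; rewrite e0 mulmxBr addrAC addrCA subrr addr0 addrC.
Qed.

Lemma affine_id : affine_map (1 : 'M[R]_2) (idfun : smap).
Proof.
apply: (@affine_criterion unit (fun=> 0) 1 idfun idfun) => //; first exact: det1.
by move=> b z Pz; exists tt, b; rewrite mul1mx addr0.
Qed.

Lemma affine_comp A B (f g : smap) : affine_map A f -> affine_map B g ->
  affine_map (B * A) (g \o f : smap).
Proof.
move=> hf hg; case: (hf) (hg) => dA [f' ff' f'f] _ _ [dB [g' gg' g'g] _ _].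
split.
- by rewrite -mulmxE det_mulmx dA dB mulr1.
- by exists (f' \o g' : smap) => x /=; rewrite ?gg' ?ff' ?f'f ?g'g.
- move=> x /singular_pointP -> /=; by rewrite (affine_sing hf) (affine_sing hg).
move=> i j u du dgfu; rewrite /= in dgfu.
have nu : u <> sing by apply/nonsing_chart; exists i.
have [k dfu] := (nonsing_chart (f u)).1 (affine_nonsing hf nu).
have h1 := affine_chart hf du dfu; have h2 := affine_chart hg dfu dgfu.
have h2' := (@cts_fun _ _ f u) _ h2.
exists (chart j (g (f u)) - (B * A) *m chart i u).
apply: nbhsS (nbhsA h1 h2') => w /= [e1 e2].
by rewrite e2 e1 [chart k (f u) + _]addrC addrK mulmxA mulmxBr -mulmxE addrCA.
Qed.

Lemma affine_inverse A (f g : smap) : affine_map A f -> cancel f g -> cancel g f ->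
  affine_map A^-1 g.
Proof.
move=> hf fg gf; case: (hf) => dA _ _ _.
have uA : A \is a GRing.unit by rewrite -/(A \in unitmx) unitmxE dA unitr1.
have gs : g sing = sing by rewrite -{1}(affine_sing hf) fg.
split; [|by exists f|by move=> x /singular_pointP ->|].
  by rewrite det_inv dA invr1.
move=> i j u du dgu.
have dfgu : chart_domain i (f (g u)) by rewrite gf.
have h := affine_chart hf dgu dfgu.
have h' := (@cts_fun _ _ g u) _ h.
exists (chart j (g u) - A^-1 *m chart i u).
apply: nbhsS h' => w /=; rewrite !gf => e.
rewrite e mulmxDr mulmxA -[A^-1 *m A]/(A^-1 * A) mulVr // mul1mx.
by apply: vecP; rewrite !(pxD, pyD, pxN, pyN); ring.
Qed.

Lemma affine_invE A (f : smap) : affine_map A f -> exists2 g : smap,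
  affine_map A^-1 g & cancel f g /\ cancel g f.
Proof.
move=> hf; case: (hf) => _ [g fg gf] _ _.
by exists g => //; exact: affine_inverse hf fg gf.
Qed.

Lemma veech_mul (A B : 'M[R]_2) : veech_group n A -> veech_group n B -> veech_group n (A * B).
Proof. by move=> [f hf] [g hg]; exists (f \o g : smap); exact: affine_comp. Qed.
Lemma veech_inv (A : 'M[R]_2) : veech_group n A -> veech_group n A^-1.
Proof. by move=> [f /affine_invE[g hg _]]; exists g. Qed.
Lemma veech1 : veech_group n (1 : 'M[R]_2).
Proof. by exists idfun; exact: affine_id. Qed.
Lemma veech_det (A : 'M[R]_2) : veech_group n A -> \det A = 1.
Proof. by case=> f []. Qed.
Lemma veech_unit (A : 'M[R]_2) : veech_group n A -> A \is a GRing.unit.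
Proof. by move/veech_det => d; rewrite -[_ \is a _]/(A \in unitmx) unitmxE d unitr1. Qed.

Definition mk2 (a e c d : R) : 'M[R]_2 :=
  \matrix_(i, j) if i == 0 then if j == 0 then a else e else if j == 0 then c else d.

Lemma px_mk2 a e c d x : px (mk2 a e c d *m x) = a * px x + e * py x.
Proof. by rewrite px_mulmx !mxE. Qed.
Lemma py_mk2 a e c d x : py (mk2 a e c d *m x) = c * px x + d * py x.
Proof. by rewrite py_mulmx !mxE. Qed.

Lemma mx_ext (A B : 'M[R]_2) : (forall x : 'cV[R]_2, A *m x = B *m x) -> A = B.
Proof.
move=> h; apply/matrixP => i j; have := h (delta_mx j 0).
rewrite -!colE => /matrixP/(_ i 0); by rewrite !mxE.
Qed.

Lemma mk2E (A : 'M[R]_2) : A = mk2 (A 0 0) (A 0 1) (A 1 0) (A 1 1).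
Proof.
by apply: mx_ext => x; apply: vecP; rewrite ?px_mk2 ?py_mk2 ?px_mulmx ?py_mulmx.
Qed.

Lemma mk2M a e c d a' e' c' d' : mk2 a e c d * mk2 a' e' c' d' =
  mk2 (a * a' + e * c') (a * e' + e * d') (c * a' + d * c') (c * e' + d * d').
Proof.
apply: mx_ext => x; rewrite -mulmxA; apply: vecP; rewrite !(px_mk2, py_mk2); ring.
Qed.

Lemma mk2_1 : mk2 1 0 0 1 = 1.
Proof. by apply: mx_ext => x; rewrite mul1mx; apply: vecP; rewrite ?px_mk2 ?py_mk2; ring. Qed.

Lemma det_mk2 a e c d : \det (mk2 a e c d) = a * d - e * c.
Proof.
rewrite (expand_det_row _ 0) big_ord_recl big_ord_recl big_ord0 addr0 !mxE /=.
rewrite /cofactor !det_mx11 !mxE /=; ring.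
Qed.

Definition rotm m := mk2 (cs m) (- sn m) (sn m) (cs m).

Lemma rotmD m m' : rotm (m + m') = rotm m * rotm m'.
Proof. by rewrite /rotm mk2M csD snD; congr mk2; ring. Qed.
Lemma rotm0 : rotm 0 = 1.
Proof. by rewrite /rotm cs0 sn0 oppr0 mk2_1. Qed.
Lemma rotmX m : rotm m = rotm 1 ^+ m.
Proof. by elim: m => [|m IH]; rewrite ?rotm0 // exprSr -IH -rotmD addn1. Qed.
Lemma rotm_n : rotm n = -1.
Proof.
apply: mx_ext => x; rewrite mulNmx mul1mx.
by apply: vecP; rewrite ?px_mk2 ?py_mk2 ?pxN ?pyN cs_n sn_n; ring.
Qed.
Lemma rotm_2n : rotm (n + n) = 1.
Proof. by rewrite rotmD rotm_n mulrNN mulr1. Qed.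

(** Rotation by [pi / n] followed by [-1] is a rotation by [n + 1] units of [pi / n], an even
    number, and therefore permutes the sides. So [rotm 1] exchanges the two polygons. *)
Lemma hf_rotm l x : hf l (- (rotm 1 *m x)) = hf (l + n.-1./2) x.
Proof.
rewrite /hf pxN pyN px_mk2 py_mk2.
set m := (2 * (l + n.-1./2) + 2)%N.
have e : (m + 1 = 2 * l + 2 + n)%N by rewrite /m; have := odd_double_half n; rewrite n_odd; lia.
have := congr1 cs e; have := congr1 sn e.
rewrite cs_addn sn_addn csD snD => es ec.
have es' : sn (2 * l + 2) = - (sn m * cs 1 + cs m * sn 1) by rewrite es opprK.
have ec' : cs (2 * l + 2) = - (cs m * cs 1 - sn m * sn 1) by rewrite ec opprK.
rewrite es' ec'; have h := cs2sn2 R n 1.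
transitivity ((cs 1 ^+ 2 + sn 1 ^+ 2) * (sn m * px x - cs m * py x)); first by ring.
by rewrite h mul1r.
Qed.

Lemma polygon_rot b x : polygon b x -> polygon (~~ b) (rotm 1 *m x).
Proof.
move=> /polygonP h; apply/polygonP => k.
rewrite sg_neg scaleNr -scalerN; have -> : sg b *: - (rotm 1 *m x) = - (rotm 1 *m (sg b *: x)).
  by rewrite -scalemxAr scalerN.
by rewrite hf_rotm.
Qed.

Lemma rot_vertex k : rotm 1 *m vertex k = - vertex (k + n.+1./2).
Proof.
have e : (2 * (k + n.+1./2) + 1 = 2 * k + 1 + 1 + n)%N.
  by have := odd_double_half n.+1; rewrite /= n_odd; lia.
apply: vecP; rewrite ?px_mk2 ?py_mk2 ?pxN ?pyN ?px_vertex ?py_vertex e;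
  move: (2 * k + 1)%N {e} => m.
  by rewrite sn_addn snD; ring.
by rewrite cs_addn csD; ring.
Qed.

Lemma sp_glueE b k x : polygon b x -> hf k (sg b *: x) = c1 ->
  sp b x = sp (~~ b) (x - sg b *: shift k).
Proof.
move=> Px e; have kn : (k %% n < n)%N by rewrite ltn_pmod ?n_gt0.
have -> : shift k = shift (k %% n).
  rewrite /side_shift vertex_mod; congr (_ + _).
  by rewrite -(vertex_mod R (k %% n).+1) -[(k %% n).+1]addn1 modnDml addn1 vertex_mod.
by rewrite -/(partner n b (k %% n) x) -sp_glue //; apply/(sideP _ _ kn); rewrite hf_mod.
Qed.

Definition rot_fun : surface -> surface := slift (fun b x => sp (~~ b) (rotm 1 *m x)).

Lemma rot_glue k x : (k < n)%N -> side n false k x ->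
  sp (~~ false) (rotm 1 *m x) = sp (~~ true) (rotm 1 *m (x - shift k)).
Proof.
move=> kn /(sideP _ _ kn)[Px]; rewrite sg0 scale1r => e.
have Px' := polygon_rot Px.
rewrite (@sp_glueE true (k + n.+1./2)) //; last first.
  rewrite sg1 scaleN1r hf_rotm -addnA.
  have -> : (n.+1./2 + n.-1./2 = n)%N.
    by have := odd_double_half n; have := odd_double_half n.+1; rewrite /= n_odd; lia.
  by rewrite hf_addn.
congr sp; rewrite mulmxBr sg1 scaleN1r; congr (_ - _).
by rewrite /side_shift mulmxDr !rot_vertex addSn opprD.
Qed.

Lemma rot_vtx b b' k l : sp (~~ b) (rotm 1 *m (sg b *: vertex k)) =
  sp (~~ b') (rotm 1 *m (sg b' *: vertex l)).
Proof.
have h c i : sp (~~ c) (rotm 1 *m (sg c *: vertex i)) = sing.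
  by rewrite -scalemxAr rot_vertex scalerN -scaleNr -sg_neg sp_vertex.
by rewrite !h.
Qed.

Lemma rot_sp b x : polygon b x -> rot_fun (sp b x) = sp (~~ b) (rotm 1 *m x).
Proof. by move=> Px; apply: slift_sp => //; [exact: rot_glue|exact: rot_vtx]. Qed.

Lemma rot_continuous : continuous rot_fun.
Proof.
apply: slift_continuous; [exact: rot_glue|exact: rot_vtx|] => b x.
by apply: continuous_comp; [exact: mulmx_continuous|exact: sp_continuous].
Qed.

Definition rot_map : smap := mkcts rot_continuous.

Lemma iter_continuous m : continuous (iter m rot_fun).
Proof.
elim: m => [|m IH] x; first exact: cvg_id.
by apply: (@continuous_comp _ _ _ (iter m rot_fun)); [exact: IH|exact: rot_continuous].
Qed.

Definition rotX m : smap := mkcts (@iter_continuous m).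

Lemma rotX_sp m b x : polygon b x ->
  polygon (b (+) odd m) (rotm m *m x) /\ rotX m (sp b x) = sp (b (+) odd m) (rotm m *m x).
Proof.
move=> Px; elim: m => [|m [IH1 IH2]]; first by rewrite rotm0 mul1mx addbF.
have -> : rotm m.+1 = rotm 1 * rotm m by exact: (rotmD 1 m).
have eb : b (+) odd m.+1 = ~~ (b (+) odd m) by rewrite /= addbN.
rewrite -mulmxA eb; split; first exact: polygon_rot.
by rewrite -rot_sp // -IH2.
Qed.

Lemma rotX_2n : rotX (n + n) =1 id.
Proof.
apply: surface_ind => b x Px; have [_ ->] := rotX_sp (n + n) Px.
by rewrite rotm_2n mul1mx oddD addbb addbF.
Qed.

Lemma rot_cancel : cancel rot_map (rotX (n + n).-1) /\ cancel (rotX (n + n).-1) rot_map.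
Proof.
have e : (n + n).-1.+1 = (n + n)%N by rewrite prednK // addn_gt0 n_gt0.
have h (u : surface) : iter (n + n).-1.+1 rot_fun u = u by rewrite e; exact: rotX_2n.
by split=> u; [rewrite -[RHS]h iterSr|exact: h].
Qed.

Lemma rot_affine : affine_map (rotm 1) rot_map.
Proof.
have [h1 h2] := rot_cancel.
apply: (@affine_criterion unit (fun=> 0) _ _ _ _ h1 h2).
- by rewrite det_mk2 -(cs2sn2 R n 1); ring.
- have v0 := @isvtx_polygon R n n_ok false (vertex 0) (ex_intro _ 0%N (esym (scale1r _))).
  transitivity (sp true (rotm 1 *m vertex 0)); first exact: rot_sp v0.
  by rewrite rot_vertex -scaleN1r -(sg1 R); exact: sp_vertex.
move=> b z Pz; exists tt, (~~ b); rewrite addr0; split; first exact: polygon_rot.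
exact: rot_sp.
Qed.

(** The affine map with derivative [-1]. It exchanges the polygons, so that the twist has to be
    described on [polygon false] only. *)
Definition oppS : surface -> surface := rotX n.

Lemma oppS_continuous : continuous oppS. Proof. exact: iter_continuous. Qed.

Lemma oppS_sp b x : polygon b x -> oppS (sp b x) = sp (~~ b) (- x).
Proof.
move=> Px; have [_] := rotX_sp n Px; rewrite /oppS => ->.
by rewrite n_odd addbT rotm_n mulNmx mul1mx.
Qed.

Lemma polygon_opp b x : polygon b x -> polygon (~~ b) (- x).
Proof. by move=> Px; have [] := rotX_sp n Px; rewrite n_odd addbT rotm_n mulNmx mul1mx. Qed.

Lemma oppSK : involutive oppS.
Proof.
apply: surface_ind => b x Px; rewrite oppS_sp // oppS_sp ?negbK ?opprK //.
exact: polygon_opp.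
Qed.

(** The reflection in the vertical axis reverses the orientation, so it is no affine map of the
    surface. It reduces sides on the left to sides on the right, and it conjugates the twist to its
    inverse, which is how that inverse is obtained. *)
Definition rfl x : 'cV[R]_2 := mkv (- px x) (py x).

Lemma px_rfl x : px (rfl x) = - px x. Proof. exact: px_mkv. Qed.
Lemma py_rfl x : py (rfl x) = py x. Proof. exact: py_mkv. Qed.

Lemma rflK : involutive rfl.
Proof. by move=> x; apply: vecP; rewrite /rfl !pE ?opprK. Qed.
Lemma rflB x y : rfl (x - y) = rfl x - rfl y.
Proof. by apply: vecP; rewrite /rfl !pE; ring. Qed.
Lemma rflD x y : rfl (x + y) = rfl x + rfl y.
Proof. by apply: vecP; rewrite /rfl !pE; ring. Qed.
Lemma rflZ a x : rfl (a *: x) = a *: rfl x.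
Proof. by apply: vecP; rewrite /rfl !pE; ring. Qed.

Lemma hf_rfl k x : (k < n)%N -> hf k (rfl x) = hf (2 * n - 2 - k) x.
Proof.
move=> kn; rewrite /hf /rfl px_mkv py_mkv.
have -> : (2 * (2 * n - 2 - k) + 2 = 2 * n - (2 * k + 2) + n + n)%N by lia.
rewrite !cs_addn !sn_addn cs_sub2n ?sn_sub2n; try lia; ring.
Qed.

Lemma rfl_vertex k : (k < n)%N -> rfl (vertex k) = vertex (2 * n - 1 - k).
Proof.
move=> kn; have -> : (2 * n - 1 - k = n - 1 - k + n)%N by lia.
have e : (2 * (n - 1 - k) + 1 = 2 * n - (2 * k + 1))%N by lia.
rewrite vertex_addn; apply: vecP; rewrite ?px_rfl ?py_rfl ?px_vertex ?py_vertex e.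
  by rewrite sn_sub2n //; lia.
by rewrite cs_sub2n //; lia.
Qed.

Lemma rfl_shift k : (k < n)%N -> rfl (shift k) = shift (2 * n - 2 - k).
Proof.
move=> kn; rewrite /side_shift rflD rfl_vertex // addrC.
have -> : (2 * n - 1 - k = (2 * n - 2 - k).+1)%N by lia.
congr (_ + _); have [kn'|kn'] := ltnP k.+1 n.
  by rewrite rfl_vertex //; congr (vertex _); lia.
have -> : vertex k.+1 = vertex 0 by rewrite -(vertex_addn R 0); congr (vertex _); lia.
rewrite rfl_vertex ?n_gt0 //.
have -> : (2 * n - 2 - k = n - 1)%N by lia.
by rewrite -(vertex_addn R (n - 1)); congr (vertex _); lia.
Qed.

Lemma polygon_rfl b x : polygon b x -> polygon b (rfl x).
Proof.
move=> /polygonP h; apply/polygonE => k.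
by rewrite -rflZ hf_rfl.
Qed.

Definition rfl_fun : surface -> surface := slift (fun b x => sp b (rfl x)).

Lemma rfl_glue k x : (k < n)%N -> side n false k x ->
  sp false (rfl x) = sp true (rfl (x - shift k)).
Proof.
move=> kn /(sideP _ _ kn)[Px]; rewrite sg0 scale1r => e.
have Px' := polygon_rfl Px.
rewrite (@sp_glueE false (2 * n - 2 - k)) //; last first.
  by rewrite sg0 scale1r -hf_rfl // rflK.
by congr sp; rewrite sg0 scale1r rflB rfl_shift.
Qed.

Lemma rfl_vtx b b' k l : sp b (rfl (sg b *: vertex k)) = sp b' (rfl (sg b' *: vertex l)).
Proof.
have h c i : sp c (rfl (sg c *: vertex i)) = sing.
  by rewrite rflZ -vertex_mod rfl_vertex ?ltn_modn // sp_vertex.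
by rewrite !h.
Qed.

Lemma rfl_sp b x : polygon b x -> rfl_fun (sp b x) = sp b (rfl x).
Proof. by move=> Px; apply: slift_sp => //; [exact: rfl_glue|exact: rfl_vtx]. Qed.

Lemma rfl_continuous : continuous rfl_fun.
Proof.
apply: slift_continuous; [exact: rfl_glue|exact: rfl_vtx|] => b x.
apply: continuous_comp; last exact: sp_continuous.
apply: mkv_continuous => y; last exact: py_continuous.
by apply: continuousN; exact: px_continuous.
Qed.

Lemma rfl_funK : involutive rfl_fun.
Proof.
apply: surface_ind => b x Px; rewrite rfl_sp // rfl_sp ?rflK //.
exact: polygon_rfl.
Qed.

Lemma rfl_oppS u : rfl_fun (oppS u) = oppS (rfl_fun u).
Proof.
elim/surface_ind: u => b x Px.
rewrite rfl_sp // !oppS_sp //; last exact: polygon_rfl.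
rewrite rfl_sp; last exact: polygon_opp.
by congr sp; apply: vecP; rewrite /rfl !pE.
Qed.

End Affine.

Lemma pasting (T Y : topologicalType) (I : finType) (A : I -> set T)
    (F : I -> T -> Y) (f : T -> Y) :
  (forall i, closed (A i)) -> (forall i, continuous (F i)) ->
  (forall t, exists i, A i t) -> (forall i t, A i t -> f t = F i t) -> continuous f.
Proof.
move=> clA cF cov agr t U nU.
have : nbhs t [set t' | forall i, A i t' -> U (F i t')].
  apply: nbhs_forall => i; have [At|nAt] := pselect (A i t).
    have nU' : nbhs (F i t) U by rewrite -(agr i).
    by have := cF i t _ nU'; apply: nbhsS => t' /= h _.
  have : nbhs t (~` A i) by apply: open_nbhs_nbhs; split => //; exact: closed_openC.
  by apply: nbhsS => t' /= h At'.
by apply: nbhsS => t' h; have [i At'] := cov t'; rewrite /= (agr i) //; exact: h.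
Qed.

Lemma closed_le_fun (R : realType) (T : topologicalType) (f g : T -> R) :
  continuous f -> continuous g -> closed [set t | f t <= g t].
Proof.
move=> cf cg; rewrite (_ : [set t | _] = (fun t => g t - f t) @^-1` [set x | 0 <= x]).
  apply: closed_comp; last exact: closed_ge.
  by move=> t _; apply: continuousB; [exact: cg|exact: cf].
by apply/seteqP; split=> t /=; rewrite subr_ge0.
Qed.

(** * The twist along the horizontal cylinders *)

Section Twist.
Variables (R : realType) (n : nat).
Context {n_ok : odd_ge5 n}.
Let n_odd : odd n := n_is_odd.
Let n_ge5 : (5 <= n)%N := n_is_ge5.
Implicit Types (z : 'cV[R]_2) (s x : R) (b : bool) (j k l : nat).

Local Notation vertex := (vertex R n).
Local Notation polygon := (@polygon R n).
Local Notation hf := (@hf R n).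
Local Notation c1 := (c1 R n).
Local Notation s1 := (s1 R n).
Local Notation cs := (cs R n).
Local Notation sn := (sn R n).
Local Notation sg := (@sg R).
Local Notation surface := (surface R n).
Local Notation shift := (side_shift R n).
Local Notation sp := (@sp R n n_ok).
Local Notation sing := (@sing R n n_ok).
Implicit Types u v w : surface.

Local Notation smap := (continuousType surface surface).
Local Notation oppS := (@oppS R n n_ok).
Local Notation rfl_fun := (@rfl_fun R n n_ok).

(** The number of horizontal cylinders. The vertices 0 to [g] form the right half of
    [polygon false], from bottom to top. *)
Definition half : nat := n.-1./2.
Local Notation g := half.
Let g2 : (n = 2 * g + 1)%N.
Proof. by rewrite /half; have := odd_double_half n; rewrite n_odd; lia. Qed.

Definition vX i : R := sn (2 * i + 1).
Definition vY i : R := - cs (2 * i + 1).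
(** [wid] is half the length of the horizontal chord of [polygon false] at parameter [s] between
    [vertex i] and [vertex i.+1], and [hgt] is its height; [cK i] is half the circumference of the
    [i]-th cylinder. *)
Definition wid i (s : R) := (1 - s) * vX i + s * vX i.+1.
Definition hgt i (s : R) := (1 - s) * vY i + s * vY i.+1.
Definition cK i := vX i + vX i.+1.

Lemma vertexE i : vertex i = mkv (vX i) (vY i). Proof. by []. Qed.
Lemma side_pointE i s : side_point n false i s = mkv (wid i s) (hgt i s).
Proof.
rewrite /side_point sgE sg0 scale1r; apply: vecP; rewrite ?px_mkv ?py_mkv !(pxD, pyD, pxZ, pyZ) //.
by rewrite !px_vertex.
by rewrite !py_vertex.
Qed.
Lemma shiftE i : shift i = mkv (cK i) (vY i + vY i.+1).
Proof. by apply: vecP; rewrite ?px_mkv ?py_mkv ?pxD ?pyD ?px_vertex ?py_vertex. Qed.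

Lemma wid_compl i s : wid i (1 - s) = cK i - wid i s.
Proof. by rewrite /wid /cK; ring. Qed.
Lemma hgt_compl i s : hgt i (1 - s) = vY i + vY i.+1 - hgt i s.
Proof. by rewrite /hgt; ring. Qed.
Lemma wid0 i : wid i 0 = vX i. Proof. by rewrite /wid; ring. Qed.
Lemma wid1 i : wid i 1 = vX i.+1. Proof. by rewrite /wid; ring. Qed.
Lemma hgt0 i : hgt i 0 = vY i. Proof. by rewrite /hgt; ring. Qed.
Lemma hgt1 i : hgt i 1 = vY i.+1. Proof. by rewrite /hgt; ring. Qed.

Lemma vX_gt0 i : (i < g)%N -> 0 < vX i.
Proof. by move=> ig; apply: sn_gt0; lia. Qed.
Lemma vX_ge0 i : (i <= g)%N -> 0 <= vX i.
Proof.
rewrite leq_eqVlt => /orP[/eqP ->|/vX_gt0/ltW//].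
by rewrite /vX -g2 sn_n.
Qed.
Lemma vY_lt i j : (i < j <= g)%N -> vY i < vY j.
Proof. by move=> ij; rewrite /vY ltrN2; apply: cs_lt; lia. Qed.
Lemma vY_le i j : (i <= j <= g)%N -> vY i <= vY j.
Proof.
by move=> /andP[]; rewrite leq_eqVlt => /orP[/eqP ->//|ij jg]; apply/ltW/vY_lt/andP.
Qed.
Lemma vY_g : vY g = 1. Proof. by rewrite /vY -g2 cs_n opprK. Qed.

Definition cot : R := cos (pi / n%:R) / sin (pi / n%:R).
Lemma cotE : cot = c1 / s1.
Proof. by rewrite /cot /c1 /s1 /c1 /s1 /cs /sn /ang mul1r. Qed.

(* All horizontal cylinders have circumference [2 * cK i] and height
   [vY i.+1 - vY i], hence the same modulus. *)
Lemma cylinder_modulus i : 2 * cot * (vY i.+1 - vY i) = 2 * cK i.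
Proof.
have s0 : s1 != 0 by apply: lt0r_neq0; exact: s1_gt0.
have e : (2 * i.+1 + 1 = 2 * i + 1 + 1 + 1)%N by lia.
rewrite cotE /cK /vX /vY e opprK addrC cs_sub addrC sn_add -/s1 -/c1.
rewrite -/s1 -/c1; field.
exact: s0.
Qed.

Lemma wid_ge0 i s : (i < g)%N -> 0 <= s <= 1 -> 0 <= wid i s.
Proof.
move=> ig /andP[s0 s1']; apply: addr_ge0; apply: mulr_ge0; rewrite ?subr_ge0 //.
  by apply: vX_ge0; lia.
exact: vX_ge0.
Qed.

Lemma wid_le i s : (i < g)%N -> 0 <= s <= 1 -> wid i s <= cK i.
Proof.
move=> ig /andP[s0 s1']; rewrite -subr_ge0 -wid_compl wid_ge0 //.
by rewrite subr_ge0 s1' lerBlDr lerDl.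
Qed.

Lemma compl01 (s : R) : 0 <= s <= 1 -> 0 <= 1 - s <= 1.
Proof. by move=> /andP[s0 s1']; rewrite subr_ge0 s1' lerBlDr lerDl. Qed.

Lemma strip_polygon i s x : 0 <= s <= 1 -> - wid i s <= x <= wid i s ->
  polygon false (mkv x (hgt i s)).
Proof.
move=> s01 /andP[xl xr].
have P1' : polygon false (mkv (wid i s) (hgt i s)).
  by rewrite -side_pointE; apply: (@side_polygon _ _ _ _ i); exists s => //=; rewrite in_itv.
have P2' : polygon false (rfl (mkv (wid i s) (hgt i s))) by exact: polygon_rfl.
rewrite /rfl px_mkv py_mkv in P2'.
apply/polygonP => l; rewrite sg0 scale1r.
have /polygonP/(_ l) := P1'; have /polygonP/(_ l) := P2'.
rewrite !sg0 !scale1r /hf !px_mkv !py_mkv.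
have [sl|/ltW sl] := leP 0 (sn (2 * l + 2)).
  move=> _ h; apply: le_trans h; rewrite lerD2r; exact: ler_wpM2l.
move=> h _; apply: le_trans h; rewrite lerD2r; exact: ler_wnM2l.
Qed.

Lemma strip_polygon_true i s x : 0 <= s <= 1 -> wid i s <= x <= 2 * cK i - wid i s ->
  polygon true (mkv x (hgt i s) - shift i).
Proof.
move=> s01 /andP[xl xr].
have : polygon false (mkv (cK i - x) (hgt i (1 - s))).
  by apply: strip_polygon; rewrite ?compl01 // wid_compl; apply/andP; split; lra.
move/polygon_opp; congr polygon; rewrite shiftE hgt_compl.
by apply: vecP; rewrite !(pxD, pyD, pxN, pyN, px_mkv, py_mkv); ring.
Qed.

Lemma polygon_strip z : polygon false z -> exists i s,
  [/\ (i < g)%N, 0 <= s <= 1, - wid i s <= px z <= wid i s & py z = hgt i s].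
Proof.
move=> Pz.
have y0 : vY 0 <= py z.
  have /polygonP/(_ (n - 1)%N) := Pz; rewrite sg0 scale1r /hf.
  have -> : (2 * (n - 1) + 2 = 0 + n + n)%N by lia.
  rewrite cs_addn sn_addn cs_addn sn_addn !opprK cs0 sn0 /vY /c1 /c1; lra.
have y1 : py z <= vY g.
  case: Pz => t [t0 t1] <-; rewrite vY_g py_sum -t1; apply: ler_sum => k _.
  rewrite expr0 scale1r pyZ -[leRHS]mulr1 ler_wpM2l // py_vertex lerNl.
  exact: cos_geN1.
have [i [ig yi]] : exists i, (i < g)%N /\ vY i <= py z <= vY i.+1.
  have : forall m, py z <= vY m.+1 -> exists i, (i < m.+1)%N /\ vY i <= py z <= vY i.+1.
    elim=> [h|m IH h]; first by exists 0%N; rewrite y0 h.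
    have [/IH[i [im hi]]|h'] := leP (py z) (vY m.+1); first by exists i; split=> //; lia.
    by exists m.+1; rewrite ltnSn (ltW h') h.
  have -> : g = g.-1.+1 by lia.
  by apply; rewrite prednK //; lia.
have d0 : 0 < vY i.+1 - vY i by rewrite subr_gt0 vY_lt // ltnSn.
pose s := (py z - vY i) / (vY i.+1 - vY i).
have ys : py z = hgt i s.
  by rewrite /hgt /s; field; exact: lt0r_neq0.
have s01 : 0 <= s <= 1.
  case/andP: yi => yi yi'; rewrite /s divr_ge0 ?subr_ge0 ?vY_le ?ltnSn //=; last lia.
  by rewrite ler_pdivrMr // mul1r lerD2r.
have key (w : 'cV_2) : polygon false w -> py w = hgt i s -> px w <= wid i s.
  move=> /polygonP/(_ i); rewrite sg0 scale1r => h e.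
  have : hf i (mkv (wid i s) (hgt i s)) = c1.
    by rewrite -side_pointE /side_point sgE sg0 scale1r hfD !hfZ hf_vertex hf_vertexS; ring.
  have sn0' : 0 < sn (2 * i + 2) by apply: sn_gt0; lia.
  move: h; rewrite /hf e px_mkv py_mkv => h e2; move: h.
  by rewrite -e2 lerD2r ler_pM2l.
exists i, s; split=> //; rewrite (key z) // andbT lerNl -px_rfl.
by apply: key; [exact: polygon_rfl|rewrite py_rfl].
Qed.

(* The point at distance [x] to the right of the middle of the strip of
   [polygon false] when going around the [i]-th horizontal cylinder. *)
Definition cyl i s x : surface :=
  if x <= wid i s then sp false (mkv x (hgt i s))
  else if x <= 2 * cK i - wid i s then sp true (mkv x (hgt i s) - shift i)
  else sp false (mkv (x - 2 * cK i) (hgt i s)).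

Lemma cyl1 i s x : x <= wid i s -> cyl i s x = sp false (mkv x (hgt i s)).
Proof. by rewrite /cyl => ->. Qed.

Lemma right_side_glue i s : (i < g)%N -> 0 <= s <= 1 ->
  sp false (mkv (wid i s) (hgt i s)) = sp true (mkv (wid i s) (hgt i s) - shift i).
Proof.
move=> ig s01; rewrite -side_pointE.
have sx : side n false i (side_point n false i s) by exists s => //=; rewrite in_itv.
have i_n : (i < n)%N by lia.
by rewrite (sp_glue i_n sx) /partner sg0 scale1r.
Qed.

Lemma left_side_glue i s : (i < g)%N -> 0 <= s <= 1 ->
  sp false (mkv (- wid i s) (hgt i s)) = sp true (rfl (mkv (wid i s) (hgt i s) - shift i)).
Proof.
move=> ig s01; have := congr1 rfl_fun (right_side_glue ig s01).
have Pw : - wid i s <= wid i s <= wid i s.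
  by rewrite lexx andbT; have := wid_ge0 ig s01; lra.
have Pw' : wid i s <= wid i s <= 2 * cK i - wid i s.
  by rewrite lexx /=; have := wid_le ig s01; lra.
rewrite rfl_sp; last exact: strip_polygon.
by rewrite rfl_sp /rfl ?px_mkv ?py_mkv //; exact: strip_polygon_true.
Qed.

Lemma cyl2 i s x : (i < g)%N -> 0 <= s <= 1 -> wid i s <= x <= 2 * cK i - wid i s ->
  cyl i s x = sp true (mkv x (hgt i s) - shift i).
Proof.
move=> ig s01 /andP[]; rewrite /cyl le_eqVlt => /orP[/eqP <- _|xl ->].
  by rewrite lexx right_side_glue.
by rewrite leNgt xl.
Qed.

Lemma cyl3 i s x : (i < g)%N -> 0 <= s <= 1 -> 2 * cK i - wid i s <= x ->
  cyl i s x = sp false (mkv (x - 2 * cK i) (hgt i s)).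
Proof.
move=> ig s01; have h := wid_le ig s01.
rewrite le_eqVlt => /orP[/eqP <-|xl]; last first.
  rewrite /cyl leNgt (le_lt_trans _ xl) /=; last by lra.
  by rewrite leNgt xl.
rewrite cyl2 ?lexx ?andbT //; last by lra.
rewrite (_ : 2 * cK i - wid i s - 2 * cK i = - wid i s) ?left_side_glue //; last by ring.
congr (sp true); rewrite shiftE.
by apply: vecP; rewrite ?px_rfl ?py_rfl !(pxD, pyD, pxN, pyN, px_mkv, py_mkv); ring.
Qed.

(** [oppS] turns the cylinder upside down and reverses its direction. As [cyl] is not written as a
    periodic function, this takes two formulas, with centres one turn apart. *)
Lemma cyl_oppS1 i s x : (i < g)%N -> 0 <= s <= 1 ->
  - wid i (1 - s) <= x <= 2 * cK i - wid i (1 - s) ->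
  cyl i s (cK i - x) = oppS (cyl i (1 - s) x).
Proof.
move=> ig s01 /andP[xl xr]; have s01' := compl01 s01; have ew := wid_compl i s.
have [xw|/ltW xw] := leP x (wid i (1 - s)).
  rewrite [in RHS]cyl1 // oppS_sp; last by apply: strip_polygon; rewrite ?xl.
  rewrite cyl2 //; last by apply/andP; split; lra.
  congr (sp true); rewrite shiftE hgt_compl.
  by apply: vecP; rewrite !(pxD, pyD, pxN, pyN, px_mkv, py_mkv); ring.
rewrite [in RHS]cyl2 ?xw // oppS_sp; last by apply: strip_polygon_true; rewrite ?xw.
rewrite cyl1; last by lra.
congr (sp false); rewrite shiftE hgt_compl.
by apply: vecP; rewrite !(pxD, pyD, pxN, pyN, px_mkv, py_mkv); ring.
Qed.

Lemma cyl_oppS2 i s x : (i < g)%N -> 0 <= s <= 1 ->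
  wid i (1 - s) <= x <= 2 * cK i + wid i (1 - s) ->
  cyl i s (3 * cK i - x) = oppS (cyl i (1 - s) x).
Proof.
move=> ig s01 /andP[xl xr]; have s01' := compl01 s01; have ew := wid_compl i s.
have [xw|/ltW xw] := leP x (2 * cK i - wid i (1 - s)).
  rewrite [in RHS]cyl2 ?xl // oppS_sp; last by apply: strip_polygon_true; rewrite ?xl.
  rewrite cyl3 //; last by lra.
  congr (sp false); rewrite shiftE hgt_compl.
  by apply: vecP; rewrite !(pxD, pyD, pxN, pyN, px_mkv, py_mkv); ring.
rewrite [in RHS]cyl3 // oppS_sp; last by apply: strip_polygon; rewrite ?s01' //; apply/andP; split; lra.
rewrite cyl2 //; last by apply/andP; split; lra.
congr (sp true); rewrite shiftE hgt_compl.
by apply: vecP; rewrite !(pxD, pyD, pxN, pyN, px_mkv, py_mkv); ring.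
Qed.

(** The chord at parameter [s] moves by the fraction [s] of the circumference [2 * cK i]. A
    relation, because a chord between two strips belongs to both; the two descriptions agree there,
    since one moves it by a full turn and the other by nothing. *)
Definition twist_rel z u : Prop := exists i s, [/\ (i < g)%N, 0 <= s <= 1,
  - wid i s <= px z <= wid i s, py z = hgt i s & u = cyl i s (px z + s * (2 * cK i))].

Definition twist0 z : surface := xget sing [set u | twist_rel z u].

Lemma hgt_bounds i s : (i < g)%N -> 0 <= s <= 1 -> vY i <= hgt i s <= vY i.+1.
Proof.
move=> ig /andP[s0 s1']; have d : vY i <= vY i.+1 by apply: vY_le; lia.
by rewrite /hgt; apply/andP; split; nra.
Qed.

Lemma hgt_inj i s s' : (i < g)%N -> hgt i s = hgt i s' -> s = s'.
Proof.
move=> ig e; have d : vY i < vY i.+1 by apply: vY_lt; lia.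
have : (s - s') * (vY i.+1 - vY i) = 0 by move: e; rewrite /hgt; lra.
by move/eqP; rewrite mulf_eq0 !subr_eq0 (gt_eqF d) orbF => /eqP.
Qed.

Lemma cyl_top i x : (i < g)%N -> - vX i.+1 <= x -> cyl i 1 (x + 1 * (2 * cK i)) = sp false (mkv x (vY i.+1)).
Proof.
move=> ig hx; rewrite cyl3 ?ler01 ?lexx // ?hgt1 ?wid1 ?mul1r; last by lra.
by rewrite addrK.
Qed.

Lemma cyl_bot i x : x <= vX i -> cyl i 0 (x + 0 * (2 * cK i)) = sp false (mkv x (vY i)).
Proof. by move=> hx; rewrite mul0r addr0 cyl1 ?wid0 // hgt0. Qed.

Lemma twist_rel_uniq z u u' : twist_rel z u -> twist_rel z u' -> u = u'.
Proof.
move=> [i [s [ig s01 xs ys ->]]] [j [s' [jg s01' xs' ys' ->]]].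
wlog ij : i j s s' ig s01 xs ys jg s01' xs' ys' / (i <= j)%N => [wl|].
  have [/wl|/ltnW/wl] := leqP i j; first by apply.
  by move=> h; apply/esym/h.
move: ij; rewrite leq_eqVlt => /orP[/eqP ij|ij].
  by subst j; rewrite (hgt_inj ig (etrans (esym ys) ys')).
have /andP[_ h1] := hgt_bounds ig s01; have /andP[h2 _] := hgt_bounds jg s01'.
rewrite -ys in h1; rewrite -ys' in h2.
have eij : j = i.+1.
  apply/eqP; rewrite eqn_leq ij andbT leqNgt; apply/negP => lt.
  by have := @vY_lt i.+1 j; rewrite lt ltnW // => /(_ isT); lra.
subst j; have ey : py z = vY i.+1 by apply/eqP; rewrite eq_le h1 h2.
have es : s = 1 by apply: (hgt_inj ig); rewrite hgt1 -ys.
have es' : s' = 0 by apply: (hgt_inj jg); rewrite hgt0 -ys'.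
rewrite es es' wid1 wid0 in xs xs' *; case/andP: xs => xl xr.
by rewrite cyl_top // cyl_bot.
Qed.

Lemma twist0P i s x : (i < g)%N -> 0 <= s <= 1 -> - wid i s <= x <= wid i s ->
  twist0 (mkv x (hgt i s)) = cyl i s (x + s * (2 * cK i)).
Proof.
move=> ig s01 xs.
have h : twist_rel (mkv x (hgt i s)) (cyl i s (x + s * (2 * cK i))).
  by exists i, s; rewrite px_mkv py_mkv.
apply: (twist_rel_uniq _ h).
by apply: (@xgetPex _ sing [set u | twist_rel (mkv x (hgt i s)) u]); exists (cyl i s (x + s * (2 * cK i))).
Qed.

Lemma twist0_level i x : (i <= g)%N -> - vX i <= x <= vX i ->
  twist0 (mkv x (vY i)) = sp false (mkv x (vY i)).
Proof.
rewrite leq_eqVlt => /orP[/eqP ->|ig] hx.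
  have [m em] : exists m, g = m.+1 by exists g.-1; lia.
  have mg : (m < g)%N by lia.
  rewrite em in hx *; rewrite -{1}hgt1 twist0P ?wid1 ?ler01 ?lexx //.
  by case/andP: hx => hx _; exact: cyl_top.
rewrite -{1}hgt0 twist0P ?wid0 ?ler01 ?lexx //.
by case/andP: hx => _ hx; exact: cyl_bot.
Qed.

Definition clamp01 (s : R) : R := Num.max 0 (Num.min 1 s).
Lemma clamp01_bounds s : 0 <= clamp01 s <= 1.
Proof. by rewrite /clamp01 le_max lexx /= ge_max ler01 ge_min lexx. Qed.
Lemma clamp01_id s : 0 <= s <= 1 -> clamp01 s = s.
Proof. by move=> /andP[s0 s1']; rewrite /clamp01 (min_r s1') (max_r s0). Qed.
Lemma clamp01_continuous : continuous clamp01.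
Proof.
move=> s; apply: (@continuous_max _ _ (fun=> 0) (fun s => Num.min 1 s)).
  exact: cst_continuous.
by apply: (@continuous_min _ _ (fun=> 1) id); [exact: cst_continuous|exact: cvg_id].
Qed.

Lemma cyl_continuous (T : topologicalType) i (s x : T -> R) : (i < g)%N ->
  continuous s -> continuous x -> (forall t, 0 <= s t <= 1) ->
  continuous (fun t => cyl i (s t) (x t)).
Proof.
move=> ig cs' cx s01.
have caff (a b : R) : continuous (fun t => a + s t * b).
  move=> t; apply: (@continuousD _ _ _ (fun=> a) (fun t => s t * b)); first exact: cst_continuous.
  by apply: (@continuousM _ _ s (fun=> b)); [exact: cs'|exact: cst_continuous].
have ch : continuous (fun t => hgt i (s t)).
  rewrite (_ : (fun t => _) = fun t => vY i + s t * (vY i.+1 - vY i)) //.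
  by apply/funext => t; rewrite /hgt; ring.
have cw : continuous (fun t => wid i (s t)).
  rewrite (_ : (fun t => _) = fun t => vX i + s t * (vX i.+1 - vX i)) //.
  by apply/funext => t; rewrite /wid; ring.
have cw' : continuous (fun t => 2 * cK i - wid i (s t)).
  by move=> t; apply: (@continuousB _ _ _ (fun=> 2 * cK i) (fun t => wid i (s t)));
    [exact: cst_continuous|exact: cw].
have cxh : continuous (fun t => mkv (x t) (hgt i (s t))) by exact: mkv_continuous.
pose A (k : 'I_3) : set T := match val k with
  | 0 => [set t | x t <= wid i (s t)]
  | 1 => [set t | wid i (s t) <= x t] `&` [set t | x t <= 2 * cK i - wid i (s t)]
  | _ => [set t | 2 * cK i - wid i (s t) <= x t] end.
pose F (k : 'I_3) t : surface := match val k with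
  | 0 => sp false (mkv (x t) (hgt i (s t)))
  | 1 => sp true (mkv (x t) (hgt i (s t)) - shift i)
  | _ => sp false (mkv (x t - 2 * cK i) (hgt i (s t))) end.
apply: (@pasting _ _ _ A F).
- case=> -[|[|[|//]]] k3 /=; rewrite /A /=.
  + exact: closed_le_fun.
  + by apply: closedI; exact: closed_le_fun.
  + exact: closed_le_fun.
- case=> -[|[|[|//]]] k3 t; rewrite /F /=.
  + by apply: (@continuous_comp _ _ _ (fun t => mkv (x t) (hgt i (s t))));
      [exact: cxh|exact: sp_continuous].
  + apply: (@continuous_comp _ _ _ (fun t => mkv (x t) (hgt i (s t)) - shift i));
      last exact: sp_continuous.
    by apply: (@continuousB _ _ _ _ (fun=> shift i)); [exact: cxh|exact: cst_continuous].
  + apply: (@continuous_comp _ _ _ (fun t => mkv (x t - 2 * cK i) (hgt i (s t))));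
      last exact: sp_continuous.
    apply: mkv_continuous => // t'.
    by apply: (@continuousB _ _ _ x (fun=> 2 * cK i)); [exact: cx|exact: cst_continuous].
- move=> t; have [h|/ltW h] := leP (x t) (wid i (s t)); first by exists ord0.
  have [h'|/ltW h'] := leP (x t) (2 * cK i - wid i (s t)).
    by exists (Ordinal (isT : (1 < 3)%N)).
  by exists (Ordinal (isT : (2 < 3)%N)).
case=> -[|[|[|//]]] k3 t; rewrite /A /F /=.
+ exact: cyl1.
+ by case=> h1 h2; apply: cyl2; rewrite ?h1.
+ exact: cyl3.
Qed.

Definition twf z : surface := twist0 (retr n false z).

Lemma twf_polygon z : polygon false z -> twf z = twist0 z.
Proof. by move=> Pz; rewrite /twf retr_id. Qed.

(** Pasted from the horizontal strips. The parameter is clamped, so that each piece is continuous on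
    the whole plane. *)
Lemma twf_continuous : continuous twf.
Proof.
pose par (i : nat) z := clamp01 ((py (retr n false z) - vY i) / (vY i.+1 - vY i)).
pose A (i : 'I_g) := [set z | vY i <= py (retr n false z)] `&`
  [set z | py (retr n false z) <= vY i.+1].
pose F (i : 'I_g) z := cyl i (par i z) (px (retr n false z) + par i z * (2 * cK i)).
have cpx : continuous (fun z => px (retr n false z)).
  by move=> z; apply: continuous_comp; [exact: retr_continuous|exact: px_continuous].
have cpy : continuous (fun z => py (retr n false z)).
  by move=> z; apply: continuous_comp; [exact: retr_continuous|exact: py_continuous].
have cpar i : continuous (par i).
  move=> z; apply: (@continuous_comp _ _ _ (fun z => (py (retr n false z) - vY i) / (vY i.+1 - vY i)));
    last exact: clamp01_continuous.
  apply: (@continuousM _ _ (fun z => py (retr n false z) - vY i)); last exact: cst_continuous.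
  by apply: (@continuousB _ _ _ _ (fun=> vY i)); [exact: cpy|exact: cst_continuous].
have clev (a : R) : continuous (fun _ : 'cV[R]_2 => a) by move=> z; exact: cst_continuous.
have strip z : exists i s, [/\ (i < g)%N, 0 <= s <= 1,
    - wid i s <= px (retr n false z) <= wid i s & py (retr n false z) = hgt i s].
  by apply: polygon_strip; exact: retr_polygon.
apply: (@pasting _ _ _ A F).
- by move=> i; apply: closedI; exact: closed_le_fun.
- move=> i; apply: cyl_continuous => // [z|z]; last exact: clamp01_bounds.
  apply: (@continuousD _ _ _ (fun z => px (retr n false z)) (fun z => par i z * (2 * cK i))).
    exact: cpx.
  by apply: (@continuousM _ _ (par i) (fun=> 2 * cK i)); [exact: cpar|exact: cst_continuous].
- move=> z; have [i [s [ig s01 _ e]]] := strip z.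
  by exists (Ordinal ig); rewrite /A /= e; case/andP: (hgt_bounds ig s01).
move=> i z [/= h1 h2]; rewrite /F /twf.
have ig := ltn_ord i; have d0 : 0 < vY i.+1 - vY i by rewrite subr_gt0 vY_lt // ltnSn.
have s01 : 0 <= (py (retr n false z) - vY i) / (vY i.+1 - vY i) <= 1.
  rewrite divr_ge0 ?subr_ge0 //=; last exact: le_trans h1 h2.
  by rewrite ler_pdivrMr // mul1r lerD2r.
rewrite /par clamp01_id //; set s := _ / _.
have ey : py (retr n false z) = hgt i s by rewrite /hgt /s; field; exact: lt0r_neq0.
have Pz := @retr_polygon R n n_ok false z.
have ez : retr n false z = mkv (px (retr n false z)) (hgt i s).
  by apply: vecP; rewrite ?px_mkv ?py_mkv.
rewrite [in LHS]ez twist0P //.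
have [j [s' [jg s01' xs ys]]] := strip z.
(* The bounds on [px] are given by [polygon_strip] for the strip that it picks,
   which may be a neighbour of the [i]-th one. *)
have [eij|nij] := eqVneq j (i : nat).
  by rewrite eij in ys xs; rewrite (hgt_inj ig (etrans (esym ey) ys)).
have /andP[b1 b2] := hgt_bounds jg s01'; rewrite -ys in b1 b2.
have [ij|ji] := ltnP i j.
  have : j = i.+1.
    apply/eqP; rewrite eqn_leq ij andbT leqNgt; apply/negP => lt.
    by have := @vY_lt i.+1 j; rewrite lt ltnW // => /(_ isT); lra.
  move=> ej; rewrite ej in b1 ys xs jg s01'.
  have e1 : s = 1 by apply: (hgt_inj ig); rewrite hgt1 -ey; apply/eqP; rewrite eq_le h2 b1.
  have e0 : s' = 0 by apply: (hgt_inj jg); rewrite hgt0 -ys; apply/eqP; rewrite eq_le h2 b1.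
  by move: xs; rewrite e1 e0 wid1 wid0.
have ji' : (j < i)%N by rewrite ltn_neqAle nij ji.
have : (i : nat) = j.+1.
  apply/eqP; rewrite eqn_leq ji' andbT leqNgt; apply/negP => lt.
  by have := @vY_lt j.+1 i; rewrite lt ltnW // => /(_ isT); lra.
move=> ej; rewrite -ej in b2.
have e1 : s' = 1 by apply: (hgt_inj jg); rewrite hgt1 -ys -ej; apply/eqP; rewrite eq_le h1 b2.
have e0 : s = 0 by apply: (hgt_inj ig); rewrite hgt0 -ey; apply/eqP; rewrite eq_le h1 b2.
by move: xs; rewrite e1 e0 wid1 wid0 ej.
Qed.

Lemma twist_vertex k : twf (vertex k) = sing.
Proof.
rewrite -vertex_mod; have kn : (k %% n < n)%N by rewrite ltn_modn.
move: (k %% n)%N kn => {}k kn.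
have Pv i : polygon false (vertex i).
  by have := @polygon_vertex R n n_ok false i; rewrite sg0 scale1r.
have sv i : sp false (vertex i) = sing.
  by have := @sp_vertex R n n_ok false i; rewrite sg0 scale1r.
rewrite twf_polygon //; have [kg|kg] := leqP k g.
  rewrite vertexE twist0_level ?sv // lexx andbT.
  have := vX_ge0 kg; lra.
have e : vertex k = rfl (vertex (n - 1 - k)).
  rewrite rfl_vertex; last by lia.
  by rewrite -(vertex_addn R k); congr (vertex _); lia.
have kg' : (n - 1 - k <= g)%N by lia.
rewrite -(sv k) e vertexE /rfl px_mkv py_mkv twist0_level // lexx /=.
have := vX_ge0 kg'; lra.
Qed.

Definition twist_fun : surface -> surface :=
  slift (fun b z => if b then oppS (twf (- z)) else twf z).

Lemma twist_glue k z : (k < n)%N -> side n false k z ->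
  twf z = oppS (twf (- (z - shift k))).
Proof.
move=> kn [s] /=; rewrite in_itv /= => s01 ez.
have s01' := compl01 s01.
(* There are three kinds of sides: on the right, the horizontal one, and on the left. On the slanted
   ones the identity is the symmetry of the cylinder under [oppS]; the horizontal one is fixed
   pointwise. *)
have [kg|kg] := ltnP k g.
  rewrite -ez side_pointE.
  have -> : - (mkv (wid k s) (hgt k s) - shift k) = mkv (wid k (1 - s)) (hgt k (1 - s)).
    rewrite shiftE wid_compl hgt_compl.
    by apply: vecP; rewrite !(pxD, pyD, pxN, pyN, px_mkv, py_mkv); ring.
  have w0 := wid_ge0 kg s01; have w0' := wid_ge0 kg s01'.
  have ew := wid_compl k s; have wl := wid_le kg s01.
  have sK : 0 <= s * (2 * cK k) <= 2 * cK k.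
    by case/andP: s01 => ? ?; apply/andP; split; nra.
  case/andP: sK => sK1 sK2.
  rewrite !twf_polygon; [|by apply: strip_polygon => //; apply/andP; split; lra..].
  rewrite !twist0P //; [|by apply/andP; split; lra..].
  rewrite -cyl_oppS2 //; last by rewrite mulrBl mul1r; apply/andP; split; lra.
  by congr (cyl k s); rewrite ew; ring.
have [kl|kl] := eqVneq k (n - 1)%N.
  have e0 : vertex k = rfl (vertex 0).
    rewrite rfl_vertex ?n_gt0 // -(vertex_addn R k); congr (vertex _); lia.
  have e1 : vertex k.+1 = vertex 0 by rewrite -(vertex_addn R 0); congr (vertex _); lia.
  have X0 : 0 < vX 0 by apply: vX_gt0; lia.
  have zE : z = mkv ((2 * s - 1) * vX 0) (vY 0).
    rewrite -ez /side_point sgE sg0 scale1r e0 e1 vertexE.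
    by apply: vecP; rewrite !(pxD, pyD, pxZ, pyZ) ?px_rfl ?py_rfl !(px_mkv, py_mkv); ring.
  have shE : shift k = mkv 0 (2 * vY 0).
    rewrite /side_shift e0 e1 vertexE.
    by apply: vecP; rewrite !(pxD, pyD) ?px_rfl ?py_rfl !(px_mkv, py_mkv); ring.
  have -> : - (z - shift k) = mkv (- ((2 * s - 1) * vX 0)) (vY 0).
    by rewrite zE shE; apply: vecP; rewrite !(pxD, pyD, pxN, pyN, px_mkv, py_mkv); ring.
  have xb : - vX 0 <= (2 * s - 1) * vX 0 <= vX 0.
    by case/andP: s01 => ? ?; apply/andP; split; nra.
  have xb' : - vX 0 <= - ((2 * s - 1) * vX 0) <= vX 0.
    by case/andP: xb => ? ?; apply/andP; split; lra.
  have g0 : (0 < g)%N by lia.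
  have PP x : - vX 0 <= x <= vX 0 -> polygon false (mkv x (vY 0)).
    by rewrite -(hgt0 0) -(wid0 0) => hx; apply: strip_polygon => //; rewrite lexx ler01.
  rewrite zE !twf_polygon; [|exact: PP..].
  rewrite !twist0_level // oppS_sp; last exact: PP.
  have sz : side n false k z by exists s.
  rewrite -zE (sp_glue kn sz) /partner sg0 scale1r; congr (sp true).
  by rewrite zE shE; apply: vecP; rewrite !(pxD, pyD, pxN, pyN, px_mkv, py_mkv); ring.
(* The [k]-th side is the mirror image of the [i]-th one with reversed direction, whence the
   parameter [1 - r]. *)
pose i := (n - 2 - k)%N; have ig : (i < g)%N by rewrite /i; lia.
have e0 : vertex k = rfl (vertex i.+1).
  rewrite rfl_vertex; last by rewrite /i; lia.
  by rewrite -(vertex_addn R k); congr (vertex _); rewrite /i; lia.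
have e1 : vertex k.+1 = rfl (vertex i).
  rewrite rfl_vertex; last by rewrite /i; lia.
  by rewrite -(vertex_addn R k.+1); congr (vertex _); rewrite /i; lia.
have [r r01 er] : exists2 r : R, 0 <= r <= 1 & s = 1 - r.
  by exists (1 - s) => //; ring.
rewrite er in ez.
have zE : z = mkv (- wid i r) (hgt i r).
  rewrite -ez /side_point sgE sg0 scale1r e0 e1 /wid /hgt.
  by apply: vecP; rewrite !(pxD, pyD, pxZ, pyZ) ?px_rfl ?py_rfl !(px_mkv, py_mkv, px_vertex, py_vertex) -/(vX _) -/(vX i) -/(vY _) -/(vY i); ring.
have shE : shift k = mkv (- cK i) (vY i + vY i.+1).
  rewrite /side_shift e0 e1 /cK.
  by apply: vecP; rewrite !(pxD, pyD) ?px_rfl ?py_rfl !(px_mkv, py_mkv, px_vertex, py_vertex) -/(vX _) -/(vX i) -/(vY _) -/(vY i); ring.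
have -> : - (z - shift k) = mkv (- wid i (1 - r)) (hgt i (1 - r)).
  rewrite zE shE wid_compl hgt_compl.
  by apply: vecP; rewrite !(pxD, pyD, pxN, pyN, px_mkv, py_mkv); ring.
have r01' := compl01 r01.
have w0 := wid_ge0 ig r01; have w0' := wid_ge0 ig r01'.
have ew := wid_compl i r; have wl := wid_le ig r01.
have sK : 0 <= r * (2 * cK i) <= 2 * cK i.
  by case/andP: r01 => ? ?; apply/andP; split; nra.
case/andP: sK => sK1 sK2.
rewrite zE !twf_polygon; [|by apply: strip_polygon => //; apply/andP; split; lra..].
rewrite !twist0P //; [|by apply/andP; split; lra..].
rewrite -cyl_oppS1 //; last by rewrite mulrBl mul1r; apply/andP; split; lra.
by congr (cyl i r); rewrite ew; ring.
Qed.

Lemma twist_vtx b b' k l :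
  (if b then oppS (twf (- (sg b *: vertex k))) else twf (sg b *: vertex k)) =
  (if b' then oppS (twf (- (sg b' *: vertex l))) else twf (sg b' *: vertex l)).
Proof.
have h c i : (if c then oppS (twf (- (sg c *: vertex i))) else twf (sg c *: vertex i)) = sing.
  case: c; last by rewrite sg0 scale1r twist_vertex.
  rewrite sg1 scaleN1r opprK twist_vertex /sing oppS_sp.
    by rewrite -scaleN1r -(sg1 R) sp_vertex.
  by have := @polygon_vertex R n n_ok false 0; rewrite sg0 scale1r.
by rewrite !h.
Qed.

Lemma twist_sp b z : polygon b z ->
  twist_fun (sp b z) = if b then oppS (twf (- z)) else twf z.
Proof. by move=> Pz; apply: slift_sp => //; [exact: twist_glue|exact: twist_vtx]. Qed.

Lemma twist_continuous : continuous twist_fun.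
Proof.
apply: slift_continuous; [exact: twist_glue|exact: twist_vtx|] => -[] z.
  apply: (@continuous_comp _ _ _ (fun z => twf (- z))); last exact: oppS_continuous.
  apply: (@continuous_comp _ _ _ (fun z : 'cV[R]_2 => - z)); last exact: twf_continuous.
  by apply: (@continuousN _ _ _ id); exact: cvg_id.
exact: twf_continuous.
Qed.

Definition twist_map : smap := mkcts twist_continuous.

Lemma twist_map_sp b z : polygon b z ->
  twist_map (sp b z) = if b then oppS (twf (- z)) else twf z.
Proof. exact: twist_sp. Qed.

Lemma twist_strip i s x : (i < g)%N -> 0 <= s <= 1 -> - wid i s <= x <= wid i s ->
  twist_map (sp false (mkv x (hgt i s))) = cyl i s (x + s * (2 * cK i)).
Proof.
move=> ig s01 hx; rewrite twist_map_sp; last exact: strip_polygon.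
by rewrite twf_polygon ?twist0P //; exact: strip_polygon.
Qed.

Lemma twist_level i x : (i <= g)%N -> - vX i <= x <= vX i ->
  twist_map (sp false (mkv x (vY i))) = sp false (mkv x (vY i)).
Proof.
move=> ig hx; have Pz : polygon false (mkv x (vY i)).
  case: i ig hx => [|i] ig hx; first by rewrite -hgt0; apply: strip_polygon; rewrite ?wid0 ?lexx ?ler01.
  by rewrite -hgt1; apply: strip_polygon; rewrite ?wid1 ?lexx ?ler01.
by rewrite twist_map_sp // twf_polygon // twist0_level.
Qed.

Lemma twist_oppS u : twist_map (oppS u) = oppS (twist_map u).
Proof.
have h z : polygon false z -> twist_map (oppS (sp false z)) = oppS (twist_map (sp false z)).
  move=> Pz; have Pz' := @polygon_opp R n n_ok _ _ Pz.
  by rewrite oppS_sp // !twist_map_sp // opprK.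
elim/surface_ind: u => -[] z Pz; last exact: h.
have Pz' : polygon false (- z) by exact: (polygon_opp Pz).
have e : sp true z = oppS (sp false (- z)) by rewrite oppS_sp // opprK.
by rewrite e oppSK h // oppSK.
Qed.

(** Composed with the involution [rfl_fun], this says that reflecting the twist inverts it. *)
Lemma twist_rfl u : twist_map (rfl_fun (twist_map u)) = rfl_fun u.
Proof.
elim/surface_ind: u.
suff h z : polygon false z ->
    twist_map (rfl_fun (twist_map (sp false z))) = rfl_fun (sp false z).
  move=> [] z Pz; last exact: h.
  have Pz' : polygon false (- z) by exact: (polygon_opp Pz).
  have -> : sp true z = oppS (sp false (- z)) by rewrite oppS_sp // opprK.
  by rewrite twist_oppS rfl_oppS twist_oppS h // rfl_oppS.
move=> Pz; have [i [s [ig s01 xs ys]]] := polygon_strip Pz.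
have -> : z = mkv (px z) (hgt i s) by apply: vecP; rewrite ?px_mkv ?py_mkv.
move: (px z) xs => x xs {Pz ys z}; have Pz := strip_polygon s01 xs.
rewrite twist_strip // rfl_sp // /rfl px_mkv py_mkv.
have w0 := wid_ge0 ig s01; have wl := wid_le ig s01.
have sK : 0 <= s * (2 * cK i) <= 2 * cK i.
  by case/andP: s01 => ? ?; apply/andP; split; nra.
case/andP: (xs) => xl xr; case/andP: sK => sK1 sK2.
set x' := x + s * (2 * cK i).
have [h1|/ltW h1] := leP x' (wid i s).
  have Px' : polygon false (mkv x' (hgt i s)) by apply: strip_polygon => //; rewrite h1 /x' andbT; lra.
  rewrite cyl1 // rfl_sp // /rfl px_mkv py_mkv twist_strip //; last by rewrite /x' in h1 *; apply/andP; split; lra.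
  have -> : - x' + s * (2 * cK i) = - x by rewrite /x'; ring.
  by rewrite cyl1 //; lra.
have [h2|/ltW h2] := leP x' (2 * cK i - wid i s).
  have Px' := strip_polygon_true s01 (introT andP (conj h1 h2)).
  rewrite cyl2 ?h1 // rfl_sp //.
  have s01' := compl01 s01; have ew := wid_compl i s.
  have eP : - rfl (mkv x' (hgt i s) - shift i) = mkv (x' - cK i) (hgt i (1 - s)).
    rewrite shiftE hgt_compl; apply: vecP;
    by rewrite !(pxN, pyN) ?px_rfl ?py_rfl !(pxD, pyD, pxN, pyN, px_mkv, py_mkv); ring.
  have -> : sp true (rfl (mkv x' (hgt i s) - shift i)) = oppS (sp false (mkv (x' - cK i) (hgt i (1 - s)))).
    rewrite -eP oppS_sp ?opprK //; apply: (@polygon_opp R n n_ok true).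
    exact: polygon_rfl.
  rewrite twist_oppS twist_strip //; last by apply/andP; split; lra.
  have -> : x' - cK i + (1 - s) * (2 * cK i) = x + cK i by rewrite /x'; ring.
  rewrite -cyl_oppS2 //; last by apply/andP; split; lra.
  have -> : 3 * cK i - (x + cK i) = 2 * cK i - x by ring.
  rewrite (cyl3 ig s01); last by lra.
  by have -> : 2 * cK i - x - 2 * cK i = - x by ring.
have xb : - wid i s <= x' - 2 * cK i <= wid i s.
  by rewrite /x' in h2 *; apply/andP; split; lra.
have xb' : - wid i s <= - (x' - 2 * cK i) <= wid i s.
  by case/andP: xb => ? ?; apply/andP; split; lra.
rewrite cyl3 // rfl_sp; last exact: strip_polygon.
have -> : rfl (mkv (x' - 2 * cK i) (hgt i s)) = mkv (- (x' - 2 * cK i)) (hgt i s).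
  by apply: vecP; rewrite ?px_rfl ?py_rfl ?px_mkv ?py_mkv.
rewrite (twist_strip ig s01 xb').
have -> : - (x' - 2 * cK i) + s * (2 * cK i) = 2 * cK i - x by rewrite /x'; ring.
rewrite (cyl3 ig s01); last by lra.
by have -> : 2 * cK i - x - 2 * cK i = - x by ring.
Qed.

Definition twist_inv : smap :=
  (mkcts (@rfl_continuous R n n_ok) : smap) \o (twist_map \o (mkcts (@rfl_continuous R n n_ok) : smap) : smap).

Lemma twist_cancel : cancel twist_map twist_inv /\ cancel twist_inv twist_map.
Proof.
have e u : twist_inv u = rfl_fun (twist_map (rfl_fun u)) by [].
split=> u; rewrite e ?twist_rfl ?rfl_funK //.
Qed.

Lemma T_mxE : T_mx R n = mk2 1 (2 * cot) 0 1.
Proof.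
apply: mx_ext => z; rewrite /T_mx mulmxDl mul1mx.
apply: vecP; rewrite ?px_mk2 ?py_mk2 ?pxD ?pyD ?px_mulmx ?py_mulmx !mxE /=.
  by rewrite !(mulr0, mulr1, mul0r, add0r, mul1r).
by rewrite !(mulr0, mulr1, mul0r, add0r, mul1r, addr0).
Qed.

Lemma twist_affine : affine_map (T_mx R n) twist_map.
Proof.
have [h1 h2] := twist_cancel.
(* The translation parts: the shear about the height [vY i], corrected according to which of the
   three pieces of [cyl] contains the image. The sign in [W] accounts for the second polygon. *)
pose W0 (i : 'I_g) (k : 'I_3) : 'cV[R]_2 := mkv (- (2 * cot * vY i)) 0 +
  match val k with 0 => 0 | 1 => - shift i | _ => - mkv (2 * cK i) 0 end.
pose W (t : bool * 'I_g * 'I_3) := sg t.1.1 *: W0 t.1.2 t.2.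
apply: (@affine_criterion _ _ _ _ W _ _ _ _ h1 h2).
- by rewrite T_mxE det_mk2; ring.
- have := @twist_map_sp false (vertex 0); rewrite twist_vertex; apply.
  by have := @polygon_vertex R n n_ok false 0; rewrite sg0 scale1r.
have key z : polygon false z -> exists (i : 'I_g) (k : 'I_3) b', polygon b' (T_mx R n *m z + W0 i k) /\
    twist_map (sp false z) = sp b' (T_mx R n *m z + W0 i k).
  move=> Pz; have [i [s [ig s01 xs ys]]] := polygon_strip Pz.
  have ez : z = mkv (px z) (hgt i s) by apply: vecP; rewrite ?px_mkv ?py_mkv.
  move: (px z) xs ez => x xs -> {ys Pz z}; rewrite twist_strip //.
  have w0 := wid_ge0 ig s01; have wl := wid_le ig s01.
  have sK : 0 <= s * (2 * cK i) <= 2 * cK i.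
    by case/andP: s01 => ? ?; apply/andP; split; nra.
  case/andP: (xs) => xl xr; case/andP: sK => sK1 sK2.
  have eT : T_mx R n *m mkv x (hgt i s) + mkv (- (2 * cot * vY i)) 0 =
      mkv (x + s * (2 * cK i)) (hgt i s).
    rewrite T_mxE -cylinder_modulus.
    by apply: vecP; rewrite !(pxD, pyD, px_mk2, py_mk2, px_mkv, py_mkv) /hgt; ring.
  set x' := x + s * (2 * cK i) in eT *.
  exists (Ordinal ig); rewrite /W0.
  have [hh1|/ltW hh1] := leP x' (wid i s).
    exists ord0, false; rewrite addr0 eT cyl1 //; split=> //.
    by apply: strip_polygon => //; rewrite hh1 /x' andbT; lra.
  have [hh2|/ltW hh2] := leP x' (2 * cK i - wid i s).
    exists (Ordinal (isT : (1 < 3)%N)), true; rewrite /= addrA eT cyl2 ?hh1 //.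
    by split=> //; apply: strip_polygon_true; rewrite ?hh1.
  exists (Ordinal (isT : (2 < 3)%N)), false; rewrite /= addrA eT cyl3 //.
  have -> : mkv x' (hgt i s) - mkv (2 * cK i) 0 = mkv (x' - 2 * cK i) (hgt i s).
    by apply: vecP; rewrite !(pxD, pyD, pxN, pyN, px_mkv, py_mkv); ring.
  by split=> //; apply: strip_polygon => //; rewrite /x' in hh2 *; apply/andP; split; lra.
move=> [] z Pz; last first.
  have [i [k [b' [P' e]]]] := key z Pz.
  by exists (false, i, k), b'; rewrite /W sg0 scale1r.
have Pz' : polygon false (- z) by exact: (polygon_opp Pz).
have [i [k [b' [P' e]]]] := key _ Pz'.
exists (true, i, k), (~~ b').
have -> : T_mx R n *m z + W (true, i, k) = - (T_mx R n *m (- z) + W0 i k).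
  by rewrite /W /= sg1 scaleN1r mulmxN [RHS]opprD opprK.
split; first exact: polygon_opp.
by rewrite -oppS_sp // -e -twist_oppS oppS_sp // opprK.
Qed.

End Twist.

(** * Straight paths *)

Section Intervals.
Variable R : realType.

(** Connectedness of intervals as an induction principle. It serves for the continuation of straight
    paths and, in place of a subdivision, for the homology of arbitrary paths. *)
Lemma interval_locally_const (D : set R) (Q : R -> Prop) s0 s1 : is_interval D ->
  (forall s, D s -> nbhs s [set t | D t -> (Q t <-> Q s)]) ->
  D s0 -> D s1 -> Q s0 -> Q s1.
Proof.
move=> /connected_intervalP cD h D0 D1 Q0.
have H := cD (D `&` [set t | Q t]).
suff : D `&` [set t | Q t] = D by move=> e; move: D1; rewrite -e => -[].
apply: H.
- by exists s0.
- exists [set t | D t -> Q t]°; first exact: open_interior.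
  apply/seteqP; split=> t /= [Dt]; last by move=> /interior_subset /= ht; split=> //; exact: ht.
  by move=> Qt; split=> //; apply: nbhsS (h _ Dt) => t' /= h' Dt'; apply/h'.
exists (~` [set t | D t -> ~ Q t]°); first by apply: open_closedC; exact: open_interior.
apply/seteqP; split=> t /= [Dt].
  by move=> Qt; split=> // /interior_subset /= ht; exact: ht.
move=> ht; split=> //; apply: contrapT => nQ; apply: ht.
by apply: nbhsS (h _ Dt) => t' /= h' Dt' Qt'; apply: nQ; apply/h'.
Qed.

Lemma pow_lt (q e : R) : 0 <= q < 1 -> 0 < e -> exists k, q ^+ k < e.
Proof.
move=> /andP[q0 q1] e0.
have := @cvg_expr R q; rewrite ger0_norm // => /(_ q1) cv.
have ne : nbhs (0 : R) (ball (0 : R) e) by exact: nbhsx_ballx.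
have [N _ /(_ N) /= h] := cv _ ne.
exists N; have := h (leqnn N); rewrite /ball /= sub0r normrN.
by apply: le_lt_trans (ler_norm _).
Qed.

End Intervals.

Section Straight.
Variables (R : realType) (n : nat).
Context {n_ok : odd_ge5 n}.
Let n_odd : odd n := n_is_odd.
Let n_ge5 : (5 <= n)%N := n_is_ge5.
Implicit Types (x z a e : 'cV[R]_2) (s t : R) (b : bool) (j k l : nat).

Local Notation vertex := (vertex R n).
Local Notation polygon := (@polygon R n).
Local Notation hf := (@hf R n).
Local Notation c1 := (c1 R n).
Local Notation c3 := (c3 R n).
Local Notation s1 := (s1 R n).
Local Notation cs := (cs R n).
Local Notation sn := (sn R n).
Local Notation sg := (@sg R).
Local Notation surface := (surface R n).
Local Notation sp := (@sp R n n_ok).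
Local Notation sing := (@sing R n n_ok).
Local Notation isvtx := (@isvtx R n).
Local Notation rpb := (@rpb R n).
Local Notation rpv := (@rpv R n).
Implicit Types (u v w : surface) (D : set R) (c : R -> surface).

Local Notation smap := (continuousType surface surface).

Local Notation chv := (@chv R n).
Local Notation Dvec := (@Dvec R n).
Local Notation ltn_modn := (@ltn_modn n n_ok).
Local Notation chart_domain_open := (@chart_domain_open R n n_ok).

Lemma near_neq (T : topologicalType) (c c' : T -> surface) (t : T) :
  continuous c -> continuous c' -> c t <> c' t -> nbhs t [set t' | c t' <> c' t'].
Proof.
move=> cc cc' /eqP ne; have hd := @surface_hausdorff R n n_ok.
rewrite open_hausdorff in hd; have [[A B] /= [tA tB] [oA oB /eqP AB]] := hd _ _ ne.
have h1 : nbhs t (c @^-1` A).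
  by apply: cc; apply: open_nbhs_nbhs; split=> //; exact/set_mem.
have h2 : nbhs t (c' @^-1` B).
  by apply: cc'; apply: open_nbhs_nbhs; split=> //; exact/set_mem.
apply: nbhsS (nbhsA h1 h2) => t' /= [hA hB] e; rewrite -e in hB.
by have : (A `&` B) (c t') by []; rewrite AB.
Qed.

Lemma agree_closure c c' (r s : R) : continuous c -> continuous c' -> r < s ->
  (forall t, r < t < s -> c t = c' t) -> c r = c' r /\ c s = c' s.
Proof.
move=> cc cc' rs h; split; apply: contrapT => /(near_neq cc cc') /nbhs_ballP[e /= e0 he].
  pose t := r + Num.min (e / 2) ((s - r) / 2).
  have m0 : 0 < Num.min (e / 2) ((s - r) / 2) by rewrite lt_min !divr_gt0 // subr_gt0.
  have m1 : Num.min (e / 2) ((s - r) / 2) <= e / 2 by rewrite ge_min lexx.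
  have m2 : Num.min (e / 2) ((s - r) / 2) <= (s - r) / 2 by rewrite ge_min lexx orbT.
  apply: (he t); last by apply: h; rewrite /t; apply/andP; split; lra.
  by rewrite /ball /= /t opprD addrA subrr sub0r normrN gtr0_norm //; lra.
pose t := s - Num.min (e / 2) ((s - r) / 2).
have m0 : 0 < Num.min (e / 2) ((s - r) / 2) by rewrite lt_min !divr_gt0 // subr_gt0.
have m1 : Num.min (e / 2) ((s - r) / 2) <= e / 2 by rewrite ge_min lexx.
have m2 : Num.min (e / 2) ((s - r) / 2) <= (s - r) / 2 by rewrite ge_min lexx orbT.
apply: (he t); last by apply: h; rewrite /t; apply/andP; split; lra.
by rewrite /ball /= /t opprB addrCA subrr addr0 gtr0_norm //; lra.
Qed.

Definition straight D c e : Prop := forall s, D s -> c s <> sing /\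
  forall k : 'I_n, chart_domain k (c s) ->
    nbhs s [set t | D t -> chart k (c t) = chart k (c s) + (t - s) *: e].

Lemma straight_unique D c c' e s0 s : is_interval D -> continuous c -> continuous c' ->
  straight D c e -> straight D c' e -> D s0 -> D s -> c s0 = c' s0 -> c s = c' s.
Proof.
move=> iD cc cc' st st'.
apply: (@interval_locally_const _ D (fun s => c s = c' s) s0 s iD) => r Dr.
have [er|ne] := pselect (c r = c' r); last first.
  by apply: nbhsS (near_neq cc cc' ne) => t h _; split.
have [ns h] := st r Dr; have [ns' h'] := st' r Dr.
have [k dk] := (nonsing_chart (c r)).1 ns.
have dk' : chart_domain k (c' r) by rewrite -er.
have n1 := cc r _ (chart_domain_open dk); have n2 := cc' r _ (chart_domain_open dk').
apply: nbhsS (nbhsA (nbhsA n1 n2) (nbhsA (h k dk) (h' k dk'))) => t /= [[d1 d2] [e1 e2]] Dt.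
by split=> // _; apply: (chart_inj d1 d2); rewrite e1 // e2 // er.
Qed.

Lemma straight_subset D D' c e : D' `<=` D -> straight D c e -> straight D' c e.
Proof.
move=> sD st s Ds; have [h1 h2] := st s (sD _ Ds); split=> // k dk.
by apply: nbhsS (h2 k dk) => t /= h Dt; apply: h; exact: sD.
Qed.

Lemma line_continuous b x e : continuous (fun s => sp b (x + s *: e)).
Proof.
move=> s; apply: (@continuous_comp _ _ _ (fun s => x + s *: e)); last exact: sp_continuous.
apply: (@continuousD _ _ _ (fun=> x) (fun s : R => s *: e)); first exact: cst_continuous.
by apply: continuousZl; exact: cvg_id.
Qed.

Lemma line_straight D b x e : (forall s, D s -> polygon b (x + s *: e)) ->
  (forall s, D s -> ~ isvtx b (x + s *: e)) ->
  straight D (fun s => sp b (x + s *: e)) e.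
Proof.
move=> PD nv s Ds; split; first by move/(singP (PD s Ds)); exact: nv.
move=> k dk; pose phi t := chart k (sp b (x + t *: e)) - t *: e.
have : nbhs s [set t | D t -> phi t = phi s].
  pose I := (bool * bool * 'I_n * 'I_n)%type.
  apply: (near_finite_const (I := (I * bool)%type)
    (c := fun i => x + Dvec i.1 + chv i.2 k 0)) => [t Dt|].
    have [i ei] := sp_Dvec (PD t Dt) (rp_polygon _) (esym (rpK _)).
    exists (i, rpb (sp b (x + t *: e))).
    rewrite /phi /chart -/(rpb _) -/(rpv _) ei /chv /=; case: (rpb _);
      by apply: vecP; rewrite !(pxD, pyD, pxN, pyN, pxZ, pyZ, px0, py0); ring.
  apply: (@continuousB _ _ _ (fun t => chart k (sp b (x + t *: e))) (fun t : R => t *: e)).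
    apply: (@continuous_comp _ _ _ (fun t => sp b (x + t *: e))).
      exact: line_continuous.
    exact: chart_continuous.
  by apply: continuousZl; exact: cvg_id.
apply: nbhsS => t /= h Dt; have := h Dt; rewrite /phi => /eqP.
rewrite subr_eq => /eqP ->.
by apply: vecP; rewrite !(pxD, pyD, pxN, pyN, pxZ, pyZ); ring.
Qed.

Lemma affine_straight D c e A (f : smap) : continuous c -> affine_map A f ->
  straight D c e -> straight D (f \o c) (A *m e).
Proof.
move=> cc af st s Ds; have [ns h] := st s Ds; split; first exact: (affine_nonsing af).
move=> j dj; have [k dk] := (nonsing_chart (c s)).1 ns.
have n1 := cc s _ (affine_chart af dk dj).
apply: nbhsS (nbhsA n1 (h k dk)) => t /= [e1 e2] Dt.
by rewrite e1 e2 // [chart k (c s) + _]addrC addrK scalemxAr.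
Qed.

Lemma comp_continuous (f : smap) c : continuous c -> continuous (f \o c).
Proof. by move=> cc s; apply: continuous_comp; [exact: cc|exact: cts_fun]. Qed.

(** On vertices [hf k] is either [c1] or at most [c3]. A displacement of norm below [delta] changes
    [hf k] by less than this gap, so it moves no vertex to another one. *)
Definition delta : R := (c1 - c3) / 2.
Lemma delta_gt0 : 0 < delta.
Proof. by rewrite divr_gt0 // subr_gt0 /c3 /c1 c3_lt_c1. Qed.

Lemma norm_coord x : `|px x| <= `|x| /\ `|py x| <= `|x|.
Proof.
rewrite /Num.norm /= mx_normrE; split.
  by apply: (le_trans _ (le_bigmax _ _ (0, 0))).
by apply: (le_trans _ (le_bigmax _ _ (1, 0))).
Qed.

Lemma hf_norm k x : hf k x <= 2 * `|x|.
Proof.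
have [h1 h2] := norm_coord x; rewrite /hf.
have a1 : sn (2 * k + 2) * px x <= `|px x|.
  apply: le_trans (ler_norm _) _; rewrite normrM ler_piMl //; exact: sin_max.
have a2 : - (cs (2 * k + 2) * py x) <= `|py x|.
  rewrite -mulNr; apply: le_trans (ler_norm _) _.
  by rewrite normrM normrN ler_piMl //; exact: cos_max.
lra.
Qed.

Lemma hf_vertex_dich k j : (k < n)%N -> hf k (vertex j) = c1 \/ hf k (vertex j) <= c3.
Proof.
move=> kn; rewrite -vertex_mod; have jn := ltn_modn j; move: (j %% n)%N jn => i jn.
have [->|jk] := eqVneq i k; first by left; rewrite hf_vertex.
have [->|jk'] := eqVneq i (k.+1 %% n)%N; first by left; rewrite vertex_mod hf_vertexS.
by right; exact: hf_vertex_far.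
Qed.

Lemma vertex_two_sides j i : (j < n)%N -> (i < n)%N ->
  hf j (vertex i) = c1 -> hf (j + n.-1) (vertex i) = c1 -> i = j.
Proof.
move=> jn i_n h1; rewrite -hf_mod => h2; have ln := ltn_modn (j + n.-1).
have [//|i1] := vertex_on_side jn i_n h1.
have el : ((j + n.-1) %% n = if j == 0 then n.-1 else j.-1)%N.
  case: eqP => [->|j0]; first by rewrite add0n modn_small //; lia.
  by rewrite (_ : j + n.-1 = j.-1 + n)%N ?modnDr ?modn_small; lia.
have [i2|i2] := vertex_on_side ln i_n h2; move: i1 i2; rewrite ?(modSn ln) el (modSn jn);
  move: jn i_n; clear -n_ge5.
  by case: eqP; case: eqP; lia.
by case: eqP; case: eqP; case: eqP; lia.
Qed.

Lemma hf_pred j : hf (j + n.-1) (vertex j) = c1.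
Proof.
rewrite -(vertex_addn R j) (_ : j + n = (j + n.-1).+1)%N ?hf_vertexS //; lia.
Qed.

Lemma vertex_sep b j j' : `|sg b *: vertex j - sg b *: vertex j'| < delta ->
  sg b *: vertex j = sg b *: vertex j'.
Proof.
rewrite -scalerBr normrZ; have -> : `|sg b| = 1.
  by case: b; rewrite ?sg0 ?sg1 ?normrN normr1.
rewrite mul1r -(vertex_mod R j) -(vertex_mod R j').
have := ltn_modn j; have := ltn_modn j'; move: (j %% n)%N (j' %% n)%N => {}j {}j' jn' jn h.
congr (_ *: vertex _); apply/esym.
have key l : hf l (vertex j) = c1 -> hf l (vertex j') = c1.
  rewrite -2!(hf_mod l) => e; have [//|le] := hf_vertex_dich j' (ltn_modn l).
  have := hf_norm (l %% n) (vertex j - vertex j'); rewrite hfB e.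
  by move: h; rewrite /delta; lra.
by apply: vertex_two_sides => //; apply: key; rewrite ?hf_vertex ?hf_pred.
Qed.

(* The displacement from the singular point in a neighbourhood of it. It is
   single valued because gluing is by translations that map vertices to
   vertices. *)
Definition near_disp u e := exists b x j, [/\ polygon b x, sp b x = u,
  `|x - sg b *: vertex j| < delta / 4 & e = x - sg b *: vertex j].

(** If a point close to a vertex lies on a side, the vertex lies on that side too, and the gluing
    translation carries both to a point and a vertex of the other polygon. *)
Lemma near_disp_rep u e b' x' : near_disp u e -> polygon b' x' -> sp b' x' = u ->
  exists2 j', x' - sg b' *: vertex j' = e & `|x' - sg b' *: vertex j'| < delta / 4.
Proof.
have d0 := delta_gt0.
move=> [b [x [j [Px ex h ->]]]] Px' ex'.
have := ex; rewrite -ex' => /(sp_eq Px Px').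
case=> [[eb exx]|[k [kn eb sx exx]]|[[i ei] [i' ei']]].
- by subst b' x'; exists j.
- have hj : hf k (vertex j) = c1.
    have [//|le] := hf_vertex_dich j kn.
    have /(sideP _ _ kn)[_ ehf] := sx.
    have := hf_norm k (sg b *: (x - sg b *: vertex j)).
    rewrite normrZ scalerBr sgK hfB ehf.
    have -> : `|sg b| = 1 by case: (b); rewrite ?sg0 ?sg1 ?normrN normr1.
    rewrite mul1r; move: h d0; rewrite /delta; lra.
  have sj : side n b k (sg b *: vertex j).
    by apply/(sideP _ _ kn); rewrite sgK; split=> //; exact: polygon_vertex.
  have [i ei] : isvtx (~~ b) (partner n b k (sg b *: vertex j)).
    by apply: isvtx_partner => //; exists j.
  have e1 : x' - sg b' *: vertex i = x - sg b *: vertex j.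
    rewrite exx eb -ei /partner.
    by apply: vecP; rewrite !(pxD, pyD, pxN, pyN); ring.
  by exists i; rewrite e1.
exists i'; rewrite ei' subrr ?normr0; last by lra.
apply/esym/eqP; rewrite ei subr_eq0; apply/eqP/vertex_sep.
by rewrite -ei; lra.
Qed.

Lemma near_disp_uniq u e e' : near_disp u e -> near_disp u e' -> e = e'.
Proof.
move=> h [b' [x' [j' [Px' ex' h' ->]]]].
have [j <- hj] := near_disp_rep h Px' ex'.
congr (_ - _); apply: vertex_sep.
have -> : sg b' *: vertex j - sg b' *: vertex j' =
    - (x' - sg b' *: vertex j) + (x' - sg b' *: vertex j').
  by apply: vecP; rewrite !(pxD, pyD, pxN, pyN); ring.
apply: le_lt_trans (ler_normD _ _) _; rewrite normrN.
by have d0 := delta_gt0; lra.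
Qed.

Definition disp u : 'cV[R]_2 := xget 0 [set e | near_disp u e].

Lemma dispE u e : near_disp u e -> disp u = e.
Proof.
move=> h; apply: (near_disp_uniq _ h).
by apply: (@xgetPex _ 0 [set e | near_disp u e]); exists e.
Qed.

Lemma disp_continuous u e : near_disp u e -> {for u, continuous disp}.
Proof.
move=> hu; have he' := dispE hu.
have he : `|e| < delta / 4 by case: hu => [b [x [j [_ _ h ->]]]].
move=> U /=; rewrite he' => /nbhs_ballP[r /= r0 hr].
have d0 := delta_gt0.
pose m := Num.min r (delta / 4 - `|e|).
have m0 : 0 < m by rewrite lt_min r0 subr_gt0 he.
have mr : m <= r by rewrite ge_min lexx.
have md : m <= delta / 4 - `|e| by rewrite ge_min lexx orbT.
apply: nbhsS (near_dist u m0) => w hw.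
have [z [Pz ez zr]] := hw _ _ (rp_polygon w) (rpK w).
have [j ej _] := near_disp_rep hu Pz ez.
have hw' : near_disp w (rpv w - sg (rpb w) *: vertex j).
  exists (rpb w), (rpv w), j; split=> //; [exact: rp_polygon|exact: rpK|].
  have -> : rpv w - sg (rpb w) *: vertex j = (rpv w - z) + e by rewrite -ej addrA subrK.
  by apply: le_lt_trans (ler_normD _ _) _; lra.
apply: hr; rewrite -ball_normE /= (dispE hw').
have -> : e - (rpv w - sg (rpb w) *: vertex j) = z - rpv w.
  by rewrite -ej opprB addrA subrK.
by rewrite distrC; lra.
Qed.

Lemma near_disp_sing r : 0 < r <= delta / 4 ->
  nbhs sing [set w | exists2 e, near_disp w e & `|e| < r].
Proof.
move=> /andP[r0 rd]; apply: nbhsS (near_dist sing r0) => w hw.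
have [z [Pz ez zr]] := hw _ _ (rp_polygon w) (rpK w).
have [j ej] := (singP Pz).1 ez.
exists (rpv w - z) => //; exists (rpb w), (rpv w), j; rewrite -ej; split=> //.
- exact: rp_polygon.
- exact: rpK.
exact: lt_le_trans zr rd.
Qed.

Lemma is_interval_oo (r s : R) : is_interval [set t | r < t < s].
Proof.
move=> x y /= /andP[rx xs] /andP[ry ys] z /andP[xz zy].
by apply/andP; split; [exact: lt_le_trans xz|exact: le_lt_trans ys].
Qed.
Lemma is_interval_oc (r s : R) : is_interval [set t | r < t <= s].
Proof.
move=> x y /= /andP[rx xs] /andP[ry ys] z /andP[xz zy].
by apply/andP; split; [exact: lt_le_trans xz|exact: le_trans ys].
Qed.
Lemma polygon_segment b x y s : 0 <= s <= 1 -> polygon b x -> polygon b y ->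
  polygon b (x + s *: (y - x)).
Proof.
move=> /andP[s0 s1'] /polygonP hx /polygonP hy; apply/polygonP => k.
have := hx k; have := hy k; rewrite !hfZ hfD hfZ hfB => h1 h2.
have -> : sg b * (hf k x + s * (hf k y - hf k x)) =
  (1 - s) * (sg b * hf k x) + s * (sg b * hf k y) by ring.
have -> : c1 = (1 - s) * c1 + s * c1 by ring.
by apply: lerD; apply: ler_wpM2l; rewrite ?subr_ge0.
Qed.

(* A straight path that starts at the singular point is a ray in one polygon
   for a short time: its displacement from the singular point is locally affine,
   hence linear. *)
Lemma ray_start c e : continuous c -> c 0 = sing ->
  straight [set t | 0 < t < 1] c e ->
  exists b j s0, [/\ 0 < s0 < 1, polygon b (sg b *: vertex j + s0 *: e) &
    forall s, 0 <= s <= s0 -> c s = sp b (sg b *: vertex j + s *: e)].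
Proof.
move=> cc c0 st; have d0 := delta_gt0.
have d40 : 0 < delta / 4 by rewrite divr_gt0.
have nd r : 0 < r <= delta / 4 -> exists2 s0, 0 < s0 < 1 &
    forall s, 0 < s < s0 -> exists2 e', near_disp (c s) e' & `|e'| < r.
  move=> hr; have := cc 0; rewrite /continuous_at c0 => /(_ _ (near_disp_sing hr)).
  move=> /nbhs_ballP[s0 /= s00 hs0]; exists (Num.min s0 (1 / 2)).
    by rewrite lt_min s00 divr_gt0 //= gt_min; apply/orP; right; lra.
  move=> s /andP[s_0]; rewrite lt_min => /andP[ss _]; apply: hs0.
  by rewrite /ball /= sub0r normrN gtr0_norm.
have [s0 /andP[s00 s01] hs0] : exists2 s0, 0 < s0 < 1 &
    forall s, 0 < s < s0 -> exists2 e', near_disp (c s) e' & `|e'| < delta / 4.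
  by apply: nd; rewrite d40 lexx.
pose phi s := disp (c s) - s *: e.
(* The chart moves with velocity [e], and [disp] differs from the chart by one of finitely many
   constants, so [phi] is locally constant. *)
have lc s : 0 < s < s0 -> nbhs s [set t | 0 < t < s0 -> phi t = phi s].
  move=> /andP[s_0 ss].
  have [ns hst] := st s (introT andP (conj s_0 (lt_trans ss s01))).
  have [k dk] := (nonsing_chart (c s)).1 ns.
  pose psi t := disp (c t) - chart k (c t).
  have [e' he' _] := hs0 s (introT andP (conj s_0 ss)).
  have h1 : nbhs s [set t | 0 < t < s0 -> psi t = psi s].
    apply: (near_finite_const (I := ((bool * 'I_n) * bool)%type)
      (c := fun i => - (sg i.1.1 *: vertex i.1.2) - chv i.2 k 0)
      (D := fun t => 0 < t < s0)) => [t ht|].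
      have [et het _] := hs0 t ht.
      have [j ej _] := near_disp_rep het (rp_polygon (c t)) (rpK (c t)).
      exists (rpb (c t), Ordinal (ltn_modn j), rpb (c t)).
      rewrite /psi (dispE het) -ej /chart -/(rpb _) -/(rpv _) /= vertex_mod /chv.
      by case: (rpb (c t)); apply: vecP; rewrite !(pxD, pyD, pxN, pyN, px0, py0); ring.
    apply: (@continuousB _ _ _ (fun t => disp (c t)) (fun t => chart k (c t))).
      by apply: (@continuous_comp _ _ _ c); [exact: cc|exact: disp_continuous he'].
    by apply: (@continuous_comp _ _ _ c); [exact: cc|exact: chart_continuous].
  apply: nbhsS (nbhsA h1 (hst k dk)) => t /= [p1 p2] /andP[t0 ts].
  have q1 := p1 (introT andP (conj t0 ts)).
  have q2 := p2 (introT andP (conj t0 (lt_trans ts s01))).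
  have {q1} : disp (c t) = psi s + chart k (c t) by rewrite -q1 /psi subrK.
  rewrite /phi => ->; rewrite q2 /psi.
  by apply: vecP; rewrite !(pxD, pyD, pxN, pyN, pxZ, pyZ); ring.
have cst s t : 0 < s < s0 -> 0 < t < s0 -> phi t = phi s.
  move=> hs ht.
  apply: (@interval_locally_const _ _ (fun t => phi t = phi s) s t (@is_interval_oo 0 s0)) => // r hr.
  by apply: nbhsS (lc r hr) => t' /= h ht'; rewrite h.
(* The constant is zero because both terms of [phi] tend to 0 at the start. *)
have zero s : 0 < s < s0 -> phi s = 0.
  move=> hs; apply/eqP; rewrite -normr_eq0; apply/negPn/negP => ne.
  have p0 : 0 < `|phi s| by rewrite lt0r ne normr_ge0.
  pose r := Num.min (delta / 4) (`|phi s| / 2).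
  have r0 : 0 < r by rewrite lt_min d40 divr_gt0.
  have r1 : r <= delta / 4 by rewrite ge_min lexx.
  have r2 : r <= `|phi s| / 2 by rewrite ge_min lexx orbT.
  have [s2 /andP[s20 _] hs2] := nd r (introT andP (conj r0 r1)).
  pose t := Num.min (Num.min s2 s0 / 2) (`|phi s| / 2 / (1 + `|e|)).
  have e1 : 0 < 1 + `|e| by have := normr_ge0 e; lra.
  have m0 : 0 < Num.min s2 s0 by rewrite lt_min s20.
  have m1 : Num.min s2 s0 <= s2 by rewrite ge_min lexx.
  have m2 : Num.min s2 s0 <= s0 by rewrite ge_min lexx orbT.
  have t0 : 0 < t by rewrite lt_min !divr_gt0.
  have t1 : t <= Num.min s2 s0 / 2 by rewrite ge_min lexx.
  have t2 : t <= `|phi s| / 2 / (1 + `|e|) by rewrite ge_min lexx orbT.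
  have ht : 0 < t < s0 by rewrite t0 /=; lra.
  have ht2 : 0 < t < s2 by rewrite t0 /=; lra.
  have [et het htr] := hs2 t ht2.
  have : `|phi t| < `|phi s|.
    rewrite /phi (dispE het).
    apply: le_lt_trans (ler_normB _ _) _; rewrite normrZ gtr0_norm //.
    have : t * `|e| <= `|phi s| / 2.
      rewrite ler_pdivlMr // in t2.
      by apply: le_trans t2; rewrite ler_pM2l // lerDr.
    lra.
  by rewrite (cst s t) // ltxx.
pose s1' := s0 / 2; have hs1 : 0 < s1' < s0 by rewrite /s1'; lra.
have [e' he' er'] := hs0 s1' hs1.
have ee : e' = s1' *: e.
  by have := zero s1' hs1; rewrite /phi (dispE he') => /eqP; rewrite subr_eq0 => /eqP.
case: (he') => [b [x [j [Px ex hx ex']]]].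
have xE : x = sg b *: vertex j + s1' *: e by rewrite -ee ex' addrC subrK.
exists b, j, s1'; rewrite -xE; split=> //; first by move: hs1 s01; lra.
have P s : 0 <= s <= s1' -> polygon b (sg b *: vertex j + s *: e).
  move=> /andP[hs hs'].
  have -> : sg b *: vertex j + s *: e = sg b *: vertex j + (s / s1') *: (x - sg b *: vertex j).
    rewrite xE; apply: vecP; rewrite !(pxD, pyD, pxN, pyN, pxZ, pyZ);
    by field; case/andP: hs1 => ? _; exact: lt0r_neq0.
  case/andP: hs1 => hs10 _.
  apply: polygon_segment => //; last exact: polygon_vertex.
  by rewrite divr_ge0 ?(ltW hs10) //= ler_pdivrMr // mul1r.
have ne0 : e != 0.
  apply/eqP => e0; have [ns _] := st s1' (introT andP (conj (proj1 (elimT andP hs1)) (lt_trans (proj2 (elimT andP hs1)) s01))).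
  by apply: ns; rewrite -ex xE e0 scaler0 addr0 sp_vertex.
have nv s : 0 < s <= s1' -> ~ isvtx b (sg b *: vertex j + s *: e).
  move=> /andP[hs hs'] [i ei].
  have : sg b *: vertex i = sg b *: vertex j.
    apply: vertex_sep; rewrite -ei addrC addKr normrZ gtr0_norm //.
    have : `|s1' *: e| < delta / 4 by rewrite -ee.
    rewrite normrZ gtr0_norm; last by case/andP: hs1.
    have : s * `|e| <= s1' * `|e| by rewrite ler_wpM2r.
    lra.
  move=> eij; move: ei; rewrite eij => /eqP; rewrite -subr_eq0 addrC addKr scaler_eq0.
  by rewrite (negbTE ne0) orbF (gt_eqF hs).
move=> s; rewrite le_eqVlt => /andP[/orP[/eqP <- _|hs hs']].
  by rewrite c0 scale0r addr0 sp_vertex.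
apply: (@straight_unique [set t | 0 < t <= s1'] c (fun s => sp b (sg b *: vertex j + s *: e)) e s1') => //.
- exact: is_interval_oc.
- exact: line_continuous.
- by apply: straight_subset st => t /= ht; move: hs1 s01; lra.
- by apply: line_straight => t /andP[t0 t1]; [apply: P; rewrite ltW|apply: nv; rewrite t0].
- by move: hs1 => /andP[h _]; rewrite /= h lexx.
- by rewrite /= hs.
by rewrite -xE ex.
Qed.

(** Uniqueness of straight paths gives equality on the open interval, and the Hausdorff property
    gives it at the ends. *)
Lemma ray_extend c e b x s0 s2 : continuous c -> 0 < s0 <= s2 -> s2 <= 1 ->
  straight [set t | 0 < t < 1] c e -> (forall s, 0 <= s <= s0 -> c s = sp b (x + s *: e)) ->
  (forall s, 0 < s < s2 -> polygon b (x + s *: e)) ->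
  (forall s, 0 < s < s2 -> ~ isvtx b (x + s *: e)) ->
  forall s, 0 <= s <= s2 -> c s = sp b (x + s *: e).
Proof.
move=> cc /andP[s00 s02] s21 st h P nv.
have lc : continuous (fun s => sp b (x + s *: e)) by exact: line_continuous.
have key s : 0 < s < s2 -> c s = sp b (x + s *: e).
  move=> hs; apply: (@straight_unique [set t | 0 < t < s2] c (fun s => sp b (x + s *: e)) e (s0 / 2)) => //.
  - exact: is_interval_oo.
  - by apply: straight_subset st => t /= ht; lra.
  - exact: line_straight.
  - by rewrite /=; lra.
  - by apply: h; lra.
have s20 : 0 < s2 by lra.
have [e0 e2] := agree_closure cc lc s20 key.
move=> s /andP[hs hs']; have [->//|n0] := eqVneq s 0; have [->//|n2] := eqVneq s s2.
by apply: key; rewrite lt0r n0 hs lt_neqAle n2.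
Qed.

(** The vector of the horizontal side at the bottom of [polygon false]. This side, [base], is a
    closed saddle connection whose images under affine maps are studied. *)
Definition e0 : 'cV[R]_2 := mkv (2 * s1) 0.
Definition base (s : R) : surface := sp false (vertex (n - 1) + s *: e0).

Lemma s1_pos : 0 < s1. Proof. by rewrite /s1 s1_gt0. Qed.

Lemma vertex_last : vertex (n - 1) = mkv (- vX R n 0) (vY R n 0).
Proof.
have -> : vertex (n - 1) = rfl (vertex 0).
  rewrite rfl_vertex ?n_gt0 // -(vertex_addn R (n - 1)); congr (vertex _); lia.
by rewrite vertexE /rfl px_mkv py_mkv.
Qed.

Lemma vX0 : vX R n 0 = s1. Proof. by []. Qed.

Lemma base_mkv s : vertex (n - 1) + s *: e0 = mkv ((2 * s - 1) * s1) (vY R n 0).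
Proof.
rewrite vertex_last vX0; apply: vecP; rewrite !(pxD, pyD, pxZ, pyZ, px_mkv, py_mkv);
by rewrite ?px_mkv ?py_mkv; ring.
Qed.

Lemma base0 : base 0 = sing /\ base 1 = sing.
Proof.
have sv i : sp false (vertex i) = sing.
  by have := @sp_vertex R n n_ok false i; rewrite sg0 scale1r.
rewrite /base scale0r addr0 sv; split=> //.
by rewrite base_mkv (_ : (2 * 1 - 1) * s1 = vX R n 0) -?vertexE ?sv // vX0; ring.
Qed.

(** A point strictly inside a chord has norm below 1, the norm of all vertices. *)
Lemma strip_not_vertex i s (x : R) k : 0 <= s <= 1 -> `|x| < wid n i s ->
  mkv x (hgt n i s) <> vertex k.
Proof.
move=> /andP[hs0 hs1] hx e.
have n2 := @norm2_vertex R n k; rewrite -e px_mkv py_mkv in n2.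
have h1 := @norm2_vertex R n i; have h2 := @norm2_vertex R n i.+1.
have hw : wid n i s ^+ 2 + hgt n i s ^+ 2 <= 1.
  move: h1 h2; rewrite /wid /hgt !px_vertex !py_vertex -/(vX R n i) -/(vX R n i.+1).
  rewrite -/(vY R n i) -/(vY R n i.+1).
  move: (vX R n i) (vX R n i.+1) (vY R n i) (vY R n i.+1) => a a' d d' h1 h2.
  have h3 : a * a' + d * d' <= 1.
    have : 0 <= (a - a') ^+ 2 + (d - d') ^+ 2 by rewrite addr_ge0 // sqr_ge0.
    nra.
  have -> : ((1 - s) * a + s * a') ^+ 2 + ((1 - s) * d + s * d') ^+ 2 =
    (1 - s) ^+ 2 * (a ^+ 2 + d ^+ 2) + s ^+ 2 * (a' ^+ 2 + d' ^+ 2) +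
    2 * (s * (1 - s)) * (a * a' + d * d') by ring.
  rewrite h1 h2; have : 0 <= s * (1 - s) by rewrite mulr_ge0 // subr_ge0.
  nra.
have : x ^+ 2 < wid n i s ^+ 2.
  move: hx; rewrite ltr_norml => /andP[hx1 hx2]; nra.
lra.
Qed.

End Straight.

(** * The Veech group is generated by [R] and [T] *)

Section Veech.
Variables (R : realType) (n : nat).
Context {n_ok : odd_ge5 n}.
Let n_odd : odd n := n_is_odd.
Let n_ge5 : (5 <= n)%N := n_is_ge5.
Implicit Types (x z a e : 'cV[R]_2) (s t : R) (b : bool) (j k l : nat).

Local Notation vertex := (vertex R n).
Local Notation polygon := (@polygon R n).
Local Notation hf := (@hf R n).
Local Notation c1 := (c1 R n).
Local Notation s1 := (s1 R n).
Local Notation cs := (cs R n).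
Local Notation sn := (sn R n).
Local Notation sg := (@sg R).
Local Notation surface := (surface R n).
Local Notation sp := (@sp R n n_ok).
Local Notation sing := (@sing R n n_ok).
Local Notation isvtx := (@isvtx R n).
Implicit Types (u v w : surface) (D : set R) (c : R -> surface).

Local Notation smap := (continuousType surface surface).
Local Notation g := (half n).
Local Notation oppS := (@oppS R n n_ok).

Local Notation ltn_modn := (@ltn_modn n n_ok).
Local Notation wid := (@wid R n).
Local Notation hgt := (@hgt R n).
Local Notation vX := (vX R n).
Local Notation vY := (vY R n).
Local Notation cK := (cK R n).
Local Notation e0 := (e0 R n).
Local Notation base := (@base R n n_ok).
Local Notation delta := (delta R n).
Local Notation cot := (cot R n).
Local Notation rotm := (@rotm R n).
Let g2 : (n = 2 * g + 1)%N.
Proof. by rewrite /half; have := odd_double_half n; rewrite n_odd; lia. Qed.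

Lemma base_continuous : continuous base. Proof. exact: line_continuous. Qed.

Lemma base_strip s : 0 <= s <= 1 -> exists2 x : R, vertex (n - 1) + s *: e0 = mkv x (hgt 0 0) &
  - wid 0 0 <= x <= wid 0 0 /\ (0 < s < 1 -> `|x| < wid 0 0).
Proof.
move=> /andP[hs hs']; have s0 : 0 < s1 by exact: s1_pos.
exists ((2 * s - 1) * s1); first by rewrite base_mkv hgt0.
rewrite wid0 vX0; split; first by apply/andP; split; nra.
by move=> /andP[? ?]; rewrite ltr_norml; apply/andP; split; nra.
Qed.

Lemma base_polygon s : 0 <= s <= 1 -> polygon false (vertex (n - 1) + s *: e0).
Proof.
move=> hs; have [x -> [h _]] := base_strip hs.
by apply: strip_polygon => //; rewrite lexx ler01.
Qed.

Lemma isvtx_false x : isvtx false x -> exists k, x = vertex k.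
Proof. by case=> k ->; exists k; rewrite sg0 scale1r. Qed.

Lemma strip_nvtx i s (x : R) : 0 <= s <= 1 -> `|x| < wid i s -> ~ isvtx false (mkv x (hgt i s)).
Proof. by move=> hs hx /isvtx_false[k]; exact: strip_not_vertex. Qed.

Lemma base_nvtx s : 0 < s < 1 -> ~ isvtx false (vertex (n - 1) + s *: e0).
Proof.
move=> hs; have [|x -> [_ h]] := @base_strip s; first by lra.
by apply: strip_nvtx; [rewrite lexx ler01|exact: h].
Qed.

Lemma base_straight : straight [set t | 0 < t < 1] base e0.
Proof.
apply: line_straight => s hs; last exact: base_nvtx.
by apply: base_polygon; rewrite /= in hs; lra.
Qed.

(** * Images of the horizontal side *)

Section Ray.
Variables (A : 'M[R]_2) (f : smap).
Hypothesis f_affine : affine_map A f.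

Lemma image_base_straight : straight [set t | 0 < t < 1] (f \o base) (A *m e0).
Proof. exact: (affine_straight base_continuous f_affine base_straight). Qed.

Lemma image_base_continuous : continuous (f \o base).
Proof. exact: comp_continuous base_continuous. Qed.

Lemma image_base0 : f (base 0) = sing /\ f (base 1) = sing.
Proof.
by have [-> ->] : base 0 = sing /\ base 1 = sing by [exact: base0]; rewrite (affine_sing f_affine).
Qed.

Lemma image_ray : exists b j s0, [/\ 0 < s0 < 1, polygon b (sg b *: vertex j + s0 *: (A *m e0)),
  forall s, 0 <= s <= s0 -> f (base s) = sp b (sg b *: vertex j + s *: (A *m e0)) &
  A *m e0 != 0].
Proof.
have [b [j [s0 [hs0 P h]]]] := ray_start image_base_continuous image_base0.1 image_base_straight.
exists b, j, s0; split=> //; apply/eqP => e.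
have [|ns _] := @image_base_straight s0; first by [].
by apply: ns; rewrite h ?e ?scaler0 ?addr0 ?sp_vertex //; case/andP: hs0 => /ltW -> _; rewrite lexx.
Qed.

(** At time 1 the image of the base is at the singular point, so the ray cannot end inside the
    polygon at a point that is no vertex. *)
Lemma image_ray_end b j s0 : 0 < s0 < 1 ->
  (forall s, 0 <= s <= s0 -> f (base s) = sp b (sg b *: vertex j + s *: (A *m e0))) ->
  (forall s, 0 < s <= 1 -> polygon b (sg b *: vertex j + s *: (A *m e0))) ->
  (forall s, 0 < s <= 1 -> ~ isvtx b (sg b *: vertex j + s *: (A *m e0))) -> False.
Proof.
move=> hs0 h P nv.
have hs : forall s, 0 <= s <= 1 -> (f \o base) s = sp b (sg b *: vertex j + s *: (A *m e0)).
  apply: (@ray_extend R n n_ok (f \o base) (A *m e0) b (sg b *: vertex j) s0 1) => //.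
  - exact: image_base_continuous.
  - by case/andP: hs0 => -> /ltW ->.
  - exact: image_base_straight.
  - by move=> s hs; apply: P; lra.
  - by move=> s hs; apply: nv; lra.
have P1' := P 1 (introT andP (conj ltr01 (lexx 1))).
apply: (nv 1); first by rewrite ltr01 lexx.
apply/(singP P1'); rewrite -hs ?ler01 ?lexx //; exact: image_base0.2.
Qed.

(** A shorter image would stay in the polygon in which it starts, but it is too short to reach
    another vertex. This lower bound is the discreteness that lets the descent stop. *)
Lemma image_base_length : delta <= `|A *m e0|.
Proof.
rewrite leNgt; apply/negP => small.
have [b [j [s0 [hs0 P h ne]]]] := image_ray.
set a := A *m e0 in small P h ne *.
apply: (image_ray_end hs0 h) => s /andP[hs hs'].
  apply/polygonP => l; rewrite scalerDr sgK hfD scalerA mulrC -scalerA hfZ.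
  rewrite -hf_mod; have [e|le] := hf_vertex_dich R j (ltn_modn l).
    have /polygonP/(_ (l %% n)%N) := P; rewrite scalerDr sgK hfD e scalerA mulrC -scalerA hfZ.
    rewrite hf_mod; case/andP: hs0 => s00 _; nra.
  have := @hf_norm R n l (sg b *: a).
  rewrite normrZ; have -> : `|sg b| = 1 by case: (b); rewrite ?sg0 ?sg1 ?normrN normr1.
  rewrite mul1r => hn; have d0 : 0 < delta by exact: delta_gt0.
  have : s * hf l (sg b *: a) <= 2 * delta.
    have [l0|l0] := leP 0 (hf l (sg b *: a)); first by nra.
    by nra.
  move=> h2; rewrite hf_mod in le; rewrite hf_mod -/a; move: h2 le; rewrite /delta; lra.
rewrite -/a; move=> [i ei]; have : sg b *: vertex i = sg b *: vertex j.
  apply: vertex_sep; rewrite -ei addrC addKr normrZ gtr0_norm //.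
  by apply: le_lt_trans small; rewrite ler_piMl ?normr_ge0.
move=> eij; move: ei; rewrite eij => /eqP; rewrite -subr_eq0 addrC addKr scaler_eq0.
by rewrite (negbTE ne) orbF (gt_eqF hs).
Qed.

End Ray.

(** The group generated by [rotm 1] and [T_mx], as the intersection of all sets that contain both
    and are closed under the group operations. Membership is thus its own induction principle. *)
Definition hecke (A : 'M[R]_2) : Prop := forall K : set 'M[R]_2,
  K 1 -> (forall B C, K B -> K C -> K (B * C)) -> (forall B, K B -> K B^-1) ->
  K (rotm 1) -> K (T_mx R n) -> K A.

Lemma hecke1 : hecke 1. Proof. by move=> K. Qed.
Lemma heckeM A B : hecke A -> hecke B -> hecke (A * B).
Proof. by move=> hA hB K K1 KM KV KR KT; exact: (KM _ _ (hA K K1 KM KV KR KT) (hB K K1 KM KV KR KT)). Qed.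
Lemma heckeV A : hecke A -> hecke A^-1.
Proof. by move=> hA K K1 KM KV KR KT; exact: (KV _ (hA K K1 KM KV KR KT)). Qed.
Lemma hecke_rot : hecke (rotm 1). Proof. by move=> K. Qed.
Lemma hecke_T : hecke (T_mx R n). Proof. by move=> K. Qed.
Lemma heckeX A m : hecke A -> hecke (A ^+ m).
Proof. by move=> hA; elim: m => [|m IH]; [exact: hecke1|rewrite exprS; exact: heckeM]. Qed.
Lemma hecke_rotm m : hecke (rotm m).
Proof. by rewrite rotmX; exact: heckeX hecke_rot. Qed.
Lemma heckeN1 : hecke (-1). Proof. by rewrite -(rotm_n R (n := n)); exact: hecke_rotm. Qed.

Lemma veech_rot : veech_group n (rotm 1). Proof. by exists (@rot_map R n n_ok); exact: rot_affine. Qed.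
Lemma veech_T : veech_group n (T_mx R n). Proof. by exists (@twist_map R n n_ok); exact: twist_affine. Qed.

Lemma hecke_veech A : hecke A -> veech_group n A.
Proof.
apply; [exact: veech1|exact: veech_mul|exact: veech_inv|exact: veech_rot|exact: veech_T].
Qed.

Definition shear (t : R) : 'M[R]_2 := mk2 1 t 0 1.

Lemma shearD s t : shear (s + t) = shear s * shear t.
Proof. by rewrite /shear mk2M; congr mk2; ring. Qed.
Lemma shear0 : shear 0 = 1. Proof. exact: mk2_1. Qed.
Lemma shearN t : shear (- t) = (shear t)^-1.
Proof.
have h : shear (- t) * shear t = 1 by rewrite -shearD addNr shear0.
have u : shear t \is a GRing.unit.
  by rewrite -[_ \is a _]/(_ \in unitmx) unitmxE det_mk2 mulr0 subr0 mulr1 unitr1.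
by rewrite -[LHS]mulr1 -(mulrV u) mulrA h mul1r.
Qed.
Lemma shearX t m : shear (t *+ m) = shear t ^+ m.
Proof. by elim: m => [|m IH]; rewrite ?mulr0n ?shear0 // mulrS exprS shearD IH. Qed.
Lemma T_shear : T_mx R n = shear (2 * cot). Proof. exact: T_mxE. Qed.
Lemma shearXz t (m : int) : shear (t *~ m) = shear t ^ m.
Proof.
case: m => m; first by rewrite -pmulrn -exprnP shearX.
by rewrite NegzE mulrNz shearN -pmulrn shearX -exprnN.
Qed.

Lemma hecke_shear (m : int) : hecke (shear (2 * cot *~ m)).
Proof.
rewrite shearXz -T_shear; case: m => m; first by rewrite -exprnP; exact: heckeX hecke_T.
by rewrite NegzE -exprnN; apply: heckeV; apply: heckeX hecke_T.
Qed.

Lemma cot_gt0 : 0 < cot.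
Proof. by rewrite cotE divr_gt0 ?s1_pos // /c1 c1_gt0. Qed.

Definition nrm (a : 'cV[R]_2) : R := px a ^+ 2 + py a ^+ 2.

Lemma nrm_ge0 a : 0 <= nrm a. Proof. by rewrite addr_ge0 // sqr_ge0. Qed.

Lemma reduce_int (x y : R) : 0 < y -> exists m : int, `|x + y *~ m| <= y / 2.
Proof.
move=> y0; exists (- Num.floor (x / y + 1 / 2)).
have := Num.Theory.real_floor_itv (num_real (x / y + 1 / 2)).
set k := Num.floor _ => /andP[h1 h2].
have y1 : x = (x / y) * y by field; exact: lt0r_neq0.
rewrite mulrNz -mulrzr y1 ler_norml; rewrite intrD in h2.
move: (x / y) h1 h2 => q h1 h2.
by apply/andP; split; nra.
Qed.

(* A rotation brings the direction of [a] to an angle at most [pi / 2n], and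
   then a power of [T_mx] shortens it. *)
Lemma reduce_step a : exists B, hecke B /\
  (py (B *m a) = 0 \/ nrm (B *m a) * (1 + c1) ^+ 2 <= nrm a).
Proof.
have n2 : (0 < n + n)%N by rewrite addn_gt0 n_gt0.
pose F (m : 'I_(n + n)) := px (rotm m *m a).
have [m _ hm] := @Order.TotalTheory.arg_maxP _ _ _ (Ordinal n2) xpredT F isT.
set a' := rotm m *m a.
have e1 (k : nat) : px (rotm (m + k) *m a) <= px a'.
  have kn : ((m + k) %% (n + n) < n + n)%N by rewrite ltn_mod.
  have <- : rotm ((m + k) %% (n + n)) = rotm (m + k).
    rewrite [in RHS](divn_eq (m + k) (n + n)) rotmD [rotm (_ * _)]rotmX mulnC exprM.
    by rewrite -rotmX rotm_2n expr1n mul1r.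
  exact: (hm (Ordinal kn) isT).
have na : nrm a' = nrm a.
  rewrite /nrm /a' px_mk2 py_mk2; have h := cs2sn2 R n m.
  transitivity ((cs m ^+ 2 + sn m ^+ 2) * (px a ^+ 2 + py a ^+ 2)); first by ring.
  by rewrite h mul1r.
have r1 : c1 * px a' - s1 * py a' <= px a'.
  by have := e1 1%N; rewrite addnC rotmD -mulmxA -/a' px_mk2; rewrite /c1 /s1 /c1 /s1; lra.
have r2 : c1 * px a' + s1 * py a' <= px a'.
  have := e1 (n + n - 1)%N; rewrite addnC rotmD -mulmxA -/a' px_mk2.
  have -> : (n + n - 1 = 2 * n - 1)%N by lia.
  rewrite cs_sub2n ?sn_sub2n; try lia; rewrite /c1 /s1 /c1 /s1; lra.
have ea : rotm m *m a = a' by []; clearbody a'.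
have c0 : 0 < c1 by exact: c1_gt0. have s0 : 0 < s1 by exact: s1_pos.
have cs1 : c1 ^+ 2 + s1 ^+ 2 = 1 by exact: cs2sn2.
have [y0|y0] := eqVneq (py a') 0.
  by exists (rotm m); split; [exact: hecke_rotm|left; rewrite ea].
have [k hk] : exists k : int, `|px a' + 2 * cot * py a' *~ k| <= cot * `|py a'|.
  have ay : 0 < 2 * cot * `|py a'| by rewrite mulr_gt0 ?normr_gt0 // mulr_gt0 ?cot_gt0.
  have [k hk] := reduce_int (px a') ay.
  have {hk}hk : `|px a' + 2 * cot * `|py a'| *~ k| <= cot * `|py a'| by move: hk; lra.
  have [p0|n0] := leP 0 (py a'); first by exists k; rewrite -{1}(ger0_norm p0).
  exists (- k); move: hk; rewrite {1}(ltr0_norm n0) mulrNz.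
  by rewrite mulrN mulNrz.
exists (shear (2 * cot *~ k) * rotm m); split.
  by apply: heckeM; [exact: hecke_shear|exact: hecke_rotm].
right; rewrite -mulmxA ea -na /nrm px_mk2 py_mk2.
have -> : 1 * px a' + 2 * cot *~ k * py a' = px a' + 2 * cot * py a' *~ k.
  by rewrite mul1r mulrzAl.
have -> : 0 * px a' + 1 * py a' = py a' by ring.
set x' := px a' + _ in hk *; set y := py a' in y0 hk r1 r2 *; set x := px a' in r1 r2 *.
have h1 : x' ^+ 2 <= cot ^+ 2 * y ^+ 2.
  rewrite -exprMn -(real_normK (num_real x')) -(real_normK (num_real (cot * y))).
  by rewrite ler_pXn2r ?nnegrE ?normr_ge0 // normrM (gtr0_norm cot_gt0).
(* By [r1] and [r2] the absolute value of [s1 * y] is at most [(1 - c1) * x]. *)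
have h2 : s1 ^+ 2 * y ^+ 2 <= (1 - c1) ^+ 2 * x ^+ 2.
  rewrite -!exprMn -(real_normK (num_real (s1 * y))) -(real_normK (num_real ((1 - c1) * x))).
  rewrite ler_pXn2r ?nnegrE ?normr_ge0 //.
  have c11 : c1 <= 1 by exact: cos_le1.
  have x0 : 0 <= (1 - c1) * x by lra.
  by rewrite (ger0_norm x0) ler_norml; apply/andP; split; lra.
have h3 : s1 ^+ 2 * (x' ^+ 2 + y ^+ 2) <= y ^+ 2.
  have ce : cot * s1 = c1 by rewrite cotE mulfVK // lt0r_neq0.
  have : s1 ^+ 2 * x' ^+ 2 <= c1 ^+ 2 * y ^+ 2.
    have -> : c1 ^+ 2 * y ^+ 2 = s1 ^+ 2 * (cot ^+ 2 * y ^+ 2) by rewrite -ce; ring.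
    by rewrite ler_pM2l // exprn_gt0.
  move=> h3; rewrite mulrDr -[X in _ <= X]mul1r -cs1 mulrDl addrC; move: h3.
  by move: (c1 ^+ 2 * y ^+ 2) (s1 ^+ 2 * x' ^+ 2) => q1 q2; lra.
have s4 : 0 < s1 ^+ 4 by rewrite exprn_gt0.
rewrite -(ler_pM2l s4).
have e4 : s1 ^+ 4 = s1 ^+ 2 * ((1 - c1) * (1 + c1)).
  have -> : s1 ^+ 4 = s1 ^+ 2 * s1 ^+ 2 by ring.
  by have -> : s1 ^+ 2 = 1 - c1 ^+ 2 by [lra]; ring.
have h4 : s1 ^+ 4 * (x' ^+ 2 + y ^+ 2) <= (1 - c1) ^+ 2 * x ^+ 2.
  apply: le_trans h2; have -> : s1 ^+ 4 = s1 ^+ 2 * s1 ^+ 2 by ring.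
  by rewrite -mulrA ler_pM2l // exprn_gt0.
(* As [s1 ^+ 2 = (1 - c1) * (1 + c1)], the bounds [h2] and [h3] combine to a factor that does not
   depend on [a]. *)
have h5 : (1 - c1) ^+ 2 * (1 + c1) ^+ 2 = s1 ^+ 4.
  have -> : (1 - c1) ^+ 2 * (1 + c1) ^+ 2 = (1 - c1 ^+ 2) ^+ 2 by ring.
  by have -> : 1 - c1 ^+ 2 = s1 ^+ 2 by [lra]; ring.
rewrite mulrA; apply: (@le_trans _ _ ((1 - c1) ^+ 2 * x ^+ 2 * (1 + c1) ^+ 2)).
  by rewrite ler_pM2r // exprn_gt0 //; lra.
rewrite mulrAC h5 ler_pM2l // lerDl sqr_ge0 //.
Qed.

Lemma nrm_norm a : `|a| ^+ 2 <= nrm a.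
Proof.
have key (r : R) : 0 <= r -> (forall i, `|a i 0| <= r) -> r ^+ 2 <= nrm a -> `|a| ^+ 2 <= nrm a.
  move=> c0 h; apply: le_trans; rewrite ler_pXn2r ?nnegrE ?normr_ge0 //.
  rewrite {1}/Num.norm /= mx_normrE; apply: bigmax_le => // -[i j] _ /=.
  by rewrite (ord1 j).
have i2 (i : 'I_2) : i = 0 \/ i = 1 by case: i => -[|[|//]] ?; [left|right]; exact: val_inj.
have [x0|x0] := leP (`|py a|) (`|px a|).
  apply: (key `|px a|); rewrite ?normr_ge0 //; first by move=> i; have [->|->] := i2 i.
  by rewrite real_normK ?num_real // lerDl sqr_ge0.
apply: (key `|py a|); rewrite ?normr_ge0 //.
  by move=> i; have [->|->] := i2 i => //; exact: ltW.
by rewrite real_normK ?num_real // lerDr sqr_ge0.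
Qed.

(** Otherwise repeated reduction steps would shorten the image of [e0] geometrically, below the
    bound [delta]. *)
Lemma veech_horizontal A : veech_group n A -> exists2 B, hecke B & py (B * A *m e0) = 0.
Proof.
move=> [f hf]; apply: contrapT => no.
have H m : exists2 B, hecke B & nrm (B * A *m e0) * ((1 + c1) ^+ 2) ^+ m <= nrm (A *m e0).
  elim: m => [|m [B hB IH]]; first by exists 1; [exact: hecke1|rewrite mul1r expr0 mulr1].
  have [C [hC [z|le]]] := reduce_step (B * A *m e0).
    by case: no; exists (C * B); [exact: heckeM|rewrite -mulrA -mulmxA].
  exists (C * B); first exact: heckeM.
  rewrite exprS mulrA; apply: le_trans IH; rewrite ler_pM2r; last first.
    by rewrite exprn_gt0 // exprn_gt0 //; have : 0 < c1 by [exact: c1_gt0]; lra.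
  by rewrite -mulrA -mulmxA.
have c0 : 0 < c1 by exact: c1_gt0.
pose q := ((1 + c1) ^+ 2)^-1.
have q01 : 0 <= q < 1.
  rewrite /q invr_ge0 sqr_ge0 /= invf_lt1; last by rewrite exprn_gt0 //; lra.
  by rewrite exprn_egt1 //; lra.
have d0 : 0 < delta by exact: delta_gt0.
have na0 : 0 < nrm (A *m e0) + 1 by have := nrm_ge0 (A *m e0); lra.
have [m hm] := pow_lt q01 (divr_gt0 (exprn_gt0 2 d0) na0).
have [B hB] := H m.
have [h hh] := hecke_veech hB.
have l : delta <= `|B * A *m e0| by exact: (image_base_length (affine_comp hf hh)).
have : delta ^+ 2 <= nrm (B * A *m e0).
  apply: le_trans (nrm_norm _); rewrite ler_pXn2r ?nnegrE ?normr_ge0 //; exact: ltW.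
have Q0 : 0 < ((1 + c1) ^+ 2) ^+ m by rewrite exprn_gt0 // exprn_gt0 //; lra.
move=> h1; rewrite -ler_pdivlMr // -exprVn -/q => h2.
have : nrm (A *m e0) * q ^+ m < delta ^+ 2.
  rewrite ltr_pdivlMr // in hm; apply: le_lt_trans hm.
  by rewrite mulrC ler_wpM2l ?exprn_ge0 //; [case/andP: q01|lra].
lra.
Qed.

Lemma affine_ext A (f h : smap) : f =1 h -> affine_map A f -> affine_map A h.
Proof. by move/continuousEP => ->. Qed.

Lemma opp_affine : affine_map (-1) (@rotX R n n_ok n).
Proof.
have H m : affine_map (rotm m) (@rotX R n n_ok m).
  elim: m => [|m IH]; first by rewrite rotm0; apply: (affine_ext _ (@affine_id R n n_ok)).
  rewrite -add1n rotmD; exact: (affine_ext _ (affine_comp IH (@rot_affine R n n_ok))).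
by have := H n; rewrite rotm_n.
Qed.

Lemma cs_pos i : (i.*2 < n)%N -> 0 < cs i.
Proof.
move=> hi; have h : cs (n - i) < cs i by apply: cs_lt; lia.
have e : cs (n - i) = - cs i.
  have h1 : cs n = cs (n - i + i) by rewrite subnK //; lia.
  have h2 : sn n = sn (n - i + i) by rewrite subnK //; lia.
  rewrite cs_n csD in h1; rewrite sn_n snD in h2; have h3 := cs2sn2 R n i.
  transitivity (cs (n - i) * (cs i ^+ 2 + sn i ^+ 2)); first by rewrite h3 mulr1.
  transitivity ((cs (n - i) * cs i - sn (n - i) * sn i) * cs i +
    (sn (n - i) * cs i + cs (n - i) * sn i) * sn i); first by ring.
  by rewrite -h1 -h2; ring.
lra.
Qed.

(** Half the length of the chord at [vertex i] is compared with half the length of the base: a ray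
    with vector [e0] from the left end of such a chord stops inside it. *)
Lemma vX_gt_s1 i : (0 < i < g)%N -> s1 < vX i.
Proof.
move=> hi; have e1 : vX i = sn i.+1 * cs i + cs i.+1 * sn i.
  by rewrite /vX (_ : 2 * i + 1 = i.+1 + i)%N ?snD //; lia.
have e2 : s1 = sn i.+1 * cs i - cs i.+1 * sn i.
  rewrite -(add1n i) snD csD; have h3 := cs2sn2 R n i.
  by transitivity (s1 * (cs i ^+ 2 + sn i ^+ 2)); [rewrite h3 mulr1|rewrite /s1; ring].
have c0 : 0 < cs i.+1 by apply: cs_pos; lia.
have s0 : 0 < sn i by apply: sn_gt0; lia.
by rewrite e1 e2; nra.
Qed.

(** From a vertex on the right, or from the top, a ray to the right leaves the half-plane of a side
    on the right. *)
Lemma ray_false j s0 : 0 < s0 < 1 -> polygon false (vertex j + s0 *: e0) ->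
  exists2 i, (i < g)%N & vertex j = mkv (- vX i) (vY i).
Proof.
rewrite -(vertex_mod R j) => /andP[s00 _] /polygonP; rewrite sg0 scale1r => P.
have jn : (j %% n < n)%N by exact: ltn_modn.
move: (j %% n)%N jn P => {}j jn P.
have [jg|gj] := leqP j g; last first.
  exists (n - 1 - j)%N; first by lia.
  rewrite -[LHS](rflK) rfl_vertex //.
  rewrite (_ : 2 * n - 1 - j = n - 1 - j + n)%N ?vertex_addn; last by lia.
  by rewrite vertexE /rfl px_mkv py_mkv.
have [k kg hk] : exists2 k, (k < g)%N & hf k (vertex j) = c1.
  have [jg'|] := ltnP j g; first by exists j => //; exact: hf_vertex.
  move=> gj; exists g.-1; first by lia.
  by rewrite (_ : j = g.-1.+1) ?hf_vertexS //; lia.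
have := P k; rewrite hfD hk hfZ.
have : 0 < hf k e0.
  rewrite /hf px_mkv py_mkv mulr0 subr0 !mulr_gt0 ?s1_pos //.
  by apply: sn_gt0; lia.
by move=> h1; have := mulr_gt0 s00 h1; lra.
Qed.

Lemma chord_polygon i (x : R) : `|x| <= vX i -> polygon false (mkv x (vY i)).
Proof.
by rewrite ler_norml -hgt0 -wid0 => h; apply: strip_polygon => //; rewrite lexx ler01.
Qed.

Lemma chord_nvtx i (x : R) : `|x| < vX i -> ~ isvtx false (mkv x (vY i)).
Proof. by rewrite -hgt0 -wid0 => h; apply: strip_nvtx => //; rewrite lexx ler01. Qed.

Lemma base_flip s : 0 <= s <= 1 -> sp true (mkv (- s1 + s * (2 * s1)) (- vY 0)) = base s.
Proof.
move=> hs; rewrite /base; have e : vertex (n - 1).+1 = vertex (n - 1) + e0.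
  rewrite (_ : (n - 1).+1 = 0 + n)%N ?vertex_addn; last by lia.
  rewrite vertex_last vertexE; apply: vecP.
    by rewrite pxD !px_mkv vX0; ring.
  by rewrite pyD !py_mkv; ring.
rewrite [RHS](@sp_glueE R n n_ok false (n - 1)); last 2 first.
- exact: base_polygon.
- have e1 : hf (n - 1) (vertex (n - 1)) = c1 by exact: hf_vertex.
  have e2 : hf (n - 1) (vertex (n - 1).+1) = c1 by exact: hf_vertexS.
  rewrite e hfD e1 in e2.
  by rewrite sg0 scale1r hfD hfZ e1 (_ : hf _ e0 = 0) ?mulr0 ?addr0 //; move: e2; lra.
congr (sp true _); rewrite sg0 scale1r /side_shift e vertex_last; apply: vecP.
  by rewrite !(pxD, pxN, pxZ, px_mkv) vX0; ring.
by rewrite !(pyD, pyN, pyZ, py_mkv); ring.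
Qed.

(** * Affine maps whose derivative fixes the horizontal side *)

Section Horizontal.
Variables (C : 'M[R]_2) (f : smap).
Hypotheses (f_affine : affine_map C f) (C_e0 : C *m e0 = e0).

(** The image of the base is a horizontal segment with vector [e0] between singular points. By
    [vX_gt_s1] it is the horizontal side of one of the two polygons, and by [base_flip] both give
    the same points of the surface. *)
Lemma base_fixed s : 0 <= s <= 1 -> f (base s) = base s.
Proof.
have [b [j [s0 [hs0 P h _]]]] := image_ray f_affine.
have E := image_ray_end f_affine hs0 h; rewrite C_e0 in P h E.
have ext : (forall s, 0 < s < 1 -> polygon b (sg b *: vertex j + s *: e0)) ->
    (forall s, 0 < s < 1 -> ~ isvtx b (sg b *: vertex j + s *: e0)) ->
    forall s, 0 <= s <= 1 -> f (base s) = sp b (sg b *: vertex j + s *: e0).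
  apply: (@ray_extend R n n_ok (f \o base) e0 b (sg b *: vertex j) s0 1) => //.
  - exact: image_base_continuous.
  - by case/andP: hs0 => -> /ltW ->.
  - by have := image_base_straight f_affine; rewrite C_e0.
have long i s1' : (0 < i < g)%N -> 0 < s1' <= 1 -> `|- vX i + s1' * (2 * s1)| < vX i.
  move=> hi hs; have h3 := vX_gt_s1 hi; have h2 : 0 < s1 by exact: s1_pos.
  case/andP: hs => hs hs'.
  by rewrite ltr_norml; apply/andP; split; nra.
case: b P h E ext => P h E ext.
- have {}P : polygon false (rfl (vertex j) + s0 *: e0).
    have -> : rfl (vertex j) + s0 *: e0 = rfl (- (sg true *: vertex j + s0 *: e0)).
      rewrite sg1 scaleN1r; apply: vecP; first by rewrite px_rfl !(pxD, pxN, pxZ, px_rfl, px_mkv); ring.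
      by rewrite py_rfl !(pyD, pyN, pyZ, py_rfl, py_mkv); ring.
    by apply: polygon_rfl; exact: polygon_opp P.
  have [j' ej'] : exists j', rfl (vertex j) = vertex j'.
    by rewrite -(vertex_mod R j); exists (2 * n - 1 - j %% n)%N; rewrite rfl_vertex ?ltn_modn.
  rewrite ej' in P; have [i ig] := ray_false hs0 P; rewrite -ej' => ei.
  have ei' s1' : sg true *: vertex j + s1' *: e0 = mkv (- vX i + s1' * (2 * s1)) (- vY i).
    have e2 : vertex j = mkv (vX i) (vY i).
      by rewrite -[LHS]rflK ei /rfl px_mkv py_mkv opprK.
    rewrite sg1 scaleN1r e2; apply: vecP.
      by rewrite !(pxD, pxN, pxZ, px_mkv).
    by rewrite !(pyD, pyN, pyZ, py_mkv); ring.
  have pol (x : R) : `|x| <= vX i -> polygon true (mkv x (- vY i)).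
    move=> hx; rewrite (_ : mkv x (- vY i) = - mkv (- x) (vY i)).
      by apply: (@polygon_opp R n n_ok false); apply: chord_polygon; rewrite normrN.
    by apply: vecP; rewrite ?pxN ?pyN ?px_mkv ?py_mkv ?opprK.
  have nvt (x : R) : `|x| < vX i -> ~ isvtx true (mkv x (- vY i)).
    move=> hx [k ek]; apply: (@chord_nvtx i (- x)); rewrite ?normrN //.
    exists k; rewrite sg0 scale1r; transitivity (- (sg true *: vertex k)); last by rewrite sg1 scaleN1r opprK.
    rewrite -ek.
    by apply: vecP; rewrite ?pxN ?pyN ?px_mkv ?py_mkv ?opprK.
  have [i0|i0] := posnP i; last first.
    case: E => s1' hs; rewrite ei'; [apply: pol; apply: ltW|apply: nvt]; apply: long => //.
      by rewrite i0 ig.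
    by rewrite i0 ig.
  subst i; move=> hs; rewrite ext //; first by rewrite ei' base_flip.
    move=> s2 /andP[h2 h2']; rewrite ei'; apply: pol; rewrite vX0 ler_norml.
    by have ? : 0 < s1 by [exact: s1_pos]; apply/andP; split; nra.
  move=> s2 /andP[h2 h2']; rewrite ei'; apply: nvt; rewrite vX0 ltr_norml.
  by have ? : 0 < s1 by [exact: s1_pos]; apply/andP; split; nra.
- rewrite sg0 scale1r in P h E ext; have [i ig ei] := ray_false hs0 P.
  have ei' s1' : vertex j + s1' *: e0 = mkv (- vX i + s1' * (2 * s1)) (vY i).
    rewrite ei; apply: vecP; first by rewrite !(pxD, pxN, pxZ, px_mkv).
    by rewrite !(pyD, pyN, pyZ, py_mkv); ring.
  have [i0|i0] := posnP i; last first.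
    case: E => s1' hs; rewrite ei'; [apply: chord_polygon; apply: ltW|apply: chord_nvtx];
      apply: long => //; by rewrite i0 ig.
  have ej : vertex j = vertex (n - 1) by rewrite vertex_last ei i0.
  rewrite ej in ext; move=> hs; rewrite ext //; last by move=> *; exact: base_nvtx.
  by move=> s2 h2; apply: base_polygon; case/andP: h2 => /ltW -> /ltW ->.
Qed.

Let m0 := vertex (n - 1) + 2^-1 *: e0.

Lemma half01 : 0 <= (2^-1 : R) <= 1. Proof. by lra. Qed.

(** If such a point were [vertex k], then by convexity the midpoint [m0], and with it both ends of
    the base, would lie on the two side lines through [vertex k]. But these lines determine the
    vertex. *)
Lemma m0_segment x s : polygon false x -> 0 <= s < 1 ->
  polygon false (m0 + s *: (x - m0)) /\ ~ isvtx false (m0 + s *: (x - m0)).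
Proof.
move=> Px /andP[s_0 s_1]; have Pm : polygon false m0 by apply: base_polygon; exact: half01.
split; first by apply: polygon_segment; rewrite ?s_0 ?ltW.
move=> /isvtx_false[k]; rewrite -(vertex_mod R k); have := @ltn_modn k.
move: (k %% n)%N => {}k kn e.
have key l : hf l (vertex k) = c1 -> hf l (vertex (n - 1)) = c1 /\ hf l (vertex 0) = c1.
  rewrite -e hfD hfZ hfB; move: Px Pm => /polygonP/(_ l); rewrite sg0 scale1r => h1.
  move=> /polygonP/(_ l); rewrite sg0 scale1r => h2 h3.
  have : hf l m0 = c1 by nra.
  rewrite /m0 (_ : e0 = vertex 0 - vertex (n - 1)); last first.
    rewrite vertex_last vertexE; apply: vecP.
      by rewrite !(pxD, pxN, px_mkv) vX0; ring.
    by rewrite !(pyD, pyN, py_mkv); ring.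
  rewrite hfD hfZ hfB.
  have /polygonP/(_ l) := @polygon_vertex R n n_ok false (n - 1).
  have /polygonP/(_ l) := @polygon_vertex R n n_ok false 0.
  by rewrite sg0 !scale1r; lra.
have [k1 k2] := key _ (hf_vertex R k); have [k3 k4] := key _ (hf_pred R k).
have n1 : (n - 1 < n)%N by lia. have n0 : (0 < n)%N by lia.
have e1 : (n - 1 = k)%N by exact: (@vertex_two_sides R n n_ok _ _ kn n1 k1 k3).
have e2 : (0 = k)%N by exact: (@vertex_two_sides R n n_ok _ _ kn n0 k2 k4).
by clear -e1 e2 n_ge5; lia.
Qed.

(* Straight segments from the midpoint of the fixed side are mapped to
   straight segments. *)
Lemma follow x : polygon false x -> polygon false (m0 + C *m (x - m0)) ->
  f (sp false x) = sp false (m0 + C *m (x - m0)).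
Proof.
move=> Px Py; set y := m0 + _ in Py *; have ey : C *m (x - m0) = y - m0 by rewrite /y [RHS]addrC addKr.
pose c s := sp false (m0 + s *: (x - m0)); pose c' s := sp false (m0 + s *: (y - m0)).
have cc : continuous c by exact: line_continuous.
have cc' : continuous c' by exact: line_continuous.
have st : straight [set s | 0 <= s < 1] (f \o c) (y - m0).
  rewrite -ey; apply: affine_straight => //.
  by apply: line_straight => s hs; have [] := m0_segment Px hs.
have st' : straight [set s | 0 <= s < 1] c' (y - m0).
  by apply: line_straight => s hs; have [] := m0_segment Py hs.
have I01 : is_interval [set s : R | 0 <= s < 1].
  by move=> r1 r2 /= h1 h2 r3 h3; lra.
have cf : continuous (f \o c) by exact: comp_continuous cc.
have z0 : (f \o c) 0 = c' 0.
  by rewrite /c /c' /= !scale0r !addr0; apply: base_fixed; exact: half01.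
have [] := @agree_closure R n n_ok (f \o c) c' 0 1 cf cc' ltr01.
  move=> s /andP[hs hs']; apply: (straight_unique I01 cf cc' st st' _ _ z0) => /=.
    by rewrite lexx ltr01.
  by rewrite hs' ltW.
move=> _; rewrite /c /c' /= !scale1r.
by rewrite !subrKC.
Qed.

End Horizontal.

Lemma shear_e0 t : shear t *m e0 = e0.
Proof.
apply: vecP; first by rewrite px_mk2 px_mkv py_mkv; ring.
by rewrite py_mk2 px_mkv py_mkv; ring.
Qed.

Lemma base_half : vertex (n - 1) + 2^-1 *: e0 = mkv 0 (vY 0).
Proof. by rewrite base_mkv; congr mkv; field. Qed.

(** If [t] is not zero, the shear about the midpoint of the base moves a point [S] inside the chord
    at height [vY 1] to an end [E] of this chord. This is impossible because [E] is singular and [S]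
    is not. The bound on [t] keeps [S] inside the chord. *)
Lemma veech_shear_small t : veech_group n (shear t) -> `|t| <= cot -> t = 0.
Proof.
move=> [f hf] ht; apply: contrapT => /eqP t0.
have t1 : 0 < `|t| by rewrite normr_gt0.
have [ep hep et] : exists2 ep : R, ep = 1 \/ ep = -1 & t = ep * `|t|.
  have [p|m] := leP 0 t; first by exists 1; [left|rewrite mul1r ger0_norm].
  by exists (-1); [right|rewrite mulN1r ltr0_norm ?opprK].
have g2' : (1 < g)%N by lia.
pose h := vY 1 - vY 0.
have h0 : 0 < h by rewrite subr_gt0; apply: vY_lt; lia.
have x01 : vX 0 < vX 1 by rewrite vX0; apply: vX_gt_s1; lia.
have th : `|t| * h <= vX 0 + vX 1.
  have := @cylinder_modulus R n n_ok 0; rewrite -/h /cK => e.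
  by have : `|t| * h <= cot * h by [rewrite ler_pM2r]; lra.
have th0 : 0 < `|t| * h by exact: mulr_gt0.
have s01 : 0 <= (1 : R) <= 1 by rewrite lexx ler01.
pose S := mkv (ep * vX 1 - t * h) (vY 1); pose E := mkv (ep * vX 1) (vY 1).
have nS : `|ep * vX 1 - t * h| < vX 1.
  rewrite et (_ : _ - _ = ep * (vX 1 - `|t| * h)); last by ring.
  have e1 : `|ep| = 1 by case: hep => ->; rewrite ?normrN normr1.
  by rewrite normrM e1 mul1r ltr_norml; apply/andP; split; lra.
have vE : E = vertex 1 \/ E = rfl (vertex 1).
  rewrite /E; case: hep => ->; [left|right]; rewrite vertexE /rfl ?mul1r //.
  by rewrite px_mkv py_mkv mulN1r.
have isE : exists k, E = vertex k.
  case: vE => eE; first exact: (ex_intro _ 1%N eE).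
  by apply: (ex_intro _ (2 * n - 1 - 1)%N); rewrite eE; apply: rfl_vertex; clear -n_ge5; lia.
have [k ek] := isE.
have PE : polygon false E.
  by have := @polygon_vertex R n n_ok false k; rewrite sg0 scale1r -ek.
have eSE : mkv 0 (vY 0) + shear t *m (S - mkv 0 (vY 0)) = E.
  apply: vecP; first by rewrite pxD px_mk2 !(pxD, pxN, pyD, pyN, px_mkv, py_mkv) /h; ring.
  by rewrite pyD py_mk2 !(pxD, pxN, pyD, pyN, px_mkv, py_mkv) /h; ring.
have PS : polygon false S by apply: chord_polygon; exact: ltW.
have := follow hf (shear_e0 t) PS; rewrite base_half eSE => /(_ PE) fS.
have sE : sp false E = sing.
  by rewrite ek; have := @sp_vertex R n n_ok false k; rewrite sg0 scale1r.
apply: (affine_nonsing hf) (etrans fS sE) => /(singP PS).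
exact: chord_nvtx.
Qed.

(** [follow] settles [polygon false]; the other polygon is reduced to it by conjugation with the map
    of derivative [-1]. *)
Lemma affine1_id (f : smap) : affine_map 1 f -> f =1 id.
Proof.
move=> hf; have key (h : smap) z : affine_map 1 h -> polygon false z -> h (sp false z) = sp false z.
  move=> hh Pz; have e1 : (1 : 'M[R]_2) *m e0 = e0 by rewrite mul1mx.
  by rewrite (follow hh e1 Pz) ?mul1mx ?subrKC.
pose h : smap := (@rotX R n n_ok n : smap) \o (f \o (@rotX R n n_ok n : smap)).
have hh : affine_map 1 h.
  have -> : (1 : 'M[R]_2) = -1 * (1 * -1) by rewrite mul1r mulrNN mulr1.
  by apply: affine_comp; [apply: affine_comp => //|]; exact: opp_affine.
apply: (@surface_ind R n n_ok (fun u => f u = u)) => -[] z Pz; last exact: key.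
have Pz' : polygon false (- z) by exact: polygon_opp Pz.
have := key h (- z) hh Pz'; rewrite /h /= -/(oppS _) -/oppS => e.
apply: (can_inj (@oppSK R n n_ok)); rewrite -[in RHS](opprK z).
by move: e; rewrite /= !oppS_sp ?opprK.
Qed.

Lemma affine_uniq A (f h : smap) : affine_map A f -> affine_map A h -> f =1 h.
Proof.
move=> hf hh; have [h' hh' [k1 k2]] := affine_invE hh.
have u : A \is a GRing.unit by apply: veech_unit; exists f.
have : affine_map 1 (h' \o f : smap) by rewrite -(mulVr u); exact: affine_comp.
by move/affine1_id => e x; have /= := e x; move/(congr1 h); rewrite k2.
Qed.

Lemma horizontal_expand (C : 'M[R]_2) (r : R) m : C *m e0 = r *: e0 -> (C ^+ m) *m e0 = r ^+ m *: e0.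
Proof.
move=> e; elim: m => [|m IH]; first by rewrite !expr0 mul1mx scale1r.
by rewrite exprSr -[_ * C]/(_ *m C) -mulmxA e -scalemxAr IH scalerA exprSr mulrC.
Qed.

Lemma veechX (A : 'M[R]_2) m : veech_group n A -> veech_group n (A ^+ m).
Proof.
by move=> h; elim: m => [|m IH]; [exact: veech1|rewrite exprS; exact: veech_mul].
Qed.

(** Otherwise powers of [C] would shrink [e0] below [delta]. *)
Lemma horizontal_ge1 (C : 'M[R]_2) (r : R) : veech_group n C -> 0 < r -> C *m e0 = r *: e0 -> 1 <= r.
Proof.
move=> hC r0 e; rewrite leNgt; apply/negP => r1.
have d0 : 0 < delta by exact: delta_gt0.
have ne : 0 < `|e0| + 1 by have := normr_ge0 e0; lra.
have [m hm] := pow_lt (introT andP (conj (ltW r0) r1)) (divr_gt0 d0 ne).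
have [f hf] := veechX m hC.
have : delta <= `|C ^+ m *m e0| by exact: (image_base_length hf).
rewrite (horizontal_expand _ e) normrZ ger0_norm; last by rewrite exprn_ge0 // ltW.
rewrite ltr_pdivlMr // in hm; have : 0 <= r ^+ m by rewrite exprn_ge0 ?ltW.
by move: hm; rewrite mulrDr mulr1; move: (r ^+ m) (r ^+ m * `|e0|) => q1 q2 *; lra.
Qed.

(** Up to the generated group, [A] maps [e0] to a positive multiple of itself. The factor is 1,
    because neither this matrix nor its inverse shrinks [e0]; as the determinant is 1, the matrix is
    a shear. Powers of [T_mx] bring the shear into the range where it must be trivial. *)
Theorem veech_hecke A : veech_group n A -> hecke A.
Proof.
move=> hA; have [B0 hB0 hy] := veech_horizontal hA.
have [B hB [r r0 er]] : exists2 B, hecke B & exists2 r : R, 0 < r & B * A *m e0 = r *: e0.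
  have s0 : 0 < 2 * s1 by rewrite mulr_gt0 ?s1_pos.
  pose r := px (B0 * A *m e0) / (2 * s1).
  have er : B0 * A *m e0 = r *: e0.
    apply: vecP; first by rewrite pxZ px_mkv /r mulfVK ?lt0r_neq0.
    by rewrite pyZ py_mkv mulr0 hy.
  have r0 : r != 0.
    apply/eqP => rz; have u : B0 * A \is a GRing.unit.
      by apply: (@veech_unit R n); apply: veech_mul => //; exact: hecke_veech.
    have := congr1 (mulmx (B0 * A)^-1) er.
    rewrite mulmxA -[X in X *m _]/((B0 * A)^-1 * (B0 * A)) mulVr // mul1mx rz scale0r mulmx0.
    by move/(congr1 (@px R)); rewrite px_mkv px0 => /eqP; rewrite gt_eqF.
  have [p|m] := ltP 0 r; first by exists B0 => //; exists r.
  exists (-1 * B0); first by apply: heckeM => //; exact: heckeN1.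
  exists (- r); first by rewrite oppr_gt0 lt_neqAle r0.
  by rewrite mulN1r mulNr mulNmx er scaleNr.
pose C := B * A.
have hC : veech_group n C by apply: veech_mul => //; exact: hecke_veech.
have uC : C \is a GRing.unit by exact: (@veech_unit R n).
have r1 : r = 1.
  apply: le_anti; rewrite (horizontal_ge1 hC r0 er) andbT -invf_ge1 //.
  apply: (horizontal_ge1 (@veech_inv R n n_ok _ hC)); rewrite ?invr_gt0 //.
  apply: (can_inj (scalerK (lt0r_neq0 r0))); rewrite scalerA mulfV ?lt0r_neq0 // scale1r.
  by rewrite scalemxAr -er mulmxA -[X in X *m _]/(C^-1 * C) mulVr // mul1mx.
rewrite r1 scale1r in er.
have [t et] : exists t, C = shear t.
  have s0 : 0 < 2 * s1 by rewrite mulr_gt0 ?s1_pos.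
  have := veech_det hC; have := congr1 (@px R) er; have := congr1 (@py R) er.
  have eC := mk2E C; rewrite -/C {1 2 3}eC px_mk2 py_mk2 px_mkv py_mkv !mulr0 !addr0 det_mk2.
  move: eC; move: (C 0 0) (C 0 1) (C 1 0) (C 1 1) => c00 c01 c10 c11 eC h1 h2.
  have c0 : c10 = 0 by apply: (mulIf (lt0r_neq0 s0)); rewrite h1 mul0r.
  have c1' : c00 = 1 by apply: (mulIf (lt0r_neq0 s0)); rewrite h2 mul1r.
  by rewrite c0 c1' mulr0 subr0 mul1r => d1; exists c01; rewrite eC c0 c1' d1.
have c20 : 0 < 2 * cot by rewrite mulr_gt0 ?cot_gt0.
have [m hm] := reduce_int t c20.
have e0' : t + 2 * cot *~ m = 0.
  apply: veech_shear_small; last by move: hm; lra.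
  by rewrite shearD -et; apply: veech_mul => //; apply: hecke_veech; exact: hecke_shear.
have hC' : hecke C.
  rewrite et (_ : t = 2 * cot *~ (- m)); first exact: hecke_shear.
  by rewrite mulrNz; lra.
have uB : B \is a GRing.unit by apply: (@veech_unit R n); exact: hecke_veech.
by rewrite -(mulKr uB A); apply: heckeM => //; exact: heckeV.
Qed.

End Veech.

(** * Singular chains *)

Section FormalSums.
Variables (K : choiceType) (G W : zmodType) (h : K -> G -> W).
Hypothesis h_add : forall s, {morph h s : x y / x + y}.
Implicit Types (c : {malg G[K]}) (s : K).

(** The additive extension of [h] from monomials; [boundary], [chain_map] and [push] all have this
    form. *)
Definition lin c : W := \sum_(s <- msupp c) h s c@_s.

Lemma h_0 s : h s 0 = 0.
Proof. by apply: (addrI (h s 0)); rewrite -h_add !addr0. Qed.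

Lemma lin_sub c (D : {fset K}) : (msupp c `<=` D)%fset -> lin c = \sum_(s <- D) h s c@_s.
Proof. by move=> sD; apply: big_fset_incl => // s _ /mcoeff_outdom ->; rewrite h_0. Qed.

Lemma linD : {morph lin : x y / x + y}.
Proof.
move=> x y; rewrite (lin_sub (msuppD_le x y)) (lin_sub (fsubsetUl (msupp x) (msupp y))).
rewrite (lin_sub (fsubsetUr (msupp x) (msupp y))) -big_split /=.
by apply: eq_bigr => s _; rewrite mcoeffD h_add.
Qed.

Lemma lin0 : lin 0 = 0. Proof. by apply: (addrI (lin 0)); rewrite -linD !addr0. Qed.

Lemma linN : {morph lin : x / - x}.
Proof. by move=> x; apply: (addrI (lin x)); rewrite -linD !subrr lin0. Qed.

Lemma linB : {morph lin : x y / x - y}. Proof. by move=> x y; rewrite linD linN. Qed.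

Lemma lin_sum I (r : seq I) (P : pred I) (F : I -> {malg G[K]}) :
  lin (\sum_(i <- r | P i) F i) = \sum_(i <- r | P i) lin (F i).
Proof. exact: (big_morph _ linD lin0). Qed.

Lemma linU x s : lin << x *g s >> = h s x.
Proof. by rewrite (lin_sub msuppU_le) big_seq_fset1 mcoeffUU. Qed.

End FormalSums.

Lemma malg_ext (K : choiceType) (G W : zmodType) (f1 f2 : {malg G[K]} -> W) :
  {morph f1 : x y / x + y} -> {morph f2 : x y / x + y} ->
  (forall x s, f1 << x *g s >> = f2 << x *g s >>) -> f1 =1 f2.
Proof.
move=> a1 a2 e c; have z1 : f1 0 = 0 by apply: (addrI (f1 0)); rewrite -a1 !addr0.
have z2 : f2 0 = 0 by apply: (addrI (f2 0)); rewrite -a2 !addr0.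
rewrite (monalgE c) (big_morph _ a1 z1) (big_morph _ a2 z2).
by apply: eq_bigr => s _; exact: e.
Qed.

Section Chains.
Variable R : realType.
Implicit Types (X Y Z : topologicalType) (G : zmodType).

Lemma boundary_add G k X (s : singular_simplex R k.+1 X) :
  {morph (fun x : G => \sum_(i < k.+2) << x *~ (-1) ^+ i *g face i s >>) : x y / x + y}.
Proof.
by move=> x y; rewrite -big_split; apply: eq_bigr => i _; rewrite mulrzDl monalgUD.
Qed.

Lemma boundaryD G k X : {morph @boundary R G k X : x y / x + y}.
Proof. exact: (linD (@boundary_add G k X)). Qed.
Lemma boundaryN G k X : {morph @boundary R G k X : x / - x}.
Proof. exact: (linN (@boundary_add G k X)). Qed.
Lemma boundaryB G k X : {morph @boundary R G k X : x y / x - y}.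
Proof. exact: (linB (@boundary_add G k X)). Qed.
Lemma boundary0 G k X : @boundary R G k X 0 = 0.
Proof. exact: (lin0 (@boundary_add G k X)). Qed.
Lemma boundary_sum G k X I (r : seq I) (P : pred I) (F : I -> chain R G k.+1 X) :
  boundary (\sum_(i <- r | P i) F i) = \sum_(i <- r | P i) boundary (F i).
Proof. exact: (lin_sum (@boundary_add G k X)). Qed.
Lemma boundaryU G k X x (s : singular_simplex R k.+1 X) :
  boundary << x *g s >> = \sum_(i < k.+2) << (x : G) *~ (-1) ^+ i *g face i s >>.
Proof. exact: (linU (@boundary_add G k X)). Qed.

Lemma chain_map_add G k X Y (f : continuousType X Y) (s : singular_simplex R k X) :
  {morph (fun x : G => << x *g (f \o s : singular_simplex R k Y) >>) : x y / x + y}.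
Proof. by move=> x y; rewrite monalgUD. Qed.

Lemma chain_mapD G k X Y f : {morph @chain_map R G k X Y f : x y / x + y}.
Proof. exact: (linD (@chain_map_add G k X Y f)). Qed.
Lemma chain_mapN G k X Y f : {morph @chain_map R G k X Y f : x / - x}.
Proof. exact: (linN (@chain_map_add G k X Y f)). Qed.
Lemma chain_mapB G k X Y f : {morph @chain_map R G k X Y f : x y / x - y}.
Proof. exact: (linB (@chain_map_add G k X Y f)). Qed.
Lemma chain_map_sum G k X Y f I (r : seq I) (P : pred I) (F : I -> chain R G k X) :
  @chain_map R G k X Y f (\sum_(i <- r | P i) F i) = \sum_(i <- r | P i) chain_map f (F i).
Proof. exact: (lin_sum (@chain_map_add G k X Y f)). Qed.
Lemma chain_mapU G k X Y f x (s : singular_simplex R k X) :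
  @chain_map R G k X Y f << x *g s >> = << x *g (f \o s : singular_simplex R k Y) >>.
Proof. exact: (linU (@chain_map_add G k X Y f)). Qed.

Lemma chain_map_boundary G k X Y (f : continuousType X Y) (c : chain R G k.+1 X) :
  chain_map f (boundary c) = boundary (chain_map f c).
Proof.
move: c; apply: malg_ext => [x y|x y|x s].
- by rewrite boundaryD chain_mapD.
- by rewrite chain_mapD boundaryD.
rewrite boundaryU chain_map_sum chain_mapU boundaryU; apply: eq_bigr => i _.
by rewrite chain_mapU; congr << _ *g _ >>; apply/continuousEP.
Qed.

Lemma chain_map_comp G k X Y Z (f : continuousType X Y) (g : continuousType Y Z)
    (h : continuousType X Z) (c : chain R G k X) :
  h =1 g \o f -> chain_map h c = chain_map g (chain_map f c).
Proof.
move=> e; move: c; apply: malg_ext => [x y|x y|x s].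
- by rewrite chain_mapD.
- by rewrite !chain_mapD.
by rewrite !chain_mapU; congr << _ *g _ >>; apply/continuousEP => t; exact: e.
Qed.

Lemma chain_map_id G k X (f : continuousType X X) (c : chain R G k X) : f =1 id -> chain_map f c = c.
Proof.
move=> e; move: c; apply: malg_ext => [x y|x y|x s] //; first by rewrite chain_mapD.
by rewrite !chain_mapU; congr << _ *g _ >>; apply/continuousEP => t; exact: e.
Qed.

(** Change of coefficients, by which integral homologies are transported to [Z/a]. *)
Definition push (G H : zmodType) (phi : G -> H) k X (c : chain R G k X) : chain R H k X :=
  lin (fun s x => << phi x *g s >>) c.

Section Push.
Variables (G H : zmodType) (phi : G -> H).
Hypothesis phiD : {morph phi : x y / x + y}.

Lemma phi_0 : phi 0 = 0.
Proof. by apply: (addrI (phi 0)); rewrite -phiD !addr0. Qed.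

Lemma phi_N : {morph phi : x / - x}.
Proof. by move=> x; apply: (addrI (phi x)); rewrite -phiD !subrr phi_0. Qed.

Lemma push_add k X (s : singular_simplex R k X) :
  {morph (fun x : G => << phi x *g s >>) : x y / x + y}.
Proof. by move=> x y; rewrite phiD monalgUD. Qed.

Lemma pushD k X : {morph @push G H phi k X : x y / x + y}.
Proof. exact: (linD (@push_add k X)). Qed.
Lemma pushB k X : {morph @push G H phi k X : x y / x - y}.
Proof. exact: (linB (@push_add k X)). Qed.
Lemma push_sum k X I (r : seq I) (P : pred I) (F : I -> chain R G k X) :
  push phi (\sum_(i <- r | P i) F i) = \sum_(i <- r | P i) push phi (F i).
Proof. exact: (lin_sum (@push_add k X)). Qed.
Lemma pushU k X x (s : singular_simplex R k X) : push phi << x *g s >> = << phi x *g s >>.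
Proof. exact: (linU (@push_add k X)). Qed.

Lemma phi_sign x i : phi (x *~ (-1) ^+ i) = phi x *~ (-1) ^+ i.
Proof.
rewrite -signr_odd; case: (odd i); rewrite ?expr0 ?expr1 ?mulr1z ?mulrNz ?mulr1z //.
exact: phi_N.
Qed.

Lemma push_boundary k X (c : chain R G k.+1 X) : push phi (boundary c) = boundary (push phi c).
Proof.
move: c; apply: malg_ext => [x y|x y|x s].
- by rewrite boundaryD pushD.
- by rewrite pushD boundaryD.
by rewrite boundaryU push_sum pushU boundaryU; apply: eq_bigr => i _; rewrite pushU phi_sign.
Qed.

Lemma push_chain_map k X Y (f : continuousType X Y) (c : chain R G k X) :
  push phi (chain_map f c) = chain_map f (push phi c).
Proof.
move: c; apply: malg_ext => [x y|x y|x s].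
- by rewrite chain_mapD pushD.
- by rewrite pushD chain_mapD.
by rewrite chain_mapU !pushU chain_mapU.
Qed.

End Push.

Section Functoriality.
Variables (G : zmodType) (X : topologicalType).
Implicit Types f g h : continuousType X X.

Lemma chain_map_cycle k f (z : chain R G k.+1 X) : boundary z = 0 -> boundary (chain_map f z) = 0.
Proof.
move=> e; rewrite -chain_map_boundary e.
exact: (lin0 (@chain_map_add G k X X f)).
Qed.

Lemma trivial_id f : f =1 id -> trivial_on_H1 R G f.
Proof. by move=> e z _; exists 0; rewrite boundary0 chain_map_id // subrr. Qed.

Lemma trivial_comp f g h : h =1 g \o f ->
  trivial_on_H1 R G f -> trivial_on_H1 R G g -> trivial_on_H1 R G h.
Proof.
move=> e tf tg z cz; have [d ed] := tf z cz; have [d' ed'] := tg _ (chain_map_cycle f cz).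
exists (d + d'); rewrite boundaryD -ed -ed' (chain_map_comp _ e).
by rewrite [RHS]addrC addrA subrK.
Qed.

Lemma trivial_inverse f g : cancel f g -> cancel g f ->
  trivial_on_H1 R G f -> trivial_on_H1 R G g.
Proof.
move=> fg gf tf z cz; have [d ed] := tf _ (chain_map_cycle g cz).
exists (- d); rewrite boundaryN -ed opprB; congr (_ - _).
rewrite -(chain_map_comp z (h := f \o g : continuousType X X)) //.
by rewrite chain_map_id.
Qed.

Lemma trivial_conj f g h h' : cancel h h' -> cancel h' h -> g =1 h \o f \o h' ->
  trivial_on_H1 R G f -> trivial_on_H1 R G g.
Proof.
move=> hh' h'h e tf z cz; have [d ed] := tf _ (chain_map_cycle h' cz).
exists (chain_map h d); rewrite -chain_map_boundary -ed chain_mapB; congr (_ - _).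
  rewrite -(chain_map_comp z (h := f \o h' : continuousType X X)) //.
  exact: (chain_map_comp (f := f \o h' : continuousType X X)).
rewrite -(chain_map_comp z (h := h \o h' : continuousType X X)) //.
by rewrite chain_map_id.
Qed.

End Functoriality.

Section AffineSimplices.
Variables (X : topologicalType) (V : normedModType R) (F : V -> X).
Hypothesis cF : continuous F.

(** Affine simplices live in a normed space on which [F] is defined everywhere, so no convex domain
    has to be carried along. This is what the extension of [sp] to the plane is for. *)
Definition aff_fun k (a : 'I_k -> V) (t : stdsimplex R k) : X := F (\sum_i val t 0 i *: a i).

Lemma aff_continuous k (a : 'I_k -> V) : continuous (aff_fun a).
Proof.
move=> t; apply: (@continuous_comp _ _ _ (fun t : stdsimplex R k => \sum_i val t 0 i *: a i) F);
  last exact: cF.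
suff h : continuous (fun t : stdsimplex R k => \sum_i val t 0 i *: a i) by exact: h.
move=> {}t; apply: continuous_big; first exact: add_continuous.
move=> i _ {}t.
have vc : {for t, continuous (val : stdsimplex R k -> 'rV[R]_k)} by exact: initial_continuous.
have sc : {for t, continuous (fun t : stdsimplex R k => val t 0 i)}.
  apply: (@continuous_comp _ _ _ (val : stdsimplex R k -> 'rV[R]_k) (fun u => u 0 i)) => //.
  exact: coord_continuous.
by apply: cvgZr_tmp; [exact: nbhs_filter|exact: sc].
Qed.

Definition aff k (a : 'I_k.+1 -> V) : singular_simplex R k X := mkcts (@aff_continuous k.+1 a).

Lemma face_aff k (a : 'I_k.+2 -> V) i : face i (aff a) = aff (fun j => a (lift i j)).
Proof.
apply/continuousEP => t /=; rewrite /aff_fun /=; congr (F _).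
rewrite (bigD1_ord i) //= mxE unlift_none /= scale0r add0r.
by apply: eq_bigr => j _; rewrite mxE liftK.
Qed.

End AffineSimplices.

End Chains.

(** The tactic [abel] proves identities between sums of integral chains: it generalizes the atoms
    and passes to coefficients, where [ring] applies. *)
Ltac gen_atoms t :=
  lazymatch t with
  | (?a + ?b)%R => gen_atoms a; gen_atoms b
  | (- ?a)%R => gen_atoms a
  | 0%R => idtac
  | _ => first [is_var t | let y := fresh "y" in move: t => y]
  end.
Ltac abel :=
  match goal with |- ?l = ?r => gen_atoms l; gen_atoms r end;
  apply/malgP => ?; rewrite !(mcoeffD, mcoeffN, mcoeff0); ring.

Section AffineSimplexEquations.
Variables (R : realType) (X : topologicalType) (V : normedModType R) (F : V -> X).
Hypothesis cF : continuous F.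

Lemma affE k (a : 'I_k.+1 -> V) (t : stdsimplex R k.+1) :
  aff cF a t = F (\sum_i val t 0 i *: a i).
Proof. by []. Qed.

End AffineSimplexEquations.

(** * Homologies between segments *)

Section Segments.
Variables (R : realType) (X : topologicalType).
Implicit Types (V : normedModType R) (c d : chain R int 1 X).

Definition bd c := exists e : chain R int 2 X, c = boundary e.

Lemma bd0 : bd 0. Proof. by exists 0; rewrite boundary0. Qed.
Lemma bdD c d : bd c -> bd d -> bd (c + d).
Proof. by move=> [x ->] [y ->]; exists (x + y); rewrite boundaryD. Qed.
Lemma bdN c : bd c -> bd (- c).
Proof. by move=> [x ->]; exists (- x); rewrite boundaryN. Qed.

Definition seg V (F : continuousType V X) (a b : V) : chain R int 1 X :=
  << 1 *g aff (@cts_fun _ _ F) (fun i : 'I_2 => if i == 0 then a else b) >>.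

Lemma sum2 (V : zmodType) (F : 'I_2 -> V) : \sum_i F i = F 0 + F 1.
Proof. by rewrite big_ord_recl big_ord1; congr (_ + F _); exact: val_inj. Qed.

(** Segments through different maps are compared by their points. In this way a segment in one
    polygon becomes a segment in the other one or in a developed cylinder. *)
Lemma seg_eq V V' (F : continuousType V X) (F' : continuousType V' X) a b a' b' :
  (forall s : R, 0 <= s <= 1 -> F ((1 - s) *: a + s *: b) = F' ((1 - s) *: a' + s *: b')) ->
  seg F a b = seg F' a' b'.
Proof.
move=> h; congr << _ *g _ >>; apply/continuousEP => t.
have [t0 t1] : stdsimplex R 2 (val t) by exact: set_mem (valP t).
rewrite !affE !sum2 /=; rewrite sum2 in t1.
have -> : val t 0 0 = 1 - val t 0 1 by rewrite -t1 addrK.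
by apply: h; rewrite t0 -t1 lerDr t0.
Qed.

Lemma triangle V (F : continuousType V X) a b (a3 : V) : bd (seg F b a3 - seg F a a3 + seg F a b).
Proof.
exists << 1 *g aff (@cts_fun _ _ F) (fun i : 'I_3 => if i == 0 then a else if i == 1 then b else a3) >>.
rewrite boundaryU !big_ord_recr big_ord0 /= add0r !face_aff expr0 expr1 sqrrN expr1n !intz monalgUN.
have E (a1 a2 : 'I_2 -> V) : a1 =1 a2 ->
    << 1 *g aff (@cts_fun _ _ F) a1 >> = << 1 *g aff (@cts_fun _ _ F) a2 >> :> chain R int 1 X.
  by move/funext => ->.
rewrite /seg; apply: congr2; [apply: congr2; last apply: congr1|]; apply: E => -[[|[|//]] p] //.
Qed.

Lemma seg_point V (F : continuousType V X) a : bd (seg F a a).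
Proof. by have := triangle F a a a; rewrite subrr add0r. Qed.

Lemma seg_const V (F : continuousType V X) a b :
  (forall s : R, 0 <= s <= 1 -> F ((1 - s) *: a + s *: b) = F a) -> bd (seg F a b).
Proof.
move=> h; rewrite (@seg_eq V V F F a b a a); first exact: seg_point.
by move=> s hs; rewrite h // -scalerDl subrK scale1r.
Qed.

Lemma seg_rev V (F : continuousType V X) a b : bd (seg F a b + seg F b a).
Proof.
rewrite (_ : _ + _ = (seg F b a - seg F a a + seg F a b) + seg F a a); last by abel.
by apply: bdD; [exact: triangle|exact: seg_point].
Qed.

End Segments.

Lemma chain_map_bd (R : realType) (X Y : topologicalType) (f : continuousType X Y) (c : chain R int 1 X) :
  bd c -> bd (chain_map f c).
Proof. by move=> [d ->]; exists (chain_map f d); rewrite chain_map_boundary. Qed.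

Lemma chain_map_seg (R : realType) (X Y : topologicalType) (V : normedModType R)
    (f : continuousType X Y) (F : continuousType V X) a b :
  chain_map f (seg F a b) = seg (f \o F : continuousType V Y) a b.
Proof. by rewrite chain_mapU; congr << _ *g _ >>; apply/continuousEP. Qed.

(** * Every path is homologous to a combination of sides *)

Section Generation.
Variables (R : realType) (n : nat).
Context {n_ok : odd_ge5 n}.
Let n_odd : odd n := n_is_odd.
Let n_ge5 : (5 <= n)%N := n_is_ge5.
Implicit Types (x z a e : 'cV[R]_2) (s t : R) (b : bool) (j k l : nat).

Local Notation vertex := (vertex R n).
Local Notation polygon := (@polygon R n).
Local Notation hf := (@hf R n).
Local Notation c1 := (c1 R n).
Local Notation sg := (@sg R).
Local Notation surface := (surface R n).
Local Notation sp := (@sp R n n_ok).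
Local Notation isvtx := (@isvtx R n).
Local Notation rpb := (@rpb R n).
Local Notation rpv := (@rpv R n).
Implicit Types (u v w : surface) (D : set R) (c : R -> surface).

Local Notation Dvec := (@Dvec R n).
Local Notation ltn_modn := (@ltn_modn n n_ok).

Local Notation clamp01 := (@clamp01 R).

Implicit Types (p q : chain R int 1 surface).

Definition spc b : continuousType 'cV[R]_2 surface := mkcts (@sp_continuous R n n_ok b).
Definition V0 b k : 'cV[R]_2 := sg b *: vertex k.
Definition gam k : chain R int 1 surface := seg (spc false) (vertex k) (vertex k.+1).

Lemma gam_mod k : gam (k %% n) = gam k.
Proof.
rewrite /gam vertex_mod; congr (seg _ _ _).
by rewrite -(vertex_mod R (k %% n).+1) -[(k %% n).+1]addn1 modnDml addn1 vertex_mod.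
Qed.

Definition spanned p := exists (e : chain R int 2 surface) (m : 'I_n -> int),
  p = boundary e + \sum_(k < n) gam k *~ m k.

Lemma spannedD p q : spanned p -> spanned q -> spanned (p + q).
Proof.
move=> [e [m ->]] [e' [m' ->]]; exists (e + e'), (fun k : 'I_n => m k + m' k).
rewrite boundaryD addrACA -big_split; congr (_ + _).
by apply: eq_bigr => k _; rewrite mulrzDr.
Qed.

Lemma spannedN p : spanned p -> spanned (- p).
Proof.
move=> [e [m ->]]; exists (- e), (fun k : 'I_n => - m k).
rewrite boundaryN opprD; apply: congr2 => //; rewrite -sumrN.
by apply: eq_bigr => k _; rewrite mulrNz.
Qed.

Lemma spannedB p q : spanned p -> spanned q -> spanned (p - q).
Proof. by move=> h1 h2; apply: spannedD => //; exact: spannedN. Qed.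

Lemma spanned_bd p : bd p -> spanned p.
Proof.
by move=> [e ->]; exists e, (fun=> 0); rewrite big1 ?addr0 // => k _; rewrite mulr0z.
Qed.

Lemma spanned_eq p q : spanned p -> p = q -> spanned q. Proof. by move=> h <-. Qed.

Lemma spanned0 : spanned 0. Proof. exact: spanned_bd (bd0 _ _). Qed.

Lemma spanned_gam k : spanned (gam k).
Proof.
rewrite -gam_mod; exists 0, (fun l : 'I_n => (l == Ordinal (ltn_modn k))%:R).
rewrite boundary0 add0r (bigD1 (Ordinal (ltn_modn k))) //= eqxx mulr1z big1 ?addr0 // => l.
by move=> /negbTE ->; rewrite mulr0z.
Qed.

Lemma seg_side_true k : seg (spc true) (V0 true k) (V0 true k.+1) =
  seg (spc false) (vertex k.+1) (vertex k).
Proof.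
apply: seg_eq => s hs; rewrite /= /mkcts.
have -> : (1 - s) *: V0 true k + s *: V0 true k.+1 = side_point n true k s.
  by rewrite /V0 /side_point sgE sg1 !scaleN1r !scalerN opprD.
have P : side n true (k %% n) (side_point n true k s).
  exists s; first by rewrite /= in_itv.
  rewrite /side_point !vertex_mod; congr (_ *: (_ + _ *: _)).
  by rewrite -(vertex_mod R (k %% n).+1) -[(k %% n).+1]addn1 modnDml addn1 vertex_mod.
rewrite (sp_glue (ltn_modn k) P) /partner; congr sp; rewrite /side_shift vertex_mod.
rewrite -(vertex_mod R (k %% n).+1) -[(k %% n).+1]addn1 modnDml addn1 vertex_mod.
rewrite /side_point sgE sg1 !scaleN1r; apply: vecP;
  by rewrite !(pxD, pyD, pxN, pyN, pxZ, pyZ); ring.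
Qed.

Lemma spanned_vertices b i j : spanned (seg (spc b) (V0 b i) (V0 b j)).
Proof.
have step k : spanned (seg (spc b) (V0 b k) (V0 b k.+1)).
  case: b; last by rewrite /V0 sg0 !scale1r; exact: spanned_gam.
  rewrite seg_side_true.
  have T := spanned_bd (seg_rev (spc false) (vertex k) (vertex k.+1)).
  by apply: (spanned_eq (spannedB T (spanned_gam k))); rewrite /gam; abel.
have V k : spanned (seg (spc b) (V0 b 0) (V0 b k)).
  elim: k => [|k IH]; first by apply: spanned_bd; exact: seg_point.
  have T := spanned_bd (triangle (spc b) (V0 b 0) (V0 b k) (V0 b k.+1)).
  by apply: (spanned_eq (spannedB (spannedD (step k) IH) T)); abel.
have T := spanned_bd (triangle (spc b) (V0 b 0) (V0 b i) (V0 b j)).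
by apply: (spanned_eq (spannedD T (spannedB (V j) (V i)))); abel.
Qed.

(** A chosen path from the singular point to [u], inside the polygon of the representative.
    Subtracting such paths at both ends makes a cycle of every path. *)
Definition pth u : chain R int 1 surface := seg (spc (rpb u)) (V0 (rpb u) 0) (rpv u).

Lemma side_segment b k x : (k < n)%N -> side n b k x ->
  seg (spc b) (V0 b k) x = seg (spc (~~ b)) (V0 (~~ b) k.+1) (partner n b k x).
Proof.
move=> kn sx; apply: seg_eq => s hs; rewrite /= /mkcts.
have [Px hx] := (sideP b x kn).1 sx.
have Pv : polygon b (V0 b k) by exact: polygon_vertex.
have e : (1 - s) *: V0 b k + s *: x = V0 b k + s *: (x - V0 b k).
  by apply: vecP; rewrite !(pxD, pyD, pxN, pyN, pxZ, pyZ); ring.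
rewrite (@sp_glueE R n n_ok b k); last 2 first.
- by rewrite e; apply: polygon_segment.
- have hv : sg b * hf k (V0 b k) = c1 by rewrite -hfZ /V0 sgK hf_vertex.
  have E y t : hf k (t *: y) = t * hf k y by exact: hfZ.
  rewrite E in hx; rewrite E hfD (E (V0 b k)) (E x).
  transitivity ((1 - s) * (sg b * hf k (V0 b k)) + s * (sg b * hf k x)); first by ring.
  by rewrite hv hx; ring.
apply: (congr1 (sp (~~ b))); rewrite /partner /V0 sg_neg /side_shift; apply: vecP;
  by rewrite !(pxD, pyD, pxN, pyN, pxZ, pyZ); ring.
Qed.

(** Up to sides, the path to a point does not depend on the representative: for a point on a side,
    the segment to it from an end of this side belongs to both polygons. *)
Lemma spanned_rep b x b' x' : polygon b x -> same_point n b x b' x' ->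
  spanned (seg (spc b) (V0 b 0) x - seg (spc b') (V0 b' 0) x').
Proof.
move=> Px [[<- <-]|[k [kn -> sx ->]]|[[i ->] [j ->]]].
- by rewrite subrr; exact: spanned0.
- have T := spanned_bd (triangle (spc b) (V0 b 0) (V0 b k) x).
  have T' := spanned_bd (triangle (spc (~~ b)) (V0 (~~ b) 0) (V0 (~~ b) k.+1) (partner n b k x)).
  have S := spanned_vertices b 0 k; have S' := spanned_vertices (~~ b) 0 k.+1.
  rewrite (side_segment kn sx) in T.
  by apply: (spanned_eq (spannedB (spannedD T' S) (spannedD T S'))); abel.
- by apply: spannedB; exact: spanned_vertices.
Qed.

Lemma spanned_segment b x x' : polygon b x -> polygon b x' ->
  spanned (seg (spc b) x x' - (pth (sp b x') - pth (sp b x))).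
Proof.
move=> Px Px'; have T := spanned_bd (triangle (spc b) (V0 b 0) x x').
have r y : polygon b y -> same_point n b y (rpb (sp b y)) (rpv (sp b y)).
  by move=> Py; apply/(sp_eq Py (rp_polygon _)); rewrite rpK.
have S := spanned_rep Px (r _ Px); have S' := spanned_rep Px' (r _ Px').
by apply: (spanned_eq (spannedD T (spannedB S' S))); rewrite -!/(pth _); abel.
Qed.

Definition near_rep (u : surface) (ep : R) b x (r : 'cV[R]_2) :=
  [/\ polygon b r, sp b r = u & `|x - r| < ep].

(** Small enough for the radial contraction to [u] to respect the gluing: a point has at most one
    representative of [u] within [ep] in its polygon, whence the factor 2, and if the point lies on
    a side or is a vertex, then so does or is that representative. *)
Definition good_radius u (ep : R) := [/\ 0 < ep,
  forall b r r', polygon b r -> polygon b r' -> sp b r = u -> sp b r' = u ->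
    `|r - r'| < 2 * ep -> r = r',
  forall b r k z, (k < n)%N -> near_rep u ep b z r -> side n b k z -> side n b k r &
  forall b r z, near_rep u ep b z r -> isvtx b z -> z = r].

Lemma hf_sg_norm k b z : hf k (sg b *: z) <= 2 * `|z|.
Proof.
apply: le_trans (hf_norm n k _) _; rewrite normrZ; have -> : `|sg b| = 1.
  by case: b; rewrite ?sg0 ?sg1 ?normrN normr1.
by rewrite mul1r.
Qed.

Lemma exists_good_radius u : exists ep, good_radius u ep.
Proof.
have rep b r : polygon b r -> sp b r = u -> exists d, r = rpv u + Dvec d.
  by move=> Pr er; apply: (sp_Dvec (rp_polygon u) Pr); rewrite rpK.
have [e1 e10 h1] := finite_eps (fun d => `|(rpv u + Dvec d.1) - (rpv u + Dvec d.2)|).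
have [e2 e20 h2] := finite_eps (fun i : bool * _ * 'I_n => c1 - hf i.2 (sg i.1.1 *: (rpv u + Dvec i.1.2))).
have [e3 e30 h3] := finite_eps (fun i : bool * _ * 'I_n => `|sg i.1.1 *: vertex i.2 - (rpv u + Dvec i.1.2)|).
exists (Num.min e1 (Num.min e2 e3) / 2).
have m1 : Num.min e1 (Num.min e2 e3) <= e1 by rewrite ge_min lexx.
have m2 : Num.min e1 (Num.min e2 e3) <= e2 by rewrite !ge_min lexx orbT.
have m3 : Num.min e1 (Num.min e2 e3) <= e3 by rewrite !ge_min lexx !orbT.
have m0 : 0 < Num.min e1 (Num.min e2 e3) by rewrite !lt_min e10 e20.
move: (Num.min _ _) m1 m2 m3 m0 => e m1 m2 m3 m0; split.
- by rewrite divr_gt0.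
- move=> b r r' Pr Pr' er er'; have [t ->] := rep b r Pr er; have [t' ->] := rep b r' Pr' er'.
  move=> h; apply/eqP; rewrite -subr_eq0 -normr_le0 leNgt; apply/negP => /(h1 (t, t')) /=.
  by move: h; lra.
- move=> b r k z kn [Pr er hr] /(sideP _ _ kn)[Pz hz]; apply/(sideP _ _ kn); split=> //.
  have [t et] := rep b r Pr er; move/polygonP: (Pr) => /(_ k).
  rewrite le_eqVlt => /orP[/eqP //|lt].
  have := h2 (b, t, Ordinal kn); rewrite /= -et subr_gt0 => /(_ lt).
  have := hf_sg_norm k b (z - r); rewrite scalerBr hfB hz; move: hr; lra.
- move=> b r z [Pr er hr] [k ez]; rewrite -(vertex_mod R k) in ez.
  have [t et] := rep b r Pr er.
  apply/eqP; rewrite -subr_eq0 -normr_le0 leNgt; apply/negP.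
  have := h3 (b, t, Ordinal (ltn_modn k)); rewrite /= -et -ez => h /h.
  by move: hr; lra.
Qed.

(** * Radial contraction of a neighbourhood *)

Section Contraction.
Variables (u : surface) (ep : R).
Hypothesis ep_good : good_radius u ep.

Definition star v := forall b x, polygon b x -> sp b x = v -> exists r, near_rep u ep b x r.
Definition center v : 'cV[R]_2 := xget 0 [set r | near_rep u ep (rpb v) (rpv v) r].
Definition contract v (t : R) : surface := sp (rpb v) (center v + t *: (rpv v - center v)).

Lemma near_star : nbhs u star.
Proof.
case: ep_good => ep0 _ _ _; apply: nbhsS (near_dist u ep0) => v h b x Px ex.
by have [r [Pr er hr]] := h b x Px ex; exists r.
Qed.

Lemma centerP v : star v -> near_rep u ep (rpb v) (rpv v) (center v).
Proof.
move=> sv; have [r hr] := sv _ _ (rp_polygon v) (rpK v).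
exact: (@xgetPex _ 0 [set r | near_rep u ep (rpb v) (rpv v) r] (ex_intro _ r hr)).
Qed.

Lemma contract_rep v b x r t : star v -> polygon b x -> sp b x = v -> near_rep u ep b x r ->
  0 <= t <= 1 -> contract v t = sp b (r + t *: (x - r)).
Proof.
move=> sv Px ex [Pr er hr] ht; have [] := centerP sv; rewrite /contract.
have /(sp_eq (rp_polygon v) Px) : sp (rpb v) (rpv v) = sp b x by rewrite rpK ex.
move: (rpb v) (rpv v) (center v) (rp_polygon v) => b1 x1 r1 Px1 sm Pr1 er1 hr1.
case: ep_good => ep0 Ha Hb Hc.
have tri y z z' : `|y - z| < ep -> `|y - z'| < ep -> `|z - z'| < 2 * ep.
  move=> h1 h2; have -> : z - z' = (y - z') - (y - z) by rewrite opprB [RHS]addrC addrA subrK.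
  by apply: le_lt_trans (ler_normB _ _) _; lra.
case: sm => [[eb exx]|[k [kn eb sx exx]]|[v1 v2]].
- by subst b1 x1; rewrite (Ha b r1 r Pr1 Pr er1 er (tri _ _ _ hr1 hr)).
- have sr1 : side n b1 k r1 by apply: (Hb b1 r1 k x1).
  have sr1' := side_partner sr1.
  have Pr1' : polygon (~~ b1) (partner n b1 k r1) by have [] := (sideP _ _ kn).1 sr1'.
  subst b x; have er' : r = partner n b1 k r1.
    apply: (Ha (~~ b1)) => //; first by rewrite -(sp_glue kn sr1).
    apply: (tri _ _ _ hr); rewrite /partner; move: hr1; congr (`|_| < _).
    by rewrite opprB addrA subrK.
  have e : polygon b1 (r1 + t *: (x1 - r1)) by exact: polygon_segment.
  have [_ h1] := (sideP _ _ kn).1 sr1; have [_ h2] := (sideP _ _ kn).1 sx.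
  have E y s : hf k (s *: y) = s * hf k y by exact: hfZ.
  rewrite (@sp_glueE R n n_ok b1 k) //; last first.
    rewrite E in h1; rewrite E in h2; rewrite E hfD (E (x1 - r1)) hfB mulrDr h1.
    by rewrite mulrCA mulrBr h1 h2 subrr mulr0 addr0.
  apply: (congr1 (sp (~~ b1))); rewrite er' /partner; apply: vecP;
    by rewrite !(pxD, pyD, pxN, pyN, pxZ, pyZ); ring.
- have -> : x1 = r1 by apply: (Hc b1).
  have -> : x = r by apply: (Hc b).
  by rewrite !subrr !scaler0 !addr0 er er1.
Qed.

Lemma contract1 v : star v -> contract v 1 = v.
Proof. by move=> sv; rewrite /contract scale1r addrC subrK rpK. Qed.

Lemma contract0 v : star v -> contract v 0 = u.
Proof. by move=> /centerP[_ e _]; rewrite /contract scale0r addr0. Qed.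

(** Continuity has to hold at all representatives of [v] at once. They are among finitely many
    candidates [z i], so the least of the tolerances serves all of them. *)
Lemma contract_continuous (c : R -> surface) : continuous c -> (forall s, star (c s)) ->
  continuous (fun p : R * R => contract (c p.1) (clamp01 p.2)).
Proof.
move=> cc sc [s0 t0]; set v := c s0; set t1 := clamp01 t0 => W /= hW.
have t01 : 0 <= t1 <= 1 by exact: clamp01_bounds.
pose z (i : bool * _) := rpv v + Dvec i.2.
pose Q i (e : R) := 0 < e /\
    (polygon i.1 (z i) -> sp i.1 (z i) = v -> exists2 r, polygon i.1 r /\ sp i.1 r = u &
      forall x t, `|x - z i| < e -> `|t - t1| < e ->
        `|x - r| < ep /\ W (sp i.1 (r + t *: (x - r)))).
(* One tolerance for each candidate; it is 1 where the candidate does not represent [v]. *)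
have /boolp.choice[e he] : forall i, exists e : R, Q i e.
  move=> [b d]; have [Pz|nP] := pselect (polygon b (z (b, d))); last first.
    by exists 1; split=> // /nP.
  have [ez|ne] := pselect (sp b (z (b, d)) = v); last by exists 1; split=> // _ /ne.
  have [r hr] := sc s0 _ _ Pz ez; have [Pr er nr] := hr.
  have cont : {for (z (b, d), t1), continuous (fun p : 'cV[R]_2 * R => sp b (r + p.2 *: (p.1 - r)))}.
    apply: (@continuous_comp _ _ _ (fun p : 'cV[R]_2 * R => r + p.2 *: (p.1 - r)) (sp b)); last first.
      exact: sp_continuous.
    apply: cvgD; first exact: cvg_cst.
    apply: cvgZ; first exact: cvg_snd.
    by apply: cvgB; [exact: cvg_fst|exact: cvg_cst].
  have := cont W; rewrite /= -(contract_rep (sc s0) Pz ez hr t01) => /(_ hW).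
  move=> [[A B] /= [/nbhs_ballP[ea ea0 hA] /nbhs_ballP[eb eb0 hB]] sub].
  exists (Num.min (ep - `|z (b, d) - r|) (Num.min ea eb)); split.
    by rewrite !lt_min ea0 eb0 subr_gt0 nr.
  move=> _ _; exists r => // x t; rewrite !lt_min => /and3P[x1 x2 _] /and3P[_ _ x3].
  split.
    rewrite -(subrK (z (b, d)) x) -addrA; apply: le_lt_trans (ler_normD _ _) _.
    by move: x1; lra.
  apply: (sub (x, t)); split; [apply: hA|apply: hB];
    by rewrite -ball_normE /= distrC.
have [e0 e00 hmin] := finite_eps e.
have n1 : nbhs s0 [set s | forall b x, polygon b x -> sp b x = c s -> exists z0,
    [/\ polygon b z0, sp b z0 = v & `|x - z0| < e0]] by exact: (cc s0 _ (near_dist v e00)).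
have n2 : nbhs t0 [set t | `|clamp01 t - t1| < e0].
  have := @clamp01_continuous R t0 (ball t1 e0) (nbhsx_ballx _ _ e00).
  by apply: nbhsS => t; rewrite -ball_normE /= distrC.
exists ([set s | forall b x, polygon b x -> sp b x = c s -> exists z0,
    [/\ polygon b z0, sp b z0 = v & `|x - z0| < e0]], [set t | `|clamp01 t - t1| < e0]).
  by split => /=; [exact: n1|exact: n2].
move=> [s t] /= [h1 h2].
have [z0 [Pz0 ez0 hz0]] := h1 _ _ (rp_polygon (c s)) (rpK (c s)).
have [d ed] := sp_Dvec (rp_polygon v) Pz0 (etrans (rpK v) (esym ez0)).
have [p0 hp] := he (rpb (c s), d); rewrite /z /= -ed in hp.
have [r [Pr er] hr] := hp Pz0 ez0; have lt := hmin _ p0.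
have [n3 n4] := hr _ _ (lt_trans hz0 lt) (lt_trans h2 lt).
rewrite (contract_rep (sc s) (rp_polygon (c s)) (rpK (c s)) (r := r)) //.
exact: clamp01_bounds.
Qed.

End Contraction.

(** The contraction to [u] gives a square: the top is the path, the vertical edges are straight
    segments in polygons and the bottom is constant. Two triangles turn the square into a
    homology. *)
Lemma local_segment u ep (F : continuousType R^o surface) (r1 r2 : R^o) : good_radius u ep ->
  (forall s, 0 <= s <= 1 -> star u ep (F ((1 - s) *: r1 + s *: r2))) ->
  spanned (seg F r1 r2 - (pth (F r2) - pth (F r1))).
Proof.
move=> gd hs; pose c s := F ((1 - clamp01 s) *: r1 + clamp01 s *: r2).
have cc : continuous c.
  move=> s; apply: (@continuous_comp _ _ _ (fun s : R^o => (1 - clamp01 s) *: r1 + clamp01 s *: r2) F);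
    last exact: cts_fun.
  have cl := @clamp01_continuous R s.
  by apply: cvgD; apply: cvgZr_tmp => //; apply: cvgB => //; exact: cvg_cst.
have sc s : star u ep (c s) by apply: hs; exact: clamp01_bounds.
pose H : continuousType (R^o * R^o)%type surface := mkcts (contract_continuous gd cc sc).
have HE (p q : R^o * R^o) s : H ((1 - s) *: p + s *: q) =
  contract u ep (c ((1 - s) * p.1 + s * q.1)) (clamp01 ((1 - s) * p.2 + s * q.2)) by [].
have c01 s : 0 <= s <= 1 -> c s = F ((1 - s) *: r1 + s *: r2) by move=> h; rewrite /c clamp01_id.
have z01 : 0 <= (0 : R) <= 1 by rewrite lexx ler01.
have o01 : 0 <= (1 : R) <= 1 by rewrite lexx ler01.
have c0 : c 0 = F r1 by rewrite c01 // subr0 scale1r scale0r addr0.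
have c1 : c 1 = F r2 by rewrite c01 // subrr scale1r scale0r add0r.
pose P (a1 a2 b1 b2 : R^o) := seg H (a1, a2) (b1, b2); pose v (r : R^o) := pth (c r).
have top : P 0 1 1 1 = seg F r1 r2.
  apply: seg_eq => s h; rewrite HE /= mulr0 add0r !mulr1 subrK (clamp01_id o01) contract1 //.
  exact: c01.
have side (s : R^o) : 0 <= s <= 1 -> spanned (P s 0 s 1 - (v s - pth u)).
  move=> h; have [Pr e _] := centerP (sc s).
  have S := spanned_segment Pr (rp_polygon (c s)); rewrite e rpK in S.
  rewrite /P (_ : seg H _ _ = seg (spc (rpb (c s))) (center u ep (c s)) (rpv (c s))) //.
  apply: seg_eq => t ht; rewrite HE /= -mulrDl subrK mul1r mulr0 add0r mulr1 clamp01_id //.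
  rewrite /contract /mkcts; congr (sp _ _); rewrite scalerBr scalerBl scale1r.
  by rewrite addrA addrAC.
have bot : spanned (P 0 0 1 0).
  apply: spanned_bd; apply: seg_const => s h.
  have HV (t1 t2 : R^o) : H (t1, t2) = contract u ep (c t1) (clamp01 t2) by [].
  by rewrite HE (HV 0 0) /= !mulr0 !addr0 (clamp01_id z01) !contract0.
have T1 : spanned (P 0 1 1 1 - P 0 0 1 1 + P 0 0 0 1) := spanned_bd (triangle H (0, 0) (0, 1) (1, 1)).
have T2 : spanned (P 1 0 1 1 - P 0 0 1 1 + P 0 0 1 0) := spanned_bd (triangle H (0, 0) (1, 0) (1, 1)).
have S1 := side 1 o01; have S0 := side 0 z01.
rewrite -c0 -c1 -top -/(v 0) -/(v 1).
by apply: (spanned_eq (spannedD (spannedB T1 T2) (spannedD (spannedB S1 S0) bot))); abel.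
Qed.

Lemma convex_lt (x y d r : R) : `|x| < d -> `|y| < d -> 0 <= r <= 1 -> `|(1 - r) * x + r * y| < d.
Proof.
move=> hx hy /andP[r0 r1]; apply: (@le_lt_trans _ _ (Num.max `|x| `|y|)); last by rewrite gt_max hx.
apply: le_trans (ler_normD _ _) _; rewrite !normrM (ger0_norm r0) (ger0_norm (_ : 0 <= 1 - r)) ?subr_ge0 //.
set m := Num.max _ _; have -> : m = (1 - r) * m + r * m by ring.
by apply: lerD; apply: ler_wpM2l; rewrite ?subr_ge0 // /m le_max lexx ?orbT.
Qed.

(** The times [s] for which the initial part of the path satisfies the claim form an open and closed
    subset of the interval, by [local_segment]. *)
Lemma spanned_path (F : continuousType R^o surface) :
  spanned (seg F 0 1 - (pth (F 1) - pth (F 0))).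
Proof.
pose P (r1 r2 : R^o) := seg F r1 r2; pose v (r : R^o) := pth (F r).
pose Q s := spanned (P 0 s - (v s - v 0)).
have I01 : is_interval [set s : R | 0 <= s <= 1] by move=> r1 r2 /= h1 h2 r3 h3; lra.
suff : Q 1 by [].
apply: (@interval_locally_const R _ Q 0 1 I01) => [s _||| ] /=; last first.
- by rewrite /Q subrr subr0; exact: spanned_bd (seg_point F 0).
- by rewrite lexx ler01.
- by rewrite lexx ler01.
have [ep gd] := exists_good_radius (F s).
have := @cts_fun _ _ F s _ (near_star gd) => /nbhs_ballP[d /= d0 hd].
have loc t t' : `|t - s| < d -> `|t' - s| < d -> spanned (P t t' - (v t' - v t)).
  move=> h1 h2; apply: local_segment gd _ => r hr; apply: hd.
  rewrite -ball_normE /= distrC; have -> : (1 - r) *: (t : R^o) + r *: (t' : R^o) - s =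
    (1 - r) * (t - s) + r * (t' - s) by rewrite /GRing.scale /=; ring.
  exact: convex_lt.
apply/nbhs_ballP; exists d => // t; rewrite -ball_normE /= distrC => ht _.
have ss : `|s - s| < d by rewrite subrr normr0.
have T : spanned (P s t - P 0 t + P 0 s) := spanned_bd (triangle F 0 s t); have L := loc s t ss ht.
rewrite /Q; split=> h.
  by apply: (spanned_eq (spannedB (spannedD T h) L)); abel.
by apply: (spanned_eq (spannedD (spannedB h T) L)); abel.
Qed.

End Generation.

Lemma push0 (R : realType) (G H : zmodType) (phi : G -> H) (phiD : {morph phi : x y / x + y}) k
  (X : topologicalType) : push phi 0 = 0 :> chain R H k X.
Proof. exact: (lin0 (@push_add R G H phi phiD k X)). Qed.

Lemma pushN (R : realType) (G H : zmodType) (phi : G -> H) (phiD : {morph phi : x y / x + y}) k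
  (X : topologicalType) (c : chain R G k X) : push phi (- c) = - push phi c.
Proof. exact: (linN (@push_add R G H phi phiD k X)). Qed.

Lemma chain_map0 (R : realType) (G : zmodType) k (X Y : topologicalType) (f : continuousType X Y) :
  chain_map f 0 = 0 :> chain R G k Y.
Proof. exact: (lin0 (@chain_map_add R G k X Y f)). Qed.

(** * The action on the sides *)

Section Action.
Variables (R : realType) (n : nat).
Context {n_ok : odd_ge5 n}.
Let n_odd : odd n := n_is_odd.
Let n_ge5 : (5 <= n)%N := n_is_ge5.
Implicit Types (b : bool) (j k l : nat).

Local Notation vertex := (vertex R n).
Local Notation polygon := (@polygon R n).
Local Notation c1 := (c1 R n).
Local Notation surface := (surface R n).
Local Notation sp := (@sp R n n_ok).
Implicit Types (u v w : surface) (D : set R) (c : R -> surface).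

Local Notation smap := (continuousType surface surface).
Local Notation oppS := (@oppS R n n_ok).

Local Notation clamp01 := (@clamp01 R).
Local Notation g := (half n).
Local Notation wid := (@wid R n).
Local Notation hgt := (@hgt R n).
Local Notation vX := (vX R n).
Local Notation vY := (vY R n).
Local Notation cK := (cK R n).
Local Notation cyl := (@cyl R n n_ok).
Local Notation spc := (@spc R n n_ok).
Local Notation V0 := (@V0 R n).
Local Notation gam := (@gam R n n_ok).
Local Notation pth := (@pth R n n_ok).
Local Notation spanned := (@spanned R n n_ok).
Local Notation twist_map := (@twist_map R n n_ok).
Local Notation rot_map := (@rot_map R n n_ok).
Implicit Types (p q : chain R int 1 surface) (f h : smap).
Let g2 : (n = 2 * g + 1)%N.
Proof. by rewrite /half; have := odd_double_half n; rewrite n_odd; lia. Qed.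

Lemma bdB p q : bd p -> bd q -> bd (p - q).
Proof. by move=> h1 h2; apply: bdD => //; exact: bdN. Qed.
Lemma bd_eq p q : bd p -> p = q -> bd q. Proof. by move=> h <-. Qed.

Section Simplices.

Definition pt1 : stdsimplex R 1.
Proof.
by apply: (exist _ (\row_j 1)); apply/mem_set; split=> [i|]; rewrite ?big_ord1 mxE ?ler01.
Defined.

Definition mk1_fun (t : R^o) : 'rV[R]_2 :=
  \row_(j < 2) if j == 0 then 1 - clamp01 t else clamp01 t.

Lemma mk1_subproof t : mk1_fun t \in stdsimplex R 2.
Proof.
apply/mem_set; have /andP[h0 h1] := @clamp01_bounds R t; split=> [i|].
  by rewrite mxE; case: ifP => _ //; rewrite subr_ge0.
by rewrite sum2 !mxE /= subrK.
Qed.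

Definition mk1 (t : R^o) : stdsimplex R 2 := exist _ (mk1_fun t) (mk1_subproof t).

Lemma mk1_continuous : continuous mk1.
Proof.
apply: continuous_comp_initial => t.
have -> : val \o mk1 = fun t => (1 - clamp01 t) *: mk1_fun 0 + clamp01 t *: mk1_fun 1.
  apply/funext => r; apply/rowP => j; rewrite !mxE.
  rewrite (@clamp01_id R 0) ?lexx ?ler01 // (@clamp01_id R 1) ?lexx ?ler01 //.
  by case: (j == 0); ring.
have cl := @clamp01_continuous R t.
by apply: cvgD; apply: cvgZr_tmp => //; apply: cvgB => //; exact: cvg_cst.
Qed.

Definition path_of (X : topologicalType) (s : singular_simplex R 1 X) : continuousType R^o X :=
  (s \o mkcts mk1_continuous : continuousType R^o X).

Lemma path_ofE (X : topologicalType) (s : singular_simplex R 1 X) :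
  << 1 *g s >> = seg (path_of s) 0 1.
Proof.
congr << _ *g _ >>; apply/continuousEP => t.
have [t0 t1] : stdsimplex R 2 (val t) by exact: set_mem (valP t).
rewrite affE /path_of /=; congr (s _); apply: val_inj; apply/rowP => j; rewrite /= mxE.
rewrite sum2 /= in t1; rewrite sum2 /= scaler0 add0r [_ *: 1]mulr1 clamp01_id; last first.
  by rewrite t0 -t1 lerDr t0.
have [->|->] : j = 0 \/ j = 1 by case: j => -[|[|//]] ?; [left|right]; exact: val_inj.
  by rewrite eqxx -t1 addrK.
by [].
Qed.

Lemma path_of_ends (X : topologicalType) (s : singular_simplex R 1 X) :
  path_of s 1 = face 0 s pt1 /\ path_of s 0 = face 1 s pt1.
Proof.
have i2 (j : 'I_2) : j = 0 \/ j = 1 by case: j => -[|[|//]] ?; [left|right]; exact: val_inj.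
have u0 : unlift (0 : 'I_2) 1 = Some 0.
  by rewrite (_ : 1 = lift 0 0) ?liftK //; exact: val_inj.
have u1 : unlift (1 : 'I_2) 0 = Some 0.
  by rewrite [X in unlift _ X](_ : 0 = lift 1 0) ?liftK //; exact: val_inj.
split; rewrite /path_of /=; congr (s _); apply: val_inj; apply/rowP => j; rewrite /= !mxE;
  rewrite clamp01_id ?lexx ?ler01 //; case: (i2 j) => -> /=.
- by rewrite unlift_none /= subrr.
- by rewrite u0 /= mxE.
- by rewrite u1 /= mxE subr0.
- by rewrite unlift_none.
Qed.

Lemma spanned_simplex (s : singular_simplex R 1 surface) :
  spanned (<< 1 *g s >> - (pth (face 0 s pt1) - pth (face 1 s pt1))).
Proof. by have [<- <-] := path_of_ends s; rewrite path_ofE; exact: spanned_path. Qed.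

Lemma boundary_simplex (G : zmodType) (X : topologicalType) (x : G) (s : singular_simplex R 1 X) :
  boundary << x *g s >> = << x *g face 0 s >> - << x *g face 1 s >>.
Proof.
rewrite boundaryU !big_ord_recr big_ord0 /= add0r expr0 expr1 mulr1z mulrNz mulr1z monalgUN.
have i0 : widen_ord (leqnSn 1) ord_max = 0 :> 'I_2 by exact: val_inj.
have i1 : ord_max = 1 :> 'I_2 by exact: val_inj.
by rewrite i0 i1.
Qed.

End Simplices.

(** * A criterion for a trivial action on homology *)

Section Criterion.
Variables (a : nat) (f : smap).
Hypothesis a_gt0 : (0 < a)%N.
Local Notation Za := 'I_a.-1.+1.

Definition hom_mod p q := exists (c : chain R int 1 surface) (d : chain R int 2 surface),
  p - q = c *+ a + boundary d.

(** A simplex with coefficient [x] is the image of the integral simplex under [gmul x], so integral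
    homologies yield homologies with coefficients in [Z/a]. *)
Definition gmul (x : Za) (m : int) : Za := x *~ m.
Lemma gmulD x : {morph gmul x : m l / m + l}. Proof. by move=> m l; rewrite /gmul mulrzDr. Qed.

Lemma push_gmulD k (c : chain R int k surface) : {morph (fun x => push (gmul x) c) : x y / x + y}.
Proof.
move=> x y.
have h : @push R _ _ (gmul (x + y)) k surface =1 (fun c : chain R int k surface => push (gmul x) c + push (gmul y) c).
  apply: malg_ext.
  - exact: (@pushD R _ _ _ (gmulD (x + y)) k surface).
  - by move=> c1 c2; rewrite (pushD (gmulD x)) (pushD (gmulD y)) addrACA.
  - move=> m s; rewrite (pushU (gmulD x)) (pushU (gmulD y)) (pushU (gmulD (x + y))).
    by rewrite /gmul mulrzDl monalgUD.
exact: h.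
Qed.

Lemma push_multiple k (x : Za) (c : chain R int k surface) : push (gmul x) (c *+ a) = 0.
Proof.
have pM m : push (gmul x) (c *+ m) = push (gmul x) c *+ m.
  elim: m => [|m IH]; last by rewrite !mulrS (pushD (gmulD _)) IH.
  by rewrite !mulr0n; exact: (@push0 R _ _ _ (gmulD x) k surface).
rewrite pM; apply/malgP => s; rewrite mcoeffMn mcoeff0; apply: val_inj.
rewrite Zp_mulrn /=; apply/eqP; rewrite -/(dvdn _ _); apply: dvdn_mull; by rewrite prednK.
Qed.

Definition Phi (G : zmodType) k (c : chain R G k surface) := chain_map f c - c.

Lemma PhiD G k : {morph @Phi G k : x y / x + y}.
Proof. by move=> x y; rewrite /Phi chain_mapD opprD addrACA. Qed.
Lemma Phi_sum G k I (r : seq I) (P : pred I) (F : I -> chain R G k surface) :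
  Phi (\sum_(i <- r | P i) F i) = \sum_(i <- r | P i) Phi (F i).
Proof.
by apply: (big_morph _ (@PhiD G k)); rewrite /Phi subr0 chain_map0.
Qed.

Hypothesis f_gam : forall k, hom_mod (chain_map f (gam k)) (gam k).

Lemma PhiMz k (c : chain R int k surface) m : Phi (c *~ m) = Phi c *~ m.
Proof.
have PMn l : Phi (c *+ l) = Phi c *+ l.
  elim: l => [|l IH]; last by rewrite !mulrS PhiD IH.
  by rewrite !mulr0n /Phi subr0 chain_map0.
case: m => m; first by rewrite -!pmulrn PMn.
rewrite NegzE !mulrNz -!pmulrn -PMn /Phi chain_mapN opprB opprK addrC.
by [].
Qed.

(** For a simplex [s], [Phi] of [s] equals, modulo [a] and the boundary of some [E s], the
    difference of [Phi] of the chosen paths to its ends. A choice of [E] extends additively to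
    chains with coefficients in [Z/a]. *)
Lemma trivial_criterion : trivial_on_H1 R Za f.
Proof.
have /boolp.choice[E hE] : forall s : singular_simplex R 1 surface, exists E : chain R int 2 surface,
    exists C : chain R int 1 surface,
    Phi << 1 *g s >> = Phi (pth (face 0 s pt1)) - Phi (pth (face 1 s pt1)) + C *+ a + boundary E.
  move=> s; have [e [m h]] := spanned_simplex s.
  have /boolp.choice[w hw] : forall k, exists w : chain R int 1 surface * chain R int 2 surface,
      Phi (gam k) = w.1 *+ a + boundary w.2.
    by move=> k; have [c [d e1]] := f_gam k; exists (c, d).
  exists (Phi e + \sum_(k < n) (w k).2 *~ m k), (\sum_(k < n) (w k).1 *~ m k).
  have -> : << 1 *g s >> = pth (face 0 s pt1) - pth (face 1 s pt1) + (boundary e + \sum_(k < n) gam k *~ m k).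
    by rewrite -h addrC subrK.
  have PhiN (c : chain R int 1 surface) : Phi (- c) = - Phi c by rewrite /Phi chain_mapN opprD.
  have Pb : Phi (boundary e) = boundary (Phi e) by rewrite /Phi chain_map_boundary boundaryB.
  transitivity (Phi (pth (face 0 s pt1)) - Phi (pth (face 1 s pt1)) +
      (boundary (Phi e) + \sum_(k < n) Phi (gam k) *~ m k)).
    rewrite (PhiD (pth (face 0 s pt1) - pth (face 1 s pt1)) (boundary e + \sum_(k < n) gam k *~ m k)).
    rewrite (PhiD (pth _) (- pth _)) PhiN (PhiD (boundary e)) Pb Phi_sum; apply: congr1; apply: congr1.
    by apply: eq_bigr => k _; exact: PhiMz.
  rewrite (boundaryD (Phi e) (\sum_(k < n) (w k).2 *~ m k)) boundary_sum -[RHS]addrA; apply: congr1; rewrite [RHS]addrCA; apply: congr1.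
  rewrite -sumrMnl -big_split; apply: eq_bigr => k _ /=.
  rewrite hw mulrzDl; congr (_ + _); first by rewrite (pmulrn (w k).1) (pmulrn (_ *~ _)) mulrzAC.
  have bM (c : chain R int 2 surface) (l : int) : boundary (c *~ l) = boundary c *~ l.
    have bn i : boundary (c *+ i) = boundary c *+ i.
      by elim: i => [|i IH]; rewrite ?mulr0n ?boundary0 // !mulrS boundaryD IH.
    by case: l => l; rewrite ?NegzE ?mulrNz ?boundaryN -!pmulrn bn.
  by rewrite bM.
move=> z cz; exists (lin (fun s x => push (gmul x) (E s)) z).
(* The terms from the ends factor through the boundary, so they vanish on cycles. *)
pose L0 := lin (fun (s : singular_simplex R 0 surface) (x : Za) => push (gmul x) (Phi (pth (s pt1)))).
have a0 (s : singular_simplex R 0 surface) :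
    {morph (fun x : Za => push (gmul x) (Phi (pth (s pt1)))) : x y / x + y} by exact: push_gmulD.
have a1 (s : singular_simplex R 1 surface) :
    {morph (fun x : Za => push (gmul x) (E s)) : x y / x + y} by exact: push_gmulD.
suff key : forall z : chain R Za 1 surface,
    Phi z = L0 (boundary z) + boundary (lin (fun s x => push (gmul x) (E s)) z).
  by have := key z; rewrite cz /L0 (lin0 a0) add0r.
apply: malg_ext => [x y|x y|x s]; first exact: PhiD.
  by rewrite boundaryD /L0 (linD a0) (linD a1) boundaryD addrACA.
have -> : << x *g s >> = push (gmul x) << 1 *g s >> :> chain R Za 1 surface.
  by rewrite (pushU (gmulD x)).
have pPhi (c : chain R int 1 surface) : Phi (push (gmul x) c) = push (gmul x) (Phi c).
  by rewrite /Phi (pushB (gmulD x)) (push_chain_map (gmulD x)).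
have [C hC] := hE s.
have g1 : gmul x 1 = x by rewrite /gmul mulr1z.
rewrite pPhi hC (pushU (gmulD x)) boundary_simplex /L0 (linB a0) !(linU a0) (linU a1) g1.
move: (Phi (pth (face 0 s pt1))) (Phi (pth (face 1 s pt1))) => q0 q1.
rewrite (pushD (gmulD x)) (pushD (gmulD x) (q0 - q1)) push_multiple addr0 (pushD (gmulD x) q0).
by rewrite (pushN (gmulD x)) (push_boundary (gmulD x)).
Qed.

End Criterion.

(** A chord is homologous to the sides that it cuts off. The sides of [polygon true] are glued with
    reversed direction, whence the sign. *)
Lemma seg_vertices b i m : bd (seg (spc b) (V0 b i) (V0 b (i + m)) -
  (\sum_(j < m) gam (i + j)) *~ (-1) ^+ b).
Proof.
have step k : bd (seg (spc b) (V0 b k) (V0 b k.+1) - gam k *~ (-1) ^+ b).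
  case: b; last first.
    by rewrite /V0 sg0 !scale1r expr0 mulr1z subrr; exact: bd0.
  rewrite seg_side_true expr1 mulrNz mulr1z opprK addrC; exact: seg_rev.
elim: m => [|m IH].
  by rewrite big_ord0 mul0rz subr0 addn0; exact: seg_point.
have T := triangle (spc b) (V0 b i) (V0 b (i + m)) (V0 b (i + m).+1).
rewrite big_ord_recr /= mulrzDl addnS.
by apply: (bd_eq (bdB (bdD (step (i + m)%N) IH) T)); abel.
Qed.

Definition cyl_fun i (p : R * R) : surface := cyl i (clamp01 p.1) p.2.

Lemma cyl_fun_continuous i : (i < g)%N -> continuous (cyl_fun i).
Proof.
move=> ig.
have h1 : continuous (fun p : R * R => clamp01 p.1).
  move=> [r1 r2]; apply: (@continuous_comp _ _ _ (fst : R * R -> R) clamp01).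
    exact: cvg_fst.
  exact: clamp01_continuous.
have h2 : continuous (fun p : R * R => p.2) by move=> [r1 r2]; exact: cvg_snd.
have h3 (p : R * R) : 0 <= clamp01 p.1 <= 1 by exact: clamp01_bounds.
exact: (@cyl_continuous R n n_ok _ i (fun r : R * R => clamp01 r.1) (fun r => r.2) ig h1 h2 h3).
Qed.

(** The lower boundary of the [i]-th cylinder consists of one chord of each polygon; after the
    translation by [shift i] the height [- vY i.+1] becomes [vY i]. *)
Definition eta1 i := seg (spc false) (mkv (- vX i) (vY i)) (mkv (vX i) (vY i)).
Definition eta2 i := seg (spc true) (mkv (- vX i.+1) (- vY i.+1)) (mkv (vX i.+1) (- vY i.+1)).
(* The core curve of the [i]-th horizontal cylinder. *)
Definition eta i := eta1 i + eta2 i.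

Lemma lin_mkv (s a1 a2 b1 b2 : R) :
  (1 - s) *: mkv a1 a2 + s *: mkv b1 b2 = mkv ((1 - s) * a1 + s * b1) ((1 - s) * a2 + s * b2).
Proof. by apply: vecP; rewrite !(pxD, pyD, pxZ, pyZ, px_mkv, py_mkv). Qed.

Lemma chord_bounds (c s : R) : 0 <= c -> 0 <= s <= 1 -> - c <= (1 - s) * - c + s * c <= c.
Proof. by move=> c0 /andP[s0 s1']; apply/andP; split; nra. Qed.

Lemma chord_in i x : (i <= g)%N -> - vX i <= x <= vX i -> polygon false (mkv x (vY i)).
Proof.
move=> ig hx; apply: chord_polygon; rewrite ler_norml; exact: hx.
Qed.

Lemma twist_eta i : (i < g)%N -> chain_map twist_map (eta i) = eta i.
Proof.
move=> ig; rewrite /eta chain_mapD; congr (_ + _).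
  rewrite /eta1 chain_map_seg; apply: seg_eq => s hs.
  rewrite /= /mkcts lin_mkv -mulrDl subrK mul1r.
  by apply: twist_level; [exact: ltnW|apply: chord_bounds => //; apply: vX_ge0; exact: ltnW].
rewrite /eta2 chain_map_seg; apply: seg_eq => s hs.
rewrite /= /mkcts lin_mkv -mulrDl subrK mul1r; set x := (X in mkv X _).
have hx : - vX i.+1 <= x <= vX i.+1 by apply: chord_bounds => //; exact: vX_ge0.
have hx' : - vX i.+1 <= - x <= vX i.+1 by case/andP: hx => h1 h2; apply/andP; split; lra.
have e : sp true (mkv x (- vY i.+1)) = oppS (sp false (mkv (- x) (vY i.+1))).
  rewrite oppS_sp; last exact: chord_in.
  by apply: (congr1 (sp true)); apply: vecP; rewrite ?pxN ?pyN ?px_mkv ?py_mkv ?opprK.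
by rewrite -[LHS]/(twist_map (sp true (mkv x (- vY i.+1)))) e twist_oppS twist_level.
Qed.

Lemma path_right (V : normedModType R) (F : continuousType V surface) (r0 r1 r2 r3 : V) :
  bd (seg F r0 r3 - seg F r2 r3 - (seg F r1 r2 + seg F r0 r1)).
Proof.
by apply: (bd_eq (bdN (bdD (triangle F r0 r2 r3) (triangle F r0 r1 r2)))); abel.
Qed.

Lemma path_left (V : normedModType R) (F : continuousType V surface) (r0 r1 r2 r3 : V) :
  bd (seg F r3 r0 - seg F r3 r2 + (seg F r0 r1 + seg F r1 r2)).
Proof.
have T := bdB (seg_rev F r2 r0) (triangle F r3 r2 r0).
by apply: (bd_eq (bdD T (triangle F r0 r1 r2))); abel.
Qed.

(** * The twist on the slanted sides *)

Section TwistSides.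
Variable i : nat.
Hypothesis ig : (i < g)%N.
Let F : continuousType (R^o * R^o)%type surface := mkcts (cyl_fun_continuous ig).
Let P (a1 a2 b1 b2 : R^o) := seg F (a1, a2) (b1, b2).

Let FE (a1 a2 b1 b2 s : R) : 0 <= (1 - s) * a1 + s * b1 <= 1 ->
  F ((1 - s) *: ((a1, a2) : R^o * R^o) + s *: ((b1, b2) : R^o * R^o)) =
  cyl i ((1 - s) * a1 + s * b1) ((1 - s) * a2 + s * b2).
Proof.
move=> h; change (cyl i (clamp01 ((1 - s) * a1 + s * b1)) ((1 - s) * a2 + s * b2) =
  cyl i ((1 - s) * a1 + s * b1) ((1 - s) * a2 + s * b2)).
by rewrite clamp01_id.
Qed.

Let x0 := vX i. Let x1 := 2 * cK i - vX i. Let x2 := vX i + 2 * cK i.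

Let z01 : 0 <= (0 : R) <= 1. Proof. by rewrite lexx ler01. Qed.
Let c00 (s : R) : (1 - s) * 0 + s * 0 = 0. Proof. by rewrite !mulr0 addr0. Qed.
Let c01 (s : R) : (1 - s) * 0 + s * 1 = s. Proof. by rewrite mulr0 add0r mulr1. Qed.
Let c10 (s : R) : (1 - s) * 1 + s * 0 = 1 - s. Proof. by rewrite mulr0 addr0 mulr1. Qed.

Let P_chord_true : P 0 x0 0 x1 = eta2 i.
Proof.
apply: seg_eq => s hs; rewrite FE ?c00 ?z01 //= /mkcts lin_mkv -[(1 - s) * - vY _ + _]mulrDl subrK mul1r.
have h := @vX_ge0 R n n_ok i (ltnW ig); have h' := @vX_ge0 R n n_ok i.+1 ig.
rewrite cyl2 ?z01 //; last first.
  by rewrite wid0 /x0 /x1 /cK; case/andP: hs => hs hs'; apply/andP; split; nra.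
apply: (congr1 (sp true)); rewrite shiftE hgt0 /x0 /x1 /cK; apply: vecP.
  by rewrite !(pxD, pxN, px_mkv); ring.
by rewrite !(pyD, pyN, py_mkv); ring.
Qed.
Let P_chord_false : P 0 x1 0 x2 = eta1 i.
Proof.
apply: seg_eq => s hs; rewrite FE ?c00 ?z01 //= /mkcts lin_mkv -[(1 - s) * vY _ + _]mulrDl subrK mul1r.
have h := @vX_ge0 R n n_ok i (ltnW ig); have h' := @vX_ge0 R n n_ok i.+1 ig.
rewrite cyl3 ?z01 //; last first.
  by rewrite wid0 /x2 /x1 /cK; case/andP: hs => hs hs'; nra.
by rewrite hgt0 /x1 /x2 /cK; apply: (congr1 (sp false)); congr mkv; ring.
Qed.
Let P_chord_left : P 0 (- x0) 0 x0 = eta1 i.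
Proof.
apply: seg_eq => s hs; rewrite FE ?c00 ?z01 //= /mkcts lin_mkv -[(1 - s) * vY _ + _]mulrDl subrK mul1r.
have h := @vX_ge0 R n n_ok i (ltnW ig).
rewrite cyl1 ?hgt0 // wid0 /x0; case/andP: hs => hs hs'; nra.
Qed.

Let P_right : P 0 x2 1 (vX i.+1 + 2 * cK i) = gam i.
Proof.
apply: seg_eq => s hs; rewrite FE ?c01 //= /mkcts !vertexE lin_mkv.
have h := @vX_ge0 R n n_ok i (ltnW ig); have h' := @vX_ge0 R n n_ok i.+1 ig.
rewrite cyl3 //; last by rewrite /wid /wid /x2; case/andP: hs => hs hs'; nra.
by apply: (congr1 (sp false)); congr mkv; rewrite /x2; ring.
Qed.
Let P_left : P 1 (- vX i.+1 + 2 * cK i) 0 x1 = gam (n - 2 - i).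
Proof.
have e1 : vertex (n - 2 - i) = mkv (- vX i.+1) (vY i.+1).
  have -> : mkv (- vX i.+1) (vY i.+1) = rfl (vertex i.+1) by rewrite vertexE /rfl px_mkv py_mkv.
  rewrite rfl_vertex; last lia.
  by rewrite (_ : 2 * n - 1 - i.+1 = n - 2 - i + n)%N ?vertex_addn //; lia.
have e2 : vertex (n - 2 - i).+1 = mkv (- vX i) (vY i).
  have -> : mkv (- vX i) (vY i) = rfl (vertex i) by rewrite vertexE /rfl px_mkv py_mkv.
  rewrite rfl_vertex; last lia.
  by rewrite (_ : 2 * n - 1 - i = (n - 2 - i).+1 + n)%N ?vertex_addn //; lia.
apply: seg_eq => s hs; have hs' : 0 <= 1 - s <= 1 by case/andP: hs => hs hs'; apply/andP; split; lra.
rewrite FE ?c10 //= /mkcts e1 e2 lin_mkv cyl3 //; last first.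
  by rewrite le_eqVlt; apply/orP; left; apply/eqP; rewrite /wid /x1; ring.
rewrite /hgt /x1; apply: (congr1 (sp false)); apply: vecP; rewrite ?px_mkv ?py_mkv; ring.
Qed.

(** In the developed cylinder the image of the side is a straight segment from the bottom to a point
    at the top that is one turn further. It is homologous to one turn along the bottom followed by
    the side. *)
Lemma twist_right : bd (chain_map twist_map (gam i) - gam i - eta i).
Proof.
have -> : chain_map twist_map (gam i) = P 0 x0 1 (vX i.+1 + 2 * cK i).
  rewrite /gam chain_map_seg; apply: seg_eq => s hs.
  rewrite FE ?c01 //= /mkcts !vertexE lin_mkv.
  rewrite -[LHS]/(twist_map (sp false (mkv (wid i s) (hgt i s)))) twist_strip //; last first.
    by have := @wid_ge0 R n n_ok i s ig hs; rewrite /wid => ?; rewrite lexx andbT; lra.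
  by apply: (congr1 (cyl i s)); rewrite /wid /x0; ring.
rewrite -P_right /eta -P_chord_true -P_chord_false; exact: path_right.
Qed.

(** Sides on the left run downwards, so they cross the cylinder in the opposite direction. *)
Lemma twist_left : bd (chain_map twist_map (gam (n - 2 - i)) - gam (n - 2 - i) + eta i).
Proof.
have -> : chain_map twist_map (gam (n - 2 - i)) = P 1 (- vX i.+1 + 2 * cK i) 0 (- x0).
  rewrite -P_left /P chain_map_seg; apply: seg_eq => s hs.
  have hs' : 0 <= 1 - s <= 1 by case/andP: hs => hs hs'; apply/andP; split; lra.
  rewrite [LHS](_ : _ = twist_map (sp false (mkv (- wid i (1 - s)) (hgt i (1 - s))))); last first.
    apply: (congr1 twist_map); rewrite [LHS]FE ?c10 // cyl3 //.
      by apply: (congr1 (sp false)); apply: vecP; rewrite ?px_mkv ?py_mkv // /wid /x1; ring.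
    by rewrite le_eqVlt; apply/orP; left; apply/eqP; rewrite /wid /x1; ring.
  rewrite FE ?c10 // twist_strip //; last first.
    by have := @wid_ge0 R n n_ok i _ ig hs' => ?; rewrite lexx /=; lra.
  by apply: (congr1 (cyl i (1 - s))); rewrite /wid /x0; ring.
rewrite -P_left /eta -P_chord_true -P_chord_left; exact: path_left.
Qed.

End TwistSides.

Lemma twist_bottom : chain_map twist_map (gam (n - 1)) = gam (n - 1).
Proof.
rewrite /gam chain_map_seg; apply: seg_eq => s hs.
have -> : vertex (n - 1).+1 = vertex 0.
  by rewrite (_ : (n - 1).+1 = 0 + n)%N ?vertex_addn //; lia.
rewrite /= /mkcts vertex_last vertexE lin_mkv -[(1 - s) * vY _ + _]mulrDl subrK mul1r.
by apply: twist_level => //; apply: chord_bounds => //; apply: vX_ge0.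
Qed.

(** The image is a side of [polygon true], and the gluing identifies it with a side of
    [polygon false] in the opposite direction. *)
Lemma rot_gam k : bd (chain_map rot_map (gam k) + gam (k + n.+1./2)).
Proof.
have -> : chain_map rot_map (gam k) =
    seg (spc true) (V0 true (k + n.+1./2)) (V0 true (k + n.+1./2).+1).
  rewrite /gam chain_map_seg; apply: seg_eq => s hs; rewrite /= /mkcts.
  have e : (1 - s) *: vertex k + s *: vertex k.+1 = side_point n false k s.
    by rewrite /side_point sgE sg0 scale1r.
  have Pz : polygon false ((1 - s) *: vertex k + s *: vertex k.+1).
    have -> : (1 - s) *: vertex k + s *: vertex k.+1 = vertex k + s *: (vertex k.+1 - vertex k).
      by apply: vecP; rewrite !(pxD, pyD, pxN, pyN, pxZ, pyZ); ring.
    have Pv j : polygon false (vertex j).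
      by have := @polygon_vertex R n n_ok false j; rewrite sg0 scale1r.
    exact: polygon_segment.
  rewrite rot_sp // mulmxDr -!scalemxAr !rot_vertex -addSn; congr (sp _ _).
  by rewrite /V0 sg1 !scaleN1r addSn.
rewrite seg_side_true addrC; exact: seg_rev.
Qed.

End Action.

(** * Congruence levels and the Wohlfahrt level *)

Section Congruence.
Variables (R : realType) (n : nat).
Context {n_ok : odd_ge5 n}.
Let n_odd : odd n := n_is_odd.
Let n_ge5 : (5 <= n)%N := n_is_ge5.
Implicit Types (j k l m : nat).

Local Notation c1 := (c1 R n).
Local Notation s1 := (s1 R n).
Local Notation surface := (surface R n).

Local Notation smap := (continuousType surface surface).

Local Notation ltn_modn := (@ltn_modn n n_ok).

Local Notation g := (half n).
Local Notation gam := (@gam R n n_ok).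
Local Notation eta := (@eta R n n_ok).
Local Notation twist_map := (@twist_map R n n_ok).
Local Notation rotm := (@rotm R n).
Local Notation T := (T_mx R n).
Local Notation cot := (cot R n).
Local Notation pc := (@principal_congruence R n).
Local Notation veech := (@veech_group R n).
Implicit Types (A B C S : 'M[R]_2) (f h : smap) (Gamma K : set 'M[R]_2).
Let g2 : (n = 2 * g + 1)%N.
Proof. by rewrite /half; have := odd_double_half n; rewrite n_odd; lia. Qed.

Fixpoint twist_iter m : smap :=
  if m is m'.+1 then (twist_map \o twist_iter m' : smap) else idfun.

Lemma twist_iter_affine m : affine_map (T ^+ m) (twist_iter m).
Proof.
elim: m => [|m IH]; first exact: affine_id.
rewrite exprS; exact: (affine_comp IH (@twist_affine R n n_ok)).
Qed.

(** As [q] is fixed, each iteration adds it once. *)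
Lemma twist_iter_transvection (p q : chain R int 1 surface) m :
  bd (chain_map twist_map p - p - q) -> chain_map twist_map q = q ->
  bd (chain_map (twist_iter m) p - p - q *+ m).
Proof.
move=> hp hq; elim: m => [|m IH].
  rewrite mulr0n subr0 chain_map_id // subrr; exact: bd0.
have qm : chain_map twist_map (q *+ m) = q *+ m.
  elim: m {IH} => [|m IH]; first by rewrite mulr0n chain_map0.
  by rewrite mulrS chain_mapD hq IH.
have e : chain_map (twist_iter m.+1) p = chain_map twist_map (chain_map (twist_iter m) p).
  exact: (chain_map_comp (f := twist_iter m)).
have := chain_map_bd twist_map IH; rewrite !chain_mapB qm -e mulrSr => H.
by apply: (bd_eq (bdD H hp)); abel.
Qed.

Lemma gam_cases k : exists q, [/\ bd (chain_map twist_map (gam k) - gam k - q),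
  chain_map twist_map q = q &
  exists (e : int) i, (i < g)%N /\ q = eta i *~ e].
Proof.
rewrite -gam_mod; have kn : (k %% n < n)%N by exact: ltn_modn.
move: (k %% n)%N kn => {}k kn.
have [kg|gk] := ltnP k g.
  exists (eta k); split; [exact: twist_right|exact: twist_eta|].
  by exists 1, k.
have [k2|k2] := ltnP k (2 * g).
  have ig : (n - 2 - k < g)%N by lia.
  exists (- eta (n - 2 - k)); split.
  - rewrite opprK; have := @twist_left R n n_ok _ ig.
    by rewrite (_ : n - 2 - (n - 2 - k) = k)%N //; lia.
  - by rewrite chain_mapN twist_eta.
  - by exists (-1), (n - 2 - k)%N; rewrite mulrNz mulr1z.
have g0 : (0 < g)%N by lia.
exists 0; split; last by exists 0, 0%N; rewrite mulr0z.
  rewrite (_ : k = n - 1)%N; last by lia.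
  rewrite twist_bottom subrr subr0; exact: bd0.
by rewrite chain_map0.
Qed.

Lemma principal_T b : (0 < b)%N -> pc b (T ^+ b).
Proof.
move=> b0; exists (twist_iter b); first exact: twist_iter_affine.
apply: (@trivial_criterion R n n_ok) => // k.
have [q [h1 h2 _]] := gam_cases k.
have [d ed] := twist_iter_transvection b h1 h2.
by exists q, d; rewrite -ed [RHS]addrC subrK.
Qed.

Lemma principal1 b : pc b 1.
Proof. by exists idfun; [exact: affine_id|exact: trivial_id]. Qed.

Lemma principalM b A B : pc b A -> pc b B -> pc b (A * B).
Proof.
move=> [f af tf] [h ah th]; exists (f \o h : smap); first exact: affine_comp.
exact: (trivial_comp (f := h) (g := f)).
Qed.

Lemma principalV b A : pc b A -> pc b A^-1.
Proof.
move=> [f af tf]; have [h ah [k1 k2]] := affine_invE af; exists h => //.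
exact: (trivial_inverse k1 k2).
Qed.

Lemma principal_conj b A S : veech S -> pc b A -> pc b (S^-1 * A * S).
Proof.
move=> [h ah] [f af tf]; have [h' ah' [k1 k2]] := affine_invE ah.
exists ((h' \o f) \o h : smap); first exact: (affine_comp ah (affine_comp af ah')).
exact: (trivial_conj (f := f) (h := h') (h' := h)).
Qed.

Lemma principal_veech b A : pc b A -> veech A. Proof. by move=> [f af _]; exists f. Qed.

(** * Coefficients modulo a product *)

Section Crt.
Variables (a b : nat).
Hypotheses (a0 : (0 < a)%N) (b0 : (0 < b)%N).
Local Notation Za := 'I_a.-1.+1.
Local Notation Zab := 'I_(a * b).-1.+1.
Let ab0 : (0 < a * b)%N. Proof. by rewrite muln_gt0 a0. Qed.

(** [red] reduces from [Z/ab] to [Z/a], and [blow] embeds [Z/a] into [Z/ab] by multiplication by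
    [b]. Their composite is multiplication by [b], so [b] times a cycle is controlled by its
    reduction modulo [a]. *)
Definition red (x : Zab) : Za := inord (val x %% a).
Definition blow (x : Za) : Zab := inord (val x * b).

Lemma val_red x : val (red x) = (val x %% a)%N.
Proof. by apply: inordK; move: (val x) => i; rewrite prednK // ltn_mod. Qed.
Lemma val_blow x : val (blow x) = (val x * b)%N.
Proof.
have := ltn_ord x; rewrite /blow /=; move: (nat_of_ord x) => i; rewrite [in X in X -> _]prednK // => lt.
by rewrite inordK // prednK // ltn_pmul2r.
Qed.

Lemma val_add c (x y : 'I_c.-1.+1) : (0 < c)%N -> val (x + y) = ((val x + val y) %% c)%N.
Proof.
move=> c0; transitivity ((val x + val y) %% c.-1.+1)%N; first by [].
by move: (val x) (val y) => i j; rewrite prednK.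
Qed.

Lemma redD : {morph red : x y / x + y}.
Proof.
move=> x y; apply: val_inj; rewrite val_red !val_add // !val_red.
by rewrite modn_dvdm ?dvdn_mulr // modnDm.
Qed.

Lemma blowD : {morph blow : x y / x + y}.
Proof. by move=> x y; apply: val_inj; rewrite val_blow !val_add // !val_blow -mulnDl muln_modl. Qed.

Lemma blow_red x : blow (red x) = x *+ b.
Proof.
apply: val_inj; rewrite val_blow val_red muln_modl Zp_mulrn /=.
by move: (nat_of_ord x) => i; rewrite prednK.
Qed.

Lemma trivial_multiple f (z : chain R Zab 1 surface) : trivial_on_H1 R Za f -> boundary z = 0 ->
  exists d : chain R Zab 2 surface, chain_map f (z *+ b) - z *+ b = boundary d.
Proof.
move=> tf cz; have cz' : boundary (push red z) = 0.
  by rewrite -(push_boundary redD) cz (@push0 R _ _ _ redD).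
have [d ed] := tf _ cz'; exists (push blow d).
have e : z *+ b = push blow (push red z).
  have h : (fun z : chain R Zab 1 surface => z *+ b) =1 (fun z => push blow (push red z)).
    apply: malg_ext => [x y|x y|x s]; first by rewrite mulrnDl.
      by rewrite (pushD redD) (pushD blowD).
    by rewrite (pushU redD) (pushU blowD) blow_red monalgUMn.
  exact: h.
rewrite -(push_boundary blowD) -ed (pushB blowD) e -(push_chain_map blowD).
by [].
Qed.

End Crt.

(** An affine map is determined by its derivative, so both levels speak of one map. It moves the
    multiples [z *+ a] and [z *+ b] of a cycle modulo [a * b] by boundaries, and a Bezout relation
    combines them to [z]. *)
Lemma principal_crt a b A : (0 < a)%N -> (0 < b)%N -> coprime a b ->
  pc a A -> pc b A -> pc (a * b) A.
Proof.
move=> a0 b0 co [f af tf] [h ah th].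
have e : f = h by apply/continuousEP; exact: (affine_uniq af ah).
subst h; exists f => // z cz.
have [d ed] := trivial_multiple a0 b0 tf cz.
have [d' ed'] : exists d, chain_map f (z *+ a) - z *+ a = boundary d.
  have ab : (a * b = b * a)%N by rewrite mulnC.
  move: z cz {ed}; rewrite ab => z cz; exact: (trivial_multiple b0 a0 th cz).
case: (egcdnP b a0) => u v euv _; rewrite (eqP co) in euv.
have zE : z = z *+ a *+ u - z *+ b *+ v.
  by rewrite -!mulrnA [(a * u)%N]mulnC euv mulrnDr mulr1n [(v * b)%N]mulnC addrAC subrr add0r.
have bM (c : chain R _ 2 surface) k : boundary (c *+ k) = boundary c *+ k :> chain R 'I_(a * b).-1.+1 1 surface.
  by elim: k => [|k IH]; rewrite ?mulr0n ?boundary0 // !mulrS boundaryD IH.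
have fM (c : chain R 'I_(a * b).-1.+1 1 surface) k : chain_map f (c *+ k) = chain_map f c *+ k.
  by elim: k => [|k IH]; rewrite ?mulr0n ?chain_map0 // !mulrS chain_mapD IH.
exists (d' *+ u - d *+ v); rewrite boundaryB !bM -ed -ed' !mulrnBl -!fM {1 2}zE chain_mapB.
by rewrite !opprB addrACA [RHS]addrACA; congr (_ + _); rewrite addrC.
Qed.

Lemma mk2_square (k s c : R) : c = k * s -> c ^+ 2 + s ^+ 2 = 1 ->
  shear (- (2 * k)) * mk2 c (- s) s c * (shear (- (2 * k)) * mk2 c (- s) s c) = -1.
Proof.
move=> -> h; have -> : (-1 : 'M[R]_2) = mk2 (-1) 0 0 (-1).
  apply: mx_ext => x; rewrite mulNmx mul1mx; apply: vecP.
    by rewrite pxN px_mk2; ring.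
  by rewrite pyN py_mk2; ring.
rewrite /shear !mk2M; congr mk2; try ring.
- by transitivity (- ((k * s) ^+ 2 + s ^+ 2)); [ring|rewrite h].
- by transitivity (- ((k * s) ^+ 2 + s ^+ 2)); [ring|rewrite h].
Qed.

(* As [(T^-1 * R)^2 = -1 = R^n] with [n] odd, the conjugates of [T] generate. *)
Lemma conj_T_generate K : K 1 -> (forall A B, K A -> K B -> K (A * B)) ->
  (forall A, K A -> K A^-1) -> (forall S, veech S -> K (S^-1 * T * S)) ->
  veech `<=` K.
Proof.
move=> K1 KM KV KT A /veech_hecke hA.
have uT : T \is a GRing.unit by apply: veech_unit; exact: veech_T.
have uR : rotm 1 \is a GRing.unit by apply: veech_unit; exact: veech_rot.
pose X := rotm 1 * T * (rotm 1)^-1 * T.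
have KTT : K T by have := KT 1 (@veech1 R n n_ok); rewrite invr1 mul1r mulr1.
have KX : K X.
  apply: KM => //; have := KT (rotm 1)^-1; rewrite invrK; apply; apply: veech_inv; exact: veech_rot.
have vR : veech (rotm 1) by exact: veech_rot.
have vT : veech T by exact: veech_T.
have uX : X \is a GRing.unit.
  by apply: veech_unit; do ![apply: veech_mul => //]; exact: veech_inv.
have rel : T^-1 * rotm 1 * (T^-1 * rotm 1) = -1.
  have s0 : s1 != 0 by rewrite lt0r_neq0 // s1_pos.
  have ce : c1 = cot * s1 by rewrite cotE mulfVK.
  have cs1 : c1 ^+ 2 + s1 ^+ 2 = 1 by exact: cs2sn2.
  rewrite T_shear -shearN; exact: mk2_square ce cs1.
have R2 : rotm 1 * rotm 1 = - X.
  have := congr1 ( *%R X) rel; rewrite mulrN1 => <-.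
  by rewrite /X !mulrA mulrK // -!mulrA mulKr // !mulrA mulrK.
have RX : (- X) ^+ g * rotm 1 = -1.
  have -> : -1 = rotm (2 * g).+1 by rewrite -(@rotm_n R n n_ok); apply: (congr1 rotm); lia.
  by rewrite (rotmX R (2 * g).+1) exprSr exprM [rotm 1 ^+ 2]expr2 R2.
have uY : (- X) ^+ g \is a GRing.unit by rewrite unitrX // unitrN.
have RY : rotm 1 = - ((- X) ^+ g)^-1 by rewrite -mulrN1 -RX mulKr.
have KXn B m : K B -> K (B ^+ m) by move=> KB; elim: m => [//|m IH]; rewrite exprS; exact: KM.
(* Inserting [RY] into [R2] expresses [- X], and thereby [-1], as a power of [X]. *)
have KN1 : K (-1).
  have : - X = (X ^+ (2 * g))^-1.
    rewrite -R2 RY mulrNN -invrM // -expr2 -exprM mulnC exprM sqrrN -exprM //.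
  move/(congr1 (fun Z => Z * X^-1)); rewrite mulNr mulrV // => ->.
  by apply: KM; apply: KV => //; exact: KXn.
have KR : K (rotm 1).
  by rewrite RY -mulN1r; apply: (KM) => //; apply: (KV); apply: KXn; rewrite -mulN1r; exact: KM.
apply: (hA K) => //.
Qed.

(** * Widths and levels *)

Section Level.
Variables (Gamma : set 'M[R]_2).
Hypothesis sub : subgroup n Gamma.

Definition conjT S m : 'M[R]_2 := S^-1 * T ^+ m * S.

Lemma veechE S : veech S -> S \is a GRing.unit. Proof. exact: veech_unit. Qed.

Lemma conjTD S m l : veech S -> conjT S (m + l) = conjT S m * conjT S l.
Proof. by move=> /veechE u; rewrite /conjT exprD !mulrA mulrK. Qed.

Lemma conjTX S m l : veech S -> conjT S (m * l) = conjT S m ^+ l.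
Proof.
move=> hS; elim: l => [|l IH]; last by rewrite mulnS conjTD // IH exprS.
by rewrite muln0 /conjT expr0 mulr1 mulVr ?expr0 // veechE.
Qed.

Lemma T_unit : T \is a GRing.unit. Proof. by apply: veechE; exact: veech_T. Qed.

Lemma conjT_unit S m : veech S -> conjT S m \is a GRing.unit.
Proof.
move=> hS; apply: veechE; apply: veech_mul => //; apply: veech_mul; first exact: veech_inv.
by apply: veechX; exact: veech_T.
Qed.

Lemma subX A m : Gamma A -> Gamma (A ^+ m).
Proof.
by case: sub => _ h1 hM _ hA; elim: m => [//|m IH]; rewrite exprS; exact: hM.
Qed.

Lemma conjT_gcd S m l : veech S -> Gamma (conjT S m) -> Gamma (conjT S l) ->
  Gamma (conjT S (gcdn m l)).
Proof.
move=> hS hm hl; case: sub => _ h1 hM hV.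
have [->|m0] := posnP m; first by rewrite gcd0n.
case: (egcdnP l m0) => km kn e _.
have := conjTD (kn * l) (gcdn m l) hS; rewrite -e => e2.
have -> : conjT S (gcdn m l) = (conjT S (kn * l))^-1 * conjT S (km * m).
  by rewrite e2 mulKr // conjT_unit.
by apply: hM; [apply: hV|]; rewrite mulnC conjTX //; exact: subX.
Qed.

Lemma conjT_int S (m : int) : veech S -> Gamma (S^-1 * T ^ m * S) -> Gamma (conjT S `|m|).
Proof.
move=> hS; have uS := veechE hS; case: m => m // h.
have uTm : T ^+ m.+1 \is a GRing.unit by rewrite unitrX // T_unit.
have e : (S^-1 * (T ^+ m.+1)^-1 * S) * conjT S m.+1 = 1.
  by rewrite /conjT !mulrA mulrK // mulrVK // mulVr.
case: sub => _ _ _ /(_ _ h).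
suff -> : (S^-1 * T ^ (Negz m) * S)^-1 = conjT S m.+1 by [].
have u := conjT_unit m.+1 hS.
rewrite -[T ^ _]/((T ^+ m.+1)^-1).
by rewrite -[X in X^-1](mulrK u) e mul1r invrK.
Qed.

Variable b : nat.
(** The form in which a level enters. It also applies to exponents that are not congruence levels,
    such as 4 in the example. *)
Hypotheses (b0 : (0 < b)%N) (conjT_in : forall S, veech S -> Gamma (conjT S b)).

(** With the exponents [m] and [b] also their greatest common divisor occurs, and maximality forbids
    a proper divisor of [m]. *)
Lemma width_dvd w : maximal_widths n Gamma w -> (w %| b)%N.
Proof.
move=> [A [hA _ _ [S [m [hS m0 eA -> hmax]]]]].
have h1 : Gamma (conjT S `|m|) by apply: conjT_int => //; rewrite -eA.
have h := conjT_gcd hS h1 (conjT_in hS).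
have g0 : (0 < gcdn `|m| b)%N by rewrite gcdn_gt0 b0 orbT.
have := hmax (gcdn `|m| b) (dvdn_gcdl _ _); rewrite g0 /= => hm.
have : ~~ (gcdn `|m| b < `|m|)%N by apply/negP => /hm; exact.
rewrite -leqNgt => le; have := dvdn_gcdr `|m| b.
suff -> : gcdn `|m| b = `|m|%N by [].
by apply/eqP; rewrite eqn_leq le andbT; apply: dvdn_leq; [rewrite absz_gt0|exact: dvdn_gcdl].
Qed.

Lemma level_dvd : (wohlfahrt_level n Gamma %| b)%N.
Proof.
rewrite /wohlfahrt_level big_seq; elim/big_ind: _ => [|x y hx hy|w].
- exact: dvd1n.
- by rewrite dvdn_lcm hx.
- case: finite_supportP => [_|F sF _ _]; first by rewrite in_nil.
  by move=> /sF; exact: width_dvd.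
Qed.

Lemma exists_width S : veech S -> exists m, [/\ (0 < m)%N, Gamma (conjT S m),
  (m %| b)%N & (m %| wohlfahrt_level n Gamma)%N].
Proof.
move=> hS.
(* The least positive exponent that occurs is a maximal width. *)
have ex : exists m, `[< (0 < m)%N /\ Gamma (conjT S m) >].
  by exists b; apply/asboolP; split=> //; exact: conjT_in.
case: (ex_minnP ex) => m /asboolP[m0 hm] hmin.
have wm : maximal_widths n Gamma m.
  exists (conjT S m).
  have tr : \tr (conjT S m) = 2.
    rewrite /conjT -mulrA mxtrace_mulC -[X in \tr X]/(T ^+ m * S * S^-1) mulrK ?veechE //.
    rewrite T_shear -shearX /shear /mxtrace sum2 !mxE //=.
  have t1 : 2 * cot *+ m != 0 by rewrite mulrn_eq0 negb_or -lt0n m0 mulf_neq0 ?lt0r_neq0 ?cot_gt0.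
  split=> //; first split.
  - apply/eqP => e; have : T ^+ m = 1.
      move/(congr1 (fun Z => S * Z * S^-1)): e; rewrite /conjT mulr1 mulrV ?veechE // => <-.
      by rewrite !mulrA mulrV ?veechE // mul1r mulrK ?veechE.
    rewrite T_shear -shearX -(shear0 R) => /(congr1 (fun M : 'M[R]_2 => M 0 1)).
    by rewrite /shear !mxE /= => /eqP; rewrite (negbTE t1).
  - apply/eqP => e; move: tr; rewrite e /mxtrace sum2 !mxE /=; lra.
  - by rewrite tr ger0_norm.
  - by rewrite tr.
  exists S, m%:Z; split=> //; first by rewrite eqz_nat -lt0n.
  move=> k km /andP[k0 lt] hk.
  have /hmin : `[< (0 < k)%N /\ Gamma (conjT S k) >] by apply/asboolP.
  by rewrite leqNgt (lt : (k < m)%N).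
exists m; split=> //; first exact: width_dvd.
(* The iterated operator runs over the widths other than its neutral element 1. They form a finite
   set, because they divide [b]. *)
have fin : finite_set (maximal_widths n Gamma `&` (fun w : nat => w) @^-1` [set~ 1%N]).
  apply: (@sub_finite_set _ _ `I_b.+1); last exact: finite_II.
  by move=> w [/width_dvd hw _] /=; rewrite ltnS; exact: dvdn_leq.
have [->|m1] := eqVneq m 1%N; first exact: dvd1n.
rewrite /wohlfahrt_level (bigD1_seq m) /=; last exact: finite_support_uniq.
  exact: dvdn_lcml.
by rewrite in_finite_support // inE; split=> //=; apply/eqP.
Qed.

End Level.

Lemma conjT_level Gamma b S : congruence_level n Gamma b -> veech S -> Gamma (conjT S b).
Proof.
move=> [b0 sb] hS; apply: sb; rewrite /conjT; apply: principal_conj => //.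
exact: principal_T.
Qed.

Theorem wohlfahrt_dvd Gamma b : congruence_group n Gamma -> minimal_congruence_level n Gamma b ->
  (wohlfahrt_level n Gamma %| b)%N /\
  forall p, prime p -> (p %| b)%N -> (p %| wohlfahrt_level n Gamma)%N.
Proof.
move=> [sub _] [lev hmin]; have hb S := @conjT_level Gamma b S lev; case: (lev) => b0 sb.
split; first exact: (level_dvd sub b0 hb).
move=> p pp pb; apply: contrapT => /negP pl.
have [b' cop eb] := pfactor_coprime pp b0.
set q := (p ^ logn p b)%N in eb.
have k0 : (0 < logn p b)%N by rewrite logn_gt0 mem_primes pp b0.
have q0 : (0 < q)%N by rewrite expn_gt0 prime_gt0.
have q1 : (1 < q)%N by rewrite -(exp1n (logn p b)) ltn_exp2r // prime_gt1.
have b'0 : (0 < b')%N by move: b0; rewrite eb muln_gt0 => /andP[].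
have cob : coprime b' q by rewrite coprime_sym; apply: coprimeXl.
case: (sub) => sv G1 GM GV.
suff lev' : congruence_level n Gamma b'.
  apply: (hmin b') lev'; first by rewrite eb dvdn_mulr.
  by rewrite eb -[X in X != _]muln1 eqn_pmul2l // eq_sym neq_ltn q1 orbT.
split=> // A hA.
(* [K] is a group because principal congruence groups are normalized by the Veech group. *)
pose K : set 'M[R]_2 := fun A => exists B C, [/\ A = B * C, Gamma B, pc b' B & pc q C].
have KA : K A.
  have : veech A by exact: principal_veech hA.
  apply: (conj_T_generate (K := K)) => [|A1 A2|A1|S hS].
  - by exists 1, 1; rewrite mulr1; split=> //; exact: principal1.
  - move=> [B1 [C1 [-> G1' p1 q1']]] [B2 [C2 [-> G2 p2 q2]]].
    have u : B2 \is a GRing.unit by apply: veech_unit; exact: sv.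
    exists (B1 * B2), (B2^-1 * C1 * B2 * C2); split.
    + by rewrite !mulrA mulrK.
    + exact: GM.
    + exact: principalM.
    + by apply: principalM => //; apply: principal_conj => //; exact: sv.
  - move=> [B [C [-> GB pB qC]]].
    have u : B \is a GRing.unit by apply: veech_unit; exact: sv.
    have uC : C \is a GRing.unit by apply: veech_unit; exact: principal_veech qC.
    exists B^-1, (B * C^-1 * B^-1); split.
    + by rewrite invrM // !mulrA mulVr // mul1r.
    + exact: GV.
    + exact: principalV.
    + have := principal_conj (@veech_inv R n n_ok _ (sv _ GB)) (principalV qC).
      by rewrite invrK.
  - have [m [m0 Gm mb ml]] := exists_width sub b0 hb hS.
    have cpm : coprime (m * b') q.
      rewrite coprimeXr // coprimeMl coprime_sym (prime_coprime _ pp) -[coprime b' p]coprime_sym cop andbT.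
      by apply: contra pl => pm; exact: dvdn_trans ml.
    (* As [m * b'] divides [j], the conjugate of [T ^+ j] is in [Gamma] and of level [b']; the
       remaining exponent [1 - j] is a multiple of [q]. Such a [j] exists because [m] divides the
       Wohlfahrt level and so is prime to [p]. *)
    pose j := chinese (m * b') q 0 1.
    have j0 : (m * b' %| j)%N by rewrite /dvdn chinese_modl // mod0n.
    have j1 : (j %% q = 1)%N by rewrite chinese_modr // modn_small.
    have jE : j = ((j %/ q) * q + 1)%N by rewrite {1}(divn_eq j q) j1.
    have pq : pc q (conjT S (q * (j %/ q))).
      rewrite conjTX //; elim: (j %/ q)%N => [|l IH]; first exact: principal1.
      by rewrite exprS; apply: principalM => //; apply: principal_conj => //; exact: principal_T.
    exists (conjT S j), (conjT S (q * (j %/ q)))^-1; split.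
    + have u := conjT_unit (q * (j %/ q)) hS.
      by rewrite {1}jE addnC mulnC conjTD // mulrK // /conjT expr1.
    + by case/dvdnP: j0 => l ->; rewrite mulnC -mulnA conjTX //; apply: subX.
    + case/dvdnP: j0 => l ->; rewrite mulnA mulnC conjTX //.
      elim: (l * m)%N => [|i IH]; first exact: principal1.
      by rewrite exprS; apply: principalM => //; apply: principal_conj => //; exact: principal_T.
    + exact: principalV.
have [B [C [eA GB pB qC]]] := KA.
have u : B \is a GRing.unit by apply: veech_unit; exact: sv.
have eC : C = B^-1 * A by rewrite eA mulKr.
have pC : pc b' C by rewrite eC; apply: principalM => //; exact: principalV.
rewrite eA; apply: GM => //; apply: sb; rewrite eb; exact: principal_crt.
Qed.

End Congruence.

(** * Winding numbers *)

Section Winding.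
Variable R : realType.

(* The signed distance to the nearest integer. *)
Definition frac (r : R) : R := r - (Num.floor (r + 2^-1))%:~R.

Lemma frac_int r : r - frac r \is a Num.int.
Proof. by rewrite /frac opprB addrC subrK intr_int. Qed.

Lemma frac_bound r : `|frac r| <= 2^-1.
Proof.
have /andP[h1 h2] := floor_itv (r + 2^-1); rewrite intrD in h2.
by rewrite ler_norml /frac; lra.
Qed.

Lemma int_lt1 (r : R) : r \is a Num.int -> `|r| < 1 -> r = 0.
Proof.
move=> /intrP[m ->]; rewrite -intr_norm -[1]/(1%:~R) ltr_int => h.
by have -> : m = 0 by lia.
Qed.

Lemma int_sep (a b : R) : a \is a Num.int -> b \is a Num.int -> a < b -> a + 1 <= b.
Proof.
move=> /intrP[m ->] /intrP[l ->]; rewrite ltr_int -[1]/(1%:~R) -intrD ler_int; lia.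
Qed.

Lemma half_not_int (b : R) : b \is a Num.int -> b + 2^-1 \isn't a Num.int.
Proof.
move=> ib; apply/negP => ih.
have lt : b < b + 2^-1 by lra.
have := int_sep ib ih lt; lra.
Qed.

Lemma int_sum N (F : 'I_N -> R) : (forall i, F i \is a Num.int) ->
  \sum_(i < N) F i \is a Num.int.
Proof. by move=> h; apply: rpred_sum => i _; exact: h. Qed.

Lemma frac_min r (m : R) : m \is a Num.int -> `|frac r| <= `|r - m|.
Proof.
move=> hm; have b := frac_bound r; have i := frac_int r.
have [e|e] := eqVneq (r - frac r) m; first by rewrite -e opprB addrC subrK.
have : 1 <= `|r - frac r - m|.
  rewrite leNgt; apply/negP => /int_lt1 h; move/eqP: e; apply.
  by apply/eqP; rewrite -subr_eq0 h // rpredB.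
have := ler_normB (r - m) (frac r); rewrite (_ : r - m - frac r = r - frac r - m); last by ring.
lra.
Qed.

Lemma frac_triangle a b (c : R) : `|frac (a - b)| <= `|frac (a - c)| + `|frac (b - c)|.
Proof.
have i : a - c - frac (a - c) - (b - c - frac (b - c)) \is a Num.int by rewrite rpredB // frac_int.
apply: le_trans (frac_min (a - b) i) _.
rewrite (_ : a - b - _ = frac (a - c) - frac (b - c)); last by ring.
exact: ler_normB.
Qed.

Lemma frac_eq r (r' : R) : r - r' \is a Num.int -> `|r'| < 2^-1 -> frac r = r'.
Proof.
move=> i b; apply/eqP; rewrite -subr_eq0; apply/eqP; apply: int_lt1.
  rewrite (_ : _ - _ = (r - r') - (r - frac r)); last by ring.
  by rewrite rpredB // frac_int.
have := ler_normB (frac r) r'; have := frac_bound r; lra.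
Qed.

Lemma frac_normD r (r' : R) : `|frac (r + r')| <= `|frac r| + `|r'|.
Proof.
apply: le_trans (frac_min (r + r') (frac_int r)) _.
by rewrite (_ : _ - _ = frac r + r'); [exact: ler_normD|ring].
Qed.

Lemma frac_norm_int r (m : R) : m \is a Num.int -> `|frac (r + m)| = `|frac r|.
Proof.
move=> hm; apply/eqP; rewrite eq_le; apply/andP; split.
  have h : r - frac r + m \is a Num.int by rewrite rpredD // frac_int.
  apply: le_trans (frac_min (r + m) h) _.
  by rewrite (_ : r + m - _ = frac r) //; ring.
have h : r + m - frac (r + m) - m \is a Num.int by rewrite rpredB // frac_int.
apply: le_trans (frac_min r h) _.
by rewrite (_ : r - _ = frac (r + m)) //; ring.
Qed.

Lemma frac_small r : `|r| < 2^-1 -> frac r = r.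
Proof. by move=> h; apply: frac_eq => //; rewrite subrr int_num0. Qed.

Lemma frac_dist (r s : R) : `| `|frac r| - `|frac s| | <= `|r - s|.
Proof.
have h1 := frac_normD s (r - s); have h2 := frac_normD r (s - r).
rewrite (_ : s + (r - s) = r) in h1; last by ring.
rewrite (_ : r + (s - r) = s) in h2; last by ring.
by rewrite (distrC s r) in h2; rewrite ler_norml; apply/andP; split; lra.
Qed.

(** [frac] jumps at the half-integers, but its absolute value is the distance to the integers. *)
Lemma frac_norm_continuous : continuous (fun r : R^o => `|frac r| : R^o).
Proof.
move=> r; apply/cvgrPdist_lt => e e0; near=> s.
apply: le_lt_trans (frac_dist r s) _; near: s; exact: cvgr_dist_lt.
Unshelve. all: by end_near. Qed.

(** A continuous map from [X] to the circle [R / Z] is given by a real valued representative [w];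
    [w_near] is its continuity. *)
Variables (X : topologicalType) (w : X -> R).
Hypothesis w_near : forall (x : X) (e : R), 0 < e -> \forall y \near x, `|frac (w y - w x)| < e.

Lemma frac_near (T : topologicalType) (p : T -> X) (x : T) (e : R) : continuous p -> 0 < e ->
  nbhs x [set y | `|frac (w (p y) - w (p x))| < e].
Proof. by move=> cp e0; exact: (cp x _ (w_near (p x) e0)). Qed.

(** The bound [4^-1] keeps the argument away from the jumps of [frac]: two nearby values differ by
    an integer up to a small error, and by less than 1. *)
Lemma frac_continuous (T : topologicalType) (p q : T -> X) : continuous p -> continuous q ->
  (forall x, `|frac (w (q x) - w (p x))| < 4^-1) ->
  continuous (fun x => frac (w (q x) - w (p x)) : R^o).
Proof.
move=> cp cq small x; apply/cvgrPdist_lt => e e0.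
have [d [d0 de d4]] : exists d : R, [/\ 0 < d, 2 * d <= e & 2 * d <= 4^-1].
  by have [h|h] := lerP e 4^-1; [exists (e / 2)|exists 8^-1]; split; lra.
near=> y.
have hp : `|frac (w (p y) - w (p x))| < d by near: y; exact: cp (w_near _ d0).
have hq : `|frac (w (q y) - w (q x))| < d by near: y; exact: cq (w_near _ d0).
have e1 : frac (w (q y) - w (p y)) - frac (w (q x) - w (p x)) =
    frac (w (q y) - w (q x)) - frac (w (p y) - w (p x)).
  apply/eqP; rewrite -subr_eq0; apply/eqP; apply: int_lt1.
    rewrite (_ : _ - _ = - (w (q y) - w (p y) - frac (w (q y) - w (p y)))
      + (w (q x) - w (p x) - frac (w (q x) - w (p x)))
      + (w (q y) - w (q x) - frac (w (q y) - w (q x)))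
      - (w (p y) - w (p x) - frac (w (p y) - w (p x)))); last by ring.
    by rewrite rpredB ?frac_int // rpredD ?frac_int // rpredD ?frac_int // rpredN frac_int.
  move: (small x) (small y) hp hq.
  move: (frac _) (frac _) (frac _) (frac _) => a1 a2 a3 a4; rewrite !ltr_norml => /andP[? ?] /andP[? ?] /andP[? ?] /andP[? ?].
  by apply/andP; split; lra.
rewrite distrC e1; have := ler_normB (frac (w (q y) - w (q x))) (frac (w (p y) - w (p x))); lra.
Unshelve. all: by end_near. Qed.

(** * Lifting maps from the circle to the line *)

Section Lift.
Variables (V : normedModType R) (H : V -> X) (A : set V) (cl : V -> V).
Hypotheses (cH : continuous H) (cA : compact A) (ccl : continuous cl).
Hypotheses (clA : forall x, A (cl x)) (cl_id : forall x, A x -> cl x = x).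
Hypotheses (starA : forall (x : V) (t : R), A x -> 0 <= t <= 1 -> A (t *: x)) (bA : forall x, A x -> `|x| <= 1).

Lemma uniform_frac : exists2 N : nat, (0 < N)%N & forall x y, A x -> `|x - y| <= N%:R^-1 ->
  `|frac (w (H y) - w (H x))| < 4^-1.
Proof.
have /compact_near_coveringP nc := cA.
have := nc nat \oo (fun N x => forall y : V, `|x - y| <= N.+1%:R^-1 ->
  `|frac (w (H y) - w (H x))| < 4^-1) _.
case=> [x _|N _ hN]; last first.
  by exists N.+1 => // x y sx; apply: (hN N) => //=.
have e8 : 0 < 8^-1 :> R by lra.
have /nbhs_ballP[r /= r0 hr] := frac_near x cH e8.
have r2 : 0 < r / 2 by lra.
exists (ball x (r / 2), [set N : nat | N.+1%:R^-1 < r / 2]) => /=.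
  by split; [exact: nbhsx_ballx|exact: (@near_infty_natSinv_lt R (PosNum r2))].
move=> [y N] /= [yr lt] z yz.
have zr : ball x r z.
  have h1 : `|x - y| < r / 2 by move: yr; rewrite -ball_normE.
  rewrite -ball_normE; apply: le_lt_trans (ler_distD y x z) _.
  by rewrite (splitr r); apply: ltrD => //; exact: le_lt_trans lt.
have yr' : ball x r y by apply: le_ball yr; lra.
have := hr _ zr; have := hr _ yr' => /= h1 h2.
have := frac_triangle (w (H z)) (w (H y)) (w (H x)); lra.
Qed.

(** The value at [x] is reached from 0 in [N] steps along the ray, each short enough for its
    increment to be read off by [frac] and to depend continuously on [x]. Modulo integers the
    increments telescope. [cl] retracts onto [A], so that the lift is defined everywhere. *)
Lemma star_lift : exists2 L : V -> R, continuous L &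
  forall x, A x -> L x - w (H x) \is a Num.int.
Proof.
have [N N0 hN] := uniform_frac.
have NR : 0 < N%:R :> R by rewrite ltr0n.
pose c i (x : V) : V := (i%:R / N%:R) *: cl x.
have cc i : continuous (c i).
  by move=> x; apply: cvgZl_tmp; exact: ccl.
have cA' i x : (i <= N)%N -> A (c i x).
  move=> iN; apply: starA => //; rewrite divr_ge0 ?ler0n //=.
  by rewrite ler_pdivrMr // mul1r ler_nat.
pose D i x : R := frac (w (H (c i.+1 x)) - w (H (c i x))).
have cD i : (i < N)%N -> continuous (D i).
  move=> iN; apply: frac_continuous => [x|x|x].
  - by apply: continuous_comp; [exact: cc|exact: cH].
  - by apply: continuous_comp; [exact: cc|exact: cH].
  apply: hN; first exact: cA' (ltnW iN).
  rewrite /c -scalerBl -mulrBl -[X in X - _]/(i%:R) -[i.+1]addn1 natrD opprD addNKr.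
  rewrite normrZ mulN1r normrN gtr0_norm ?invr_gt0 // ler_piMr ?invr_ge0 ?(ltW NR) //.
  exact: bA.
pose L (x : V) : R := w (H 0) + \sum_(i < N) D i x.
exists L.
  move=> x; apply: cvgD; first exact: cvg_cst.
  by apply: continuous_big => [|i _]; [exact: add_continuous|exact: cD].
move=> x Ax.
have e : \sum_(i < N) (w (H (c i.+1 x)) - w (H (c i x))) = w (H x) - w (H 0).
  rewrite -(big_mkord xpredT (fun i => w (H (c i.+1 x)) - w (H (c i x)))).
  by rewrite telescope_sumr // /c mul0r scale0r divff ?lt0r_neq0 // scale1r cl_id.
rewrite (_ : _ - _ = \sum_(i < N) (D i x - (w (H (c i.+1 x)) - w (H (c i x))))); last first.
  by rewrite sumrB e opprB addrCA addrA.
apply: (@int_sum N (fun i => D i x - (w (H (c i.+1 x)) - w (H (c i x))))) => i.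
have := frac_int (w (H (c i.+1 x)) - w (H (c i x))); rewrite -rpredN opprB.
by [].
Qed.

End Lift.

Definition lifts (p : R^o -> X) (L : R -> R) :=
  continuous L /\ forall t, 0 <= t <= 1 -> L t - w (p t) \is a Num.int.

(** The difference of two lifts is continuous with integer values; if it were not constant, it would
    take a half-integer value. *)
Lemma lifts_uniq p (L L' : R -> R) : lifts p L -> lifts p L' -> L 1 - L 0 = L' 1 - L' 0.
Proof.
move=> [cL hL] [cL' hL'].
pose D t := L t - L' t.
have iD t : 0 <= t <= 1 -> D t \is a Num.int.
  move=> ht; rewrite (_ : D t = (L t - w (p t)) - (L' t - w (p t))); last by rewrite /D; ring.
  by rewrite rpredB ?hL ?hL'.
have cD : {within `[0, 1], continuous D}.
  apply: continuous_subspaceT => t; apply: continuousB; [exact: cL|exact: cL'].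
suff e : D 1 = D 0 by move: e; rewrite /D; lra.
apply: contrapT => ne.
have lt01 : 0 <= 1 :> R by [].
have i0 : D 0 \is a Num.int by apply: iD; rewrite lexx ler01.
have i1 : D 1 \is a Num.int by apply: iD; rewrite lexx ler01.
have [lt|lt] : D 0 < D 1 \/ D 1 < D 0.
  by case: (ltgtP (D 0) (D 1)) => h; [left|right|case: ne].
- have hv : Num.min (D 0) (D 1) <= D 0 + 2^-1 <= Num.max (D 0) (D 1).
    by rewrite (min_l (ltW lt)) (max_r (ltW lt)); have := int_sep i0 i1 lt; lra.
  have [t] := IVT lt01 cD hv; rewrite in_itv /= => ht e.
  by have := half_not_int i0; rewrite -e iD.
- have hv : Num.min (D 0) (D 1) <= D 1 + 2^-1 <= Num.max (D 0) (D 1).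
    by rewrite (min_r (ltW lt)) (max_l (ltW lt)); have := int_sep i1 i0 lt; lra.
  have [t] := IVT lt01 cD hv; rewrite in_itv /= => ht e.
  by have := half_not_int i1; rewrite -e iD.
Qed.

Section Square.
Variable H : 'cV[R]_2 -> X.
Hypothesis cH : continuous H.

Definition unit_square : set 'cV[R]_2 := [set x | 0 <= px x <= 1 /\ 0 <= py x <= 1].

Lemma unit_square_compact : compact unit_square.
Proof.
have -> : unit_square = (fun t : R * R => mkv t.1 t.2) @` (`[0, 1] `*` `[0, 1]).
  apply/seteqP; split=> [x [h1 h2]|_ [[a b] [/= ha hb] <-]].
    exists (px x, py x); first by split; rewrite /= in_itv.
    by apply: vecP; rewrite pE.
  by move: ha hb; rewrite !in_itv /= => ha hb; split; rewrite pE.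
apply: continuous_compact; last by apply: compact_setX; exact: segment_compact.
apply: continuous_subspaceT; apply: mkv_continuous => t; [exact: cvg_fst|exact: cvg_snd].
Qed.

Lemma square_lift : exists2 L : 'cV[R]_2 -> R, continuous L &
  forall a b, 0 <= a <= 1 -> 0 <= b <= 1 -> L (mkv a b) - w (H (mkv a b)) \is a Num.int.
Proof.
have c0 := @clamp01_bounds R.
pose cl (x : 'cV[R]_2) := mkv (clamp01 (px x)) (clamp01 (py x)).
have ccl : continuous cl.
  apply: mkv_continuous => x; apply: continuous_comp; try exact: clamp01_continuous.
    exact: px_continuous.
  exact: py_continuous.
have clA x : unit_square (cl x) by split; rewrite pE c0.
have cl_id x : unit_square x -> cl x = x.
  by move=> [h1 h2]; apply: vecP; rewrite pE clamp01_id.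
have starA x (t : R) : unit_square x -> 0 <= t <= 1 -> unit_square (t *: x).
  move=> [/andP[h1 h2] /andP[h3 h4]] /andP[t0 t1].
  by split; rewrite pE mulr_ge0 //= mulr_ile1.
have bA x : unit_square x -> `|x| <= 1.
  move=> [/andP[h1 h2] /andP[h3 h4]].
  rewrite /Num.norm /= mx_normrE; apply: bigmax_le => // -[i j] _ /=.
  have [->|->] : i = 0 \/ i = 1 by case: i => -[|[|//]] ?; [left|right]; exact: val_inj.
    by rewrite (ord1 j) -/(px x) ger0_norm.
  by rewrite (ord1 j) -/(py x) ger0_norm.
have [L cL hL] := star_lift cH unit_square_compact ccl clA cl_id starA bA.
exists L => // a b ha hb; apply: hL; by split; rewrite pE.
Qed.

(** One lift over the square restricts to its four edges, and its increments along the two ways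
    between opposite corners agree. *)
Lemma square_lifts : exists L01 L11 L0 L1 : R -> R,
  [/\ lifts (fun t => H (mkv t 0)) L0, lifts (fun t => H (mkv t 1)) L1,
      lifts (fun t => H (mkv 0 t)) L01, lifts (fun t => H (mkv 1 t)) L11 &
      (L0 1 - L0 0) + (L11 1 - L11 0) = (L01 1 - L01 0) + (L1 1 - L1 0)].
Proof.
have [L cL hL] := square_lift.
have cst (a : R) : continuous (fun t : R => a) by move=> t; exact: cvg_cst.
have cid : continuous (fun t : R => t) by move=> t.
have comp (p q : R -> R) : continuous p -> continuous q -> continuous (fun t => L (mkv (p t) (q t))).
  move=> cp cq t; apply: (@continuous_comp _ _ _ (fun t => mkv (p t) (q t)) L); last exact: cL.
  exact: mkv_continuous.
have b0 : 0 <= (0 : R) <= 1 by apply/andP; split; [exact: lexx|exact: ler01].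
have b1 : 0 <= (1 : R) <= 1 by apply/andP; split; [exact: ler01|exact: lexx].
exists (fun t => L (mkv 0 t)), (fun t => L (mkv 1 t)), (fun t => L (mkv t 0)), (fun t => L (mkv t 1)).
split; [| | | |ring].
all: by split=> [|t ht]; [exact: comp|exact: hL].
Qed.

End Square.

Lemma lifts_exist (p : R^o -> X) : continuous p -> exists L, lifts p L.
Proof.
move=> cp; have cH : continuous (fun x : 'cV[R]_2 => p (px x)).
  move=> x; apply: (@continuous_comp _ _ _ (@px R : 'cV[R]_2 -> R^o) p); last exact: cp.
  exact: px_continuous.
have [_ [_ [L [_ [h _ _ _ _]]]]] := square_lifts cH; exists L.
by case: h => c h; split=> // t ht; have := h t ht; rewrite pE.
Qed.

Lemma lifts_cst (p : R^o -> X) L x : lifts p L -> (forall t, p t = x) -> L 1 = L 0.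
Proof.
move=> h e; apply/eqP; rewrite -subr_eq0; apply/eqP.
have := @lifts_uniq p L (fun=> w x) h; rewrite subrr; apply.
by split=> [t|t _]; [exact: cvg_cst|rewrite e subrr int_num0].
Qed.

(** Subtracting the difference of [w] at the ends makes the increment of a lift an integer even for
    paths that are not closed. The correction is a coboundary, so the result is an integral
    cocycle. *)
Lemma winding_ex (s : singular_simplex R 1 X) : exists m : int, exists2 L, lifts (path_of s) L &
  L 1 - L 0 - (w (path_of s 1) - w (path_of s 0)) = m%:~R.
Proof.
have [L hL] : exists L, lifts (path_of s) L by apply: lifts_exist; exact: cts_fun.
have : L 1 - L 0 - (w (path_of s 1) - w (path_of s 0)) \is a Num.int.
  rewrite (_ : _ - _ = (L 1 - w (path_of s 1)) - (L 0 - w (path_of s 0))); last by ring.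
  by case: hL => _ h; rewrite rpredB // h // lexx ler01.
by move/intrP => [m e]; exists m, L.
Qed.

Definition winding (s : singular_simplex R 1 X) : int := sval (cid (winding_ex s)).

Lemma windingE s (L : R -> R) : lifts (path_of s) L ->
  (winding s)%:~R = L 1 - L 0 - (w (path_of s 1) - w (path_of s 0)).
Proof.
move=> h; rewrite /winding; case: cid => m /= [L' h' <-].
by rewrite (lifts_uniq h h').
Qed.

Section Triangle.
Variable s : singular_simplex R 2 X.

(** A map from the square onto the triangle that collapses the edge [px = 0] to a vertex and carries
    the other edges to the three faces. *)
Definition mk2_row (x : 'cV[R]_2) : 'rV[R]_3 :=
  \row_(j < 3) if j == 0 then 1 - clamp01 (px x)
    else if j == 1 then clamp01 (px x) * (1 - clamp01 (py x)) else clamp01 (px x) * clamp01 (py x).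

Lemma mk2_row_subproof x : mk2_row x \in stdsimplex R 3.
Proof.
apply/mem_set; have /andP[h0 h1] := @clamp01_bounds R (px x).
have /andP[h2 h3] := @clamp01_bounds R (py x); split=> [i|].
  by rewrite mxE; do 2?case: ifP => _; rewrite ?mulr_ge0 ?subr_ge0.
by rewrite !big_ord_recr big_ord0 /= !mxE /=; ring.
Qed.

Definition mk2_simplex x : stdsimplex R 3 := exist _ (mk2_row x) (mk2_row_subproof x).

Lemma mk2_simplex_continuous : continuous mk2_simplex.
Proof.
apply: continuous_comp_initial.
pose e k : 'rV[R]_3 := delta_mx 0 k.
have -> : val \o mk2_simplex = fun x => (1 - clamp01 (px x)) *: e 0
    + (clamp01 (px x) * (1 - clamp01 (py x))) *: e 1 + (clamp01 (px x) * clamp01 (py x)) *: e ord_max.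
  apply/funext => x; apply/rowP => j; rewrite !mxE /=.
  by case: j => -[|[|[|//]]] p /=; ring.
have ca : continuous (fun x : 'cV[R]_2 => clamp01 (px x)).
  move=> x; apply: continuous_comp; [exact: px_continuous|exact: clamp01_continuous].
have cb : continuous (fun x : 'cV[R]_2 => clamp01 (py x)).
  move=> x; apply: continuous_comp; [exact: py_continuous|exact: clamp01_continuous].
have c1 (f : 'cV[R]_2 -> R) : continuous f -> continuous (fun x => 1 - f x).
  by move=> cf x; apply: (@continuousB R R^o _ (fun=> 1) f); [apply: cvg_cst; exact: nbhs_filter|exact: cf].
have cM (f h : 'cV[R]_2 -> R) : continuous f -> continuous h -> continuous (fun x => f x * h x).
  by move=> cf ch x; apply: (@continuousM R _ f h); [exact: cf|exact: ch].
have cZ (f : 'cV[R]_2 -> R) k : continuous f -> continuous (fun x => f x *: e k).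
  move=> cf x; apply: (@continuousZ R 'rV[R]_3 _ f (fun=> e k)); [exact: cf|apply: cvg_cst; exact: nbhs_filter].
have cD (f h : 'cV[R]_2 -> 'rV[R]_3) : continuous f -> continuous h -> continuous (fun x => f x + h x).
  by move=> cf ch x; apply: (@continuousD R 'rV[R]_3 _ f h); [exact: cf|exact: ch].
apply: (cD (fun x => _ *: _ + _ *: _) (fun x => _ *: _)); first apply: cD.
- exact: cZ (c1 _ ca).
- exact: cZ (cM _ _ ca (c1 _ cb)).
- exact: cZ (cM _ _ ca cb).
Qed.

Let H (x : 'cV[R]_2) : X := s (mk2_simplex x).

Lemma triangle_faces t : [/\ path_of (face 0 s) t = H (mkv 1 t), path_of (face 1 s) t = H (mkv t 1),
  path_of (face ord_max s) t = H (mkv t 0) & H (mkv 0 t) = H (mkv 0 0)].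
Proof.
have k0 : clamp01 0 = 0 :> R by rewrite clamp01_id // lexx ler01.
have k1 : clamp01 1 = 1 :> R by rewrite clamp01_id // lexx ler01.
rewrite /H /path_of /face /=; split; congr (s _); apply: val_inj; apply/rowP => j /=.
all: rewrite !mxE !pE ?k0 ?k1 /=.
all: try (case: (unliftP _ j) => [i|] -> /=; rewrite ?mxE).
all: try (case: i => -[|[|//]] p /=; ring).
all: try ring.
case: j => -[|[|[|//]]] p /=; ring.
Qed.

Lemma winding_boundary : winding (face 0 s) - winding (face 1 s) + winding (face ord_max s) = 0.
Proof.
have cH : continuous H.
  move=> x; apply: continuous_comp; [exact: mk2_simplex_continuous|exact: cts_fun].
have [L01 [L11 [L0 [L1 [h0 h1 h01 h11 e]]]]] := square_lifts cH.
have F t : [/\ path_of (face 0 s) t = H (mkv 1 t), path_of (face 1 s) t = H (mkv t 1),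
  path_of (face ord_max s) t = H (mkv t 0) & H (mkv 0 t) = H (mkv 0 0)] := triangle_faces t.
have l (p q : R^o -> X) L : lifts p L -> (forall t, q t = p t) -> lifts q L.
  by move=> [c h] pq; split=> // t ht; rewrite pq h.
have w0 := windingE (l _ (path_of (face 0 s)) _ h11 (fun t => let: And4 a _ _ _ := F t in a)).
have w1 := windingE (l _ (path_of (face 1 s)) _ h1 (fun t => let: And4 _ a _ _ := F t in a)).
have w2 := windingE (l _ (path_of (face ord_max s)) _ h0 (fun t => let: And4 _ _ a _ := F t in a)).
have c := lifts_cst h01 (fun t => let: And4 _ _ _ a := F t in a).
apply: (@intr_inj R); rewrite intrD intrB w0 w1 w2.
case: (F 0) => -> -> -> _; case: (F 1) => -> -> -> <-.
by rewrite (_ : 0%:~R = 0 :> R) //; move: e; rewrite c; move: (w _) (w _) (w _) => a1 a2 a3; lra.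
Qed.

End Triangle.

Variable G : zmodType.

(** Evaluation of the cocycle [winding] on chains with arbitrary coefficients. *)
Definition circulation (c : chain R G 1 X) : G := lin (fun s x => x *~ winding s) c.

Lemma circulation_add (s : singular_simplex R 1 X) : {morph (fun x : G => x *~ winding s) : x y / x + y}.
Proof. by move=> x y; rewrite mulrzDl. Qed.

Lemma circulationD : {morph circulation : c d / c + d}.
Proof. exact: (linD circulation_add). Qed.

Lemma circulation_sum I (r : seq I) (P : pred I) (F : I -> chain R G 1 X) :
  circulation (\sum_(i <- r | P i) F i) = \sum_(i <- r | P i) circulation (F i).
Proof. exact: (lin_sum circulation_add). Qed.

Lemma circulationU x s : circulation << x *g s >> = x *~ winding s.
Proof. exact: (linU circulation_add). Qed.

Lemma circulation_boundary (d : chain R G 2 X) : circulation (boundary d) = 0.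
Proof.
move: d; apply: (malg_ext (f2 := fun=> 0)) => [c d|c d|x s].
- by rewrite boundaryD circulationD.
- by rewrite addr0.
rewrite boundaryU circulation_sum !big_ord_recr big_ord0 /= add0r !circulationU.
rewrite expr0 expr1 sqrrN expr1n mulr1z mulrN1z mulNrz.
rewrite -mulrzBr -mulrzDr.
rewrite (_ : _ + _ = winding (face 0 s) - winding (face 1 s) + winding (face ord_max s)).
  by rewrite winding_boundary mulr0z.
by congr (winding (face _ s) - winding (face _ s) + winding (face _ s)); apply: val_inj.
Qed.

End Winding.

Lemma morphMz (U V : zmodType) (f : U -> V) (fD : {morph f : x y / x + y}) x (l : int) :
  f (x *~ l) = f x *~ l.
Proof.
have f0 : f 0 = 0 by apply: (addrI (f 0)); rewrite -fD !addr0.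
have fN y : f (- y) = - f y by apply: (addrI (f y)); rewrite -fD !subrr.
have fMn m : f (x *+ m) = f x *+ m by elim: m => [//|m IH]; rewrite !mulrS fD IH.
by case: l => m; rewrite ?NegzE ?mulrNz -!pmulrn ?fN fMn.
Qed.

(** * Cocycles that detect the sides *)

Section SideCocycles.
Variables (R : realType) (n : nat).
Context {n_ok : odd_ge5 n}.
Let n_odd : odd n := n_is_odd.
Let n_ge5 : (5 <= n)%N := n_is_ge5.
Implicit Types (b : bool) (j k l : nat).

Local Notation vertex := (vertex R n).
Local Notation polygon := (@polygon R n).
Local Notation hf := (@hf R n).
Local Notation c1 := (c1 R n).
Local Notation c3 := (c3 R n).
Local Notation sg := (@sg R).
Local Notation surface := (surface R n).
Local Notation shift := (side_shift R n).
Local Notation sp := (@sp R n n_ok).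
Local Notation sing := (@sing R n n_ok).
Local Notation rpb := (@rpb R n).
Local Notation rpv := (@rpv R n).
Local Notation ltn_modn := (@ltn_modn n n_ok).
Local Notation gam := (@gam R n n_ok).

Section Bump.
Variable j : nat.
Hypothesis jn : (j < n)%N.
Let j' := (j.+1 %% n)%N.
Let j'n : (j' < n)%N. Proof. exact: ltn_modn. Qed.

Lemma j_neq : j != j'.
Proof. by apply/eqP; rewrite /j' modSn //; case: eqP => ?; lia. Qed.

(** The affine function with value 1 at [vertex j.+1] and 0 at the two neighbouring vertices. It is
    at most 0 at all vertices but [vertex j.+1], so its positive part [bump] is a hat at this corner
    and affine on every side. *)
Definition ell (x : 'cV[R]_2) : R := (hf j x + hf j.+1 x - (c1 + c3)) / (c1 - c3).
Definition bump (x : 'cV[R]_2) : R := Num.max 0 (ell x).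

Let c13 : 0 < c1 - c3. Proof. by rewrite subr_gt0 c3_lt_c1. Qed.

Lemma ell_comb t (x y : 'cV[R]_2) : ell ((1 - t) *: x + t *: y) = (1 - t) * ell x + t * ell y.
Proof. by rewrite /ell !hfD !hfZ; field; rewrite lt0r_neq0. Qed.

Lemma ell_vertices : [/\ ell (vertex j) = 0, ell (vertex j.+1) = 1 & ell (vertex j.+2) = 0].
Proof.
have e1 : hf j (vertex j.+2) = c3 by rewrite hf_vertexE /c3; congr (cs _ _ _); lia.
have e2 : hf j.+1 (vertex j) = c3 by rewrite hf_vertexE /c3; congr (cs _ _ _); lia.
have h : c1 - c3 != 0 by rewrite lt0r_neq0.
rewrite /ell !hf_vertex !hf_vertexS e1 e2; split; by field.
Qed.

Lemma ell_vertex_le k : (k < n)%N -> k != j' -> ell (vertex k) <= 0.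
Proof.
move=> kn kj'; rewrite /ell; apply: mulr_le0_ge0; last by rewrite invr_ge0 ltW.
rewrite subr_le0; have [->|kj] := eqVneq k j.
  by rewrite hf_vertex lerD2l hf_vertexE /c3 le_eqVlt; apply/orP; left; apply/eqP; congr (cs _ _ _); lia.
by rewrite [leRHS]addrC; apply: lerD; [exact: (@hf_vertex_far R n n_ok)|exact: (@hf_vertex_le R n n_ok)].
Qed.

Lemma bump_vertex k : (k < n)%N -> bump (vertex k) = (k == j')%:R.
Proof.
move=> kn; rewrite /bump; case: eqP => [->|/eqP ne].
  by rewrite /j' vertex_mod; case: ell_vertices => _ -> _; rewrite max_r ?ler01.
by rewrite max_l // ell_vertex_le.
Qed.

Definition bump_slope k : int := if k == j then 1 else if k == j' then -1 else 0.

Lemma bump_side k s : (k < n)%N -> 0 <= s <= 1 ->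
  bump ((1 - s) *: vertex k + s *: vertex k.+1) = (k == j')%:R + s * (bump_slope k)%:~R.
Proof.
move=> kn /andP[s0 s1']; have s1 : 0 <= 1 - s by lra.
rewrite /bump /bump_slope ell_comb; case: ell_vertices => e0 e1 e2.
have jj' := j_neq.
case: (eqVneq k j) => [->|kj].
  by rewrite (negbTE jj') e0 e1 mulr1z max_r /=; lra.
case: (eqVneq k j') => [->|kj'].
  have -> : ell (vertex j') = 1 by rewrite /j' vertex_mod.
  have -> : ell (vertex j'.+1) = 0.
    by rewrite -vertex_mod /j' -addn1 modnDml addn1 vertex_mod.
  by rewrite mulrN1z max_r /=; lra.
have h0 : ell (vertex k) <= 0 by exact: ell_vertex_le.
have h1 : ell (vertex k.+1) <= 0.
  rewrite -vertex_mod; apply: ell_vertex_le; first exact: ltn_modn.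
  apply: contra kj; rewrite /j' !modSn //; case: (k.+1 =P n) => ?; case: (j.+1 =P n) => ? /eqP ?; apply/eqP; lia.
rewrite max_l /= ?mulr0 ?addr0 //.
by apply: (@le_trans _ _ 0) => //; rewrite -[0]addr0; apply: lerD; rewrite mulr_ge0_le0.
Qed.

Lemma bump_continuous : continuous bump.
Proof.
move=> x; apply: continuous_max; first exact: cst_continuous.
have h k := @hf_continuous R n k.
apply: (@continuousM R _ (fun x => hf j x + hf j.+1 x - (c1 + c3)) (fun=> (c1 - c3)^-1)); last exact: cst_continuous.
apply: (@continuousB R R^o _ (fun x => hf j x + hf j.+1 x) (fun=> c1 + c3)); last exact: cst_continuous.
by apply: (@continuousD R R^o _ (hf j) (hf j.+1)); exact: h.
Qed.

(* Represents a map from the surface to [R / Z] that wraps the [j]-th side once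
   around the circle, the next side once backwards, and is constant on the other
   sides. *)
Definition wrap b (x : 'cV[R]_2) : R := sg b * bump (sg b *: x).
Definition wrapS (x : surface) : R := wrap (rpb x) (rpv x).

Lemma wrap_vertex b k : wrap b (sg b *: vertex k) \is a Num.int.
Proof.
rewrite /wrap sgK -vertex_mod bump_vertex ?ltn_modn //.
by case: b; rewrite ?sg1 ?sg0 ?mulN1r ?mul1r ?rpredN natr_int.
Qed.

(** On a side the gluing replaces [s] by [1 - s], and the values of the affine function [bump] at
    these parameters have an integral sum. So the sign in [wrap] makes the values agree modulo
    integers. *)
Lemma wrap_glue k x : (k < n)%N -> side n false k x ->
  wrap false x - wrap true (x - shift k) \is a Num.int.
Proof.
move=> kn [s]; rewrite /= in_itv /= => hs <-.
have spE b r : wrap b (side_point n b k r) = sg b * bump ((1 - r) *: vertex k + r *: vertex k.+1).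
  by rewrite /wrap /side_point sgE sgK.
have := @side_point_partner R n false k s; rewrite /partner sg0 scale1r => ->.
have hs' : 0 <= 1 - s <= 1 by move/andP: hs => [? ?]; apply/andP; split; lra.
rewrite !spE sg0 sg1 mul1r mulN1r opprK !bump_side //.
rewrite (_ : _ + _ = (k == j')%:R + (k == j')%:R + (bump_slope k)%:~R); last by ring.
by rewrite !rpredD ?natr_int ?intr_int.
Qed.

Lemma wrap_continuous b : continuous (wrap b).
Proof.
rewrite /wrap => x; apply: (@continuousM R _ (fun=> sg b) (fun x : 'cV[R]_2 => bump (sg b *: x))); first exact: cst_continuous.
apply: (@continuous_comp _ _ _ (fun x : 'cV[R]_2 => sg b *: x) bump); last exact: bump_continuous.
exact: scaler_continuous.
Qed.

Lemma frac_norm_int_sub (r r' c : R) : r - r' \is a Num.int -> `|frac (r - c)| = `|frac (r' - c)|.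
Proof.
by move=> h; rewrite -(@frac_norm_int R (r' - c) _ h) (_ : r' - c + _ = r - c) //; ring.
Qed.

(** [wrap] itself is not compatible with the gluing, but its distance modulo integers to a constant
    is, so the lifting lemmas for the quotient apply to this distance. *)
Lemma wrap_frac_glue c k x : (k < n)%N -> side n false k x ->
  `|frac (wrap false x - c)| = `|frac (wrap true (x - shift k) - c)|.
Proof. by move=> kn sx; apply: frac_norm_int_sub; exact: wrap_glue. Qed.

Lemma wrap_frac_vtx c b b' k l :
  `|frac (wrap b (sg b *: vertex k) - c)| = `|frac (wrap b' (sg b' *: vertex l) - c)|.
Proof. by apply: frac_norm_int_sub; rewrite rpredB // wrap_vertex. Qed.

Lemma wrapS_sp b x : polygon b x -> wrapS (sp b x) - wrap b x \is a Num.int.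
Proof.
move=> Px.
have := @slift_sp R n n_ok R (fun b' z => `|frac (wrap b' z - wrap b x)|)
  (wrap_frac_glue (wrap b x)) (wrap_frac_vtx (wrap b x)) b x Px.
rewrite subrr frac_small ?normr0 ?invr_gt0 ?ltr0n // => /normr0_eq0 e.
by have := frac_int (wrapS (sp b x) - wrap b x); rewrite e subr0.
Qed.

Lemma wrapS_near (x : surface) (e : R) : 0 < e -> \forall y \near x, `|frac (wrapS y - wrapS x)| < e.
Proof.
move=> e0.
have cF : continuous (@slift R n R (fun b z => `|frac (wrap b z - wrapS x)|)).
  apply: (@slift_continuous R n n_ok R _ (wrap_frac_glue (wrapS x)) (wrap_frac_vtx (wrapS x))).
  move=> b z; apply: (@continuous_comp _ _ _ (fun z => wrap b z - wrapS x) (fun r : R => `|frac r|)).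
    apply: (@continuousB R R^o _ (wrap b) (fun=> wrapS x)); [exact: wrap_continuous|exact: cst_continuous].
  exact: frac_norm_continuous.
have := cF x; rewrite /continuous_at /slift -/(wrapS x) subrr frac_small ?normr0 ?invr_gt0 ?ltr0n //.
by move=> /cvgrPdist_lt /(_ e e0); apply: nbhsS => y /=; rewrite sub0r normrN normr_id.
Qed.

Lemma circulation_gam (G : zmodType) (phi : int -> G) (phiD : {morph phi : x y / x + y}) k :
  (k < n)%N -> circulation wrapS_near (push phi (gam k)) = phi 1 *~ bump_slope k.
Proof.
move=> kn; rewrite /gam /seg (pushU phiD) circulationU; congr (_ *~ _).
set s := aff _ _; apply: (@intr_inj R).
have pE t : path_of s t = sp false ((1 - clamp01 t) *: vertex k + clamp01 t *: vertex k.+1).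
  transitivity (sp false (\sum_i val (mk1 t) 0 i *: (if i == 0 then vertex k else vertex k.+1))); first by [].
  by rewrite sum2 !mxE.
have c0 : clamp01 0 = 0 :> R by rewrite clamp01_id // lexx ler01.
have c1' : clamp01 1 = 1 :> R by rewrite clamp01_id // lexx ler01.
have h : lifts wrapS (path_of s) (fun t => bump ((1 - t) *: vertex k + t *: vertex k.+1)).
  split=> [t|t ht].
    apply: (@continuous_comp _ _ _ (fun t : R => (1 - t) *: vertex k + t *: vertex k.+1) bump); last exact: bump_continuous.
    apply: cvgD; apply: cvgZr_tmp; last exact: cvg_id.
    by apply: cvgB; [exact: cvg_cst|exact: cvg_id].
  have Px : polygon false ((1 - t) *: vertex k + t *: vertex k.+1).
    by apply: (@side_polygon R n n_ok false k); exists t => //; rewrite /side_point expr0 scale1r.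
  rewrite pE clamp01_id //; have := wrapS_sp Px.
  by rewrite /wrap sg0 mul1r scale1r -rpredN opprB.
have v l : sp false (vertex l) = sing.
  by have := @sp_vertex R n n_ok false l; rewrite sg0 scale1r => ->.
have b0 : 0 <= (0 : R) <= 1 by rewrite lexx ler01.
have b1 : 0 <= (1 : R) <= 1 by rewrite lexx ler01.
rewrite (windingE wrapS_near h) !pE c0 c1' !bump_side //.
by rewrite !subrr !subr0 !scale0r !scale1r !add0r !addr0 !v; ring.
Qed.

End Bump.

(** Evaluating the [j]-th cocycle leaves only the coefficients of two consecutive sides, with
    opposite signs. So all coefficients of a relation agree up to the annihilator of [phi 1]. *)
Lemma gam_independent (G : zmodType) (phi : int -> G) (phiD : {morph phi : x y / x + y})
    (m : nat -> int) (d : chain R G 2 surface) j : (j < n)%N ->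
  \sum_(k < n) push phi (gam k) *~ m k = boundary d ->
  phi 1 *~ (m j - m (j.+1 %% n)%N) = 0.
Proof.
move=> jn e; have := circulation_boundary (wrapS_near (j := j) jn) d.
rewrite -e circulation_sum => <-.
have cM (c : chain R G 1 surface) (l : int) : circulation (wrapS_near jn) (c *~ l) = circulation (wrapS_near jn) c *~ l.
  exact: (morphMz (@circulationD _ _ _ _ G)).
rewrite (eq_bigr (fun k : 'I_n => phi 1 *~ (bump_slope j k * m k))); last first.
  by move=> k _; rewrite cM circulation_gam // -mulrzA.
have j'n : (j.+1 %% n < n)%N by exact: ltn_modn.
rewrite (bigD1 (Ordinal jn)) //= (bigD1 (Ordinal j'n)) /=; last first.
  by rewrite -val_eqE /= eq_sym j_neq.
rewrite big1 => [|k /andP[/negP k1 /negP k2]]; last first.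
  rewrite /bump_slope; case: eqP => [h|_]; first by case: k1; apply/eqP/val_inj.
  by case: eqP => [h|_]; [case: k2; apply/eqP/val_inj|rewrite mul0r mulr0z].
rewrite /bump_slope !eqxx; case: eqP => [h|_].
  by have := j_neq jn; rewrite h eqxx.
by rewrite addr0 -mulrzDr mul1r mulN1r.
Qed.

End SideCocycles.

Lemma bd_sum (R : realType) (X : topologicalType) I (r : seq I) (P : pred I) (F : I -> chain R int 1 X) :
  (forall i, P i -> bd (F i)) -> bd (\sum_(i <- r | P i) F i).
Proof. by move=> h; elim/big_ind: _ => //; [exact: bd0|exact: bdD]. Qed.

Lemma bdMz (R : realType) (X : topologicalType) (c : chain R int 1 X) (l : int) : bd c -> bd (c *~ l).
Proof.
move=> [d ->]; exists (d *~ l); rewrite -(morphMz (@boundaryD R int 1 X)).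
by [].
Qed.

(** * A congruence group of level 8 for [n = 5] *)

Section CoreCurves.
Variables (R : realType) (n : nat).
Context {n_ok : odd_ge5 n}.
Let n_odd : odd n := n_is_odd.
Let n_ge5 : (5 <= n)%N := n_is_ge5.
Local Notation vertex := (vertex R n).
Local Notation spc := (@spc R n n_ok).
Local Notation V0 := (@V0 R n).
Local Notation gam := (@gam R n n_ok).
Local Notation eta := (@eta R n n_ok).
Local Notation g := (half n).
Local Notation vX := (vX R n).
Local Notation vY := (vY R n).
Let g2 : (n = 2 * g + 1)%N.
Proof. by rewrite /half; have := odd_double_half n; rewrite n_odd; lia. Qed.

Lemma vertex_left i : (i < n)%N -> vertex (n - 1 - i) = mkv (- vX i) (vY i).
Proof.
move=> ip; have e : (2 * (n - 1 - i) + 1 = 2 * n - (2 * i + 1))%N by lia.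
by rewrite vertexE /vX /vY e sn_sub2n ?cs_sub2n //; lia.
Qed.

(** Each of the two chords of [eta i] is replaced by an arc of sides of its polygon; the arc in
    [polygon true] counts negatively. *)
Lemma eta_gam i : (i < g)%N -> bd (eta i -
  (\sum_(j < 2 * i + 1) gam (n - 1 - i + j) - \sum_(j < n - 3 - 2 * i) gam (i.+1 + j))).
Proof.
move=> ig.
have h1 := @seg_vertices R n n_ok false (n - 1 - i) (2 * i + 1).
have h2 := @seg_vertices R n n_ok true i.+1 (n - 3 - 2 * i).
rewrite /V0 sg0 !scale1r expr0 mulr1z in h1.
rewrite /V0 sg1 !scaleN1r expr1 mulrNz mulr1z opprK in h2.
have e1 : vertex (n - 1 - i + (2 * i + 1)) = vertex i.
  by rewrite (_ : n - 1 - i + (2 * i + 1) = i + n)%N ?vertex_addn //; lia.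
have e2 : vertex (i.+1 + (n - 3 - 2 * i)) = mkv (- vX i.+1) (vY i.+1).
  by rewrite -vertex_left; [congr (Defs.vertex _ _ _); lia|lia].
have NE (a b : R) : - mkv a b = mkv (- a) (- b).
  by apply: vecP; rewrite ?pxN ?pyN ?px_mkv ?py_mkv.
rewrite e1 vertex_left ?vertexE in h1; last by lia.
rewrite e2 vertexE !NE (opprK (vX i.+1)) in h2.
rewrite /eta /eta1 /eta2.
by apply: (bd_eq (bdD h1 h2)); abel.
Qed.

Lemma sum_gam : bd (\sum_(k < n) gam k).
Proof.
have h := @seg_vertices R n n_ok false 0 n.
rewrite expr0 mulr1z /V0 vertex_addn in h.
by apply: (bd_eq (bdB (seg_point (spc false) _) h)); exact: subKr.
Qed.

Lemma gam_cycle k : boundary (gam k) = 0.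
Proof.
rewrite /gam /seg boundaryU !big_ord_recr big_ord0 /= add0r !face_aff expr0 expr1 !intz monalgUN.
apply/eqP; rewrite subr_eq0; apply/eqP; congr << _ *g _ >>; apply/continuousEP => t.
have [t0 t1] : stdsimplex R 1 (val t) by exact: set_mem (valP t).
rewrite !affE !big_ord1 in t1 *.
have -> : val t 0 0 = 1 by rewrite -t1; congr (val t 0 _); exact: val_inj.
rewrite !scale1r /=.
have v l : (spc false : _ -> _) (vertex l) = sing R (n_ok := n_ok).
  by have := @sp_vertex R n n_ok false l; rewrite sg0 scale1r => <-.
by rewrite !v.
Qed.

End CoreCurves.

(** * Integer matrices of size 5 *)

Section Tables.
Implicit Types (A B : seq (seq int)) (F : nat -> nat -> int).

(** Matrices are nested lists, so that [vm_compute] decides identities between concrete ones. *)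
Definition ent A j k : int := nth 0 (nth [::] A j) k.
Definition tab F := [seq [seq F j k | k <- iota 0 5] | j <- iota 0 5].
Definition tab1 := tab (fun j k => (j == k)%:R).
Definition tabM A B := tab (fun i k => ent A i 0 * ent B 0 k + ent A i 1 * ent B 1 k +
  ent A i 2 * ent B 2 k + ent A i 3 * ent B 3 k + ent A i 4 * ent B 4 k).

Lemma ent_tab F j k : (j < 5)%N -> (k < 5)%N -> ent (tab F) j k = F j k.
Proof.
by move=> hj hk; rewrite /ent /tab (nth_map 0%N) ?size_iota // (nth_map 0%N) ?size_iota // !nth_iota.
Qed.

Lemma ent_tabM A B i k : (i < 5)%N -> (k < 5)%N -> ent (tabM A B) i k = \sum_(j < 5) ent A i j * ent B j k.
Proof. by move=> hi hk; rewrite ent_tab // !big_ord_recr big_ord0 /= add0r. Qed.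

Lemma dvdz_sum_prod (d : int) (a a' b b' : 'I_5 -> int) :
  (forall j, (d %| a j - a' j)%Z) -> (forall j, (d %| b j - b' j)%Z) ->
  (d %| \sum_j a j * b j - \sum_j a' j * b' j)%Z.
Proof.
move=> ha hb; rewrite -sumrB; apply: rpred_sum => j _.
rewrite (_ : _ - _ = a j * (b j - b' j) + (a j - a' j) * b' j); last by ring.
by apply: rpredD; [exact: dvdz_mull (hb j)|exact: dvdz_mulr (ha j)].
Qed.

Lemma forall2_lt5 (P : nat -> nat -> bool) :
  all (fun j => all (P j) (iota 0 5)) (iota 0 5) ->
  forall j k, (j < 5)%N -> (k < 5)%N -> P j k.
Proof.
move=> /allP h j k hj hk; have /h/allP h' : j \in iota 0 5 by rewrite mem_iota.
by apply: h'; rewrite mem_iota.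
Qed.

End Tables.

#[global] Instance five_ok : odd_ge5 5 := @OddGe5 5 isT isT.

(** * Affine maps of the double pentagon *)

Section Pentagons.
Variable R : realType.
Local Notation surface := (surface R 5).
Local Notation smap := (continuousType surface surface).
Local Notation gam := (@gam R 5 five_ok).
Local Notation eta := (@eta R 5 five_ok).
Local Notation twist_map := (@twist_map R 5 five_ok).
Local Notation rot_map := (@rot_map R 5 five_ok).
Local Notation twist_iter := (@twist_iter R 5 five_ok).
Local Notation T := (T_mx R 5).
Local Notation rotm := (@rotm R 5).
Local Notation veech := (@veech_group R 5).
Implicit Types (f h : smap) (A B : seq (seq int)) (v : nat -> int).

Definition comb v : chain R int 1 surface := \sum_(j < 5) gam j *~ v j.

Lemma combD v (v' : nat -> int) : comb (fun j => v j + v' j) = comb v + comb v'.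
Proof. by rewrite /comb -big_split; apply: eq_bigr => j _; rewrite mulrzDr. Qed.

Lemma combZ (l : int) v : comb (fun j => l * v j) = comb v *~ l.
Proof.
rewrite /comb (morphMz (f := fun c : chain R int 1 surface => c)) // mulrz_suml.
by apply: eq_bigr => j _; rewrite -mulrzA mulrC.
Qed.

Lemma comb_eq v (v' : nat -> int) : (forall j, (j < 5)%N -> v j = v' j) -> comb v = comb v'.
Proof. by move=> h; apply: eq_bigr => j _; rewrite h. Qed.

Lemma comb_delta k : (k < 5)%N -> comb (fun j => (j == k)%:R) = gam k.
Proof.
move=> hk; rewrite /comb (bigD1 (Ordinal hk)) //= eqxx mulr1z big1 ?addr0 // => j ne.
have /negbTE -> : (j : nat) != k by move: ne; rewrite -val_eqE.
by rewrite mulr0z.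
Qed.

(** Column [k] of [A] describes the image of the [k]-th side. As the sum of the sides is a boundary,
    [A] is determined by [f] only up to constant columns. *)
Definition act f A := forall k, (k < 5)%N -> bd (chain_map f (gam k) - comb (fun j => ent A j k)).

Lemma chain_map_comb f v : chain_map f (comb v) = \sum_(j < 5) chain_map f (gam j) *~ v j.
Proof.
by rewrite chain_map_sum; apply: eq_bigr => j _; rewrite (morphMz (chain_mapD f)).
Qed.

Lemma act_comb f A v : act f A ->
  bd (chain_map f (comb v) - comb (fun i => \sum_(j < 5) ent A i j * v j)).
Proof.
move=> h; rewrite chain_map_comb.
have -> : comb (fun i => \sum_(j < 5) ent A i j * v j) =
    \sum_(j < 5) comb (fun i => ent A i j) *~ v j.
  rewrite /comb; under eq_bigr do rewrite mulrz_sumr.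
  rewrite exchange_big /=; apply: eq_bigr => j _; rewrite mulrz_suml.
  by apply: eq_bigr => i _; rewrite mulrzA.
rewrite -sumrB; apply: bd_sum => j _; rewrite -mulrzBl; apply: bdMz; exact: h.
Qed.

Lemma act_comp f h A B : act f A -> act h B -> act (f \o h : smap) (tabM A B).
Proof.
move=> hf hh k hk; have := chain_map_bd f (hh k hk); rewrite chain_mapB => H1.
have H2 := act_comb (fun j => ent B j k) hf.
rewrite (chain_map_comp (gam k) (h := f \o h : smap) (f := h) (g := f)) //.
rewrite (comb_eq (v' := fun i => \sum_(j < 5) ent A i j * ent B j k)); last first.
  by move=> j hj; rewrite ent_tabM.
by apply: (bd_eq (bdD H1 H2)); abel.
Qed.

Lemma act_inv f h A B : act f A -> cancel f h -> tabM A B = tab1 -> act h B.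
Proof.
move=> hf fh e k hk; have H := act_comb (fun j => ent B j k) hf.
rewrite (comb_eq (v := fun i => \sum_(j < 5) ent A i j * ent B j k) (v' := fun i => (i == k)%:R)) in H; last first.
  by move=> i hi; rewrite -ent_tabM // e ent_tab.
rewrite comb_delta // in H; have := chain_map_bd h H; rewrite chain_mapB => H2.
have e2 : chain_map h (chain_map f (comb (fun j => ent B j k))) = comb (fun j => ent B j k).
  by rewrite -(chain_map_comp _ (h := h \o f : smap)) // chain_map_id.
rewrite e2 in H2.
by apply: (bd_eq (bdN H2)); abel.
Qed.

Lemma act1 : act (idfun : smap) tab1.
Proof.
move=> k hk; rewrite chain_map_id // (comb_eq (v' := fun i => (i == k)%:R)); last first.
  by move=> j hj; rewrite ent_tab.
by rewrite comb_delta // subrr; exact: bd0.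
Qed.

Lemma sum_gam5 : bd (gam 0 + gam 1 + gam 2 + gam 3 + gam 4).
Proof. by have := @sum_gam R 5 five_ok; rewrite !big_ord_recr big_ord0 /= add0r. Qed.

Lemma eta0_gam : bd (eta 0 - (gam 0 + gam 3 + gam 4 + gam 4)).
Proof.
have := @eta_gam R 5 five_ok 0 isT; rewrite !big_ord_recr !big_ord0 /= !add0r => H.
by apply: (bd_eq (bdB H sum_gam5)); abel.
Qed.

Lemma eta1_gam : bd (eta 1 + gam 1 + gam 2).
Proof.
have := @eta_gam R 5 five_ok 1 isT; rewrite !big_ord_recr !big_ord0 /= !add0r subr0.
have -> : gam (5 - 1 - 1 + 2) = gam 0 by rewrite -(@gam_mod R 5 five_ok (5 - 1 - 1 + 2)).
rewrite -[(5 - 1 - 1 + 0)%N]/3%N -[(5 - 1 - 1 + 1)%N]/4%N => H.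
by apply: (bd_eq (bdD H sum_gam5)); abel.
Qed.

(* [1 + nilT] is the action of the twist on the sides. The relation between the
   sides is used to make its square zero. *)
Definition nilT : seq (seq int) :=
  [:: [:: 1; 0; 0; -1; 0]; [:: 0; -1; 1; 0; 0]; [:: 0; -1; 1; 0; 0];
      [:: 1; 0; 0; -1; 0]; [:: 2; 0; 0; -2; 0]].

Lemma twist_col k : (k < 5)%N -> exists q, [/\ bd (chain_map twist_map (gam k) - gam k - q),
  chain_map twist_map q = q & bd (q - comb (fun j => ent nilT j k))].
Proof.
have z2 (c : chain R int 1 surface) : c *~ 2 = c + c by rewrite -pmulrn mulr2n.
have zN2 (c : chain R int 1 surface) : c *~ (-2) = - (c + c) by rewrite mulrNz z2.
have r0 := @twist_right R 5 five_ok 0 isT; have r1 := @twist_right R 5 five_ok 1 isT.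
have l0 := @twist_left R 5 five_ok 0 isT; have l1 := @twist_left R 5 five_ok 1 isT.
have t0 := @twist_eta R 5 five_ok 0 isT; have t1 := @twist_eta R 5 five_ok 1 isT.
have e0 := eta0_gam; have e1 := eta1_gam.
have gz := (mulr0z, mulr1z, mulrN1z, z2, zN2).
case: k => [|[|[|[|[|//]]]]] _.
- exists (eta 0); split=> //; rewrite /comb !big_ord_recr big_ord0 /= !gz.
  by apply: (bd_eq e0); abel.
- exists (eta 1); split=> //; rewrite /comb !big_ord_recr big_ord0 /= !gz.
  by apply: (bd_eq e1); abel.
- exists (- eta 1); split; first by rewrite opprK.
    by rewrite chain_mapN t1.
  rewrite /comb !big_ord_recr big_ord0 /= !gz.
  by apply: (bd_eq (bdN e1)); abel.
- exists (- eta 0); split; first by rewrite opprK.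
    by rewrite chain_mapN t0.
  rewrite /comb !big_ord_recr big_ord0 /= !gz.
  by apply: (bd_eq (bdN e0)); abel.
exists 0; split; last 2 first.
- by rewrite chain_map0.
- rewrite /comb big1 => [|[[|[|[|[|[|//]]]]] p] _]; try exact: mulr0z.
  by rewrite subrr; exact: bd0.
have e4 : chain_map twist_map (gam 4) = gam 4 by exact: (@twist_bottom R 5 five_ok).
by rewrite e4 subrr subr0; exact: bd0.
Qed.

Definition tabT (m : nat) := tab (fun j k => (j == k)%:R + m%:Z * ent nilT j k).

Lemma act_twist m : act (twist_iter m) (tabT m).
Proof.
move=> k hk; have [q [h1 h2 h3]] := twist_col hk.
have H := @twist_iter_transvection R 5 five_ok _ _ m h1 h2.
rewrite (comb_eq (v' := fun j => (j == k)%:R + m%:Z * ent nilT j k)); last first.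
  by move=> j hj; rewrite ent_tab.
rewrite combD combZ comb_delta //.
have H3 := bdMz m%:Z h3; rewrite mulrzBl -pmulrn in H3.
by apply: (bd_eq (bdD H H3)); abel.
Qed.

Definition tabR := tab (fun j k => - (j == (k + 3) %% 5)%:R)%N.
Definition tabR' := tab (fun j k => - ((j + 3) %% 5 == k)%:R)%N.

Lemma act_rot : act rot_map tabR.
Proof.
move=> k hk; have := @rot_gam R 5 five_ok k; rewrite -[5.+1./2]/3%N -(@gam_mod R 5 five_ok (k + 3)).
have e := comb_delta (ltn_pmod (k + 3) (isT : 0 < 5)%N).
rewrite (comb_eq (v' := fun j => -1 * (j == (k + 3) %% 5)%N%:R)); last first.
  by move=> j hj; rewrite ent_tab // mulN1r.
by rewrite combZ e mulrN1z opprK.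
Qed.

Lemma rot_inverse : exists2 r' : smap, affine_map (rotm 1)^-1 r' &
  [/\ cancel rot_map r', cancel r' rot_map & act r' tabR'].
Proof.
have [r' ar' [h1 h2]] := affine_invE (@rot_affine R 5 five_ok).
exists r' => //; split=> //; apply: act_inv act_rot h1 _.
by vm_compute.
Qed.

(** The inverse of [1 + m nilT], since the square of [nilT] is zero. *)
Definition tabTV (m : nat) := tab (fun j k => (j == k)%:R - m%:Z * ent nilT j k).

Lemma twist_inverse m : tabM (tabT m) (tabTV m) = tab1 -> exists2 t' : smap,
  affine_map (T ^+ m)^-1 t' & [/\ cancel (twist_iter m) t', cancel t' (twist_iter m) & act t' (tabTV m)].
Proof.
move=> e; have [t' at' [h1 h2]] := affine_invE (@twist_iter_affine R 5 five_ok m).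
by exists t' => //; split=> //; apply: act_inv (act_twist m) h1 e.
Qed.

Section Permutations.

(* The pair [(s, c)] stands for the permutation [k |-> s * k + c] of [Z/5]. *)
Definition dihedral : seq (nat * nat) := [seq (s, c) | s <- [:: 1; 4]%N, c <- iota 0 5].
Definition dact (d : nat * nat) k := ((d.1 * k + d.2) %% 5)%N.
Definition dmul (d e : nat * nat) := ((d.1 * e.1) %% 5, (d.1 * e.2 + d.2) %% 5)%N.
Definition dinv (d : nat * nat) := (d.1, (4 * d.1 * d.2) %% 5)%N.

Definition permutes A d := forall j k, (j < 5)%N -> (k < 5)%N -> (2 %| ent A j k - (j == dact d k)%:R)%Z.

(** The condition for the matrix of the inverse map: modulo 2 it is the inverse permutation matrix,
    expressed by [d] itself. *)
Definition copermutes A d := forall j k, (j < 5)%N -> (k < 5)%N -> (2 %| ent A j k - (k == dact d j)%:R)%Z.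

Lemma dact_lt d k : (dact d k < 5)%N. Proof. by rewrite /dact ltn_pmod. Qed.

Lemma dmul_in d e : d \in dihedral -> e \in dihedral -> dmul d e \in dihedral.
Proof.
have /allP h : all (fun d => all (fun e => dmul d e \in dihedral) dihedral) dihedral by vm_compute.
by move=> /h /allP h'; exact: h'.
Qed.

Lemma dactM d e k : dact (dmul d e) k = dact d (dact e k).
Proof.
transitivity ((d.1 * (e.1 * k + e.2) + d.2) %% 5)%N; rewrite /dact /dmul /=.
  by rewrite modnDmr -(modnDml (_ %% 5 * k)) modnMml modnDml mulnDr mulnA addnA.
by rewrite -(modnDml (d.1 * ((_ + _) %% 5))) modnMmr modnDml.
Qed.

Lemma dinv_in d : d \in dihedral -> dinv d \in dihedral.
Proof.
have /allP h : all (fun d => dinv d \in dihedral) dihedral by vm_compute.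
exact: h.
Qed.

Lemma dactV d j k : d \in dihedral -> (j < 5)%N -> (k < 5)%N -> (j == dact d k) = (k == dact (dinv d) j).
Proof.
have /allP h : all (fun d => all (fun j => all (fun k => (j == dact d k) == (k == dact (dinv d) j))
  (iota 0 5)) (iota 0 5)) dihedral by vm_compute.
move=> /h hd hj hk.
by have /eqP := @forall2_lt5 (fun j k => (j == dact d k) == (k == dact (dinv d) j)) hd j k hj hk.
Qed.

Lemma sum_delta (F : nat -> int) c : (c < 5)%N -> \sum_(j < 5) F j * (nat_of_ord j == c)%:R = F c.
Proof.
move=> hc; rewrite (bigD1 (Ordinal hc)) //= eqxx mulr1 big1 ?addr0 // => j ne.
have /negbTE -> : (j : nat) != c by move: ne; rewrite -val_eqE.
by rewrite mulr0.
Qed.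

Lemma permutesM A B d e : permutes A d -> permutes B e -> permutes (tabM A B) (dmul d e).
Proof.
move=> hA hB j k hj hk; rewrite ent_tabM // dactM.
rewrite -(sum_delta (fun i => (j == dact d i)%:R) (dact_lt e k)).
by apply: dvdz_sum_prod => i; [apply: hA|apply: hB].
Qed.

Lemma copermutesM A B d e : copermutes A d -> copermutes B e -> copermutes (tabM B A) (dmul d e).
Proof.
move=> hA hB j k hj hk; rewrite ent_tabM // dactM.
rewrite -(sum_delta (fun i => (k == dact d i)%:R) (dact_lt e j)).
rewrite (eq_bigr (fun i : 'I_5 => ent A i k * ent B j i)); last by move=> i _; rewrite mulrC.
by apply: dvdz_sum_prod => i; [apply: hA|apply: hB].
Qed.

End Permutations.

(* Modulo 2 the affine maps permute the sides as a dihedral group. *)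
Definition permuting (S : 'M[R]_2) := exists f f' A A' d, [/\ affine_map S f, affine_map S^-1 f',
  cancel f f' /\ cancel f' f, act f A /\ act f' A' &
  [/\ d \in dihedral, permutes A d & copermutes A' d]].

Lemma permutes_check A d : all (fun j => all (fun k =>
  (2 %| ent A j k - (j == dact d k)%:R)%Z) (iota 0 5)) (iota 0 5) -> permutes A d.
Proof. by move=> /forall2_lt5 h j k hj hk; exact: h. Qed.

Lemma copermutes_check A d : all (fun j => all (fun k =>
  (2 %| ent A j k - (k == dact d j)%:R)%Z) (iota 0 5)) (iota 0 5) -> copermutes A d.
Proof. by move=> /forall2_lt5 h j k hj hk; exact: h. Qed.

Lemma permuting1 : permuting 1.
Proof.
exists idfun, idfun, tab1, tab1, (1, 0)%N; rewrite invr1.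
split; [exact: affine_id|exact: affine_id|by []|by split; exact: act1|].
by split; [|apply: permutes_check; vm_compute|apply: copermutes_check; vm_compute].
Qed.

Lemma permutingM S1 (S2 : 'M[R]_2) : permuting S1 -> permuting S2 -> permuting (S1 * S2).
Proof.
move=> [f [f' [A [A' [d [a1 a1' [c1 c1'] [h1 h1'] [d1 p1 p1']]]]]]].
move=> [g [g' [B [B' [e [a2 a2' [c2 c2'] [h2 h2'] [d2 p2 p2']]]]]]].
have u1 : S1 \is a GRing.unit by apply: (@veech_unit R 5); exists f.
have u2 : S2 \is a GRing.unit by apply: (@veech_unit R 5); exists g.
exists (f \o g : smap), (g' \o f' : smap), (tabM A B), (tabM B' A'), (dmul d e).
split.
- exact: affine_comp.
- by rewrite invrM //; exact: affine_comp.
- by split=> x /=; rewrite ?c1 ?c2 ?c1' ?c2'.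
- by split; exact: act_comp.
by split; [exact: dmul_in|exact: permutesM|exact: copermutesM].
Qed.

Lemma permutingV (S1 : 'M[R]_2) : permuting S1 -> permuting S1^-1.
Proof.
move=> [f [f' [A [A' [d [a1 a1' [c1 c1'] [h1 h1'] [d1 p1 p1']]]]]]].
exists f', f, A', A, (dinv d); rewrite invrK; split=> //; split=> [|j k hj hk|j k hj hk].
- exact: dinv_in.
- by rewrite -dactV //; exact: p1'.
- by rewrite -dactV //; exact: p1.
Qed.

Lemma permuting_rot : permuting (rotm 1).
Proof.
have [r' ar' [k1 k2 h']] := rot_inverse.
exists rot_map, r', tabR, tabR', (1, 3)%N; split=> //.
- exact: (@rot_affine R 5 five_ok).
- by split=> //; exact: act_rot.
by split; [|apply: permutes_check; vm_compute|apply: copermutes_check; vm_compute].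
Qed.

Lemma permuting_T : permuting T.
Proof.
have [|t' at' [k1 k2 h']] := twist_inverse (m := 1); first by vm_compute.
exists (twist_iter 1), t', (tabT 1), (tabTV 1), (4, 3)%N; split.
- by rewrite -[T_mx R 5]expr1; exact: (@twist_iter_affine R 5 five_ok).
- by rewrite -[T_mx R 5]expr1.
- by [].
- by split=> //; exact: act_twist.
by split; [|apply: permutes_check; vm_compute|apply: copermutes_check; vm_compute].
Qed.

Lemma hecke_permuting S : hecke 5 S -> permuting S.
Proof.
apply; [exact: permuting1|exact: permutingM|exact: permutingV|exact: permuting_rot|exact: permuting_T].
Qed.

Lemma rot_conj S f A : affine_map S f -> act f A -> exists2 u : smap,
  affine_map (rotm 1 * (S * (rotm 1)^-1)) u & act u (tabM tabR (tabM A tabR')).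
Proof.
move=> af hf; have [r' ar' [_ _ hr']] := rot_inverse.
exists (rot_map \o (f \o r' : smap) : smap).
  exact: (affine_comp (affine_comp ar' af) (@rot_affine R 5 five_ok)).
exact: (act_comp act_rot (act_comp hf hr')).
Qed.

(* The commutator of [T^2] and [R T^2 R^-1]. *)
Definition tabC : seq (seq int) :=
  tabM (tabT 2) (tabM (tabM tabR (tabM (tabT 2) tabR'))
    (tabM (tabTV 2) (tabM tabR (tabM (tabTV 2) tabR')))).

Lemma commutator_act : exists (S : 'M[R]_2) f, affine_map S f /\ act f tabC.
Proof.
have [|t' at' [_ _ ht']] := twist_inverse (m := 2); first by vm_compute.
have [t at2 ht] : exists2 t : smap, affine_map (T ^+ 2) t & act t (tabT 2).
  by exists (twist_iter 2); [exact: (@twist_iter_affine R 5 five_ok)|exact: act_twist].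
have [u au hu] := rot_conj at2 ht; have [u' au' hu'] := rot_conj at' ht'.
exists (T ^+ 2 * (rotm 1 * (T ^+ 2 * (rotm 1)^-1) * (T ^- 2 * (rotm 1 * (T ^- 2 * (rotm 1)^-1))))).
exists (t \o (u \o (t' \o u' : smap) : smap) : smap); split.
  exact: (affine_comp (affine_comp (affine_comp au' at') au) at2).
exact: (act_comp ht (act_comp hu (act_comp ht' hu'))).
Qed.

(** * Homology modulo 8 and the exotic congruence group *)

Section ModEight.
(** [phi] stands for the reduction of integers modulo 8. *)
Variables (G : zmodType) (phi : int -> G).
Hypotheses (phiD : {morph phi : x y / x + y}) (G8 : forall x : G, x *+ 8 = 0).

Local Notation ch8 := (chain R G).
Definition gam8 k : ch8 1 surface := push phi (gam k).
Definition homologous (p q : ch8 1 surface) := exists d : ch8 2 surface, p - q = boundary d.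

Lemma homologous_refl p : homologous p p.
Proof. by exists 0; rewrite boundary0 subrr. Qed.
Lemma homologous_sym p q : homologous p q -> homologous q p.
Proof. by move=> [d e]; exists (- d); rewrite boundaryN -e opprB. Qed.
Lemma homologous_trans q p (r : ch8 1 surface) : homologous p q -> homologous q r -> homologous p r.
Proof. by move=> [d e] [d' e']; exists (d + d'); rewrite boundaryD -e -e' addrA subrK. Qed.
Lemma homologousD p q (p' q' : ch8 1 surface) : homologous p q -> homologous p' q' ->
  homologous (p + p') (q + q').
Proof. by move=> [d e] [d' e']; exists (d + d'); rewrite boundaryD -e -e' opprD addrACA. Qed.
Lemma homologousMz p q (l : int) : homologous p q -> homologous (p *~ l) (q *~ l).
Proof.
move=> [d e]; exists (d *~ l); rewrite (morphMz (@boundaryD R G 1 surface)) -e.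
by rewrite mulrzBl.
Qed.
Lemma homologous_sum (F F' : 'I_5 -> ch8 1 surface) : (forall j, homologous (F j) (F' j)) ->
  homologous (\sum_j F j) (\sum_j F' j).
Proof.
move=> h; elim/big_ind2: _ => //; first exact: homologous_refl.
by move=> p q p' q'; exact: homologousD.
Qed.
Lemma homologous_map f p q : homologous p q -> homologous (chain_map f p) (chain_map f q).
Proof. by move=> [d e]; exists (chain_map f d); rewrite -chain_map_boundary -e chain_mapB. Qed.

Lemma ch8_eq0 k (c : ch8 k surface) (l : int) : (8 %| l)%Z -> c *~ l = 0.
Proof.
move=> /dvdzP[m ->]; rewrite mulrC mulrzA.
suff -> : c *~ 8 = 0 by rewrite mul0rz.
move: c; apply: (malg_ext (f1 := fun c => c *~ 8) (f2 := fun=> 0)) => [c d|c d|x s].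
- exact: mulrzDl.
- by rewrite addr0.
by rewrite -pmulrn -monalgUMn G8 monalgU0.
Qed.

Definition comb8 v : ch8 1 surface := \sum_(j < 5) gam8 j *~ v j.

Lemma comb8D v (v' : nat -> int) : comb8 (fun j => v j + v' j) = comb8 v + comb8 v'.
Proof. by rewrite /comb8 -big_split; apply: eq_bigr => j _; rewrite mulrzDr. Qed.

Lemma comb8N v : comb8 (fun j => - v j) = - comb8 v.
Proof. by rewrite /comb8 -sumrN; apply: eq_bigr => j _; rewrite mulrNz. Qed.

Lemma push_comb v : push phi (comb v) = comb8 v.
Proof.
by rewrite /comb (push_sum phiD); apply: eq_bigr => j _; rewrite (morphMz (@pushD R _ _ _ phiD 1 surface)).
Qed.

Lemma push_bd (p q : chain R int 1 surface) : bd (p - q) -> homologous (push phi p) (push phi q).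
Proof. by move=> [d e]; exists (push phi d); rewrite -(pushB phiD) e (push_boundary phiD). Qed.

Section Perturbations.
Variable e : int.
Hypothesis e2 : (8 %| e * e)%Z.

(* [f] acts on [H_1] as [1 + e X]. *)
Definition perturbs f (X : nat -> nat -> int) := forall k, (k < 5)%N ->
  homologous (chain_map f (gam8 k)) (gam8 k + comb8 (X ^~ k) *~ e).

Lemma mulrze2 (c : ch8 1 surface) : c *~ e *~ e = 0.
Proof. by rewrite -mulrzA; exact: ch8_eq0. Qed.

(** After multiplication by [e] the perturbation disappears, since 8 divides [e * e]. *)
Lemma perturbs4 f X k : (k < 5)%N -> perturbs f X -> homologous (chain_map f (gam8 k) *~ e) (gam8 k *~ e).
Proof.
move=> hk /(_ k hk) /(homologousMz e).
by rewrite (mulrzDl e (gam8 k) (comb8 (X ^~ k) *~ e)) mulrze2 addr0.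
Qed.

Lemma homologous_swap (p q : ch8 1 surface) (l : int) :
  homologous (p *~ e) (q *~ e) -> homologous (p *~ l *~ e) (q *~ l *~ e).
Proof. by move=> /(homologousMz l); rewrite !(mulrzAC l e). Qed.

Lemma perturbs_comb4 f X v : perturbs f X -> homologous (chain_map f (comb8 v) *~ e) (comb8 v *~ e).
Proof.
move=> h; rewrite /comb8 (chain_map_sum f) !mulrz_suml; apply: homologous_sum => j.
rewrite (morphMz (chain_mapD f) (gam8 j) (v j)); apply: homologous_swap.
exact: perturbs4 (ltn_ord j) h.
Qed.

(** In the product of [1 + e X] and [1 + e Y] the term with [e * e] vanishes modulo 8, so
    perturbations add. *)
Lemma perturbsM f h X (Y : nat -> nat -> int) : perturbs f X -> perturbs h Y ->
  perturbs (f \o h : smap) (fun j k => X j k + Y j k).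
Proof.
move=> hf hh k hk.
rewrite (chain_map_comp (gam8 k) (h := f \o h : smap) (f := h) (g := f)) //.
apply: homologous_trans (homologous_map f (hh k hk)) _.
rewrite chain_mapD (morphMz (chain_mapD f)) comb8D mulrzDl addrA.
exact: homologousD (hf k hk) (perturbs_comb4 (Y ^~ k) hf).
Qed.

Lemma perturbsV f h X : perturbs f X -> cancel f h -> perturbs h (fun j k => - X j k).
Proof.
move=> hf fh k hk.
have hfK (c : ch8 1 surface) : chain_map h (chain_map f c) = c.
  by rewrite -(chain_map_comp c (h := h \o f : smap)) // chain_map_id.
have h1 := homologous_map h (hf k hk); rewrite hfK chain_mapD (morphMz (chain_mapD h)) in h1.
have h2 : homologous (chain_map h (comb8 (X ^~ k)) *~ e) (comb8 (X ^~ k) *~ e).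
  apply: homologous_sym; have := homologous_map h (perturbs_comb4 (X ^~ k) hf).
  by rewrite !(morphMz (chain_mapD h)) hfK.
have h3 := homologousD (homologous_sym h1) (homologousMz (-1) h2).
by rewrite !mulrN1z addrK in h3; rewrite comb8N mulNrz.
Qed.

Lemma act_perturbs f (X : nat -> nat -> int) :
  (forall k, (k < 5)%N -> bd (chain_map f (gam k) - gam k - comb (X ^~ k) *~ e)) -> perturbs f X.
Proof.
move=> h k hk; have := h k hk; rewrite -addrA -opprD => /push_bd.
by rewrite (push_chain_map phiD) (pushD phiD) (morphMz (@pushD R _ _ _ phiD 1 surface)) push_comb.
Qed.

End Perturbations.

(* The pairs [(j, k)] with [k - j = 1] or [2] modulo 5. A perturbation [X] is
   determined by [f] modulo 2 up to matrices with constant columns, which do not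
   change the parity of this sum, and the sum is even for all dihedral
   conjugates of [nilT]. *)
Definition pairs : seq (nat * nat) :=
  [:: (4, 0); (3, 0); (0, 1); (4, 1); (1, 2); (0, 2); (2, 3); (1, 3); (3, 4); (2, 4)]%N.
Definition parity (X : nat -> nat -> int) : int := \sum_(p <- pairs) X p.1 p.2.

Lemma parityD X (Y : nat -> nat -> int) : parity (fun j k => X j k + Y j k) = parity X + parity Y.
Proof. exact: big_split. Qed.

Lemma parityN (X : nat -> nat -> int) : parity (fun j k => - X j k) = - parity X.
Proof. exact: sumrN. Qed.

(** Any [X] that describes the action may be used; by [parity_uniq] the condition does not depend on
    it. *)
Definition exotic : set 'M[R]_2 :=
  [set S | exists f X, [/\ affine_map S f, perturbs 4 f X & (2 %| parity X)%Z]].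

Lemma exotic_subgroup : subgroup 5 exotic.
Proof.
split.
- by move=> S [f [X [af _ _]]]; exists f.
- exists idfun, (fun _ _ => 0); split; first exact: affine_id.
    move=> k _; rewrite chain_map_id // /comb8 big1 ?mul0rz ?addr0; first exact: homologous_refl.
    by move=> j _; rewrite mulr0z.
  by rewrite /parity big1.
- move=> S S' [f [X [af pf ef]]] [h [Y [ah ph eh]]].
  exists (f \o h : smap), (fun j k => X j k + Y j k); split; first exact: affine_comp.
    exact: (@perturbsM 4).
  by rewrite parityD; exact: rpredD.
move=> S [f [X [af pf ef]]]; have [h ah [fh hf]] := affine_invE af.
exists h, (fun j k => - X j k); split=> //; first exact: (@perturbsV 4) pf fh.
by rewrite parityN rpredN.
Qed.

Lemma exotic_trivial S f : affine_map S f -> trivial_on_H1 R G f -> exotic S.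
Proof.
move=> af tf; exists f, (fun _ _ => 0); split=> //; last by rewrite /parity big1.
move=> k _.
have cz : boundary (gam8 k) = 0 by rewrite /gam8 -(push_boundary phiD) gam_cycle (@push0 R _ _ _ phiD).
have [d e] := tf _ cz; exists d; rewrite -e /comb8 big1 ?mul0rz ?addr0 //.
Qed.

Hypothesis phi1 : forall l : int, phi 1 *~ l = 0 -> (8 %| l)%Z.

(** Two descriptions of one map give a relation between the sides modulo 8 with coefficients
    [4 * (X - Y)]. These agree modulo 8 within each column. *)
Lemma perturbs_uniq f X (Y : nat -> nat -> int) j k : (j < 5)%N -> (k < 5)%N ->
  perturbs 4 f X -> perturbs 4 f Y ->
  (2 %| (X j k - Y j k) - (X (j.+1 %% 5)%N k - Y (j.+1 %% 5)%N k))%Z.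
Proof.
move=> hj hk /(_ k hk) hX /(_ k hk) hY.
have [d e] := homologous_trans (homologous_sym hX) hY.
have e2 : \sum_(i < 5) push phi (gam i) *~ ((X i k - Y i k) * 4) = boundary d.
  rewrite -e opprD addrACA subrr add0r -mulrzBl -comb8N -comb8D /comb8 mulrz_suml.
  by apply: eq_bigr => i _; rewrite mulrzA.
have := gam_independent phiD (m := fun i => (X i k - Y i k) * 4) hj e2.
by rewrite -mulrBl => /phi1 /dvdzP[q eq]; apply/dvdzP; exists q; lia.
Qed.

Lemma commutator_perturbs f : act f tabC ->
  perturbs 4 f (fun j k => ((ent tabC j k - (j == k)%:R) %/ 4)%Z).
Proof.
move=> hf; apply: act_perturbs => k hk.
have h : forall j k, (j < 5)%N -> (k < 5)%N ->
    ent tabC j k == (j == k)%:R + 4 * ((ent tabC j k - (j == k)%:R) %/ 4)%Z.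
  by apply: forall2_lt5; vm_compute.
have := hf k hk; rewrite (comb_eq (v' := fun j => (j == k)%:R + 4 * ((ent tabC j k - (j == k)%:R) %/ 4)%Z)).
  by rewrite combD comb_delta // combZ opprD addrA.
by move=> j hj; apply/eqP; exact: h.
Qed.

Lemma even_add (l m : int) : (2 %| l - m)%Z -> (2 %| m + l)%Z.
Proof. by move=> /dvdzP[q eq]; apply/dvdzP; exists (q + m); lia. Qed.

Lemma parity_uniq f X (Y : nat -> nat -> int) : perturbs 4 f X -> perturbs 4 f Y ->
  (2 %| parity X - parity Y)%Z.
Proof.
move=> hX hY; have D j k (hj : (j < 5)%N) (hk : (k < 5)%N) := perturbs_uniq hj hk hX hY.
(* In each column [pairs] has two cyclically adjacent rows, so a column that is constant modulo 2
   contributes an even number. *)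
have h3 := even_add (D 3%N 0%N isT isT); have h4 := even_add (D 4%N 1%N isT isT).
have h0 := even_add (D 0%N 2%N isT isT); have h1 := even_add (D 1%N 3%N isT isT).
have h2 := even_add (D 2%N 4%N isT isT).
rewrite /parity -sumrB /pairs !big_cons big_nil /= addr0.
rewrite addrA; apply: rpredD; first exact: h3.
rewrite addrA; apply: rpredD; first exact: h4.
rewrite addrA; apply: rpredD; first exact: h0.
rewrite addrA; apply: rpredD; first exact: h1.
exact: h2.
Qed.

Lemma commutator_parity : ~~ (2 %| parity (fun j k => ((ent tabC j k - (j == k)%:R) %/ 4)%Z))%Z.
Proof. by rewrite /parity /pairs !big_cons big_nil; vm_compute. Qed.

Lemma commutator_not_exotic S f : affine_map S f -> act f tabC -> ~ exotic S.
Proof.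
move=> af hf [h [X [ah hX ev]]].
have e : f = h by apply/continuousEP; exact: (affine_uniq af ah).
subst h; have d := parity_uniq hX (commutator_perturbs hf).
have := commutator_parity; have := rpredB ev d; rewrite subKr => h /negP; exact.
Qed.

(** The commutator acts as [1 + 4 X] already on integral combinations of sides, hence trivially
    modulo 4. *)
Lemma commutator_principal S f d : affine_map S f -> act f tabC -> (d %| 4)%N ->
  principal_congruence 5 d S.
Proof.
move=> af hf d4; have d0 : (0 < d)%N by case: d d4.
exists f => //; apply: (@trivial_criterion R 5 five_ok) => // k.
rewrite -(@gam_mod R 5 five_ok k); move: (k %% 5)%N (ltn_pmod k (isT : 0 < 5)%N) => {}k hk.
have h : forall j k, (j < 5)%N -> (k < 5)%N ->
    ent tabC j k == (j == k)%:R + 4 * ((ent tabC j k - (j == k)%:R) %/ 4)%Z.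
  by apply: forall2_lt5; vm_compute.
have := hf k hk; rewrite (comb_eq (v' := fun j => (j == k)%:R + 4 * ((ent tabC j k - (j == k)%:R) %/ 4)%Z)).
  rewrite combD comb_delta // combZ => -[w e].
  exists (comb (fun j => (ent tabC j k - (j == k)%:R) %/ 4)%Z *~ (4 %/ d)%N), w.
  have E (c : chain R int 1 surface) : c *~ (4 %/ d)%N *+ d = c *~ 4.
    by rewrite pmulrn -mulrzA -PoszM divnK.
  by rewrite E -e; abel.
by move=> j hj; apply/eqP; exact: h.
Qed.

(** [T ^+ 4] acts as [1 + 4 nilT], and [h'] is inverse to [h], so the conjugate acts as
    [1 + 4 B' nilT B]. *)
Lemma conj_perturbation h h' B B' k : (k < 5)%N -> cancel h h' -> act h B -> act h' B' ->
  bd (chain_map h' (chain_map (twist_iter 4) (chain_map h (gam k))) - gam k -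
    comb (fun j => ent (tabM B' (tabM nilT B)) j k) *~ 4).
Proof.
move=> hk c hB hB'.
have E1 := chain_map_bd (twist_iter 4) (hB k hk).
have T4 v : bd (chain_map (twist_iter 4) (comb v) - comb v -
    comb (fun i => \sum_(j < 5) ent nilT i j * v j) *~ 4).
  have H := act_comb v (act_twist 4).
  have e : comb (fun i => \sum_(j < 5) ent (tabT 4) i j * v j) =
      comb v + comb (fun i => \sum_(j < 5) ent nilT i j * v j) *~ 4.
    rewrite -combZ -combD; apply: comb_eq => i hi.
    rewrite mulr_sumr -(sum_delta v hi) -big_split; apply: eq_bigr => j _.
    by rewrite ent_tab // eq_sym /=; ring.
  by rewrite e opprD addrA in H.
have E2 := T4 (fun j => ent B j k).
have E3 := chain_map_bd h' (bdD (bdD E1 E2) (bdN (hB k hk))).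
have E4 := bdMz 4 (act_comb (fun j => \sum_(i < 5) ent nilT j i * ent B i k) hB').
have hh : chain_map h' (chain_map h (gam k)) = gam k.
  by rewrite -(chain_map_comp (gam k) (h := h' \o h : smap)) // chain_map_id.
rewrite (comb_eq (v := fun j => ent (tabM B' (tabM nilT B)) j k)
  (v' := fun i => \sum_(j < 5) ent B' i j * (\sum_(l < 5) ent nilT j l * ent B l k))); last first.
  by move=> i hi; rewrite ent_tabM //; apply: eq_bigr => j _; rewrite ent_tabM.
rewrite mulrzBl in E4; rewrite chain_mapB !chain_mapD !chain_mapN hh (morphMz (chain_mapD h')) in E3.
by apply: (bd_eq (bdD E3 E4)); abel.
Qed.

(** Only [B' nilT B] modulo 2 matters, and modulo 2 the matrices [B] and [B'] are inverse dihedral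
    permutations. This leaves ten permuted copies of [nilT], whose parity is computed. *)
Lemma exotic_conjT S : veech S -> exotic (@conjT R 5 S 4).
Proof.
move=> hS; have [h [h' [B [B' [d [ah ah' [c c'] [hB hB'] [dd p p']]]]]]] := hecke_permuting (veech_hecke hS).
pose X j k := ent (tabM B' (tabM nilT B)) j k.
exists ((h' \o twist_iter 4) \o h : smap), X; split.
- exact: (affine_comp ah (affine_comp (@twist_iter_affine R 5 five_ok 4) ah')).
- apply: act_perturbs => k hk.
  have e1 := chain_map_comp (gam k) (h := (h' \o twist_iter 4) \o h : smap) (f := h) (g := h' \o twist_iter 4 : smap) (fun=> erefl).
  have e2 := chain_map_comp (chain_map h (gam k)) (h := h' \o twist_iter 4 : smap) (f := twist_iter 4) (g := h') (fun=> erefl).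
  rewrite e1 e2.
  exact: conj_perturbation.
have hX j k : (j < 5)%N -> (k < 5)%N -> (2 %| X j k - ent nilT (dact d j) (dact d k))%Z.
  move=> hj hk; rewrite /X ent_tabM //.
  rewrite -(sum_delta (fun i => ent nilT i (dact d k)) (dact_lt d j)).
  rewrite [X in (_ %| X - _)%Z](eq_bigr (fun i : 'I_5 => ent (tabM nilT B) i k * ent B' j i)); last by move=> i _; rewrite mulrC.
  apply: dvdz_sum_prod => i; last exact: p'.
  rewrite ent_tabM // -(sum_delta (fun l => ent nilT i l) (dact_lt d k)).
  by apply: dvdz_sum_prod => l; [rewrite subrr|exact: p].
have e : (2 %| parity (fun j k => ent nilT (dact d j) (dact d k)))%Z.
  have /allP al : all (fun d => (2 %| foldr (fun p s => ent nilT (dact d p.1) (dact d p.2) + s) 0%R pairs)%Z) dihedral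
    by vm_compute.
  by have := al d dd; rewrite /parity /pairs !big_cons big_nil.
have : (2 %| parity X - parity (fun j k => ent nilT (dact d j) (dact d k)))%Z.
  rewrite /parity -sumrB big_seq; apply: rpred_sum => q hq.
  have /allP al : all (fun q => (q.1 < 5) && (q.2 < 5))%N pairs by [].
  by have /andP[q1 q2] := al q hq; exact: hX.
by move=> /(rpredD e); rewrite addrC subrK.
Qed.

End ModEight.

Definition z8 (m : int) : 'I_8.-1.+1 := 1 *~ m.
Lemma z8D : {morph z8 : l m / l + m}. Proof. by move=> l m; rewrite /z8 mulrzDr. Qed.

Lemma z8_order (x : 'I_8.-1.+1) : x *+ 8 = 0.
Proof. by apply: val_inj; rewrite Zp_mulrn /= modnMl. Qed.

Lemma z8_dvd (l : int) : z8 1 *~ l = 0 -> (8 %| l)%Z.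
Proof.
rewrite /z8 mulr1z; case: l => m; rewrite ?NegzE ?mulrNz -pmulrn => e.
  by have := congr1 val e; rewrite Zp_mulrn /= mul1n => h; rewrite dvdzE /=; apply/eqP.
have {}e : (1 : 'I_8.-1.+1) *+ m.+1 = 0 by rewrite -[LHS]opprK e oppr0.
by have := congr1 val e; rewrite Zp_mulrn /= mul1n => h; rewrite dvdzE /=; apply/eqP.
Qed.

Lemma exotic_level : congruence_level 5 (exotic z8) 8.
Proof. by split=> // S [f af tf]; apply: exotic_trivial af tf; exact: z8D. Qed.

Theorem exotic_minimal_level : [/\ congruence_group 5 (exotic z8), minimal_congruence_level 5 (exotic z8) 8 &
  ~~ (8 %| wohlfahrt_level 5 (exotic z8))%N].
Proof.
have sub := @exotic_subgroup _ z8 z8_order; have lev := exotic_level; split.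
- by split; [exact: sub|exists 8%N].
- split=> // b b8 nb [b0 sb].
  have [S [f [af hf]]] := commutator_act.
  apply: (commutator_not_exotic z8D z8_dvd af hf); apply: sb; apply: commutator_principal af hf _.
  (* A proper divisor of 8 divides 4, and the commutator has every level dividing 4. *)
  have : b \in divisors 8 by rewrite -dvdn_divisors.
  rewrite (_ : divisors 8 = [:: 1; 2; 4; 8]%N) // !inE; case/or4P=> /eqP eb; rewrite eb //.
  by rewrite eb in nb.
apply/negP => h8.
(* All conjugates of [T ^+ 4] are in the group, so its Wohlfahrt level divides 4. *)
have hconj S : veech S -> exotic z8 (@conjT R 5 S 4) by move=> hS; exact: (exotic_conjT z8D hS).
by have := @level_dvd R 5 five_ok _ sub 4 isT hconj; move=> /(dvdn_trans h8).
Qed.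

End Pentagons.

Theorem theorem3 (R : realType) :
  (forall (n : nat) (Gamma : set 'M[R]_2) (b : nat),
     odd n -> (5 <= n)%N ->
     congruence_group n Gamma ->
     minimal_congruence_level n Gamma b ->
     (wohlfahrt_level n Gamma %| b)%N /\
     forall p : nat, prime p -> (p %| b)%N -> (p %| wohlfahrt_level n Gamma)%N)
  /\
  (exists (n : nat) (Gamma : set 'M[R]_2) (b : nat),
     [/\ odd n, (5 <= n)%N,
         congruence_group n Gamma,
         minimal_congruence_level n Gamma b &
         ~~ (b %| wohlfahrt_level n Gamma)%N]).
Proof.
split=> [n Gamma b n_odd n_ge5 hG hb|].
  exact: (@wohlfahrt_dvd R n (OddGe5 n_odd n_ge5) Gamma b hG hb).
by have [hG hb nd] := exotic_minimal_level R; exists 5%N, (exotic z8), 8%N.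
Qed.
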